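(* Let $p$ and $q$ be primes satisfying either (I) $p\equiv 1\pmod 4$, $q\equiv 3\pmod 4$, $\left(\frac{2}{p}\right)=-1$, $\left(\frac{2}{q}\right)=1$, $\left(\frac{p}{q}\right)=-1$; or (II) $p\equiv q\equiv 3\pmod 4$, $\left(\frac{2}{p}\right)=-1$, $\left(\frac{2}{q}\right)=1$, $\left(\frac{p}{q}\right)=-1$. Let $m$ be the integer with $h_2(-2q)=2^m$. Then the $2$-class group of $L_{pq}^*=\mathbb{Q}(\sqrt2,\sqrt q,\sqrt p,i)$ is isomorphic to $\mathbb{Z}/2^m\mathbb{Z}$.
   Context: $\left(\frac{\cdot}{\cdot}\right)$ is the Legendre symbol; $h_2(d)$ is the order of the $2$-class group of $\mathbb{Q}(\sqrt d)$; the $2$-class group of a number field is the $2$-Sylow subgroup of its ideal class group; $i=\sqrt{-1}$. *)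

(* Defs.v *)
From mathcomp Require Import all_boot all_order all_algebra all_field.
Set Implicit Arguments. Unset Strict Implicit. Unset Printing Implicit Defensive.
Import Order.TTheory GRing.Theory Num.Theory.
Local Open Scope ring_scope.

(* Number fields are realised as subfields of algC (the algebraic closure of Q
   inside C), given as Prop-valued predicates. *)
Definition cset := algC -> Prop.

Definition is_subfield (F : cset) : Prop :=
  [/\ F 1, (forall x y, F x -> F y -> F (x - y)),
      (forall x y, F x -> F y -> F (x * y)) & (forall x, F x -> F x^-1)].

Definition Qgen (S : seq algC) : cset :=
  fun x => forall F : cset, is_subfield F -> (forall s, s \in S -> F s) -> F x.

Definition ORing (K : cset) : cset := fun x => K x /\ x \in Aint.

Definition is_ideal (K : cset) (I : cset) : Prop :=
  [/\ (forall x, I x -> ORing K x), I 0,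
      (forall x y, I x -> I y -> I (x + y)) &
      (forall a x, ORing K a -> I x -> I (a * x))].

Definition nonzero_ideal (K : cset) (I : cset) : Prop :=
  is_ideal K I /\ exists x, I x /\ x != 0.

Definition ideal_mul (I J : cset) : cset :=
  fun x => exists s : seq (algC * algC),
    (forall u, u \in s -> I u.1 /\ J u.2) /\ x = \sum_(u <- s) u.1 * u.2.

Fixpoint ideal_pow (K : cset) (I : cset) (n : nat) : cset :=
  match n with
  | 0 => ORing K
  | n'.+1 => ideal_mul I (ideal_pow K I n')
  end.

Definition scale (a : algC) (I : cset) : cset :=
  fun x => exists y, I y /\ x = a * y.

Definition seteq (I J : cset) : Prop := forall x, I x <-> J x.

Definition ideal_equiv (K : cset) (I J : cset) : Prop :=
  exists a b, [/\ ORing K a, ORing K b, a != 0, b != 0 &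
                  seteq (scale a I) (scale b J)].

Definition principal_class (K : cset) (I : cset) : Prop := ideal_equiv K I (ORing K).

(* [I] lies in the 2-class group (2-Sylow subgroup of the class group). *)
Definition two_power_class (K : cset) (I : cset) : Prop :=
  nonzero_ideal K I /\ exists k, principal_class K (ideal_pow K I (2 ^ k)).

Definition two_class_number (K : cset) (N : nat) : Prop :=
  exists f : 'I_N -> cset,
    [/\ (forall i, two_power_class K (f i)),
        (forall i j, ideal_equiv K (f i) (f j) -> i = j) &
        (forall I, two_power_class K I -> exists i, ideal_equiv K I (f i))].

Definition two_class_group_cyclic (K : cset) (N : nat) : Prop :=
  exists C : cset,
    [/\ two_power_class K C,
        (forall j, principal_class K (ideal_pow K C j) <-> (N %| j)%N) &
        (forall I, two_power_class K I ->
           exists j, ideal_equiv K I (ideal_pow K C j))].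

Definition legendre (a : int) (p : nat) : int :=
  if (p%:Z %| a)%Z then 0
  else if [exists x : 'I_p, ((x%:Z ^+ 2 - a) %% p%:Z == 0)%Z] then 1 else -1.

Definition quadfield (d : int) : cset := Qgen [:: sqrtC (d%:~R)].
Definition h2 (d : int) (N : nat) : Prop := two_class_number (quadfield d) N.

Definition Lstar (p q : nat) : cset :=
  Qgen [:: sqrtC 2; sqrtC q%:R; sqrtC p%:R; 'i].

(* Main.v *)
(** Ideal classes of a number field K are represented by "ideal numbers": an
    invertible ideal I whose N-th power is generated by w becomes the algebraic
    number a = w^(1/N), with I = {x in K | x/a is an algebraic integer}; two such
    numbers are in the same class iff they differ by an element of K times a unit
    of the ring of all algebraic integers.

    Write L = Q(sqrt 2, sqrt q, sqrt p, i) and k = Q(sqrt(-2q)).  The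
    group of elements generating squares of ideals is bounded modulo squares by
    descending through quadratic steps down to Q, and compared with the 2^8
    square classes of units of L (Dirichlet's theorem by Pell equations in the
    seven real quadratic subfields); hence at most one nontrivial class of L is
    killed by 2, and likewise for k, so both 2-class groups are cyclic.

    A generator for k is the class pi of a prime P above p, a nonsquare because
    p is not a square modulo q.  In L, P ramifies, and with C the class of a
    prime above it (taken to an odd power), C^4 is pi because the quadratic
    fields Q(i), Q(sqrt(-2)), Q(sqrt q), Q(sqrt(2q)) have odd class number.
    The class of order 2 of k is that of the prime above 2.  If pi has order
    2^(n+1), the square root pi^(2^(n-1)) of this class capitulates in L, whence
    C^(2^(n+1)) = 1; C is not a square, by a norm argument to Q modulo 8; and
    C^(2^n) is not principal, because the norm to k of a generator would be
    twice a square up to sign, whereas inertia at p makes it a square modulo P.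
    So C generates the 2-class group of L, with the order of pi. *)

Require Import Defs.
From HB Require Import structures.
From mathcomp Require Import all_boot all_order all_algebra all_fingroup all_solvable all_field.
From mathcomp Require Import ring lra zify.
From Stdlib Require Import Classical FunctionalExtensionality PropExtensionality.
Set Implicit Arguments. Unset Strict Implicit. Unset Printing Implicit Defensive.
Import Order.TTheory GRing.Theory Num.Theory.
Local Open Scope ring_scope.

(** Since every root exists in [algC], multiplying, dividing and conjugating ideals becomes
    arithmetic with numbers up to units, and no theory of Dedekind domains enters. The price is to
    show that each finitely generated ideal has such a generator, which is the finiteness of the
    class number; it is proved by the pigeonhole principle for a tower of quadratic extensions and
    then descends to every fixed field.

    The bound for L comes out of the chain Q(i), Q(i, sqrt q), Q(i, sqrt q, sqrt p), L, in which the
    group of these elements modulo squares has order at most 2, 4, 16, 512; against the 2^8 classes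
    of units, 512 leaves room for a single class of order 2. Logarithms of units are avoided: a unit
    is projected multiplicatively onto each real quadratic subfield, and only exponents of
    fundamental units are compared.

    The two cases of the theorem differ in the biquadratic field in which p splits completely, Q(i,
    sqrt(2q)) or Q(sqrt(-2), sqrt q). The relation behind C^4 = pi multiplies the norms of one prime
    of that field to its three quadratic subfields. *)

(** * Algebraic integers, units and associates *)

(** Each coefficient is a root of its own monic integral minimal polynomial, hence integral over the
    image of the integers, and integrality is transitive. *)
Lemma Aint_integral (p : {poly algC}) x :
  p \is monic -> root p x -> {subset (p : seq algC) <= Aint} -> x \in Aint.
Proof.
move=> mp px pA.
have [|q mq qx] := @integral_root_monic _ _ (intr : int -> algC) x p mp px.
  move=> y /pA; rewrite unfold_in => /floorpP[q Dq].
  have mq := minCpoly_monic y; have rq := root_minCpoly y.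
  rewrite Dq in mq rq; exists q => //; move: mq.
  rewrite !monicE lead_coef_map_inj ?rmorph0 //; last exact: intr_inj.
  by move/eqP; rewrite -[RHS]/(1%:~R) => /intr_inj->.
apply: (root_monic_Aint qx); first exact: monic_map.
by apply/polyOverP => i; rewrite coef_map /=.
Qed.

Lemma Aint_root n x : (0 < n)%N -> x ^+ n \in Aint -> x \in Aint.
Proof.
move=> n0 xn; apply: (@Aint_integral ('X^n - (x ^+ n)%:P)).
- exact: monicXnsubC.
- by rewrite rootE !hornerE subrr.
move=> y /(nthP 0)[i _ <-]; rewrite coefB coefXn coefC.
by rewrite rpredB //; [case: eqP | case: eqP].
Qed.

Lemma Aint_quad a b x : a \in Aint -> b \in Aint -> x ^+ 2 = a * x + b -> x \in Aint.
Proof.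
move=> aA bA e; apply: (@Aint_integral ('X^2 - (a *: 'X + b%:P))).
- rewrite monicE lead_coefDl ?lead_coefXn //.
  rewrite size_polyN size_polyXn ltnS (leq_trans (size_polyD _ _)) // geq_max.
  by rewrite (leq_trans (size_scale_leq _ _)) ?size_polyX // (leq_trans (size_polyC_leq1 _)).
- by rewrite rootE !hornerE -?expr2 e subrr.
move=> y /(nthP 0)[i _ <-]; rewrite coefB coefXn coefD coefZ coefX coefC.
by rewrite rpredB ?rpredD ?rpredM //; case: eqP.
Qed.

Lemma Aintg (g : {rmorphism algC -> algC}) x : x \in Aint -> g x \in Aint.
Proof. by rewrite Aint_aut. Qed.

Ltac ai := repeat first
  [ assumption | apply: rpredM | apply: rpredD | apply: rpredB | apply: rpredN
  | apply: rpredX | apply: Aintg | apply: Aint1 | apply: Aint_int ].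

(** Units of the ring of all algebraic integers; [assoc x y] says that x and y generate the same
    ideal there, and forces both to be nonzero because x / 0 is 0. *)
Definition aunit (x : algC) := [&& x != 0, x \in Aint & x^-1 \in Aint].
Definition assoc (x y : algC) := aunit (x / y).

Lemma aunit1 : aunit 1. Proof. by rewrite /aunit oner_eq0 invr1 Aint1. Qed.
Lemma aunitN1 : aunit (- 1).
Proof. by rewrite /aunit oppr_eq0 oner_eq0 invrN1 rpredN Aint1. Qed.
Lemma aunitV x : aunit x -> aunit x^-1.
Proof. by case/and3P=> ? ? ?; rewrite /aunit invr_eq0 invrK; apply/and3P. Qed.
Lemma aunitM x y : aunit x -> aunit y -> aunit (x * y).
Proof.
case/and3P=> x0 xA xV /and3P[y0 yA yV].
by rewrite /aunit mulf_neq0 // invfM !rpredM.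
Qed.
Lemma aunitX x n : aunit x -> aunit (x ^+ n).
Proof. by move=> ux; elim: n => [|n IH]; rewrite ?aunit1 // exprS aunitM. Qed.
Lemma aunit_root n x : (0 < n)%N -> aunit (x ^+ n) -> aunit x.
Proof.
move=> n0 /and3P[x0 xA xV]; apply/and3P; split; last 2 first.
- exact: Aint_root n0 xA.
- by apply: (Aint_root n0); rewrite exprVn.
by move: x0; rewrite expf_eq0 n0.
Qed.
Lemma aunit_aut (g : {rmorphism algC -> algC}) x : aunit (g x) = aunit x.
Proof. by rewrite /aunit -fmorphV !Aint_aut fmorph_eq0. Qed.
Lemma aunit_norm1 x y : x \in Aint -> y \in Aint -> aunit (x * y) -> aunit x.
Proof.
move=> xA yA /and3P[]; rewrite mulf_eq0 negb_or => /andP[x0 y0] _ v.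
rewrite /aunit x0 xA /=; have -> : x^-1 = y * (x * y)^-1 by field; rewrite x0 y0.
by rewrite rpredM.
Qed.

Lemma assocE x y : assoc x y -> [/\ x != 0, y != 0, x / y \in Aint & y / x \in Aint].
Proof.
case/and3P; rewrite mulf_eq0 invr_eq0 negb_or => /andP[x0 y0] h1 h2.
by split=> //; move: h2; rewrite invfM invrK mulrC.
Qed.
Lemma assocI x y : x != 0 -> y != 0 -> x / y \in Aint -> y / x \in Aint -> assoc x y.
Proof. by move=> x0 y0 h1 h2; rewrite /assoc /aunit mulf_neq0 ?invr_eq0 // h1 invfM invrK mulrC h2. Qed.
Lemma assoc_refl x : x != 0 -> assoc x x.
Proof. by move=> x0; rewrite /assoc divff // aunit1. Qed.
Lemma assoc_sym x y : assoc x y -> assoc y x.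
Proof. by move=> h; have := aunitV h; rewrite invfM invrK mulrC. Qed.
Lemma assoc_nz1 x y : assoc x y -> x != 0. Proof. by case/assocE. Qed.
Lemma assoc_nz2 x y : assoc x y -> y != 0. Proof. by case/assocE. Qed.
Lemma assoc_trans y x z : assoc x y -> assoc y z -> assoc x z.
Proof.
move=> h1 h2; have := aunitM h1 h2; rewrite /assoc.
by rewrite mulrA divfK // (assoc_nz2 h1).
Qed.
Lemma assocM x y x' y' : assoc x y -> assoc x' y' -> assoc (x * x') (y * y').
Proof. by move=> h1 h2; have := aunitM h1 h2; rewrite /assoc invfM mulrACA. Qed.
Lemma assocV x y : assoc x y -> assoc x^-1 y^-1.
Proof. by move=> /assoc_sym h; move: h; rewrite /assoc invrK mulrC. Qed.
Lemma assocX x y n : assoc x y -> assoc (x ^+ n) (y ^+ n).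
Proof. by move=> /(aunitX n); rewrite /assoc exprMn exprVn. Qed.
(** The ring of all algebraic integers is integrally closed, so two ideals may be compared after
    raising both to a power; this does the work of unique factorisation. *)
Lemma assoc_root n x y : (0 < n)%N -> assoc (x ^+ n) (y ^+ n) -> assoc x y.
Proof. by move=> n0; rewrite /assoc -exprVn -exprMn; apply: aunit_root. Qed.
Lemma assoc_aut (g : {rmorphism algC -> algC}) x y : assoc (g x) (g y) = assoc x y.
Proof. by rewrite /assoc -fmorphV -rmorphM aunit_aut. Qed.
Lemma assoc_unit x u : x != 0 -> aunit u -> assoc (x * u) x.
Proof. by move=> x0 uu; rewrite /assoc mulrAC divff // mul1r. Qed.
Lemma assocN x : x != 0 -> assoc (- x) x.
Proof. by move=> x0; rewrite -mulrN1 assoc_unit // aunitN1. Qed.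
Lemma assoc_dvd x y z : assoc x y -> (z / x \in Aint) = (z / y \in Aint).
Proof.
case/assocE=> x0 y0 h1 h2; apply/idP/idP => h.
  have -> : z / y = (z / x) * (x / y) by field; rewrite ?x0 ?y0.
  by rewrite rpredM.
have -> : z / x = (z / y) * (y / x) by field; rewrite ?x0 ?y0.
by rewrite rpredM.
Qed.
Lemma assoc_dvd2 x y z : assoc x y -> (x / z \in Aint) = (y / z \in Aint).
Proof.
case/assocE=> x0 y0 h1 h2; apply/idP/idP => h.
  have -> : y / z = (x / z) * (y / x) by rewrite [RHS]mulrC -mulrA (mulrA x^-1) mulVf // mul1r.
  by rewrite rpredM.
have -> : x / z = (y / z) * (x / y) by rewrite [RHS]mulrC -mulrA (mulrA y^-1) mulVf // mul1r.
by rewrite rpredM.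
Qed.
Lemma assoc_mul x y z : assoc x y -> (x * z \in Aint) = (y * z \in Aint).
Proof. by move=> h; rewrite -[z]invrK (assoc_dvd2 _ h). Qed.

(** * Subfields of the algebraic numbers and their ideal numbers *)

Section Subfield.
Variable K : cset.
Hypothesis sK : is_subfield K.
Lemma sf1 : K 1. Proof. by case: sK. Qed.
Lemma sfB x y : K x -> K y -> K (x - y). Proof. by case: sK => _ h _ _; apply: h. Qed.
Lemma sfM x y : K x -> K y -> K (x * y). Proof. by case: sK => _ _ h _; apply: h. Qed.
Lemma sfV x : K x -> K x^-1. Proof. by case: sK => _ _ _ h; apply: h. Qed.
Lemma sf0 : K 0. Proof. by rewrite -(subrr 1); apply: sfB sf1 sf1. Qed.
Lemma sfN x : K x -> K (- x). Proof. by rewrite -sub0r; apply: sfB sf0. Qed.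
Lemma sfD x y : K x -> K y -> K (x + y).
Proof. by move=> h1 h2; rewrite -[y]opprK; apply: sfB => //; apply: sfN. Qed.
Lemma sfX x n : K x -> K (x ^+ n).
Proof. by move=> h; elim: n => [|n IH]; [apply: sf1 | rewrite exprS; apply: sfM]. Qed.
Lemma sfMn x n : K x -> K (x *+ n).
Proof. by move=> h; elim: n => [|n IH]; [apply: sf0 | rewrite mulrS; apply: sfD]. Qed.
Lemma sf_nat n : K n%:R. Proof. by apply: sfMn; apply: sf1. Qed.
Lemma sf_int (n : int) : K n%:~R.
Proof. by case: n => n; [apply: sf_nat | rewrite NegzE rmorphN; apply: sfN; apply: sf_nat]. Qed.
Lemma sf_rat x : x \in Crat -> K x.
Proof.
case/CratP => r ->; rewrite -(divq_num_den r) rmorphM fmorphV /= !ratr_int.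
by apply: sfM; [apply: sf_int | apply: sfV; apply: sf_int].
Qed.
Lemma sf_sum (I : eqType) (r : seq I) (F : I -> algC) :
  (forall i, i \in r -> K (F i)) -> K (\sum_(i <- r) F i).
Proof.
move=> h; rewrite big_seq; elim/big_rec: _ => [|i x ir IH]; first exact: sf0.
by apply: sfD => //; apply: h.
Qed.
End Subfield.

Ltac sf := repeat first
  [ assumption | apply: sfM | apply: sfD | apply: sfB | apply: sfN
  | apply: sfV | apply: sfX | apply: sf1 | apply: sf0 | apply: sf_nat | apply: sf_int ].

(* [DD K a]: the fractional ideal of [K] with generator [a] over the ring of all
   algebraic integers is defined and invertible over [K]; [u.1] runs over elements
   of this ideal, [u.2] over elements of its inverse. *)
Definition DD (K : cset) (a : algC) := a != 0 /\ exists s : seq (algC * algC),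
  [/\ (forall u, u \in s -> K u.1 /\ K u.2),
      (forall u, u \in s -> u.1 / a \in Aint /\ u.2 * a \in Aint) &
      \sum_(u <- s) u.1 * u.2 = 1].

Lemma DD_nz K a : DD K a -> a != 0. Proof. by case. Qed.

Lemma DD_elt (K : cset) a : is_subfield K -> K a -> a != 0 -> DD K a.
Proof.
move=> sK Ka a0; split=> //; exists [:: (a, a^-1)]; split.
- by move=> u; rewrite inE => /eqP-> /=; split=> //; apply: sfV.
- by move=> u; rewrite inE => /eqP-> /=; rewrite divff // mulVf.
by rewrite big_seq1 /= divff.
Qed.

Lemma DD_assoc K a b : assoc a b -> DD K a -> DD K b.
Proof.
move=> ab [a0 [s [sK sa s1]]]; split; first exact: assoc_nz2 ab.
exists s; split=> // u us; have [h1 h2] := sa u us; split.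
  by rewrite -(assoc_dvd _ ab).
by rewrite mulrC -(assoc_mul _ ab) mulrC.
Qed.

Lemma DD_unit (K : cset) u : is_subfield K -> aunit u -> DD K u.
Proof.
move=> sK uu; apply: (@DD_assoc _ 1); last by apply: DD_elt => //; [apply: sf1 | apply: oner_neq0].
by apply: assoc_sym; rewrite /assoc divr1.
Qed.

Lemma DDV K a : DD K a -> DD K a^-1.
Proof.
case=> a0 [s [sK sa s1]]; split; first by rewrite invr_eq0.
exists [seq (u.2, u.1) | u <- s]; split.
- by move=> _ /mapP[u us ->] /=; have [] := sK u us.
- by move=> _ /mapP[u us ->] /=; rewrite invrK; have [] := sa u us.
by rewrite big_map -[RHS]s1; apply: eq_bigr => u _; rewrite mulrC.
Qed.

Lemma DDM K a b : is_subfield K -> DD K a -> DD K b -> DD K (a * b).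
Proof.
move=> sK [a0 [s [sKs sa s1]]] [b0 [t [sKt tb t1]]]; split; first by rewrite mulf_neq0.
exists [seq (u.1 * v.1, u.2 * v.2) | u <- s, v <- t]; split.
- move=> _ /allpairsP[[u v] [us vt ->]] /=.
  by have [? ?] := sKs u us; have [? ?] := sKt v vt; split; sf.
- move=> _ /allpairsP[[u v] [us vt ->]] /=.
  have [? ?] := sa u us; have [? ?] := tb v vt.
  by rewrite invfM mulrACA [u.2 * _ * _]mulrACA; split; rewrite rpredM.
rewrite big_allpairs_dep /=  -[RHS](mulr1 1).
transitivity ((\sum_(u <- s) u.1 * u.2) * (\sum_(v <- t) v.1 * v.2)); last by rewrite s1 t1.
rewrite mulr_suml; apply: eq_bigr => u _; rewrite mulr_sumr.
by apply: eq_bigr => v _; rewrite mulrACA.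
Qed.

Lemma DDX K a n : is_subfield K -> DD K a -> DD K (a ^+ n).
Proof.
move=> sK da; elim: n => [|n IH]; first exact: DD_unit sK aunit1.
by rewrite exprS; apply: DDM.
Qed.

Lemma DD_sub (K K' : cset) a : (forall x, K x -> K' x) -> DD K a -> DD K' a.
Proof.
move=> sKK [a0 [s [sK sa s1]]]; split=> //; exists s; split=> // u us.
by have [h1 h2] := sK u us; split; apply: sKK.
Qed.

Lemma DD_aut (K K' : cset) (g : {rmorphism algC -> algC}) a :
  (forall x, K x -> K' (g x)) -> DD K a -> DD K' (g a).
Proof.
move=> gK [a0 [s [sK sa s1]]]; split; first by rewrite fmorph_eq0.
exists [seq (g u.1, g u.2) | u <- s]; split.
- by move=> _ /mapP[u us ->] /=; have [? ?] := sK u us; split; apply: gK.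
- move=> _ /mapP[u us ->] /=; have [? ?] := sa u us.
  by rewrite -fmorphV -!rmorphM !Aint_aut.
by rewrite big_map /= -[RHS](rmorph1 g) -[in RHS]s1 rmorph_sum; apply: eq_bigr => u _; rewrite rmorphM.
Qed.

(* The ideal of [a] is generated by elements of [K], so it is fixed by [Gal(./K)]. *)
Lemma DD_fixed (K : cset) (g : {rmorphism algC -> algC}) a :
  (forall x, K x -> g x = x) -> DD K a -> assoc (g a) a.
Proof.
move=> gK [a0 [s [sK sa s1]]]; have ga0 : g a != 0 by rewrite fmorph_eq0.
apply: assocI => //.
  rewrite -[g a]mul1r -s1 !mulr_suml big_seq rpred_sum // => u us.
  have [h1 h2] := sa u us; have [k1 k2] := sK u us.
  have -> : u.1 * u.2 * g a / a = (u.1 / a) * (u.2 * g a) by field.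
  by rewrite rpredM // -(gK _ k2) -rmorphM Aint_aut.
rewrite -[a in a / _]mul1r -s1 !mulr_suml big_seq rpred_sum // => u us.
have [h1 h2] := sa u us; have [k1 k2] := sK u us.
have -> : u.1 * u.2 * a / g a = (u.1 / g a) * (u.2 * a) by field.
by rewrite rpredM // -[u.1 in X in X \in _](gK _ k1) -fmorphV -rmorphM Aint_aut.
Qed.

(** The ideal of [a] is principal over [K]; two ideal classes are equal when [pr K (a / b)].
    Membership in the 2-class group is [TT]. *)
Definition pr (K : cset) a := exists2 b, K b & assoc a b.
Definition TT (K : cset) a := DD K a /\ exists n, pr K (a ^+ (2 ^ n)).

Lemma pr_assoc K a b : assoc a b -> pr K a -> pr K b.
Proof. by move=> ab [c Kc ac]; exists c => //; apply: assoc_trans ac; apply: assoc_sym. Qed.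
Lemma prM K a b : is_subfield K -> pr K a -> pr K b -> pr K (a * b).
Proof. by move=> sK [c Kc ac] [d Kd bd]; exists (c * d); [sf | apply: assocM]. Qed.
Lemma prV K a : is_subfield K -> pr K a -> pr K a^-1.
Proof. by move=> sK [c Kc ac]; exists c^-1; [sf | apply: assocV]. Qed.
Lemma pr_elt (K : cset) a : K a -> a != 0 -> pr K a.
Proof. by move=> Ka a0; exists a => //; apply: assoc_refl. Qed.
Lemma pr1 (K : cset) : is_subfield K -> pr K 1.
Proof. by move=> sK; apply: pr_elt (sf1 sK) (oner_neq0 _). Qed.
Lemma prX K a n : is_subfield K -> pr K a -> pr K (a ^+ n).
Proof. by move=> sK pa; elim: n => [|n IH]; [exact: pr1 | rewrite exprS; apply: prM]. Qed.
Lemma pr_nz K a : pr K a -> a != 0. Proof. by case=> b _ /assoc_nz1. Qed.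
Lemma pr_sub (K K' : cset) a : (forall x, K x -> K' x) -> pr K a -> pr K' a.
Proof. by move=> s [b Kb ab]; exists b => //; apply: s. Qed.
Lemma pr_DD K a : is_subfield K -> pr K a -> DD K a.
Proof.
move=> sK [b Kb ab]; apply: DD_assoc (assoc_sym ab) _.
by apply: DD_elt => //; apply: assoc_nz2 ab.
Qed.

Lemma pr2X_le K a n m : is_subfield K -> (n <= m)%N -> pr K (a ^+ (2 ^ n)) -> pr K (a ^+ (2 ^ m)).
Proof. by move=> sK /subnKC <-; rewrite expnD exprM; apply: prX. Qed.
Lemma TTM K a b : is_subfield K -> TT K a -> TT K b -> TT K (a * b).
Proof.
move=> sK [da [n pa]] [db [m pb]]; split; first exact: DDM.
exists (maxn n m); rewrite exprMn; apply: prM => //.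
  by apply: (pr2X_le sK _ pa); rewrite leq_maxl.
by apply: (pr2X_le sK _ pb); rewrite leq_maxr.
Qed.
Lemma pr_TT K a : is_subfield K -> pr K a -> TT K a.
Proof. by move=> sK pa; split; [apply: pr_DD | exists 0%N; rewrite expn0 expr1]. Qed.
Lemma TTX K a n : is_subfield K -> TT K a -> TT K (a ^+ n).
Proof. by move=> sK ta; elim: n => [|n IH]; [apply: pr_TT (pr1 sK) | rewrite exprS; apply: TTM]. Qed.

(** * Greatest common divisors of ideals *)

Lemma DD_fin K a : DD K a -> exists (I : finType) (x z : I -> algC),
  [/\ (forall i, K (x i) /\ K (z i)), (forall i, x i / a \in Aint /\ z i * a \in Aint)
    & \sum_i x i * z i = 1].
Proof.
case=> a0 [s [sK sa s1]]; exists 'I_(size s), (fun i : 'I_(size s) => (nth 0 s i).1), (fun i : 'I_(size s) => (nth 0 s i).2).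
split; [by move=> i; apply: sK; rewrite mem_nth | by move=> i; apply: sa; rewrite mem_nth |].
by rewrite -[RHS]s1 [RHS](big_nth 0) big_mkord.
Qed.

Lemma fin_DD (K : cset) a (I : finType) (x z : I -> algC) :
  a != 0 -> (forall i, K (x i) /\ K (z i)) ->
  (forall i, x i / a \in Aint /\ z i * a \in Aint) -> \sum_i x i * z i = 1 -> DD K a.
Proof.
move=> a0 xK xa x1; split=> //; exists [seq (x i, z i) | i <- enum I]; split.
- by move=> _ /mapP[i _ ->]; apply: xK.
- by move=> _ /mapP[i _ ->]; apply: xa.
by rewrite big_map big_enum.
Qed.

(* [Bez]: finitely generated ideals become principal over the ring of all algebraic
   integers; [Inv]: finitely generated fractional ideals are invertible. *)
Definition Bez (K : cset) := forall (I : finType) (x : I -> algC),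
  (forall i, K (x i)) -> (exists i, x i != 0) ->
  exists a (z : I -> algC), [/\ a != 0, (forall i, K (z i)),
    (forall i, x i / a \in Aint /\ z i * a \in Aint) & \sum_i x i * z i = 1].

Definition Inv (K : cset) := forall (I : finType) (x : I -> algC),
  (forall i, K (x i)) -> (exists i, x i != 0) ->
  exists z : I -> algC, [/\ (forall i, K (z i)),
    (forall i j, x i * z j \in Aint) & \sum_i x i * z i = 1].

Lemma sum1_nz (I : finType) (x z : I -> algC) :
  \sum_i x i * z i = 1 -> exists i, x i != 0.
Proof.
move=> x1; case: (pickP (fun i => x i != 0)) => [i xi|h]; first by exists i.
have e : \sum_i x i * z i = 0.
  by rewrite big1 // => i _; move/negbFE: (h i) => /eqP->; rewrite mul0r.
by have := oner_neq0 algC; rewrite -x1 e eqxx.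
Qed.

(** The relation with integral [z i * a] writes [a] as an integral combination of the [x i], so
    every common divisor of them divides [a]. *)
Lemma Bez_gcd K (I : finType) (x : I -> algC) : Bez K ->
  (forall i, K (x i)) -> (exists i, x i != 0) ->
  exists a, [/\ DD K a, (forall i, x i / a \in Aint) &
    forall e, e != 0 -> (forall i, x i / e \in Aint) -> a / e \in Aint].
Proof.
move=> bK xK x0; have [a [z [a0 zK xa x1]]] := bK I x xK x0; exists a; split.
- by apply: (fin_DD a0 _ xa x1).
- by move=> i; have [] := xa i.
move=> e e0 xe; rewrite -[a]mul1r -x1 !mulr_suml rpred_sum // => i _.
have -> : x i * z i * a / e = (x i / e) * (z i * a) by field.
by rewrite rpredM //; have [] := xa i.
Qed.

(** The sum of two ideals: generators of both are put into one family. *)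
Lemma DD_gcd K a b : Bez K -> DD K a -> DD K b ->
  exists g, [/\ DD K g, a / g \in Aint, b / g \in Aint &
    forall e, e != 0 -> a / e \in Aint -> b / e \in Aint -> g / e \in Aint].
Proof.
move=> bK da db; have [a0 b0] := (DD_nz da, DD_nz db).
have [I [x [z [xK xa x1]]]] := DD_fin da.
have [J [y [w [yK yb y1]]]] := DD_fin db.
pose X (k : I + J) := match k with inl i => x i | inr j => y j end.
have [|| g [dg Xg gm]] := @Bez_gcd K _ X bK.
- by case=> k; [have [] := xK k | have [] := yK k].
- by have [i xi] := sum1_nz x1; exists (inl i).
have g0 := DD_nz dg; exists g; split=> //.
- rewrite -[a]mul1r -x1 !mulr_suml rpred_sum // => i _.
  have -> : x i * z i * a / g = (x i / g) * (z i * a) by field.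
  by rewrite rpredM //; [apply: (Xg (inl i)) | have [] := xa i].
- rewrite -[b]mul1r -y1 !mulr_suml rpred_sum // => i _.
  have -> : y i * w i * b / g = (y i / g) * (w i * b) by field.
  by rewrite rpredM //; [apply: (Xg (inr i)) | have [] := yb i].
move=> e e0 ae be; apply: gm => // -[i|j] /=.
  have -> : x i / e = (x i / a) * (a / e) by field; rewrite ?e0 ?a0.
  by rewrite rpredM //; have [] := xa i.
have -> : y j / e = (y j / b) * (b / e) by field; rewrite ?e0 ?b0.
by rewrite rpredM //; have [] := yb j.
Qed.

(** * Quadratic extensions: descent, norms, Hilbert 90 *)

(** Only the involution [s] of [K] with fixed field [k] is recorded, so that towers are built from
    automorphisms of [algC] without speaking of degrees. *)
Definition quad (k K : cset) (s : {rmorphism algC -> algC}) :=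
  [/\ is_subfield K, (forall x, K x -> K (s x)), (forall x, K x -> s (s x) = x)
    & forall x, k x <-> K x /\ s x = x].

(** Collects a double sum into the diagonal and the unordered pairs; for a product with its
    conjugate, each such group is a norm or a trace. *)
Lemma sum_sym (I : finType) (G : I -> I -> algC) :
  \sum_i \sum_j G i j =
  \sum_i (G i i + \sum_(j | (enum_rank i < enum_rank j)%N) (G i j + G j i)).
Proof.
have E i : \sum_j G i j = G i i + (\sum_(j | (enum_rank i < enum_rank j)%N) G i j
    + \sum_(j | (enum_rank j < enum_rank i)%N) G i j).
  rewrite (bigD1 i) //=; congr (_ + _).
  rewrite (bigID (fun j => enum_rank i < enum_rank j)%N) /=; congr (_ + _); apply: eq_bigl => j.
    by case: ltngtP => // h; rewrite ?andbT ?andbF //; apply/eqP => e; move: h; rewrite e ltnn.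
  rewrite -leqNgt leq_eqVlt; have [->|ne] := eqVneq j i; first by rewrite ltnn.
  by rewrite /= val_eqE (inj_eq enum_rank_inj) (negPf ne).
rewrite (eq_bigr _ (fun i _ => E i)) !big_split /=; congr (_ + _).
rewrite [X in _ + X = _](exchange_big_dep xpredT) //= -big_split /=.
by apply: eq_bigr => i _; rewrite big_split.
Qed.

Section Quad.
Variables (k K : cset) (s : {rmorphism algC -> algC}).
Hypothesis q : quad k K s.

Lemma quad_sub x : k x -> K x. Proof. by case: q => _ _ _ h /h[]. Qed.
Lemma quad_sK : is_subfield K. Proof. by case: q. Qed.
Lemma quad_fix x : k x -> s x = x. Proof. by case: q => _ _ _ h /h[]. Qed.
Lemma quad_in x : K x -> s x = x -> k x. Proof. by case: q => _ _ _ h *; apply/h. Qed.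
Lemma quad_K x : K x -> K (s x). Proof. by case: q => _ h _ _; apply: h. Qed.
Lemma quad_inv x : K x -> s (s x) = x. Proof. by case: q => _ _ h _; apply: h. Qed.
Let sK := quad_sK.
Lemma quad_sk : is_subfield k.
Proof.
split.
- by apply: quad_in; [sf | rewrite rmorph1].
- move=> x y kx ky; apply: quad_in; first by apply: sfB => //; apply: quad_sub.
  by rewrite rmorphB !quad_fix.
- move=> x y kx ky; apply: quad_in; first by apply: sfM => //; apply: quad_sub.
  by rewrite rmorphM !quad_fix.
by move=> x kx; apply: quad_in; [apply: sfV => //; apply: quad_sub | rewrite fmorphV quad_fix].
Qed.
Lemma quad_tr x : K x -> k (x + s x).
Proof. by move=> Kx; apply: quad_in; [sf; apply: quad_K | rewrite rmorphD quad_inv // addrC]. Qed.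
Lemma quad_tr2 x y : K x -> K y -> k (x * s y + y * s x).
Proof.
move=> Kx Ky; apply: quad_in; first by sf; apply: quad_K.
by rewrite rmorphD !rmorphM !quad_inv // addrC; congr (_ + _); rewrite mulrC.
Qed.
Lemma quad_N x : K x -> k (x * s x).
Proof. by move=> Kx; apply: quad_in; [sf; apply: quad_K | rewrite rmorphM quad_inv // mulrC]. Qed.

(** The same [a] serves below: the relation times its conjugate, collected over unordered pairs, has
    norms and traces as coefficients, which lie in [k]. Integrality survives because [a / s a] is
    integral. *)
Lemma Bez_down : Bez K -> Bez k.
Proof.
move=> bK I x xk x0; have [a [z [a0 zK xa x1]]] := bK I x (fun i => quad_sub (xk i)) x0.
have sa0 : s a != 0 by rewrite fmorph_eq0.
have sz1 : \sum_i x i * s (z i) = 1.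
  by rewrite -[RHS](rmorph1 s) -x1 rmorph_sum; apply: eq_bigr => i _; rewrite rmorphM (quad_fix (xk i)).
have saa : a / s a \in Aint.
  rewrite -[a in a / _]mul1r -x1 !mulr_suml rpred_sum // => i _; have [h1 h2] := xa i.
  have -> : x i * z i * a / s a = (x i / s a) * (z i * a) by field.
  by rewrite rpredM // -(quad_fix (xk i)) -fmorphV -rmorphM Aint_aut.
pose G i j := x i * x j * (z i * s (z j)).
have G1 : \sum_i \sum_j G i j = 1.
  rewrite -[RHS](mulr1 1).
  transitivity ((\sum_i x i * z i) * (\sum_j x j * s (z j))); last by rewrite x1 sz1.
  rewrite mulr_suml; apply: eq_bigr => i _; rewrite mulr_sumr.
  by apply: eq_bigr => j _; rewrite /G mulrACA.
pose w i := x i * (z i * s (z i)) +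
  \sum_(j | (enum_rank i < enum_rank j)%N) x j * (z i * s (z j) + z j * s (z i)).
exists a, w; split=> //.
- move=> i; apply: (sfD quad_sk); first by apply: (sfM quad_sk) => //; apply: quad_N.
  elim/big_rec: _ => [|j y _ ky]; first exact: (sf0 quad_sk).
  by apply: (sfD quad_sk) => //; apply: (sfM quad_sk) => //; apply: quad_tr2.
- move=> i; split; first by have [] := xa i.
  have A j l : x j * (z i * s (z l)) * a \in Aint.
    have -> : x j * (z i * s (z l)) * a = (x j / a) * (z i * a) * (s (z l * a) * (a / s a)).
      by rewrite rmorphM; field; rewrite a0 sa0.
    by have [? _] := xa j; have [_ ?] := xa i; have [_ ?] := xa l; ai.
  have B j l : x j * (z l * s (z i)) * a \in Aint.
    have -> : x j * (z l * s (z i)) * a = (x j / a) * (z l * a) * (s (z i * a) * (a / s a)).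
      by rewrite rmorphM; field; rewrite a0 sa0.
    by have [? _] := xa j; have [_ ?] := xa i; have [_ ?] := xa l; ai.
  rewrite mulrDl rpredD // mulr_suml rpred_sum // => j _.
  by rewrite mulrDr mulrDl rpredD.
rewrite -[RHS]G1 sum_sym; apply: eq_bigr => i _; rewrite /w mulrDr; congr (_ + _).
  by rewrite /G; ring.
by rewrite mulr_sumr; apply: eq_bigr => j _; rewrite /G; ring.
Qed.

(** Coefficients of the product of the linear form with coefficients [x] and its conjugate; they
    generate the norm of the ideal of [x]. *)
Let y2 (I : finType) (x : I -> algC) (p : I * I) :=
  if p.1 == p.2 then x p.1 * s (x p.1) else x p.1 * s (x p.2) + x p.2 * s (x p.1).

Let y2k (I : finType) (x : I -> algC) p : (forall i, K (x i)) -> k (y2 x p).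
Proof. by move=> xK; rewrite /y2; case: ifP => _; [apply: quad_N | apply: quad_tr2]. Qed.

(** A product [x i * s (x j)] is a root of a monic quadratic whose coefficients come from [y2]: the
    content theorem for a linear form and its conjugate. *)
Let y2int (I : finType) (x : I -> algC) w : (forall p, y2 x p * w \in Aint) ->
  forall i j, x i * s (x j) * w \in Aint.
Proof.
move=> yw i j; have n l : x l * s (x l) * w \in Aint by have := yw (l, l); rewrite /y2 eqxx.
have [->//|ne] := eqVneq i j.
apply: (@Aint_quad ((x i * s (x j) + x j * s (x i)) * w)
   (- ((x i * s (x i) * w) * (x j * s (x j) * w)))).
- by have := yw (i, j); rewrite /y2 /= (negPf ne).
- by rewrite rpredN rpredM.
ring.
Qed.

(** The inverse ideal is the conjugate ideal divided by the norm ideal, and the latter is invertible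
    in [k]. *)
Lemma Inv_up : Inv k -> Inv K.
Proof.
move=> ik I x xK [i0 xi0].
have [||w [wk yw y1]] := ik _ (y2 x).
- by move=> p; apply: y2k.
- by exists (i0, i0); rewrite /y2 eqxx mulf_neq0 // fmorph_eq0.
pose z i := w (i, i) * s (x i) + \sum_(j | j != i) (w (i, j) + w (j, i)) * s (x j).
have A i j p : x i * s (x j) * w p \in Aint by apply: y2int.
have wK p : K (w p) by apply: quad_sub.
exists z; split.
- move=> i; apply: sfD => //; first by apply: sfM => //; apply: quad_K.
  elim/big_rec: _ => [|j y _ Ky]; first by sf.
  by apply: sfD => //; apply: sfM => //; [apply: sfD | apply: quad_K].
- move=> i j; rewrite mulrDr rpredD //.
    by rewrite mulrCA mulrC.
  rewrite mulr_sumr rpred_sum // => l _.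
  by rewrite mulrCA mulrC mulrDr rpredD.
have -> : 1 = \sum_i \sum_j y2 x (i, j) * w (i, j).
  by rewrite -y1 pair_big; apply: eq_bigr => -[].
rewrite [RHS]sum_sym.
have -> : \sum_i x i * z i = \sum_i \sum_j
   (if i == j then x i * s (x i) * w (i, i) else (w (i, j) + w (j, i)) * (x i * s (x j))).
  apply: eq_bigr => i _; rewrite (bigD1 i) //= eqxx /z mulrDr; congr (_ + _); first by ring.
  by rewrite mulr_sumr; apply: eq_bigr => j; rewrite eq_sym => /negPf ->; ring.
rewrite sum_sym; apply: eq_bigr => i _; rewrite eqxx /y2 /= eqxx; congr (_ + _).
apply: eq_bigr => j h; have ne : i != j by apply: contraTneq h => ->; rewrite ltnn.
by rewrite (negPf ne) eq_sym (negPf ne); ring.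
Qed.

(** The gcd in [k] of the coefficients [y2] is an associate of [a * s a]. *)
Lemma DD_norm a : Bez k -> DD K a -> DD k (a * s a).
Proof.
move=> bk da; have a0 := DD_nz da; have sa0 : s a != 0 by rewrite fmorph_eq0.
have [I [x [z [xK xa x1]]]] := DD_fin da.
have [i0 xi0] := sum1_nz x1.
have [||g [dg yg gm]] := @Bez_gcd k _ (y2 x) bk.
- by move=> p; apply: y2k => i; have [] := xK i.
- by exists (i0, i0); rewrite /y2 eqxx mulf_neq0 // fmorph_eq0.
have g0 := DD_nz dg; apply: DD_assoc dg; apply: assocI => //; first by rewrite mulf_neq0.
- apply: gm => [|p]; first by rewrite mulf_neq0.
  have B i j : x i * s (x j) / (a * s a) \in Aint.
    have -> : x i * s (x j) / (a * s a) = (x i / a) * s (x j / a).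
      by rewrite rmorphM fmorphV; field; rewrite a0 sa0.
    by have [? _] := xa i; have [? _] := xa j; ai.
  by rewrite /y2; case: ifP => _; rewrite ?mulrDl ?rpredD.
have B i j : x i * s (x j) / g \in Aint by apply: y2int.
have -> : a * s a / g = (\sum_i x i * (z i * a)) * (\sum_j s (x j) * s (z j * a)) / g.
  have -> : \sum_i x i * (z i * a) = a.
    by rewrite -[RHS]mul1r -x1 mulr_suml; apply: eq_bigr => i _; rewrite mulrA.
  congr (_ * _ / _); rewrite -[in LHS](mul1r a) -x1 mulr_suml rmorph_sum.
  by apply: eq_bigr => i _; rewrite -rmorphM mulrA.
rewrite mulr_suml mulr_suml rpred_sum // => i _; rewrite mulr_sumr mulr_suml rpred_sum // => j _.
have -> : x i * (z i * a) * (s (x j) * s (z j * a)) / g = (x i * s (x j) / g) * (z i * a) * s (z j * a).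
  by ring.
by have [_ ?] := xa i; have [_ ?] := xa j; have ? := B i j; ai.
Qed.

(* [x * (w - s w) = Tr (x w) - s w * Tr x]: traces generate an ideal up to the different. *)
Lemma DD_descend b w : Bez k -> DD K b -> assoc (s b) b -> K w -> w \in Aint -> w != s w ->
  exists a, [/\ DD k a, a / b \in Aint & (w - s w) * b / a \in Aint].
Proof.
move=> bk db sb Kw wA wsw; have b0 := DD_nz db; have sb0 : s b != 0 by rewrite fmorph_eq0.
have [I [x [z [xK xb x1]]]] := DD_fin db.
have d0 : w - s w != 0 by rewrite subr_eq0.
pose T (p : I + I) := match p with inl i => x i + s (x i) | inr i => x i * w + s (x i * w) end.
have D i : x i * (w - s w) = T (inr i) - s w * T (inl i) by rewrite /T rmorphM; ring.
have [||a [da Ta am]] := @Bez_gcd k _ T bk.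
- by case=> i; apply: quad_tr; sf; have [] := xK i.
- have [i xi] := sum1_nz x1.
  have [e|ne] := eqVneq (T (inl i)) 0; last by exists (inl i).
  exists (inr i); have := mulf_neq0 xi d0; rewrite D e mulr0 subr0.
  by [].
have a0 := DD_nz da; exists a; split=> //.
- apply: am => //.
  have tr y : y / b \in Aint -> (y + s y) / b \in Aint.
    move=> yb; rewrite mulrDl rpredD // -(assoc_dvd _ sb) -fmorphV -rmorphM Aint_aut //.
  case=> i; have [xi _] := xb i; apply: tr => //.
  by rewrite mulrAC; apply: rpredM.
rewrite -[b]mul1r -x1 mulr_suml mulr_sumr mulr_suml rpred_sum // => i _.
have -> : (w - s w) * (x i * z i * b) / a = (z i * b) * ((x i * (w - s w)) / a) by ring.
rewrite rpredM //; first by have [] := xb i.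
by rewrite D mulrBl -mulrA; apply: rpredB => //; apply: rpredM => //; apply: Aintg.
Qed.

(** From [(a + n) ^+ 2 = a * (a + s a + n *+ 2)] the inverse of the trace factor serves as [r]; when
    [a = - n] the element already lies in [k]. *)
Lemma hilbert90 a n : K a -> a != 0 -> k n -> a * s a = n ^+ 2 ->
  exists r b, [/\ k r, r != 0, K b, b != 0 & a = r * b ^+ 2].
Proof.
move=> Ka a0 kn e; have [an|an] := eqVneq (a + n) 0.
  exists a, 1; rewrite expr1n mulr1 oner_neq0; split=> //; last by sf.
  by rewrite (eqP (_ : a == - n)) -?addr_eq0 ?an //; apply: sfN => //; exact: quad_sk.
have Kn := quad_sub kn.
have E : (a + n) ^+ 2 = a * (a + s a + n *+ 2) by rewrite sqrrD -e; ring.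
have t0 : a + s a + n *+ 2 != 0.
  by apply: contra_neq an => t; apply/eqP; rewrite -sqrf_eq0 E t mulr0.
exists (a + s a + n *+ 2)^-1, (a + n); split=> //; last by rewrite E mulrC mulfK.
- by apply: (sfV quad_sk); apply: (sfD quad_sk); [apply: quad_tr | apply: (sfMn quad_sk)].
- by rewrite invr_eq0.
by sf.
Qed.

End Quad.

(** * Finiteness of the class number in towers of quadratic extensions *)

Lemma nat_min (P : nat -> Prop) : (exists n, P n) -> exists n, P n /\ forall m, P m -> (n <= m)%N.
Proof.
case=> n; elim/ltn_ind: n => n IH Pn.
case: (classic (exists2 m, P m & (m < n)%N)) => [[m Pm mn]|h]; first exact: (IH m).
by exists n; split=> // m Pm; rewrite leqNgt; apply/negP => mn; apply: h; exists m.
Qed.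

Definition rmC := {rmorphism algC -> algC}.

(** Data for Hurwitz's argument: [G] are conjugations whose product is a norm to the rationals, [B]
    a spanning family of integers, [D] a common denominator for the coordinates of all integers, [C]
    a bound for all conjugates of [B]. *)
Record tower (K : cset) (G : seq rmC) (B : seq algC) : Prop := Tower {
  tw_nil : (0 < size G)%N;
  tw_norm : forall x, K x -> \prod_(g <- G) (g : rmC) x \in Crat;
  tw_rat : forall x, K x -> exists c : nat -> rat, x = \sum_(i < size B) ratr (c i) * B`_i;
  tw_int : exists D : nat, (0 < D)%N /\ forall x, K x -> x \in Aint ->
    exists c : nat -> int, D%:R * x = \sum_(i < size B) (c i)%:~R * B`_i;
  tw_bas : forall i, (i < size B)%N -> K B`_i /\ B`_i \in Aint;
  tw_bnd : exists C : nat, forall (g : rmC) i, (i < size B)%N -> `|g B`_i| <= C%:R }.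

Definition idrm : rmC := GRing.RMorphism.clone _ _ (@idfun algC) _.
Definition comprm (g h : rmC) : rmC := GRing.RMorphism.clone _ _ (g \o h) _.

Lemma tower_rat : tower (fun x => x \in Crat) [:: idrm] [:: 1].
Proof.
split=> //=.
- by move=> x xq; rewrite big_seq1.
- by move=> x /CratP[r ->]; exists (fun _ => r); rewrite big_ord1 mulr1.
- exists 1%N; split=> // x xq xA; have /intrP[z ->] := Cint_rat_Aint xq xA.
  by exists (fun _ => z); rewrite big_ord1 mulr1 mul1r.
- by case=> // _; rewrite rpred1 Aint1.
by exists 1%N => g [|//] _; rewrite rmorph1 normr1.
Qed.

Lemma nth_cat_map (B : seq algC) d (F : nat -> algC) :
  \sum_(i < size (B ++ map ( *%R^~ d) B)) F i * (B ++ map ( *%R^~ d) B)`_i =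
  \sum_(i < size B) F i * B`_i + (\sum_(i < size B) F (size B + i)%N * B`_i) * d.
Proof.
rewrite size_cat size_map big_split_ord /=; congr (_ + _).
  by apply: eq_bigr => i _; rewrite nth_cat ltn_ord.
rewrite mulr_suml; apply: eq_bigr => i _.
by rewrite nth_cat ltnNge leq_addr /= addKn (nth_map 0) // mulrA.
Qed.

(** The coordinates of [x] come from its trace [x + s x] and from [(x - s x) * d], both in [k];
    recovering [x] costs the factor [2 * |dz|] in the denominator. *)
Lemma tower_step k K G B (s : rmC) d (dz : int) :
  tower k G B -> quad k K s -> K d -> s d = - d -> d != 0 -> d ^+ 2 = dz%:~R ->
  tower K (G ++ [seq comprm g s | g <- G]) (B ++ map ( *%R^~ d) B).
Proof.
case=> G0 tN tR [D [D0 tI]] tB [C tC] q Kd sd d0 dz2.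
have sK := quad_sK q; have sk := quad_sk q; have kK := quad_sub q.
have dA : d \in Aint by apply: (@Aint_root 2) => //; rewrite dz2 Aint_int.
have nC : 2%:R != 0 :> algC by rewrite pnatr_eq0.
have kd2 : k (d ^+ 2) by rewrite dz2; apply: sf_int.
have ctr x : K x -> k ((x - s x) * d).
  move=> Kx; apply: (quad_in q); first by sf; apply: (quad_K q).
  by rewrite rmorphM rmorphB (quad_inv q) // sd; ring.
split.
- by rewrite size_cat ltn_addr.
- move=> x Kx; rewrite big_cat big_map /= -big_split /=.
  have := tN _ (quad_N q Kx); congr (_ \in Crat).
  by apply: eq_bigr => g _; rewrite rmorphM.
- move=> x Kx.
  have [c ec] := tR _ (sfM sk (quad_tr q Kx) (sfV sk (sf_nat sk 2))).
  have [c' ec'] := tR _ (sfM sk (ctr x Kx) (sfV sk (sfM sk (sf_nat sk 2) kd2))).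
  pose F i := if (i < size B)%N then c i else c' (i - size B)%N.
  exists F; rewrite (nth_cat_map _ _ (fun i => ratr (F i))) /F.
  under eq_bigr => i _ do rewrite ltn_ord.
  under [X in _ + X * _]eq_bigr => i _ do rewrite ltnNge leq_addr /= addKn.
  by rewrite -ec -ec'; field; rewrite d0.
- exists (`|dz| * (2 * D))%N; split.
    have dz0 : dz != 0 by apply: contraNneq d0 => dz0; rewrite -sqrf_eq0 dz2 dz0.
    by rewrite !muln_gt0 absz_gt0 dz0 D0.
  move=> x Kx xA.
  have [c ec] := tI _ (quad_tr q Kx) (rpredD xA (etrans (Aint_aut s x) xA)).
  have [c' ec'] := tI _ (ctr x Kx) (rpredM (rpredB xA (etrans (Aint_aut s x) xA)) dA).
  pose e : int := `|dz|%N; pose f : int := sgz dz.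
  pose F i := if (i < size B)%N then e * c i else f * c' (i - size B)%N.
  exists F; rewrite (nth_cat_map _ _ (fun i => (F i)%:~R)) /F.
  under eq_bigr => i _ do rewrite ltn_ord rmorphM -mulrA.
  under [X in _ + X * _]eq_bigr => i _ do rewrite ltnNge leq_addr /= addKn rmorphM -mulrA.
  rewrite -!mulr_sumr -ec -ec' mulrA natrM.
  have -> : (`|dz|%N)%:R = e%:~R :> algC by [].
  have -> : f%:~R * (D%:R * ((x - s x) * d)) * d = (f * dz)%:~R * D%:R * (x - s x) :> algC.
    by rewrite intrM -dz2; ring.
  have -> : f * dz = e by rewrite /e /f abszEsg.
  by rewrite natrM; ring.
- move=> i; rewrite size_cat size_map nth_cat => iBB; case: (ltnP i (size B)) => [iB|Bi].
    by have [h1 h2] := tB i iB; split=> //; apply: kK.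
  have iB : (i - size B < size B)%N by rewrite ltn_subLR.
  by rewrite (nth_map 0) //; have [h1 h2] := tB _ iB; split; [sf; apply: kK | rewrite rpredM].
exists (C * (`|dz| + 1))%N => g i; rewrite size_cat size_map nth_cat natrM natrD => iBB.
have h1 : 1 <= (`|dz|%N)%:R + 1 :> algC by rewrite lerDr ler0n.
case: (ltnP i (size B)) => [iB|Bi].
  by apply: le_trans (tC g i iB) _; rewrite ler_peMr ?ler0n.
have iB : (i - size B < size B)%N by rewrite ltn_subLR.
rewrite (nth_map 0) // rmorphM normrM; apply: ler_pM => //; first exact: tC.
have : `|g d| ^+ 2 <= ((`|dz|%N)%:R + 1) ^+ 2.
  rewrite -normrX -rmorphXn dz2 rmorph_int.
  have -> : `|dz%:~R| = (`|dz|%N)%:R :> algC by rewrite -intr_norm -abszE.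
  have e0 : 0 <= (`|dz|%N)%:R :> algC by rewrite ler0n.
  have -> : ((`|dz|%N)%:R + 1) ^+ 2 = (`|dz|%N)%:R + ((`|dz|%N)%:R ^+ 2 + (`|dz|%N)%:R + 1) :> algC by ring.
  by rewrite lerDl addr_ge0 ?ler01 // addr_ge0 // exprn_ge0.
by rewrite ler_sqr ?nnegrE ?normr_ge0 // (le_trans ler01).
Qed.

Lemma ratr_bound (x : algC) : x \in Crat -> exists M : nat, (0 < M)%N /\ M%:R * x \in Aint.
Proof.
case/CratP => r ->; exists `|denq r|%N; split; first by rewrite absz_gt0 denq_neq0.
have -> : (`|denq r|%N)%:R = (denq r)%:~R :> algC.
  by rewrite -[LHS]/((`|denq r|%N%:Z)%:~R) gez0_abs // ltW // denq_gt0.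
rewrite -{2}(divq_num_den r) rmorphM fmorphV /= !ratr_int mulrC divfK ?Aint_int //.
by rewrite intr_eq0 denq_neq0.
Qed.

Section Finiteness.
Variables (K : cset) (G : seq rmC) (B : seq algC).
Hypotheses (tw : tower K G B) (sK : is_subfield K).
Let n := size B.

Lemma tower_denom x : K x -> exists M : nat, (0 < M)%N /\ M%:R * x \in Aint.
Proof.
move=> Kx; have [c ->] := tw_rat tw Kx.
have /fin_all_exists[M HM] : forall i : 'I_n, exists m : nat, (0 < m)%N /\ m%:R * ratr (c i) \in Aint.
  by move=> i; apply: ratr_bound; apply: Crat_rat.
exists (\prod_i M i)%N; split; first by rewrite prodn_cond_gt0 // => i _; case: (HM i).
rewrite mulr_sumr rpred_sum // => i _; rewrite (bigD1 i) //= natrM mulrA.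
rewrite [X in X * _ \in _]mulrAC; apply: rpredM; last by have [] := tw_bas tw (ltn_ord i).
by apply: rpredM; [have [] := HM i | apply: Aint_Cnat; rewrite rpred_nat].
Qed.

Let N x := \prod_(g <- G) (g : rmC) x.
Let NM x y : N (x * y) = N x * N y.
Proof. by rewrite /N -big_split; apply: eq_bigr => g _; rewrite rmorphM. Qed.
Let N0 x : x != 0 -> N x != 0.
Proof.
move=> x0; rewrite /N; elim/big_rec: _ => [|g y _ y0]; first exact: oner_neq0.
by rewrite mulf_neq0 // fmorph_eq0.
Qed.
Let N_int x : K x -> x \in Aint -> exists m : nat, `|N x| = m%:R.
Proof.
move=> Kx xA; have /intrP[z ->] : N x \in Num.int.
  apply: Cint_rat_Aint; first exact: tw_norm tw _ Kx.
  by rewrite /N rpred_prod // => g _; apply: Aintg.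
by exists `|z|%N; rewrite -intr_norm -abszE.
Qed.

(** Pigeonhole on the fractional parts of the coordinates of the multiples of [x]: two multiples
    share a box, and their difference is close, at every conjugation in question, to an integer [w]
    of [K]. *)
Lemma hurwitz : exists T : nat, forall x, K x -> exists (t : nat) (w : algC),
  [/\ (0 < t)%N, (t <= T)%N, K w, w \in Aint & `|N (t%:R * x - w)| < 1].
Proof.
(* With this [R], n coordinates of size at most [1 / (R + 1)] times conjugates of size at most [C]
   add up to at most [R / (R + 1)], which is below 1. *)
have [C tC] := tw_bnd tw; pose R := (n * C)%N.
pose box := {ffun 'I_n -> 'I_R.+1}; exists #|box| => x Kx.
have [c ec] := tw_rat tw Kx.
pose fr (t : nat) (i : 'I_n) : rat := t%:R * c i - (Num.floor (t%:R * c i))%:~R.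
have fr_ge t i : 0 <= fr t i by rewrite subr_ge0 floor_le.
have fr_lt t i : fr t i < 1.
  by rewrite ltrBlDr addrC -[1]/(1%:~R) -intrD floorD1_gt.
pose bx (t : 'I_#|box|.+1) : box := [ffun i => inord `|Num.floor (R.+1%:R * fr t i)|%N].
have /injectivePn[t1 [t2 ne e]] : ~~ injectiveb bx.
  by apply/injectiveP => /leq_card; rewrite card_ord ltnn.
have bxE (t : 'I_#|box|.+1) (i : 'I_n) : (bx t i)%:R <= R.+1%:R * fr t i < (bx t i)%:R + 1.
  have h0 : 0 <= R.+1%:R * fr t i by rewrite mulr_ge0 ?ler0n.
  have f0 : (0 <= Num.floor (R.+1%:R * fr t i))%R by rewrite floor_ge0.
  have f1 : (Num.floor (R.+1%:R * fr t i) < R.+1%:Z)%R.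
    by rewrite floor_lt_int; rewrite -[X in _ < X]mulr1 ltr_pM2l ?ltr0n.
  have f2 : (`|Num.floor (R.+1%:R * fr t i)| < R.+1)%N by lia.
  have zE : (`|Num.floor (R.+1%:R * fr t i)|%N)%:R = (Num.floor (R.+1%:R * fr t i))%:~R :> rat.
    by rewrite -[LHS]/((`|Num.floor (R.+1%:R * fr t i)|%N%:Z)%:~R) gez0_abs.
  rewrite ffunE inordK // zE floor_le /=.
  by have := floorD1_gt (R.+1%:R * fr t i); rewrite intrD.
wlog lt : t1 t2 ne e / (t1 < t2)%N.
  move=> W; have [h|h|h] := ltngtP t1 t2; first exact: (W t1 t2).
    by apply: (W t2 t1) => //; rewrite eq_sym.
  by case/eqP: ne; apply: val_inj.
exists (t2 - t1)%N.
exists (\sum_(i < n) (Num.floor (t2%:R * c i) - Num.floor (t1%:R * c i))%:~R * B`_i); split.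
- by rewrite subn_gt0.
- by rewrite (leq_trans (leq_subr _ _)) // -ltnS.
- apply: sf_sum => // i _; apply: sfM => //; first exact: sf_int.
  by have [] := tw_bas tw (ltn_ord i).
- by rewrite rpred_sum // => i _; apply: rpredM; [apply: Aint_int | have [] := tw_bas tw (ltn_ord i)].
have -> : (t2 - t1)%:R * x - \sum_(i < n) (Num.floor (t2%:R * c i) - Num.floor (t1%:R * c i))%:~R * B`_i
   = \sum_(i < n) ratr (fr t2 i - fr t1 i) * B`_i.
  rewrite ec mulr_sumr -sumrB; apply: eq_bigr => i _; rewrite mulrA -mulrBl; congr (_ * _).
  rewrite /fr !rmorphB !rmorphM /= !ratr_nat !ratr_int natrB; last exact: ltnW.
  by ring.
have small (g : rmC) : `|g (\sum_(i < n) ratr (fr t2 i - fr t1 i) * B`_i)| < 1.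
  rewrite rmorph_sum; apply: le_lt_trans (ler_norm_sum _ _ _) _.
  have le i : `|g (ratr (fr t2 i - fr t1 i) * B`_(i : 'I_n))| <= C%:R / R.+1%:R.
    rewrite rmorphM normrM fmorph_rat mulrC ler_pM //; first exact: tC.
    have -> : `|ratr (fr t2 i - fr t1 i)| = ratr `|fr t2 i - fr t1 i| :> algC by rewrite ratr_norm.
    have -> : R.+1%:R^-1 = ratr (R.+1%:R^-1) :> algC by rewrite fmorphV /= ratr_nat.
    rewrite ler_rat; have := bxE t1 i; have := bxE t2 i; rewrite e.
    have Rp : 0 < R.+1%:R :> rat by rewrite ltr0n.
    move=> /andP[a1 a2] /andP[b1 b2]; rewrite -(ler_pM2l Rp) mulfV ?gt_eqF //.
    rewrite -[X in X * _]gtr0_norm // -normrM ler_norml; apply/andP; split; lra.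
  apply: le_lt_trans (ler_sum _ (fun i _ => le i)) _.
  have -> : \sum_(i < n) C%:R / R.+1%:R = R%:R / R.+1%:R :> algC.
    by rewrite sumr_const card_ord natrM -mulrnAl mulr_natl.
  by rewrite ltr_pdivrMr ?ltr0n // mul1r ltr_nat.
have := tw_nil tw; rewrite /N; case: G => // g0 G' _; rewrite big_cons normrM.
have : `|\prod_(g <- G') (g : rmC) (\sum_(i < n) ratr (fr t2 i - fr t1 i) * B`_i)| <= 1.
  elim/big_rec: _ => [|g y _ y1]; first by rewrite normr1.
  by rewrite normrM mulr_ile1 // ltW.
move=> h; apply: le_lt_trans (small g0); by rewrite ler_piMr.
Qed.

(** [T!] is a multiple of every multiplier [t] given by [hurwitz]. For [b] of least norm in the
    ideal the remainder [t * y - w * b] must vanish, so [T! * y] is a multiple of [b]; scaled by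
    [l = T! / b] the ideal becomes integral and contains [W]. *)
Lemma bounded_ideals : exists W : nat, (0 < W)%N /\
  forall (I : finType) (x z : I -> algC), (forall i, K (x i)) -> (forall i, K (z i)) ->
  (forall i j, x i * z j \in Aint) -> \sum_i x i * z i = 1 ->
  exists l, [/\ K l, l != 0, (forall i, l * x i \in Aint) & forall i, W%:R * (z i / l) \in Aint].
Proof.
have [T HT] := hurwitz; exists T`!; split=> [|I x z xK zK xz x1]; first exact: fact_gt0.
have [i0 xi0] := sum1_nz x1.
have /fin_all_exists[M HM] : forall i, exists m : nat, (0 < m)%N /\ m%:R * x i \in Aint.
  by move=> i; apply: tower_denom.
pose M0 := (\prod_i M i)%N.
have M0x i : M0%:R * x i \in Aint.
  rewrite /M0 (bigD1 i) //= natrM mulrAC; apply: rpredM; first by have [] := HM i.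
  by apply: Aint_Cnat; rewrite rpred_nat.
have M0n : M0%:R != 0 :> algC.
  by rewrite pnatr_eq0 -lt0n prodn_cond_gt0 // => i _; case: (HM i).
pose mem y := K y /\ forall j, y * z j \in Aint.
have mem_int y : mem y -> M0%:R * y \in Aint.
  case=> Ky yz; have -> : M0%:R * y = \sum_i (M0%:R * x i) * (y * z i).
    transitivity (M0%:R * y * \sum_i x i * z i); first by rewrite x1 mulr1.
    by rewrite mulr_sumr; apply: eq_bigr => i _; ring.
  by rewrite rpred_sum // => i _; apply: rpredM.
have memK y : mem y -> exists m : nat, `|N (M0%:R * y)| = m%:R.
  by move=> my; apply: N_int; [apply: sfM => //; [apply: sf_nat | case: my] | apply: mem_int].
pose P m := exists y, [/\ mem y, y != 0 & `|N (M0%:R * y)| = m%:R].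
have [|m [[b [mb b0 bm]] bmin]] := @nat_min P.
  have mx : mem (x i0) by split.
  by have [m Hm] := memK _ mx; exists m, (x i0).
have [Kb bz] := mb.
have div y : mem y -> T`!%:R * (y / b) \in Aint.
  move=> my; have [Ky yz] := my.
  have [t [w [t0 tT Kw wA Nw]]] := HT (y / b) (sfM sK Ky (sfV sK Kb)).
  have my' : mem (t%:R * y - w * b).
    split; first by sf.
    move=> j; rewrite mulrBl -!mulrA; apply: rpredB; apply: rpredM => //.
    by apply: Aint_Cnat; rewrite rpred_nat.
  have [y0|y0] := eqVneq (t%:R * y - w * b) 0.
    have -> : y / b = w / t%:R.
      have tn : t%:R != 0 :> algC by rewrite pnatr_eq0 -lt0n.
      by apply/eqP; rewrite eqr_div // -subr_eq0 [y * _]mulrC y0.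
    have /dvdnP[e ->] : (t %| T`!)%N by apply: dvdn_fact; rewrite t0.
    have -> : (e * t)%:R * (w / t%:R) = e%:R * w.
      by rewrite natrM; field; rewrite pnatr_eq0 -lt0n.
    by apply: rpredM => //; apply: Aint_Cnat; rewrite rpred_nat.
  have [m' Hm'] := memK _ my'.
  have : (m <= m')%N by apply: bmin; exists (t%:R * y - w * b).
  rewrite leqNgt -(ltr_nat algC) -Hm' -bm => /negP[].
  have -> : M0%:R * (t%:R * y - w * b) = (M0%:R * b) * (t%:R * (y / b) - w) by field.
  by rewrite NM normrM gtr_pMr // normr_gt0 N0 // mulf_neq0.
have Tn : T`!%:R != 0 :> algC by rewrite pnatr_eq0 -lt0n fact_gt0.
exists (T`!%:R / b); split.
- by apply: sfM => //; [apply: sf_nat | apply: sfV].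
- by rewrite mulf_neq0 // invr_eq0.
- by move=> i; rewrite mulrAC -mulrA; apply: div; split.
move=> i; have -> : T`!%:R * (z i / (T`!%:R / b)) = b * z i by field; rewrite b0 Tn.
exact: bz.
Qed.

(** An integral ideal containing [W] is known from the residues modulo [D * W] of the coordinates of
    its elements, so only finitely many occur. Ideals are tested through their inverses [z] and
    [z']; inclusion of the finite patterns gives inclusion of the ideals. *)
Lemma pattern_eq D W (I J : finType) (x z : I -> algC) (z' : J -> algC) :
  (0 < D)%N -> (0 < W)%N ->
  (forall y, K y -> y \in Aint -> exists c : nat -> int, D%:R * y = \sum_(i < n) (c i)%:~R * B`_i) ->
  (forall i, K (x i)) -> (forall i, x i \in Aint) ->
  (forall i j, x i * z j \in Aint) ->
  (forall i, W%:R * z i \in Aint) -> (forall i, W%:R * z' i \in Aint) ->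
  (forall f : {ffun 'I_n -> 'I_(D * W)},
    [forall j, (\sum_i (f i)%:R * B`_i) / D%:R * z j \in Aint] ->
    [forall j, (\sum_i (f i)%:R * B`_i) / D%:R * z' j \in Aint]) ->
  forall i j, x i * z' j \in Aint.
Proof.
move=> D0 W0 tI xK xA xz zW z'W H i j.
have V0 : (0 < D * W)%N by rewrite muln_gt0 D0.
have [c ec] := tI _ (xK i) (xA i).
have Dn : D%:R != 0 :> algC by rewrite pnatr_eq0 -lt0n.
have lt l : (`|(c l %% (D * W)%N%:Z)%Z| < D * W)%N.
  by rewrite -ltz_nat gez0_abs ?modz_ge0 -?lt0n // ?ltz_pmod // -lt0n.
pose f := [ffun l : 'I_n => Ordinal (lt l)].
pose h := \sum_(l < n) (c l %/ (D * W)%N%:Z)%Z%:~R * B`_l.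
have hA : h \in Aint.
  rewrite rpred_sum // => l _; apply: rpredM; first exact: Aint_int.
  by have [] := tw_bas tw (ltn_ord l).
have E : (\sum_l (f l)%:R * B`_l) / D%:R = x i - W%:R * h.
  suff -> : \sum_l (f l)%:R * B`_l = D%:R * x i - D%:R * W%:R * h by field.
  rewrite ec /h mulr_sumr -sumrB; apply: eq_bigr => l _; rewrite ffunE /=.
  have -> : (`|(c l %% (D * W)%N%:Z)%Z|%N)%:R = (c l %% (D * W)%N%:Z)%Z%:~R :> algC.
    by rewrite -[LHS]/((`|(c l %% (D * W)%N%:Z)%Z|%N%:Z)%:~R) gez0_abs ?modz_ge0 -?lt0n.
  have -> : (c l)%:~R = (c l %/ (D * W)%N%:Z)%Z%:~R * (D%:R * W%:R) + (c l %% (D * W)%N%:Z)%Z%:~R :> algC.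
    by rewrite [in LHS](divz_eq (c l) (D * W)%N%:Z) intrD intrM -natrM.
  by ring.
have A : forall y, W%:R * y \in Aint -> ((\sum_l (f l)%:R * B`_l) / D%:R * y \in Aint) = (x i * y \in Aint).
  move=> y Wy; have hy : W%:R * h * y \in Aint by rewrite mulrAC; apply: rpredM.
  by rewrite E mulrBl; apply/idP/idP => u; [rewrite -[x i * y](subrK (W%:R * h * y)); apply: rpredD | apply: rpredB].
have : [forall l, (\sum_l (f l)%:R * B`_l) / D%:R * z l \in Aint].
  by apply/forallP => l; rewrite A.
by move/H/forallP/(_ j); rewrite A.
Qed.

(** There are finitely many patterns and infinitely many powers of the ideal, so two powers are
    proportional and some power of exponent [k.+1] is principal; the ideal number is the [k.+1]-st
    root of its generator. *)
Lemma tower_Bez_ord (J : finType) (x : J -> algC) : Inv K -> (forall i, K (x i)) -> (exists i, x i != 0) ->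
  exists a (z : J -> algC) k, [/\ a != 0, (forall i, K (z i)),
    (forall i, x i / a \in Aint /\ z i * a \in Aint), \sum_i x i * z i = 1 & K (a ^+ k.+1)].
Proof.
move=> iK xK x0; have [z [zK xz x1]] := iK J x xK x0.
have [W [W0 HW]] := bounded_ideals; have [D [D0 tI]] := tw_int tw.
(* The products of [m] generators generate the m-th power of the ideal; the same products of the
   [z j] generate its inverse. *)
pose X (y : J -> algC) m (f : {ffun 'I_m -> J}) := \prod_i y (f i).
have X1 m : \sum_f X x m f * X z m f = 1.
  transitivity (\prod_(i < m) \sum_j x j * z j); last by rewrite big1.
  by rewrite bigA_distr_bigA; apply: eq_bigr => f _; rewrite -big_split.
have XK y m f : (forall j, K (y j)) -> K (X y m f).
  by move=> yK; rewrite /X; elim/big_rec: _ => [|i u _ Ku]; sf; apply: yK.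
have XX m f g : X x m f * X z m g \in Aint.
  by rewrite /X -big_split rpred_prod // => i _; apply: xz.
pose pat := {set {ffun 'I_n -> 'I_(D * W)}}.
have /fin_all_exists[l Hl] : forall m : 'I_#|{: pat}|.+1, exists l, [/\ K l, l != 0,
    (forall f, l * X x m f \in Aint) & forall f, W%:R * (X z m f / l) \in Aint].
  by move=> m; apply: HW => // f; apply: XK.
pose pt (m : 'I_#|{: pat}|.+1) : pat :=
  [set f : {ffun 'I_n -> 'I_(D * W)} | [forall g, (\sum_i (f i)%:R * B`_i) / D%:R * (X z m g / l m) \in Aint]].
have /injectivePn[m [m' ne e]] : ~~ injectiveb pt.
  by apply/injectiveP => /leq_card; rewrite card_ord ltnn.
wlog lt : m m' ne e / (m < m')%N.
  move=> H; have [h|h|h] := ltngtP m m'; first exact: (H m m').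
    by apply: (H m' m) => //; rewrite eq_sym.
  by case/eqP: ne; apply: val_inj.
have cmp (a b : 'I_#|{: pat}|.+1) : pt a = pt b ->
    forall f g, (l a * X x a f) * (X z b g / l b) \in Aint.
  move=> eab; have [Ka a0 xa za] := Hl a; have [Kb b0 xb zb] := Hl b.
  apply: (pattern_eq (x := fun f => l a * X x a f) (z := fun f => X z a f / l a)
    (z' := fun g => X z b g / l b) D0 W0 tI _ xa _ za zb).
  - by move=> f; apply: sfM => //; apply: XK.
  - move=> f g; have -> : l a * X x a f * (X z a g / l a) = X x a f * X z a g by field.
    exact: XX.
  by move=> f; have := congr1 (fun s : pat => f \in s) eab; rewrite !inE => ->.
have c1 := cmp _ _ e; have c2 := cmp _ _ (esym e).
have [Km m0 _ _] := Hl m; have [Km' m'0 _ _] := Hl m'.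
(* The scaled powers of exponents [m] and [m'] coincide, so [u] generates the power of exponent
   [m' - m]; [d1] and [d2] are the two inclusions. *)
pose u := l m / l m'; have u0 : u != 0 by rewrite mulf_neq0 // invr_eq0.
have d1 f g : X x m f * X z m' g * u \in Aint.
  by have := c1 f g; congr (_ \in Aint); rewrite /u; ring.
have d2 f g : X x m' f * X z m g / u \in Aint.
  by have := c2 f g; congr (_ \in Aint); rewrite /u; field; rewrite m0 m'0.
have [k ek] : exists k, val m' = (m + k.+1)%N by exists (m' - m).-1; rewrite prednK ?subn_gt0 // subnKC // ltnW.
have ext (j : J) (f : {ffun 'I_m -> J}) : exists g : {ffun 'I_m' -> J},
    forall y, X y m' g = X y m f * y j ^+ k.+1.
  rewrite ek; exists [ffun i => match split i with inl a => f a | inr _ => j end] => y.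
  rewrite /X big_split_ord /=; congr (_ * _).
    by apply: eq_bigr => i _; rewrite ffunE (unsplitK (inl i)).
  rewrite -[k.+1 in RHS]card_ord -prodr_const; apply: eq_bigr => i _.
  by rewrite ffunE (unsplitK (inr i)).
pose a := k.+1.-root u; have ak : a ^+ k.+1 = u by rewrite rootCK.
have a0 : a != 0 by rewrite rootC_eq0.
exists a, z, k; split=> //; last by rewrite ak; apply: sfM => //; apply: sfV.
move=> j; split.
  apply: (@Aint_root k.+1) => //; rewrite exprMn exprVn ak.
  rewrite -[x j ^+ _]mulr1 -(X1 m) mulr_sumr mulr_suml rpred_sum // => f _.
  have [g eg] := ext j f.
  have -> : x j ^+ k.+1 * (X x m f * X z m f) / u = X x m' g * X z m f / u by rewrite eg; ring.
  exact: d2.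
apply: (@Aint_root k.+1) => //; rewrite exprMn ak.
rewrite -[z j ^+ _]mulr1 -(X1 m) mulr_sumr mulr_suml rpred_sum // => f _.
have [g eg] := ext j f.
have -> : z j ^+ k.+1 * (X x m f * X z m f) * u = X x m f * X z m' g * u by rewrite eg; ring.
exact: d1.
Qed.

Lemma tower_Bez : Inv K -> Bez K.
Proof.
move=> iK J x xK x0; have [a [z [k [? ? ? ? _]]]] := tower_Bez_ord iK xK x0.
by exists a, z.
Qed.

Lemma tower_ord b : Inv K -> DD K b -> exists n, (0 < n)%N /\ pr K (b ^+ n).
Proof.
move=> iK db; have b0 := DD_nz db; have [J [x [y [xK xb x1]]]] := DD_fin db.
have xK' j : K (x j) by have [] := xK j.
have [a [z [k [a0 zK xa z1 Ka]]]] := tower_Bez_ord iK xK' (sum1_nz x1).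
exists k.+1; split=> //; exists (a ^+ k.+1) => //; apply: assocX; apply: assocI => //.
  have -> : b / a = \sum_j (x j / a) * (y j * b).
    rewrite -[b / a]mul1r -x1 mulr_suml; apply: eq_bigr => j _; ring.
  by apply: rpred_sum => j _; apply: rpredM; [case: (xa j) | case: (xb j)].
have -> : a / b = \sum_j (x j / b) * (z j * a).
  rewrite -[a / b]mul1r -z1 mulr_suml; apply: eq_bigr => j _; ring.
by apply: rpred_sum => j _; apply: rpredM; [case: (xb j) | case: (xa j)].
Qed.

End Finiteness.

(** * Multiquadratic fields and their automorphisms *)

(** The field generated by square roots, given by coordinates [a + b * d] over the field of the
    remaining roots; [d] may already lie in that field. *)
Fixpoint mq (s : seq algC) : cset :=
  if s is d :: s' then fun x => exists a b, [/\ mq s' a, mq s' b & x = a + b * d]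
  else fun x => x \in Crat.

Definition rsq (s : seq algC) := forall d, d \in s -> d ^+ 2 \in Crat.

Lemma rat_subfield : is_subfield (fun x => x \in Crat).
Proof. by split=> *; rewrite ?rpred1 ?rpredB ?rpredM ?rpredV. Qed.

Lemma mq_subfield s : rsq s -> is_subfield (mq s).
Proof.
elim: s => [_|d s IH rs /=]; first exact: rat_subfield.
have sM : is_subfield (mq s) by apply: IH => x xs; apply: rs; rewrite inE xs orbT.
have d2 : mq s (d ^+ 2) by apply: sf_rat sM _ _; apply: rs; rewrite mem_head.
have up a b : mq s a -> mq s b -> exists a' b', [/\ mq s a', mq s b' & a + b * d = a' + b' * d].
  by move=> ha hb; exists a, b.
split.
- by exists 1, 0; split; [exact: sf1 | exact: sf0 | ring].
- move=> _ _ [a [b [ha hb ->]]] [a' [b' [ha' hb' ->]]].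
  by exists (a - a'), (b - b'); split; [sf | sf | ring].
- move=> _ _ [a [b [ha hb ->]]] [a' [b' [ha' hb' ->]]].
  by exists (a * a' + b * b' * d ^+ 2), (a * b' + a' * b); split; [sf | sf | ring].
move=> _ [a [b [ha hb ->]]].
case: (classic (mq s d)) => [sd|sd].
  by exists ((a + b * d)^-1), 0; split; [sf | exact: sf0 | ring].
have [b0|b0] := eqVneq b 0.
  by exists a^-1, 0; split; [sf | exact: sf0 | rewrite b0 !mul0r !addr0].
have n0 : a - b * d != 0.
  rewrite subr_eq0; apply/eqP => e; apply: sd.
  by have -> : d = a / b by [rewrite e mulrAC divff // mul1r]; sf.
have n1 : a + b * d != 0.
  rewrite addr_eq0; apply/eqP => e; apply: sd.
  have -> : d = - (a / b) by rewrite e mulNr opprK mulrAC divff // mul1r.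
  by sf.
have n2 : a ^+ 2 - b ^+ 2 * d ^+ 2 != 0.
  by rewrite -exprMn subr_sqr mulf_neq0.
exists (a / (a ^+ 2 - b ^+ 2 * d ^+ 2)), (- b / (a ^+ 2 - b ^+ 2 * d ^+ 2)); split; try by sf.
by rewrite -exprMn subr_sqr; field; rewrite n0 n1.
Qed.

Lemma mq_gen s d : rsq s -> d \in s -> mq s d.
Proof.
elim: s => //= e s IH rs; rewrite inE.
have rs' : rsq s by move=> x xs; apply: rs; rewrite inE xs orbT.
have sM := mq_subfield rs'.
case/predU1P => [->|ds]; first by exists 0, 1; split; [exact: sf0 | exact: sf1 | ring].
by exists d, 0; split; [exact: IH | exact: sf0 | ring].
Qed.

Lemma Qgen_mq s x : rsq s -> Qgen s x <-> mq s x.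
Proof.
move=> rs; split=> [h|]; first by apply: h; [apply: mq_subfield | move=> d; apply: mq_gen].
elim: s rs x => [|d s IH] rs x /=; first by move=> xq F sF _; apply: sf_rat.
have rs' : rsq s by move=> y ys; apply: rs; rewrite inE ys orbT.
move=> [a [b [ha hb ->]]] F sF hF.
have hF' y : y \in s -> F y by move=> ys; apply: hF; rewrite inE ys orbT.
apply: sfD => //; first exact: (IH rs' _ ha).
by apply: sfM => //; [exact: (IH rs' _ hb) | apply: hF; rewrite mem_head].
Qed.

(** Kummer theory: if [d] is new, a rational square [(a + b * d) ^+ 2] has no cross term, so [a] or
    [b] vanishes. *)
Lemma mq_sqrt s x : rsq s -> mq s x -> x ^+ 2 \in Crat ->
  exists (m : bitseq) (r : algC), r \in Crat /\ x = r * \prod_(d <- mask m s) d.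
Proof.
elim: s x => [|d s IH] x rs /=.
  by move=> xq _; exists [::], x; rewrite big_nil mulr1.
have rs' : rsq s by move=> y ys; apply: rs; rewrite inE ys orbT.
have sM := mq_subfield rs'.
have d2 : d ^+ 2 \in Crat by apply: rs; rewrite mem_head.
have keep y : mq s y -> y ^+ 2 \in Crat -> exists (m : bitseq) (r : algC),
   r \in Crat /\ y = r * \prod_(e <- mask m (d :: s)) e.
  by move=> hy y2; have [m [r [rq e]]] := IH y rs' hy y2; exists (false :: m), r.
move=> [a [b [ha hb ex]]] x2.
case: (classic (mq s d)) => [sd|sd]; first by apply: keep => //; rewrite ex; sf.
have ab : a * b = 0.
  apply/eqP; apply: contra_notT sd => ab0.
  have -> : d = (x ^+ 2 - a ^+ 2 - b ^+ 2 * d ^+ 2) / (2%:R * (a * b)).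
    by rewrite ex; field; move: ab0; rewrite mulf_eq0 negb_or => /andP[-> ->].
  have := sf_rat sM x2; have := sf_rat sM d2 => h1 h2; by sf.
have d0 : d != 0 by apply: contra_notN sd => /eqP->; apply: sf0.
have [b0|b0] := eqVneq b 0; first by apply: keep; rewrite // ex b0 mul0r addr0.
have a0 : a = 0 by apply/eqP; move/eqP: ab; rewrite mulf_eq0 (negPf b0) orbF.
have [|m [r [rq e]]] := IH b rs' hb.
  have -> : b ^+ 2 = x ^+ 2 / d ^+ 2 by rewrite ex a0 add0r exprMn mulfK // expf_neq0.
  by rewrite rpredM // rpredV.
by exists (true :: m), r; rewrite /= big_cons ex a0 e add0r; split=> //; ring.
Qed.

Section Automorphism.
Variables (s : seq algC) (d : algC).
Hypotheses (rs : rsq s) (d2 : d ^+ 2 \in Crat) (sd : ~ mq s d).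

Lemma adjoin_mem (Qs : fieldExtType rat) (QsC : {rmorphism Qs -> algC}) (F : cset) (t : seq Qs) :
  is_subfield F -> (forall y, y \in t -> F (QsC y)) -> forall x, x \in <<1 & t>>%VS -> F (QsC x).
Proof.
move=> sF; elim/last_ind: t => [|t y IH] hF x.
  rewrite Fadjoin_nil => /vlineP[r ->]; rewrite alg_num_field fmorph_rat.
  by apply: sf_rat => //; apply: Crat_rat.
rewrite adjoin_rcons => /Fadjoin_polyP[p pE ->]; rewrite horner_coef rmorph_sum.
apply: sf_sum => // i _; rewrite rmorphM rmorphXn; apply: sfM => //; last first.
  by apply: sfX => //; apply: hF; rewrite mem_rcons mem_head.
apply: IH; last exact: (polyOverP pE).
by move=> z zt; apply: hF; rewrite mem_rcons inE zt orbT.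
Qed.

(** The conjugation is first defined on a finite extension of the rationals, along the minimal
    polynomial ['X^2 - d^2], and then extended to [algC], where it can act on ideal numbers as
    well. *)
Lemma aut_exists : exists g : rmC, (forall x, mq s x -> g x = x) /\ g d = - d.
Proof.
have [Qs [QsC [s1 es1 full]]] := num_field_exists (rcons s d).
case/lastP: s1 es1 full => [|t d1]; first by case: (s).
rewrite map_rcons => /rcons_inj[et ed]; rewrite adjoin_rcons.
set E := <<1 & t>>%AS => full.
have E'd : d1 \notin E.
  apply/negP => /(@adjoin_mem _ QsC (mq s) t) h; apply: sd; rewrite -ed; apply: h.
    exact: mq_subfield.
  by move=> y yt; apply: mq_gen => //; rewrite -et map_f.
have [r er] : exists r : rat, d1 ^+ 2 = r%:A.
  case/CratP: d2 => r er; exists r; apply: (fmorph_inj QsC).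
  by rewrite rmorphXn /= ed er alg_num_field fmorph_rat.
have rE : (r%:A : Qs) \in E by rewrite rpredZ // mem1v.
pose P : {poly Qs} := 'X^2 - (r%:A)%:P.
have PE : P \is a polyOver E by rewrite rpredB ?polyOverC ?rpredX ?polyOverX.
have mP : P \is monic by apply: monicXnsubC.
have dv : minPoly E d1 %| P.
  by apply: minPoly_dvdp => //; rewrite rootE !hornerE -?expr2 er subrr.
have szP : size P = 3%N by rewrite size_XnsubC.
have szm : (2 < size (minPoly E d1))%N.
  rewrite size_minPoly ltnS ltn_neqAle eq_sym adjoin_deg_eq1 E'd /=.
  by rewrite adjoin_degreeE divn_gt0 ?adim_gt0 // dimvS // subv_adjoin.
have eP : minPoly E d1 = P.
  apply/eqP; rewrite -eqp_monic ?monic_minPoly // -dvdp_size_eqp // eqn_leq szP szm andbT.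
  by rewrite -szP dvdp_leq // monic_neq0.
pose f := kHomExtend E \1%VF d1 (- d1).
have h1 : kHom 1 E (\1%VF : 'End(Qs)) by apply: kHom1.
have idp (p : {poly Qs}) : map_poly (\1%VF : 'End(Qs)) p = p.
  by apply/polyP => i; rewrite coef_map /= id_lfunE.
have rt : root (map_poly (\1%VF : 'End(Qs)) (minPoly E d1)) (- d1).
  by rewrite idp eP rootE !hornerE ?sqrrN er subrr.
have s1E : (1 <= E)%VS by apply: sub1v.
have hf : kHom 1 {:Qs} f by rewrite -full; apply: kHomExtendP.
have mf : monoid_morphism f by apply/kHom_monoid_morphism.
pose fM := GRing.isMonoidMorphism.Build _ _ (fun_of_lfun f) mf.
pose fR : {rmorphism Qs -> Qs} := HB.pack (fun_of_lfun f) fM (GRing.Linear.on (fun_of_lfun f)).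
have [nu Hnu] := extend_algC_subfield_aut QsC fR.
have nug y : y \in s -> nu y = y.
  rewrite -et => /mapP[z zt ->]; rewrite -Hnu /=; congr (QsC _).
  by rewrite kHomExtend_id ?id_lfunE //= seqv_sub_adjoin.
exists nu; split; last by rewrite -ed -Hnu /= (kHomExtend_val h1 rt) rmorphN.
move=> x /(proj2 (Qgen_mq x rs)) h; apply: (h (fun y => nu y = y)) => [|y /nug //]; split.
- by rewrite rmorph1.
- by move=> a b ea eb; rewrite rmorphB ea eb.
- by move=> a b ea eb; rewrite rmorphM ea eb.
by move=> a ea; rewrite fmorphV ea.
Qed.

End Automorphism.

(** Every intermediate field is presented in this way, so that dropping one automorphism from the
    list is a quadratic step. *)
Fixpoint fixf (L : cset) (gs : list rmC) : cset :=
  if gs is g :: gs' then fun x => fixf L gs' x /\ g x = x else L.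

Section Gal.
Variable S : seq algC.
Hypothesis rS : rsq S.
Let L := Qgen S.

(** Sign changes of the generators; on [L] they are commuting involutions, which is what the descent
    uses of the Galois group. *)
Definition flips (g : rmC) := forall d, d \in S -> g d = d \/ g d = - d.

Fixpoint allflips (gs : list rmC) : Prop :=
  if gs is g :: gs' then flips g /\ allflips gs' else True.

Lemma L_sf : is_subfield L.
Proof.
have sM := mq_subfield rS; have e x := Qgen_mq x rS.
by split=> *; apply/e; [sf | sf; apply/e | sf; apply/e | sf; apply/e].
Qed.

Lemma L_gen d : d \in S -> L d. Proof. by move=> dS F _; apply. Qed.

Lemma L_ind (P : algC -> Prop) : is_subfield P -> (forall d, d \in S -> P d) -> forall x, L x -> P x.
Proof. by move=> sP hP x; apply. Qed.

Lemma agree_sf (F : cset) (g h : rmC) : is_subfield F -> is_subfield (fun x => F x /\ g x = h x).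
Proof.
move=> sF; split=> [|x y [? e] [? e']|x y [? e] [? e']|x [? e]].
- by split; [exact: sf1 | rewrite !rmorph1].
- by split; [sf | rewrite !rmorphB e e'].
- by split; [sf | rewrite !rmorphM e e'].
by split; [sf | rewrite !fmorphV e].
Qed.

Lemma flips_L g x : flips g -> L x -> L (g x).
Proof.
move=> gg; have sL := L_sf; apply: (L_ind (P := fun x => L (g x))) => [|d dS]; last first.
  by case: (gg d dS) => ->; [|apply: (sfN sL)]; apply: L_gen.
split=> [|a b La Lb|a b La Lb|a La]; rewrite ?rmorph1 ?rmorphB ?rmorphM ?fmorphV.
- exact: (sf1 sL).
- exact: (sfB sL).
- exact: (sfM sL).
exact: (sfV sL).
Qed.

Lemma flips_inv g x : flips g -> L x -> g (g x) = x.
Proof.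
move=> gg Lx; suff [] : L x /\ comprm g g x = idrm x by [].
move: x Lx; apply: L_ind; first exact: agree_sf L_sf.
move=> d dS; split; first exact: L_gen.
by rewrite /=; case: (gg d dS) => e; rewrite e ?rmorphN e ?opprK.
Qed.

Lemma flips_comm g h x : flips g -> flips h -> L x -> g (h x) = h (g x).
Proof.
move=> gg gh Lx; suff [] : L x /\ comprm g h x = comprm h g x by [].
move: x Lx; apply: L_ind; first exact: agree_sf L_sf.
move=> d dS; split; first exact: L_gen.
by rewrite /=; case: (gg d dS) => e; case: (gh d dS) => e'; rewrite e' e ?rmorphN ?e ?e'.
Qed.

Lemma flips_comp g h : flips g -> flips h -> flips (comprm g h).
Proof.
move=> gg gh d dS /=; case: (gh d dS) => ->; rewrite ?rmorphN; case: (gg d dS) => ->; rewrite ?opprK; auto.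
Qed.

Lemma fixf_L gs x : fixf L gs x -> L x.
Proof. by elim: gs => //= g gs IH [/IH]. Qed.

Lemma fixf_flips gs g x : flips g -> allflips gs -> fixf L gs x -> fixf L gs (g x).
Proof.
move=> gg; elim: gs => [_|h gs IH [gh ags] [hx e]] /=; first exact: flips_L.
by split; [exact: IH | rewrite -flips_comm ?e //; apply: fixf_L hx].
Qed.

Lemma fixf_sf gs : allflips gs -> is_subfield (fixf L gs).
Proof.
elim: gs => [_|g gs IH [gg ags]]; first exact: L_sf.
by have := agree_sf g idrm (IH ags).
Qed.

Lemma fixf_quad g gs : flips g -> allflips gs -> quad (fixf L (g :: gs)) (fixf L gs) g.
Proof.
move=> gg ags; split=> //.
- exact: fixf_sf.
- by move=> x; apply: fixf_flips.
by move=> x /fixf_L; apply: flips_inv.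
Qed.

Lemma fixf_Bez gs : allflips gs -> Bez L -> Bez (fixf L gs).
Proof.
by elim: gs => //= g gs IH [gg ags] /(IH ags); apply: Bez_down (fixf_quad gg ags).
Qed.


End Gal.

(** * Quadratic residues and the reciprocity law *)

(** The field of order [l ^ totient n] works: by Euler's theorem [n] divides the order of its cyclic
    multiplicative group. *)
Lemma pchar_prim_root l n : prime l -> (0 < n)%N -> coprime l n ->
  exists (F : finFieldType) (z : F), l \in [pchar F] /\ n.-primitive_root z.
Proof.
move=> pl n0 cl; have t0 : (0 < totient n)%N by rewrite totient_gt0.
have [F cF eF] := pPrimePowerField pl t0.
pose N := #|F|.-1; have N1 : (0 < N)%N by rewrite -ltnS prednK ?finNzRing_gt1 // (ltnW (finNzRing_gt1 F)).
have [z /andP[_ pz]] : exists z, (z \in [seq x <- enum F | x != 0]) && N.-primitive_root z.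
  have /hasP[z zs pz] : has N.-primitive_root [seq x <- enum F | x != 0].
    apply: has_prim_root => //.
    - apply/allP => x; rewrite mem_filter => /andP[x0 _]; rewrite unity_rootE.
      apply/eqP; apply: (mulfI x0); rewrite mulr1 -exprS prednK ?expf_card //.
      exact: ltnW (finNzRing_gt1 F).
    - by rewrite filter_uniq // enum_uniq.
    rewrite -[N](cardC1 (0 : F)) cardE; apply: uniq_leq_size; first exact: enum_uniq.
    by move=> x; rewrite mem_enum inE mem_filter mem_enum inE andbT.
  by exists z; rewrite zs.
exists F, (z ^+ (N %/ n)); split=> //; apply: dvdn_prim_root => //.
have := Euler_exp_totient cl; rewrite -eF => /eqP.
by rewrite eqn_mod_dvd ?subn1 // ltnW // finNzRing_gt1.
Qed.

(** Zero counts as a square here, so the value -1 of [legendre] is the one that yields the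
    negation. *)
Definition sqmod (c : int) (l : nat) := exists x : int, (l%:Z %| x ^+ 2 - c)%Z.

Section Char.
Variables (l : nat) (F : finFieldType).
Hypotheses (pl : prime l) (lodd : odd l) (cF : l \in [pchar F]).

Lemma pchar_int (n : int) : (n%:~R == 0 :> F) = (l%:Z %| n)%Z.
Proof.
case: n => n; first by rewrite -(dvdn_pcharf cF).
by rewrite NegzE rmorphN oppr_eq0 dvdzE abszN -(dvdn_pcharf cF).
Qed.

(** ['X^l - 'X] has at most [l] roots, and the prime field already supplies that many. *)
Lemma frob_nat (y : F) : y ^+ l = y -> exists m : nat, y = m%:R.
Proof.
move=> yl; case: (pickP (fun m : 'I_l => y == m%:R)) => [m /eqP ->|h]; first by exists m.
pose P : {poly F} := 'X^l - 'X.
have l1 := prime_gt1 pl.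
have sP : size P = l.+1 by rewrite size_polyDl size_polyXn // size_polyN size_polyX ltnS.
have P0 : P != 0 by rewrite -size_poly_gt0 sP.
pose rs := y :: [seq (val m)%:R | m <- enum 'I_l].
have : (size rs < size P)%N.
  apply: max_poly_roots => //.
    apply/allP => x; rewrite inE rootE !hornerE => /predU1P[->|/mapP[m _ ->]].
      by rewrite yl subrr.
    by rewrite -(pFrobenius_autE cF) pFrobenius_aut_nat subrr.
  rewrite /= map_inj_uniq ?enum_uniq ?andbT.
    by apply/mapP => -[m _ e]; have := h m; rewrite e eqxx.
  move=> a b /= e; apply: val_inj => /=.
  have : (a : nat) == b %[mod l].
    wlog ab : a b e / (b <= a)%N.
      by move=> W; case/orP: (leq_total b a) => h'; [apply: W | rewrite eq_sym; apply: W].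
    by rewrite eqn_mod_dvd // (dvdn_pcharf cF) natrB // e subrr.
  by rewrite !modn_small // => /eqP.
by rewrite /= size_map size_enum_ord sP ltnn.
Qed.

(** A square root of [c] lies in the prime field exactly when the Frobenius fixes it; this turns
    each residue symbol into a computation with roots of unity. *)
Lemma sqmodP (c : int) (t : F) : t ^+ 2 = c%:~R -> sqmod c l <-> t ^+ l = t.
Proof.
move=> tc; split=> [[x]|/frob_nat[m em]].
  rewrite -pchar_int rmorphB rmorphXn /= -tc subr_eq0 eqf_sqr => h.
  have {h} : (t == x%:~R) || (t == - x%:~R) by case/orP: h => /eqP->; rewrite ?opprK eqxx ?orbT.
  have fx : (x%:~R : F) ^+ l = x%:~R by rewrite -(pFrobenius_autE cF) pFrobenius_aut_int.
  case/orP => /eqP->; first by [].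
  by rewrite exprNn fx -signr_odd lodd expr1 mulN1r.
exists m; rewrite -pchar_int rmorphB rmorphXn /= -tc em subrr //.
Qed.
End Char.

Lemma sqmodN1 l : prime l -> odd l -> sqmod (-1) l <-> (l %% 4 = 1)%N.
Proof.
move=> pl lo; have [|F [z [cF pz]]] := @pchar_prim_root l 4 pl isT.
  by rewrite -[4%N]/(2 ^ 2)%N coprime_pexpr // coprimen2.
have z2 : z ^+ 2 = (-1)%:~R.
  have : z ^+ 2 != 1 by rewrite -(prim_order_dvd pz).
  have /eqP : (z ^+ 2) ^+ 2 = 1 by rewrite -exprM (prim_expr_order pz).
  by rewrite sqrf_eq1 => /orP[->//|/eqP->].
rewrite (sqmodP pl lo cF z2) -(prim_expr_mod pz).
have : (l %% 4 = 1)%N \/ (l %% 4 = 3)%N by have := lo; lia.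
case=> ->; first by split.
split=> // e; have : z ^+ 2 = 1.
  by apply: (mulIf (x := z)); [apply/eqP => z0; have := prim_expr_order pz; rewrite z0 expr0n => /esym/eqP; rewrite oner_eq0 | rewrite mul1r -exprSr].
by rewrite z2 => /eqP; rewrite -subr_eq0 -[1]/(1%:~R) -rmorphB (pchar_int cF) => /dvdn_leq; have := prime_gt1 pl; lia.
Qed.

(** For a primitive eighth root of unity [z], the sum of [z] and its inverse [z ^+ 7] squares to 2,
    and the Frobenius acts on it through [l] modulo 8. *)
Lemma sqmod2 l : prime l -> odd l -> sqmod 2 l <-> (l %% 8 = 1)%N \/ (l %% 8 = 7)%N.
Proof.
move=> pl lo; have [|F [z [cF pz]]] := @pchar_prim_root l 8 pl isT.
  by rewrite -[8%N]/(2 ^ 3)%N coprime_pexpr // coprimen2.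
have z0 : z != 0 by apply/eqP => z0; have := prim_expr_order pz; rewrite z0 expr0n => /esym/eqP; rewrite oner_eq0.
have z4 : z ^+ 4 = -1.
  have : z ^+ 4 != 1 by rewrite -(prim_order_dvd pz).
  have /eqP : (z ^+ 4) ^+ 2 = 1 by rewrite -exprM (prim_expr_order pz).
  by rewrite sqrf_eq1 => /orP[->//|/eqP->].
have n2 : (2%:R : F) != 0 by rewrite -(dvdn_pcharf cF) gtnNdvd // ltn_neqAle prime_gt1 // andbT; apply: contraL lo => /eqP <-.
pose t := z + z ^+ 7.
have t2 : t ^+ 2 = 2%:~R.
  have -> : t ^+ 2 = (z ^+ 4) ^+ 2 * 2%:R + z ^+ 2 * (1 + z ^+ 4 * (z ^+ 4) ^+ 2) by rewrite /t; ring.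
  by rewrite z4; ring.
have tl : t ^+ l = z ^+ (l %% 8) + z ^+ ((7 * l) %% 8).
  by rewrite -(pFrobenius_autE cF) rmorphD /= !pFrobenius_autE -exprM !(prim_expr_mod pz).
have t0 : t != 0 by rewrite -sqrf_eq0 t2.
rewrite (sqmodP pl lo cF t2) tl -modnMmr.
have : (l %% 8 = 1)%N \/ (l %% 8 = 3)%N \/ (l %% 8 = 5)%N \/ (l %% 8 = 7)%N by have := lo; lia.
have neg : - t <> t.
  move/eqP; rewrite -subr_eq0 -opprD oppr_eq0 -mulr2n -mulr_natl mulf_eq0 (negPf n2).
  by rewrite (negPf t0).
case=> [->|[->|[->|->]]]; rewrite /=; split=> //; try by [left | right | rewrite addrC].
- move=> e; case: neg; rewrite -[RHS]e /t -[X in _ = _ + X]expr1.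
  have -> : z ^+ 7 = z ^+ 4 * z ^+ 3 by rewrite -exprD.
  have -> : z ^+ 5 = z ^+ 4 * z by rewrite -exprSr.
  by rewrite z4; ring.
- by case.
- move=> e; case: neg; rewrite -[RHS]e /t.
  have -> : z ^+ 7 = z ^+ 4 * z ^+ 3 by rewrite -exprD.
  have -> : z ^+ 5 = z ^+ 4 * z by rewrite -exprSr.
  by rewrite z4; ring.
by case.
Qed.

Section Gauss.
Variables (p l : nat) (F : finFieldType) (z : F).
Hypotheses (pp : prime p) (podd : odd p) (pl : prime l) (lodd : odd l).
Hypotheses (cF : l \in [pchar F]) (pz : p.-primitive_root z).

Let e (x : 'F_p) : F := z ^+ x.
Let pF : (Zp_trunc (pdiv p)).+2 = p. Proof. exact: Fp_cast. Qed.

Let valD (x y : 'F_p) : nat_of_ord (x + y) = ((x + y)%N %% p)%N.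
Proof. by rewrite /=; congr (modn _ _); exact: pF. Qed.
Let valM (x y : 'F_p) : nat_of_ord (x * y) = ((x * y)%N %% p)%N.
Proof. by rewrite /=; congr (modn _ _); exact: pF. Qed.
Let val1 : nat_of_ord (1 : 'F_p) = 1%N.
Proof. by have := @val_Fp_nat p pp 1; rewrite (modn_small (prime_gt1 pp)). Qed.

Let eD x y : e (x + y) = e x * e y.
Proof. by rewrite /e valD (prim_expr_mod pz) exprD. Qed.

Let esum : \sum_(x : 'F_p) e x = 0.
Proof.
have E : \sum_(x : 'F_p) e x = e 1 * \sum_(x : 'F_p) e x.
  rewrite mulr_sumr (reindex_inj (addrI 1)) /=.
  by apply: eq_bigr => x _; rewrite eD.
have e1 : e 1 != 1.
  by rewrite /e val1 -(prim_order_dvd pz) gtnNdvd // prime_gt1.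
apply/eqP; move/eqP: E; rewrite -subr_eq0 -{1}[\sum_x _]mul1r -mulrBl mulf_eq0 subr_eq0.
by rewrite eq_sym (negPf e1).
Qed.

(** The quadratic Gauss sum in characteristic [l], in the form that sums over all squares instead of
    using the residue symbol. *)
Definition gauss (c : 'F_p) := \sum_(a : 'F_p) e (c * a ^+ 2).

Let two0 : (2%:R : 'F_p) != 0.
Proof.
rewrite -(dvdn_pcharf (pchar_Fp pp)) gtnNdvd // ltn_neqAle prime_gt1 // andbT.
by apply: contraL podd => /eqP <-.
Qed.

Lemma gauss_sq (c b : 'F_p) : b != 0 -> c = b ^+ 2 -> gauss c = gauss 1.
Proof.
move=> b0 ->; rewrite /gauss [RHS](reindex_inj (mulfI b0)) /=.
by apply: eq_bigr => a _; rewrite mul1r exprMn.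
Qed.

(** The forms [a ^+ 2] and [c * a ^+ 2] together take each value at most twice, and they have 2p
    arguments, so exactly twice; the two sums add up to twice the sum of all p-th roots of unity. *)
Lemma gauss_nsq (c : 'F_p) : c != 0 -> (forall b, c != b ^+ 2) -> gauss c = - gauss 1.
Proof.
move=> c0 cn; apply/eqP; rewrite -addr_eq0 addrC; apply/eqP.
pose n (c x : 'F_p) := #|[set a : 'F_p | c * a ^+ 2 == x]|.
have G c' : gauss c' = \sum_x e x *+ n c' x.
  rewrite /gauss (partition_big (fun a => c' * a ^+ 2) xpredT) //=.
  apply: eq_bigr => x _; rewrite (eq_bigr (fun _ => e x)) => [|a /eqP -> //].
  by rewrite sumr_const; congr (_ *+ _); apply: eq_card => a; rewrite !inE.
have n2 c' x : c' != 0 -> (n c' x <= 2)%N.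
  move=> c'0; case: (set_0Vmem [set a : 'F_p | c' * a ^+ 2 == x]) => [e0|[a ax]].
    by rewrite /n e0 cards0.
  apply: (@leq_trans #|[set a; - a]|); last by rewrite cards2; case: eqP.
  apply: subset_leq_card; apply/subsetP => b; move: ax; rewrite !inE => /eqP <-.
  by rewrite (inj_eq (mulfI c'0)) eqf_sqr.
have nle x : (n 1%R x + n c x <= 2)%N.
  case: (set_0Vmem [set a : 'F_p | 1 * a ^+ 2 == x]) => [e0|[a]].
    by rewrite {1}/n e0 cards0 add0n n2.
  rewrite inE mul1r => /eqP ax.
  case: (set_0Vmem [set b : 'F_p | c * b ^+ 2 == x]) => [e0|[b]].
    by rewrite {2}/n e0 cards0 addn0 n2 // oner_neq0.
  rewrite inE => /eqP cb0; have cb : c * b ^+ 2 = a ^+ 2 by rewrite ax.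
  have [b0|b0] := eqVneq b 0; last first.
    by case/eqP: (cn (a / b)); rewrite expr_div_n -cb mulfK // expf_neq0.
  have a0 : a = 0 by apply/eqP; rewrite -sqrf_eq0 -cb b0 expr0n mulr0.
  have n1 c' : c' != 0 -> (n c' x <= 1)%N.
    move=> c'0; rewrite -(cards1 (0 : 'F_p)); apply: subset_leq_card; apply/subsetP => d.
    by rewrite !inE -ax a0 expr0n mulf_eq0 (negPf c'0) sqrf_eq0.
  exact: (leq_add (n1 1 (oner_neq0 _)) (n1 c c0)).
have ntot c' : (\sum_x n c' x = p)%N.
  rewrite -[RHS](card_Fp pp) -[RHS]sum1_card [RHS](partition_big (fun a => c' * a ^+ 2) xpredT) //=.
  by apply: eq_bigr => x _; rewrite /n -sum1_card; apply: eq_bigl => a; rewrite !inE.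
have neq x : (n 1%R x + n c x = 2)%N.
  apply/eqP; rewrite eqn_leq nle /= leqNgt; apply/negP => lt.
  have : (\sum_x (n 1%R x + n c x) < \sum_(x : 'F_p) 2)%N.
    rewrite (bigD1 x) //= [X in (_ < X)%N](bigD1 x) //= -addSn.
    by apply: leq_add => //; apply: leq_sum => y _.
  by rewrite big_split /= !ntot sum_nat_const card_Fp // muln2 addnn ltnn.
rewrite !G -big_split /= (eq_bigr (fun x => e x *+ 2)) => [|x _]; last by rewrite -mulrnDr neq.
by rewrite sumrMnl esum mul0rn.
Qed.

(** The substitution [u = a - b], [v = a + b] makes the exponent bilinear, and orthogonality leaves
    only [u = 0]. *)
Lemma gauss_norm : gauss 1 * gauss (-1) = p%:R.
Proof.
rewrite /gauss mulr_suml.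
transitivity (\sum_(u : 'F_p) \sum_(v : 'F_p) e (u * v)).
  rewrite (eq_bigr (fun a => \sum_b e ((a - b) * (a + b)))); last first.
    move=> a _; rewrite mulr_sumr; apply: eq_bigr => b _.
    by rewrite -eD; congr (e _); ring.
  rewrite !pair_big /= [RHS](reindex (fun w : 'F_p * 'F_p => (w.1 - w.2, w.1 + w.2))) //=.
  exists (fun w => ((w.1 + w.2) / 2%:R, (w.2 - w.1) / 2%:R)) => -[a b] _ /=.
    by congr (_, _); field.
  by congr (_, _); field.
rewrite (bigD1 0) //= [X in _ + X]big1 => [|u u0]; last first.
  by rewrite -[RHS]esum [RHS](reindex_inj (mulfI u0)).
rewrite addr0 (eq_bigr (fun _ => 1)) => [|v _]; last by rewrite mul0r /e expr0.
by rewrite sumr_const card_Fp.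
Qed.

Lemma gauss_frob : gauss 1 ^+ l = gauss l%:R.
Proof.
rewrite -(pFrobenius_autE cF) rmorph_sum; apply: eq_bigr => a _.
rewrite -[LHS]/(e (1 * a ^+ 2) ^+ l) /e -exprM mul1r -(prim_expr_mod pz) -[in RHS](prim_expr_mod pz).
by rewrite valM val_Fp_nat // modn_mod modnMml mulnC.
Qed.
End Gauss.

Lemma sqmod_Fp (c : int) p : prime p ->
  sqmod c p <-> exists b : 'F_p, c%:~R = b ^+ 2.
Proof.
move=> pp; split=> [[x]|[b e]].
  rewrite -(pchar_int (pchar_Fp pp)) rmorphB rmorphXn subr_eq0 => /eqP h.
  by exists (x%:~R); rewrite h.
exists (b : nat)%:Z; rewrite -(pchar_int (pchar_Fp pp)) rmorphB rmorphXn /= subr_eq0 e.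
by rewrite -[(_%:Z)%:~R]/((b : nat)%:R) natr_Zp.
Qed.

(** The Gauss sum is a square root of p or -p, according to whether -1 is a square modulo [p], and
    the Frobenius sends it to the sum attached to [l]. *)
Lemma reciprocity p l : prime p -> odd p -> prime l -> odd l -> p != l ->
  sqmod l%:Z p <-> sqmod (if (p %% 4 == 1)%N then p%:Z else - p%:Z) l.
Proof.
move=> pp po pl lo ne.
have [||F [z [cF pz]]] := @pchar_prim_root l p pl.
- exact: prime_gt0.
- by rewrite prime_coprime // dvdn_prime2 // eq_sym.
pose G := gauss z (1 : 'F_p).
have pF0 : p%:R != 0 :> F.
  by rewrite -(dvdn_pcharf cF) dvdn_prime2 // eq_sym.
have l0 : (l%:R : 'F_p) != 0 by rewrite -(dvdn_pcharf (pchar_Fp pp)) dvdn_prime2.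
have l2 : (2%:R : F) != 0.
  by rewrite -(dvdn_pcharf cF) gtnNdvd // ltn_neqAle prime_gt1 // andbT; apply: contraL lo => /eqP <-.
have gm := gauss_norm pp po pz.
have G0 : G != 0 by apply: contraNneq pF0 => h; rewrite -gm -/G h mul0r.
have cs (c : 'F_p) : c != 0 -> (exists b, c = b ^+ 2) \/ gauss z c = - G.
  move=> c0; case: (pickP (fun b : 'F_p => c == b ^+ 2)) => [b /eqP e|h]; first by left; exists b.
  by right; apply: gauss_nsq => // b; rewrite h.
have sq1 (c : 'F_p) : c != 0 -> (exists b, c = b ^+ 2) -> gauss z c = G.
  move=> c0 [b e]; apply: (gauss_sq _ _ e).
  by apply: contraNneq c0 => b0; rewrite e b0 expr0n.
have G2 : G ^+ 2 = (if (p %% 4 == 1)%N then p%:Z else - p%:Z)%:~R.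
  have N1 : (-1 : 'F_p) != 0 by rewrite oppr_eq0 oner_eq0.
  have := sqmodN1 pp po; rewrite (sqmod_Fp _ pp) /=; case: ifP => [/eqP p4|p4] h.
    by rewrite -[RHS]gm -(sq1 _ N1 (h.2 p4)) expr2 (sq1 _ N1 (h.2 p4)).
  case: (cs _ N1) => [/h.1 e|e]; first by rewrite e eqxx in p4.
  by rewrite rmorphN /= -[_%:~R]gm e -/G mulrN opprK expr2.
rewrite (sqmodP pl lo cF G2) (gauss_frob pp cF pz) (sqmod_Fp _ pp).
split=> [h|h]; first exact: sq1.
case: (cs _ l0) => // e; case/negP: G0; rewrite -(mulrI_eq0 _ (mulfI l2)) mulr_natl mulr2n -/G.
by rewrite -{1}[G]h e addNr.
Qed.

Lemma legendre_sq a p : legendre a p = 1 -> sqmod a p.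
Proof.
rewrite /legendre; case: ifP => // _; case: ifP => // /existsP[x /eqP e] _.
by exists x%:Z; apply/dvdz_mod0P.
Qed.

Lemma legendre_nsq a p : (0 < p)%N -> legendre a p = -1 -> ~ sqmod a p.
Proof.
move=> p0; rewrite /legendre; case: ifP => // _; case: ifP => // /existsPn h _ [x px].
have r0 : (0 <= (x %% p%:Z)%Z)%R by rewrite modz_ge0 // -lt0n.
have rp : (`|(x %% p%:Z)%Z| < p)%N by rewrite -ltz_nat gez0_abs // ltz_pmod.
have /negP[] := h (Ordinal rp); apply/eqP/dvdz_mod0P => /=.
rewrite -[(_%N%:Z)]/(Posz _) gez0_abs //.
have -> : (x %% p%:Z)%Z ^+ 2 - a = x ^+ 2 - a - p%:Z * ((x %/ p)%Z * (x + (x %% p%:Z)%Z)).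
  by rewrite {2 4}(divz_eq x p%:Z); ring.
by apply: rpredB => //; apply: dvdz_mulr; apply: dvdzz.
Qed.

Lemma sqmodM a b p : sqmod a p -> sqmod b p -> sqmod (a * b) p.
Proof.
move=> [x hx] [y hy]; exists (x * y).
have -> : (x * y) ^+ 2 - a * b = (x ^+ 2 - a) * y ^+ 2 + a * (y ^+ 2 - b) by ring.
by apply: rpredD; [apply: dvdz_mulr | apply: dvdz_mull].
Qed.

(** Nonresidues are odd powers of a primitive root, and two odd exponents have an even sum. *)
Lemma nsqmodM a b p : prime p -> ~ sqmod a p -> ~ sqmod b p -> sqmod (a * b) p.
Proof.
move=> pp na nb.
have N0 : (0 < p.-1)%N by have := prime_gt1 pp; lia.
have [g pg] : exists g : 'F_p, (p.-1).-primitive_root g.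
  have /hasP[g _ pg] : has (p.-1).-primitive_root [seq x <- enum 'F_p | x != 0].
    apply: has_prim_root => //.
    - apply/allP => x; rewrite mem_filter => /andP[x0 _]; rewrite unity_rootE.
      apply/eqP; apply: (mulfI x0); rewrite mulr1 -exprS prednK ?prime_gt0 //.
      by have := expf_card x; rewrite card_Fp.
    - by rewrite filter_uniq // enum_uniq.
    have e : #|predC1 (0 : 'F_p)| = p.-1 by rewrite cardC1 card_Fp.
    rewrite -[X in (X <= _)%N]e cardE; apply: uniq_leq_size; first exact: enum_uniq.
    by move=> x; rewrite mem_enum inE mem_filter mem_enum inE andbT.
  by exists g.
have odd_ind c : ~ sqmod c p -> exists i, odd i /\ (c%:~R : 'F_p) = g ^+ i.
  move=> nc; have c0 : (c%:~R : 'F_p) != 0.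
    by apply/eqP => c0; apply: nc; apply/(sqmod_Fp _ pp); exists 0; rewrite c0 expr0n.
  have [|i ei] := prim_rootP pg (x := c%:~R).
    apply: (mulfI c0); rewrite mulr1 -exprS prednK ?prime_gt0 //.
    by have := expf_card (c%:~R : 'F_p); rewrite card_Fp.
  exists i; split=> //; apply/negPn/negP => ev; apply: nc; apply/(sqmod_Fp _ pp).
  by exists (g ^+ i./2); rewrite ei -exprM muln2 even_halfK.
have [i [oi ei]] := odd_ind _ na; have [j [oj ej]] := odd_ind _ nb.
apply/(sqmod_Fp _ pp); exists (g ^+ (i + j)./2).
by rewrite intrM ei ej -exprD -exprM muln2 even_halfK // oddD oi oj.
Qed.

(** All residue facts used later. By the supplementary laws [q] is 7 modulo 8, and the two cases of
    the theorem become [p] equal to 5 or to 3 modulo 8. [ar_k] lets [p] split in Q(sqrt(-2q));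
    [ar_i] says that a square root of -1 modulo [p] is itself a nonresidue. *)
Record arith (p q : nat) : Prop := Arith {
  ar_p : prime p; ar_q : prime q; ar_q8 : (q %% 8 = 7)%N;
  ar_p8 : (p %% 8 = 5)%N \/ (p %% 8 = 3)%N;
  ar_pq : ~ sqmod p%:Z q; ar_2p : ~ sqmod 2 p; ar_2q : sqmod 2 q;
  ar_N1q : ~ sqmod (-1) q; ar_k : sqmod (- (2 * q%:Z)) p;
  ar_N1p : (p %% 8 = 5)%N -> sqmod (-1) p;
  ar_qp : (p %% 8 = 5)%N -> ~ sqmod q%:Z p;
  ar_i : (p %% 8 = 5)%N -> forall x : int, ~~ (p%:Z %| x ^+ 4 + 1)%Z;
  ar_N1p' : (p %% 8 = 3)%N -> ~ sqmod (-1) p;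
  ar_qp' : (p %% 8 = 3)%N -> sqmod q%:Z p;
  ar_N2p' : (p %% 8 = 3)%N -> sqmod (-2) p }.

Lemma arith_hyp p q : prime p -> prime q -> ((p %% 4 = 1)%N \/ (p %% 4 = 3)%N) ->
  (q %% 4 = 3)%N -> legendre 2 p = -1 -> legendre 2 q = 1 -> legendre p%:Z q = -1 -> arith p q.
Proof.
move=> pp pq p4 q4 l2p l2q lpq.
have po : odd p by have := p4; lia.
have qo : odd q by have := q4; lia.
have n2p := legendre_nsq (prime_gt0 pp) l2p; have s2q := legendre_sq l2q.
have npq := legendre_nsq (prime_gt0 pq) lpq.
have q8 : (q %% 8 = 7)%N by move/(sqmod2 pq qo): s2q => h; lia.
have p8 : (p %% 8 = 5)%N \/ (p %% 8 = 3)%N.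
  have : ~ ((p %% 8 = 1)%N \/ (p %% 8 = 7)%N) by move=> h; apply: n2p; apply/(sqmod2 pp po).
  by move=> h; lia.
have N1q : ~ sqmod (-1) q by move/(sqmodN1 pq qo) => h; lia.
have ne : p != q by apply/eqP => e; move: q8 p8; rewrite -e => ->; lia.
have rc := reciprocity pp po pq qo ne.
have N1p : (p %% 8 = 5)%N -> sqmod (-1) p by move=> h; apply/(sqmodN1 pp po); lia.
have N1p' : (p %% 8 = 3)%N -> ~ sqmod (-1) p by move=> h /(sqmodN1 pp po); lia.
have qp : (p %% 8 = 5)%N -> ~ sqmod q%:Z p.
  by move=> h /rc; rewrite (_ : (p %% 4 == 1)%N); last by apply/eqP; lia.
have qp' : (p %% 8 = 3)%N -> sqmod q%:Z p.
  move=> h; apply/rc; rewrite (_ : (p %% 4 == 1)%N = false); last by apply/eqP; lia.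
  by rewrite -mulN1r; apply: nsqmodM.
have N2p' : (p %% 8 = 3)%N -> sqmod (-2) p.
  by move=> h; rewrite -mulN1r; apply: nsqmodM => //; apply: N1p'.
split=> //.
- case: p8 => h.
    by rewrite -mulN1r; apply: sqmodM; [exact: N1p | apply: nsqmodM => //; exact: qp].
  by rewrite -mulNr; apply: sqmodM; [exact: N2p' | exact: qp'].
(* As [p - 1] is 4 times an odd number, [x ^+ 4 = -1] would give [x ^+ p.-1 = -1], against
   Fermat. *)
move=> h x; apply/negP; rewrite -(pchar_int (pchar_Fp pp)) rmorphD rmorphXn /= addr_eq0 => /eqP x4.
have x0 : (x%:~R : 'F_p) != 0.
  by apply/eqP => e; move: x4; rewrite e expr0n => /eqP; rewrite eq_sym oppr_eq0 oner_eq0.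
have : (x%:~R : 'F_p) ^+ p.-1 = 1.
  apply: (mulfI x0); rewrite mulr1 -exprS prednK ?prime_gt0 //.
  by have := expf_card (x%:~R : 'F_p); rewrite card_Fp.
have [k ek] : exists k, p.-1 = (4 * (2 * k + 1))%N by exists (p %/ 8)%N; lia.
rewrite ek exprM x4 -[X in X = _]signr_odd oddD oddM /= expr1 => /eqP.
rewrite eq_sym -addr_eq0 -mulr2n -(dvdn_pcharf (pchar_Fp pp)) => /dvdn_leq.
by have := prime_gt1 pp; lia.
Qed.

(** * Valuations and ideals over the rationals *)

Lemma Crat_frac (r : algC) : r \in Crat ->
  exists (a b : int), b != 0 /\ r = a%:~R / b%:~R.
Proof.
case/CratP => s ->; exists (numq s), (denq s); split; first exact: denq_neq0.
by rewrite -{1}(divq_num_den s) rmorphM fmorphV /= !ratr_int.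
Qed.

(** The [l]-adic valuation is odd on the left and even on the right. *)
Lemma ratsq_val (l : nat) (n : int) (r : algC) : prime l -> ~~ (l%:Z %| n)%Z ->
  r \in Crat -> l%:R != r ^+ 2 * n%:~R.
Proof.
move=> pl ln /Crat_frac[a [b [b0 ->]]]; apply/eqP => e.
have n0 : n != 0 by apply: contraNneq ln => ->; apply: dvdz0.
have bC : b%:~R != 0 :> algC by rewrite intr_eq0.
have : l%:Z * b ^+ 2 = a ^+ 2 * n.
  apply: (@intr_inj algC); rewrite !intrM -[(l%:Z)%:~R]/(l%:R) e.
  by field.
move=> E0; have a0 : a != 0.
  apply/eqP => a0; move/eqP: E0; rewrite a0 expr0n mul0r mulf_eq0 sqrf_eq0 (negPf b0) orbF.
  by rewrite -[0]/(0%:Z) eqz_nat; have := prime_gt0 pl; lia.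
move/(congr1 absz): E0; rewrite !abszM absz_nat => /(congr1 (logn l)).
have a1 : (0 < `|a|)%N by rewrite absz_gt0.
have b1 : (0 < `|b|)%N by rewrite absz_gt0.
have n1 : (0 < `|n|)%N by rewrite absz_gt0.
rewrite !lognM ?muln_gt0 ?a1 ?b1 ?n1 ?prime_gt0 //.
have -> : logn l `|n|%N = 0%N by apply: logn_coprime; rewrite prime_coprime // -[l]absz_nat -dvdzE.
by rewrite logn_prime // eqxx => h; lia.
Qed.

(** After clearing denominators, the least positive integral combination divides every member of the
    family. *)
Lemma rat_gcd (I : finType) (x : I -> algC) :
  (forall i, x i \in Crat) -> (exists i, x i != 0) ->
  exists g (u : I -> int), [/\ g \in Crat, g != 0, (forall i, x i / g \in Num.int)
    & g = \sum_i x i * (u i)%:~R].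
Proof.
move=> xq [i0 xi0].
have /fin_all_exists[M HM] : forall i, exists m : nat, (0 < m)%N /\ m%:R * x i \in Aint.
  by move=> i; apply: ratr_bound.
pose N := (\prod_i M i)%N.
have N0 : N%:R != 0 :> algC by rewrite pnatr_eq0 -lt0n prodn_cond_gt0 // => i _; case: (HM i).
have /fin_all_exists[a Ha] : forall i, exists a : int, N%:R * x i = a%:~R.
  move=> i; have /intrP[z ez] : N%:R * x i \in Num.int; last by exists z.
  apply: Cint_rat_Aint; first by rewrite rpredM // rpred_nat.
  rewrite /N (bigD1 i) //= natrM mulrAC; apply: rpredM; first by have [] := HM i.
  by apply: Aint_Cnat; rewrite rpred_nat.
have ai0 : a i0 != 0.
  by rewrite -(intr_eq0 algC) -Ha mulf_neq0.
pose P (n : nat) := (0 < n)%N /\ exists u : I -> int, \sum_i a i * u i = n%:Z.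
have [|g [[g0 [u eu]] gmin]] := @nat_min P.
  exists `|a i0|%N; split; first by rewrite absz_gt0.
  exists (fun i => if i == i0 then sgz (a i0) else 0).
  rewrite (bigD1 i0) //= eqxx big1 => [|i /negPf ->]; last by rewrite mulr0.
  by rewrite addr0 mulrC -abszEsg.
have gZ : g%:Z != 0 by rewrite -lt0n.
have dv j : (g%:Z %| a j)%Z.
  apply/dvdz_mod0P; apply/eqP/negPn/negP => r0.
  have r1 : (0 <= (a j %% g%:Z)%Z)%R by rewrite modz_ge0.
  have : (g <= `|(a j %% g%:Z)%Z|)%N.
    apply: gmin; split; first by rewrite absz_gt0.
    exists (fun i => (i == j)%:Z - (a j %/ g%:Z)%Z * u i); rewrite gez0_abs //.
    transitivity (a j - (a j %/ g%:Z)%Z * g%:Z); last by rewrite {1}(divz_eq (a j) g%:Z); ring.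
    rewrite -eu mulr_sumr -[X in X - _](_ : \sum_i a i * (i == j)%:Z = _).
      by rewrite -sumrB; apply: eq_bigr => i _; ring.
    by rewrite (bigD1 j) //= eqxx mulr1 big1 ?addr0 // => i /negPf ->; rewrite mulr0.
  by rewrite leqNgt -ltz_nat gez0_abs // ltz_pmod // -lt0n.
have gC : g%:R != 0 :> algC by rewrite pnatr_eq0 -lt0n.
have xE i : x i = (a i)%:~R / N%:R by rewrite -Ha mulrC mulKf.
exists (g%:R / N%:R), u; split.
- by rewrite rpredM ?rpredV ?rpred_nat.
- by rewrite mulf_neq0 ?invr_eq0.
- move=> i; have /dvdzP[k ek] := dv i.
  have -> : x i / (g%:R / N%:R) = k%:~R; last exact: rpred_int.
  by rewrite xE ek !intrM -[(g%:Z)%:~R]/(g%:R); field; rewrite gC N0.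
have -> : g%:R = (\sum_i a i * u i)%:~R :> algC by rewrite eu.
rewrite rmorph_sum mulr_suml; apply: eq_bigr => i _; rewrite xE [in LHS]rmorphM /=.
by field.
Qed.

Lemma Inv_rat : Inv (fun x => x \in Crat).
Proof.
move=> I x xq x0; have [g [u [gq g0 xg eg]]] := rat_gcd xq x0.
exists (fun i => (u i)%:~R / g); split.
- by move=> i; rewrite rpredM ?rpredV ?rpred_int.
- move=> i j; rewrite mulrCA; apply: rpredM; first exact: Aint_int.
  by apply: Aint_Cint; apply: xg.
rewrite -[RHS](divff g0) {2}eg mulr_suml; apply: eq_bigr => i _; ring.
Qed.

Lemma DD_rat a : DD (fun x => x \in Crat) a -> exists2 r, r \in Crat & assoc a r.
Proof.
move=> da; have a0 := DD_nz da; have [I [x [z [xq xa x1]]]] := DD_fin da.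
have [|g [u [gq g0 xg eg]]] := rat_gcd (x := x) _ (sum1_nz x1); first by move=> i; have [] := xq i.
exists g => //; apply: assocI => //.
  rewrite -[a]mul1r -x1 !mulr_suml rpred_sum // => i _.
  have -> : x i * z i * a / g = (x i / g) * (z i * a) by ring.
  by apply: rpredM; [apply: Aint_Cint; apply: xg | have [] := xa i].
rewrite {1}eg mulr_suml rpred_sum // => i _; rewrite mulrAC; apply: rpredM; last exact: Aint_int.
by have [] := xa i.
Qed.

(** * The field L and generators of its Galois group *)

Section Setup.
Variables p q : nat.
Definition w2 : algC := sqrtC 2.
Definition wq : algC := sqrtC q%:R.
Definition wp : algC := sqrtC p%:R.
Definition gens := [:: w2; wq; wp; 'i].
Definition LL : cset := Qgen gens.

Record setup (s2 sq sp si : rmC) : Prop := Setup {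
  s22 : s2 w2 = - w2; s2q : s2 wq = wq; s2p : s2 wp = wp; s2i : s2 'i = 'i;
  sq2 : sq w2 = w2; sqq : sq wq = - wq; sqp : sq wp = wp; sqi : sq 'i = 'i;
  sp2 : sp w2 = w2; spq : sp wq = wq; spp : sp wp = - wp; spi : sp 'i = 'i;
  si2 : si w2 = w2; siq : si wq = wq; sip : si wp = wp; sii : si 'i = - 'i }.

Lemma w2K : w2 ^+ 2 = 2. Proof. exact: sqrtCK. Qed.
Lemma wqK : wq ^+ 2 = q%:R. Proof. exact: sqrtCK. Qed.
Lemma wpK : wp ^+ 2 = p%:R. Proof. exact: sqrtCK. Qed.

Lemma rsq_gens : rsq gens.
Proof.
move=> d; rewrite !inE => /or4P[] /eqP->; rewrite ?w2K ?wqK ?wpK ?sqrCi;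
  by rewrite ?rpred_nat // rpredN rpred1.
Qed.

Lemma rsq_sub s : {subset s <= gens} -> rsq s.
Proof. by move=> h d ds; apply: rsq_gens; apply: h. Qed.

Lemma mask3 (a b c : algC) (m : bitseq) : exists e1 e2 e3 : bool,
  \prod_(d <- mask m [:: a; b; c]) d = a ^+ e1 * b ^+ e2 * c ^+ e3.
Proof.
case: m => [|e1 m]; first by exists false, false, false; rewrite big_nil !mulr1.
case: m => [|e2 m].
  by exists e1, false, false; case: e1; rewrite /= ?big_cons big_nil; ring.
case: m => [|e3 m].
  by exists e1, e2, false; case: e1; case: e2; rewrite /= ?big_cons big_nil; ring.
by exists e1, e2, e3; case: e1; case: e2; case: e3; case: m => [|? ?]; rewrite /= ?big_cons big_nil; ring.
Qed.

Lemma mq_sqrt3 (a b c x : algC) (A B C X : int) : x ^+ 2 = X%:~R ->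
  a ^+ 2 = A%:~R -> b ^+ 2 = B%:~R -> c ^+ 2 = C%:~R -> mq [:: a; b; c] x ->
  exists (r : algC) (e1 e2 e3 : bool), r \in Crat /\
    X%:~R = r ^+ 2 * (A ^+ e1 * B ^+ e2 * C ^+ e3)%:~R.
Proof.
move=> hx ha hb hc h; have rs : rsq [:: a; b; c].
  by move=> d; rewrite !inE => /or3P[] /eqP->; rewrite ?ha ?hb ?hc; apply: rpred_int.
have [|m [r [rq e]]] := mq_sqrt rs h; first by rewrite hx; apply: rpred_int.
have [e1 [e2 [e3 em]]] := mask3 a b c m; exists r, e1, e2, e3; split=> //.
rewrite -hx e em !exprMn !intrM !rmorphXn /= -ha -hb -hc -!exprM.
by congr (_ * (_ * _ * _)); rewrite mulnC.
Qed.

Lemma aut_of (t : seq algC) (d : algC) : {subset t <= gens} -> d ^+ 2 \in Crat -> ~ mq t d ->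
  exists g : rmC, (forall x, x \in t -> g x = x) /\ g d = - d.
Proof.
move=> st d2 nd; have rt := rsq_sub st; have [g [gx gd]] := aut_exists rt d2 nd.
by exists g; split=> // x xt; apply: gx; apply: mq_gen.
Qed.

Lemma dvdz_prim (l : nat) (A B C : int) (e1 e2 e3 : bool) : prime l ->
  ~~ (l%:Z %| A)%Z -> ~~ (l%:Z %| B)%Z -> ~~ (l%:Z %| C)%Z ->
  ~~ (l%:Z %| (A ^+ e1 * B ^+ e2 * C ^+ e3))%Z.
Proof.
move=> pl; rewrite !dvdzE !abszM !abszX absz_nat => a b c.
rewrite !Euclid_dvdM // !Euclid_dvdX // !negb_or.
by rewrite (negPf a) (negPf b) (negPf c).
Qed.

(** Each of the four roots is independent of the other three: a relation contradicts the parity of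
    the valuation at 2, [q] or [p], and for ['i] it contradicts positivity of rational squares. *)
Lemma setup_exists : arith p q -> exists s2 sq sp si, setup s2 sq sp si.
Proof.
move=> ar; have [pp pq p8 q8] := And4 (ar_p ar) (ar_q ar) (ar_p8 ar) (ar_q8 ar).
have ne : p != q by apply/eqP => e; rewrite e in p8; lia.
have ne' : q != p by rewrite eq_sym.
have p2 : p != 2%N by apply/eqP => e; rewrite e in p8; lia.
have q2 : q != 2%N by apply/eqP => e; rewrite e in q8; lia.
have dv l m : prime l -> prime m -> l != m -> ~~ (l%:Z %| m%:Z)%Z.
  by move=> pl pm nlm; rewrite dvdzE !absz_nat dvdn_prime2.
have dv1 l : prime l -> ~~ (l%:Z %| -1)%Z by move=> pl; rewrite dvdzE /= dvdn1; case: l pl => [|[|l]].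
have h2 : w2 ^+ 2 = (2%N%:Z)%:~R by exact: w2K.
have hq : wq ^+ 2 = (q%:Z)%:~R by exact: wqK.
have hp : wp ^+ 2 = (p%:Z)%:~R by exact: wpK.
have hi : 'i ^+ 2 = (-1)%:~R :> algC by rewrite sqrCi.
have ra d (D : int) : d ^+ 2 = D%:~R -> d ^+ 2 \in Crat by move=> ->; apply: rpred_int.
have [s2 [s2x s22]] : exists g : rmC, (forall x, x \in [:: wq; wp; 'i] -> g x = x) /\ g w2 = - w2.
  apply: aut_of; [by move=> x; rewrite !inE => /or3P[] ->; rewrite ?orbT | exact: ra h2 |].
  move=> /(mq_sqrt3 h2 hq hp hi)[r [e1 [e2 [e3 [rq /eqP e]]]]].
  by apply/negP: e; apply: ratsq_val => //; apply: dvdz_prim; [by [] | apply: dv | apply: dv | exact: dv1]; rewrite // eq_sym.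
have [sq [sqx sqq]] : exists g : rmC, (forall x, x \in [:: w2; wp; 'i] -> g x = x) /\ g wq = - wq.
  apply: aut_of; [by move=> x; rewrite !inE => /or3P[] ->; rewrite ?orbT | exact: ra hq |].
  move=> /(mq_sqrt3 hq h2 hp hi)[r [e1 [e2 [e3 [rq /eqP e]]]]].
  by apply/negP: e; apply: ratsq_val => //; apply: dvdz_prim; [by [] | apply: dv | apply: dv | exact: dv1]; rewrite // eq_sym.
have [sp [spx spp]] : exists g : rmC, (forall x, x \in [:: w2; wq; 'i] -> g x = x) /\ g wp = - wp.
  apply: aut_of; [by move=> x; rewrite !inE => /or3P[] ->; rewrite ?orbT | exact: ra hp |].
  move=> /(mq_sqrt3 hp h2 hq hi)[r [e1 [e2 [e3 [rq /eqP e]]]]].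
  by apply/negP: e; apply: ratsq_val => //; apply: dvdz_prim; [by [] | apply: dv | apply: dv | exact: dv1]; rewrite // eq_sym.
have [si [six sii]] : exists g : rmC, (forall x, x \in [:: w2; wq; wp] -> g x = x) /\ g 'i = - 'i.
  apply: aut_of; [by move=> x; rewrite !inE => /or3P[] ->; rewrite ?orbT | exact: ra hi |].
  move=> /(mq_sqrt3 hi h2 hq hp)[r [e1 [e2 [e3 [rq e]]]]].
  have r2 : 0 <= r ^+ 2 by rewrite real_exprn_even_ge0 // Creal_Crat.
  have : (-1)%:~R < 0 :> algC by rewrite ltrz0.
  by rewrite e => /lt_geF; rewrite mulr_ge0 // ler0z !mulr_ge0 ?exprn_ge0.
exists s2, sq, sp, si; split=> //; first [exact: s2x | exact: sqx | exact: spx | exact: six | idtac];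
  by [apply: s2x; rewrite !inE eqxx ?orbT | apply: sqx; rewrite !inE eqxx ?orbT
    | apply: spx; rewrite !inE eqxx ?orbT | apply: six; rewrite !inE eqxx ?orbT].
Qed.

Section Fields.
Variables s2 sq sp si : rmC.
Hypothesis st : setup s2 sq sp si.

Ltac galt := move=> d; rewrite !inE => /or4P[] /eqP->;
  rewrite ?(s22 st) ?(s2q st) ?(s2p st) ?(s2i st) ?(sq2 st) ?(sqq st) ?(sqp st) ?(sqi st)
   ?(sp2 st) ?(spq st) ?(spp st) ?(spi st) ?(si2 st) ?(siq st) ?(sip st) ?(sii st); auto.
Lemma flips_s2 : flips gens s2. Proof. galt. Qed.
Lemma flips_sq : flips gens sq. Proof. galt. Qed.
Lemma flips_sp : flips gens sp. Proof. galt. Qed.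
Lemma flips_si : flips gens si. Proof. galt. Qed.

Lemma LL_sf : is_subfield LL. Proof. exact: L_sf rsq_gens. Qed.
Lemma LL_w2 : LL w2. Proof. by apply: L_gen; rewrite !inE eqxx. Qed.
Lemma LL_wq : LL wq. Proof. by apply: L_gen; rewrite !inE eqxx orbT. Qed.
Lemma LL_wp : LL wp. Proof. by apply: L_gen; rewrite !inE eqxx !orbT. Qed.
Lemma LL_i : LL 'i. Proof. by apply: L_gen; rewrite !inE eqxx !orbT. Qed.

Lemma mq_fix (g : rmC) d t x : rsq (d :: t) -> (forall y, y \in t -> g y = y) -> g d = - d ->
  d != 0 -> mq (d :: t) x -> g x = x -> mq t x.
Proof.
move=> rt gt gd d0 [a [b [ha hb ->]]].
have rt' : rsq t by move=> y yt; apply: rt; rewrite inE yt orbT.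
have gf y : mq t y -> g y = y.
  move=> hy; apply: ((Qgen_mq y rt').2 hy (fun y => g y = y)) => [|z zt]; last exact: gt.
  split=> [|u v eu ev|u v eu ev|u eu]; first exact: rmorph1.
  - by rewrite rmorphB eu ev.
  - by rewrite rmorphM eu ev.
  by rewrite fmorphV eu.
rewrite rmorphD rmorphM (gf a) // (gf b) // gd mulrN => /addrI /eqP.
rewrite -subr_eq0 -opprD oppr_eq0 -mulr2n mulrn_eq0 /= mulf_eq0 (negPf d0) orbF => /eqP->.
by rewrite mul0r addr0.
Qed.

Lemma w2_neq0 : w2 != 0. Proof. by rewrite -sqrf_eq0 w2K pnatr_eq0. Qed.

Lemma fix_rat x : arith p q -> LL x -> s2 x = x -> sq x = x -> sp x = x -> si x = x -> x \in Crat.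
Proof.
move=> ar Lx e2 eq ep ei.
have wq0 : wq != 0 by rewrite -sqrf_eq0 wqK pnatr_eq0 -lt0n prime_gt0 // (ar_q ar).
have wp0 : wp != 0 by rewrite -sqrf_eq0 wpK pnatr_eq0 -lt0n prime_gt0 // (ar_p ar).
have rs t : {subset t <= gens} -> rsq t by exact: rsq_sub.
have h0 := (Qgen_mq x rsq_gens).1 Lx.
have h1 : mq [:: wq; wp; 'i] x.
  apply: (mq_fix (g := s2) rsq_gens _ (s22 st) w2_neq0 h0 e2).
  by move=> y; rewrite !inE => /or3P[] /eqP->; [exact: (s2q st) | exact: (s2p st) | exact: (s2i st)].
have h2 : mq [:: wp; 'i] x.
  apply: (mq_fix (g := sq) _ _ (sqq st) wq0 h1 eq).
    by apply: rs => y; rewrite !inE => /or3P[] ->; rewrite ?orbT.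
  by move=> y; rewrite !inE => /orP[] /eqP->; [exact: (sqp st) | exact: (sqi st)].
have h3 : mq [:: 'i] x.
  apply: (mq_fix (g := sp) _ _ (spp st) wp0 h2 ep).
    by apply: rs => y; rewrite !inE => /orP[] ->; rewrite ?orbT.
  by move=> y; rewrite !inE => /eqP->; exact: (spi st).
apply: (mq_fix (g := si) _ _ (sii st) (neq0Ci _) h3 ei) => //.
by apply: rs => y; rewrite !inE => ->; rewrite !orbT.
Qed.

(** Both the tower data and the invertibility of ideals climb from the rationals, one automorphism
    being dropped at each step. *)
Lemma LL_Bez_ord : arith p q -> Bez LL /\ forall b, DD LL b -> exists n, (0 < n)%N /\ pr LL (b ^+ n).
Proof.
move=> ar; have g2 := flips_s2; have gq := flips_sq; have gp := flips_sp; have gi := flips_si.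
have wq0 : wq != 0 by rewrite -sqrf_eq0 wqK pnatr_eq0 -lt0n prime_gt0 // (ar_q ar).
have wp0 : wp != 0 by rewrite -sqrf_eq0 wpK pnatr_eq0 -lt0n prime_gt0 // (ar_p ar).
have FQ := fixf_quad rsq_gens.
have Q1 := FQ s2 [::] g2 Logic.I.
have Q2 := FQ sq [:: s2] gq (conj g2 Logic.I).
have Q3 := FQ sp [:: sq; s2] gp (conj gq (conj g2 Logic.I)).
have Q4 := FQ si [:: sp; sq; s2] gi (conj gp (conj gq (conj g2 Logic.I))).
have eQ x : fixf LL [:: si; sp; sq; s2] x <-> x \in Crat.
  split=> [[[[[Lx e2] eq] ep] ei]|xq]; first exact: fix_rat.
  have Lx : LL x by apply: sf_rat LL_sf _ _.
  have gx (g : rmC) : g x = x by case/CratP: xq => r ->; apply: fmorph_rat.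
  by split; rewrite ?gx //; split; rewrite ?gx //; split; rewrite ?gx //; split; rewrite ?gx.
have Q4' : quad (fun x => x \in Crat) (fixf LL [:: sp; sq; s2]) si.
  by case: Q4 => a b c d; split=> // x; rewrite -eQ; apply: d.
have i4 : fixf LL [:: sp; sq; s2] 'i.
  by split; [split; [split; [exact: LL_i | exact: (s2i st)] | exact: (sqi st)] | exact: (spi st)].
have i3 : fixf LL [:: sq; s2] wp by split; [split; [exact: LL_wp | exact: (s2p st)] | exact: (sqp st)].
have i2 : fixf LL [:: s2] wq by split; [exact: LL_wq | exact: (s2q st)].
have T4 := tower_step (dz := -1) tower_rat Q4' i4 (sii st) (neq0Ci _) (sqrCi _).
have T3 := tower_step (dz := p%:Z) T4 Q3 i3 (spp st) wp0 wpK.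
have T2 := tower_step (dz := q%:Z) T3 Q2 i2 (sqq st) wq0 wqK.
have T1 := tower_step (dz := 2) T2 Q1 LL_w2 (s22 st) w2_neq0 w2K.
have I1 : Inv LL; last by split=> [|b]; [exact: (tower_Bez T1 LL_sf) | exact: (tower_ord T1 LL_sf)].
by apply: (Inv_up Q1); apply: (Inv_up Q2); apply: (Inv_up Q3); apply: (Inv_up Q4'); apply: Inv_rat.
Qed.
Lemma LL_Bez : arith p q -> Bez LL. Proof. by case/LL_Bez_ord. Qed.

End Fields.
End Setup.

(** * Selmer elements and the counting of square classes *)

Definition sqe (K : cset) (a b : algC) := exists z, [/\ K z, z != 0 & a = b * z ^+ 2].

(* The 2-Selmer elements of [K]: those generating the square of an ideal. *)
Definition SS (K : cset) (a : algC) :=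
  [/\ K a, a != 0 & exists2 b, DD K b & assoc (b ^+ 2) a].

Section Sel.
Variable K : cset.
Hypothesis sK : is_subfield K.

Lemma sqe_refl a : sqe K a a.
Proof. by exists 1; split; [exact: sf1 | exact: oner_neq0 | rewrite expr1n mulr1]. Qed.
Lemma sqe_sym a b : sqe K a b -> sqe K b a.
Proof.
case=> z [Kz z0 ->]; exists z^-1; split; [exact: sfV | by rewrite invr_eq0 |].
by rewrite -mulrA -exprMn divff // expr1n mulr1.
Qed.
Lemma sqe_trans b a c : sqe K a b -> sqe K b c -> sqe K a c.
Proof.
case=> z [Kz z0 ->] [y [Ky y0 ->]]; exists (y * z); split; [exact: sfM | exact: mulf_neq0 |].
by ring.
Qed.
(* [a * b] square is the same as [a ~ b]. *)
Lemma sqe_mul a b : K b -> b != 0 -> sqe K (a * b) 1 -> sqe K a b.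
Proof.
move=> Kb b0 [z [Kz z0 e]]; exists (z / b); split; [by sf | by rewrite mulf_neq0 ?invr_eq0 |].
by apply: (mulIf b0); rewrite e; field.
Qed.
Lemma SSM a b : SS K a -> SS K b -> SS K (a * b).
Proof.
case=> Ka a0 [x dx ax] [Kb b0 [y dy by_]]; split; [exact: sfM | exact: mulf_neq0 |].
by exists (x * y); [exact: DDM | rewrite exprMn; apply: assocM].
Qed.
Lemma SS_sq z : K z -> z != 0 -> SS K (z ^+ 2).
Proof.
move=> Kz z0; split; [exact: sfX | exact: expf_neq0 |].
by exists z; [exact: DD_elt | apply: assoc_refl; apply: expf_neq0].
Qed.
Lemma SS_sqe a b : sqe K a b -> SS K b -> SS K a.
Proof. by case=> z [Kz z0 ->] sb; apply: SSM => //; apply: SS_sq. Qed.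
Lemma SS_nz a : SS K a -> a != 0. Proof. by case. Qed.
Lemma SS_K a : SS K a -> K a. Proof. by case. Qed.
Lemma SS_unit u : K u -> aunit u -> SS K u.
Proof.
move=> Ku uu; have u0 : u != 0 by case/and3P: uu.
split=> //; exists 1; first exact: DD_unit sK aunit1.
by apply: assoc_sym; rewrite expr1n /assoc divr1.
Qed.

(** If each Selmer element is a square up to a unit, then no class has order 2, and the exponent of
    a class goes down step by step. *)
Lemma TT_triv : (forall a, SS K a -> exists2 b, K b & assoc a (b ^+ 2)) ->
  forall a, TT K a -> pr K a.
Proof.
move=> H a [da [n pa]]; elim: n pa => [|n IH pa]; first by rewrite expn0 expr1.
apply: IH; move: pa; rewrite expnSr exprM => -[c Kc ac].
have [|b Kb cb] := H c.
  by split=> //; [exact: assoc_nz2 ac | exists (a ^+ (2 ^ n)); [exact: DDX | ]].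
by exists b => //; apply: (@assoc_root 2) => //; apply: assoc_trans cb.
Qed.

End Sel.

(** At most [n] square classes meet [P]. Bounding inequivalent families avoids forming the quotient
    group, and the bounds of the steps below multiply without any group structure. *)
Definition pk (P : algC -> Prop) (K : cset) (n : nat) := forall (I : finType) (f : I -> algC),
  (forall i, P (f i)) -> (forall i j, sqe K (f i) (f j) -> i = j) -> (#|I| <= n)%N.

Lemma fiber_card (I J : finType) (c : I -> J) n :
  (forall j, (#|{: {i | c i == j}}| <= n)%N) -> (#|I| <= #|J| * n)%N.
Proof.
move=> H; rewrite -sum1_card (partition_big c xpredT) //= -sum_nat_const.
apply: leq_sum => j _; apply: leq_trans (H j); rewrite card_sub.
by rewrite sum1_card; apply: subset_leq_card; apply/subsetP => i; rewrite !inE.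
Qed.

Lemma pk_list (P : algC -> Prop) (K : cset) (t : seq algC) : is_subfield K ->
  (forall x, P x -> exists2 y, y \in t & sqe K x y) -> pk P K (size t).
Proof.
move=> sK H I f fP inj.
have /fin_all_exists[c Hc] : forall i, exists j : 'I_(size t), sqe K (f i) t`_j.
  move=> i; have [y yt e] := H _ (fP i).
  have lt : (index y t < size t)%N by rewrite index_mem.
  by exists (Ordinal lt); rewrite /= nth_index.
rewrite -[X in (_ <= X)%N]card_ord; apply: (leq_card c) => i j e; apply: inj.
by apply: sqe_trans (Hc i) _ => //; rewrite e; apply: sqe_sym.
Qed.

(** Every member is sent to a chosen representative of its class; the representatives are pairwise
    inequivalent, hence at most [n]. *)
Lemma pk_color (P : algC -> Prop) (K : cset) n (I : finType) (f : I -> algC) : is_subfield K ->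
  pk P K n -> (forall i, P (f i)) -> exists c : I -> 'I_n, forall i j, c i = c j -> sqe K (f i) (f j).
Proof.
move=> sK H fP.
have /fin_all_exists[b Hb] : forall p : I * I, exists b : bool, b <-> sqe K (f p.1) (f p.2).
  by move=> p; case: (classic (sqe K (f p.1) (f p.2))) => h; [exists true | exists false].
pose r i := odflt i [pick j | b (i, j)].
have rP i : sqe K (f i) (f (r i)).
  rewrite /r; case: pickP => [j /Hb //|_]; exact: sqe_refl.
have rE i j : sqe K (f i) (f j) -> r i = r j.
  move=> e; rewrite /r; have -> : [pick k | b (i, k)] = [pick k | b (j, k)].
    apply: eq_pick => k; apply/idP/idP => /Hb /= h; apply/Hb => /=.
      by apply: sqe_trans h => //; apply: sqe_sym.
    exact: sqe_trans h.
  by case: pickP => //= /(_ j) /negP[]; apply/Hb; apply: sqe_refl.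
have rr i : r (r i) == r i by apply/eqP/esym/rE.
pose J := {: {i | r i == i}}.
have cJ : (#|J| <= n)%N.
  apply: (H _ (fun i => f (val i))) => [i|i j e]; first exact: fP.
  by apply: val_inj; rewrite -(eqP (valP i)) -(eqP (valP j)); apply: rE.
exists (fun i => widen_ord cJ (enum_rank (exist (fun i => r i == i) (r i) (rr i) : J))) => i j.
move/(congr1 val) => /= /val_inj /enum_rank_inj /(congr1 val) /= e.
by apply: sqe_trans (rP i) _ => //; rewrite e; apply: sqe_sym.
Qed.

Section Steps.
Variables (k K : cset) (s : rmC).
Hypotheses (q : quad k K s) (bk : Bez k).
Let sK := quad_sK q.
Let sk := quad_sk q.

Lemma SS_norm a : SS K a -> SS k (a * s a).
Proof.
case=> Ka a0 [b db ab]; split; [exact: (quad_N q) | by rewrite mulf_neq0 ?fmorph_eq0 |].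
exists (b * s b); first exact: (DD_norm q).
by rewrite exprMn -rmorphXn; apply: assocM => //; rewrite assoc_aut.
Qed.

(** [N1] bounds the image of the norm on square classes and [N2] its kernel, which by Hilbert 90
    consists of classes of elements of [k]. *)
Lemma pk_step N1 N2 : pk (fun n => exists2 a, SS K a & n = a * s a) k N1 ->
  pk (fun r => k r /\ SS K r) K N2 -> pk (SS K) K (N1 * N2).
Proof.
move=> H1 H2 I f fS inj.
have [|c Hc] := pk_color (f := fun i => f i * s (f i)) sk H1; first by move=> i; exists (f i).
rewrite -[N1]card_ord; apply: (fiber_card (c := c)) => j.
case: (pickP (fun i => c i == j)) => [i0 ci0|h]; last first.
  by rewrite card_sub eq_card0 // => i; rewrite inE h.
have F0 := fS i0; have f00 := SS_nz F0.
have /fin_all_exists[r Hr] : forall i : {i | c i == j}, exists r, [/\ k r, SS K r & sqe K (f (val i) * f i0) r].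
  move=> [i ci] /=; have Fi := fS i.
  have [n [kn n0 en]] := Hc i i0 (etrans (eqP ci) (esym (eqP ci0))).
  have [|||r [b [kr r0 Kb b0 e]]] := hilbert90 q (n := f i0 * s (f i0) * n) (sfM sK (SS_K Fi) (SS_K F0)).
  - by rewrite mulf_neq0 // (SS_nz Fi).
  - by apply: (sfM sk) => //; apply: (quad_N q); apply: SS_K F0.
  - by rewrite rmorphM mulrACA en; ring.
  exists r; have E : sqe K (f i * f i0) r by exists b.
  split=> //; apply: (SS_sqe sK (sqe_sym sK E)).
  exact: (SSM sK).
apply: (H2 _ r) => [i|i i' e]; first by have [] := Hr i.
have [_ _ ei] := Hr i; have [_ _ ei'] := Hr i'.
apply: val_inj; apply: inj.
have [z [Kz z0 ez]] : sqe K (f (val i) * f i0) (f (val i') * f i0).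
  by apply: (sqe_trans sK ei); apply: (sqe_trans sK e); apply: sqe_sym.
by exists z; split=> //; apply: (mulIf f00); rewrite ez; ring.
Qed.

(** The classes of [r] and of [r * d ^+ 2] are different in [k] but equal in [K], so an inequivalent
    family over [K] yields one of twice the size over [k]. *)
Lemma pk_half d N : K d -> s d = - d -> d != 0 ->
  pk (fun r => k r /\ SS K r) k (2 * N) -> pk (fun r => k r /\ SS K r) K N.
Proof.
move=> Kd sd d0 H I f fS inj.
have kd2 : k (d ^+ 2) by apply: (quad_in q); [apply: (sfX sK) | rewrite rmorphXn sd sqrrN].
have nd z : k z -> d ^+ 2 = z ^+ 2 -> False.
  move=> kz /eqP; rewrite eqf_sqr => /orP[] /eqP e.
    by have := quad_fix q kz; rewrite -e sd => /eqP; rewrite -subr_eq0 -opprD oppr_eq0 -mulr2n mulrn_eq0 (negPf d0).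
  by have := quad_fix q (sfN sk kz); rewrite -e sd => /eqP; rewrite -subr_eq0 -opprD oppr_eq0 -mulr2n mulrn_eq0 (negPf d0).
suff : (#|{: I * bool}| <= 2 * N)%N by rewrite card_prod card_bool mulnC leq_pmul2l.
apply: (H _ (fun p : I * bool => f p.1 * (d ^+ 2) ^+ (nat_of_bool p.2))) => [[i b]|[i b] [i' b'] /=].
  have [kf sf_] := fS i; split; first by apply: (sfM sk) => //; apply: (sfX sk).
  by apply: (SSM sK) => //; rewrite -exprM mulnC exprM; apply: SS_sq; [exact: sK | apply: (sfX sK) | apply: expf_neq0].
move=> [z [kz z0 e]].
have ii : i = i'.
  apply: inj; exists (d ^+ b' * z / d ^+ b); split.
  - by apply: (sfM sK); [apply: (sfM sK); [apply: (sfX sK) | apply: (quad_sub q)] | apply: (sfV sK); apply: (sfX sK)].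
  - by rewrite !mulf_neq0 ?invr_eq0 // expf_neq0.
  have db : (d ^+ 2) ^+ b != 0 by rewrite !expf_neq0.
  apply: (mulIf db); rewrite e -!exprM ![(2 * _)%N]mulnC !exprM; field.
  by rewrite expf_neq0.
subst i'; congr (_, _); have fi0 : f i != 0 by have [_ /SS_nz] := fS i.
case: b b' e => [] [] //; rewrite expr1 expr0 mulr1 => e; exfalso.
  by apply: (nd z kz); apply: (mulfI fi0); rewrite e.
apply: (nd z^-1 (sfV sk kz)); apply: (mulfI fi0); rewrite exprVn {2}e mulfK //.
by rewrite expf_neq0.
Qed.

(** Modulo squares of ideals of [k], the ideal of [r] is one of those listed in [t], in practice the
    products of ramified primes; two elements with the same entry differ by a Selmer element of
    [k]. *)
Lemma pk_ram t N : pk (SS k) k N -> (forall y, y \in t -> DD k y) ->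
  (forall r, k r -> SS K r -> exists2 y, y \in t & exists2 e, DD k e & assoc r (y * e ^+ 2)) ->
  pk (fun r => k r /\ SS K r) k (size t * N).
Proof.
move=> H tD tS I f fS inj.
have /fin_all_exists[c Hc] : forall i, exists j : 'I_(size t), exists2 e, DD k e & assoc (f i) (t`_j * e ^+ 2).
  move=> i; have [kf Sf] := fS i; have [y yt [e de ae]] := tS _ kf Sf.
  have lt : (index y t < size t)%N by rewrite index_mem.
  by exists (Ordinal lt); exists e => //; rewrite /= nth_index.
rewrite -[size t]card_ord; apply: (fiber_card (c := c)) => j.
case: (pickP (fun i => c i == j)) => [i0 ci0|h]; last first.
  by rewrite card_sub eq_card0 // => i; rewrite inE h.
have [e0 de0 ae0] := Hc i0; have [kf0 Sf0] := fS i0; have f00 := SS_nz Sf0.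
apply: (H _ (fun i : {i | c i == j} => f (val i) * f i0)) => [[i ci]|i i' e] /=.
  have [kf Sf] := fS i; split; [exact: (sfM sk) | by rewrite mulf_neq0 ?(SS_nz Sf) |].
  have [e1 de1 ae1] := Hc i; rewrite (eqP ci) -(eqP ci0) in ae1.
  exists (t`_(c i0) * e1 * e0).
    by apply: (DDM sk) => //; apply: (DDM sk) => //; apply: tD; apply: mem_nth.
  have -> : (t`_(c i0) * e1 * e0) ^+ 2 = (t`_(c i0) * e1 ^+ 2) * (t`_(c i0) * e0 ^+ 2) by ring.
  by apply: assoc_sym; apply: assocM.
apply: val_inj; apply: inj; have [z [kz z0 ez]] := e; exists z; split=> //.
by apply: (mulIf f00); rewrite ez; ring.
Qed.

(** The square root [b] of the ideal of [r] is stable under [s], so it comes from an ideal [a] of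
    [k] up to the different [w - s w]; the defect is [c = a ^+ 2 / r]. *)
Lemma SS_descend r w : k r -> SS K r -> K w -> w \in Aint -> w != s w ->
  exists c e, [/\ DD k c, DD k e, assoc r (c * e ^+ 2), c \in Aint & (w - s w) ^+ 2 / c \in Aint].
Proof.
move=> kr [Kr r0 [b db br]] Kw wA wsw.
have sb : assoc (s b) b.
  apply: (@assoc_root 2) => //; apply: (assoc_trans (y := r)); last exact: assoc_sym.
  by rewrite -(quad_fix q kr) -rmorphXn assoc_aut.
have [a [da ab ba]] := DD_descend q bk db sb Kw wA wsw.
have a0 := DD_nz da; have b0 := DD_nz db; have dr : DD k r by apply: DD_elt.
exists (a ^+ 2 / r), (r / a); split.
- by apply: (DDM sk); [apply: (DDX _ sk) | apply: DDV].
- by apply: (DDM sk) => //; apply: DDV.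
- have -> : a ^+ 2 / r * (r / a) ^+ 2 = r by field; rewrite a0 r0.
  exact: assoc_refl.
- by rewrite -(assoc_dvd _ br) -expr_div_n; apply: rpredX.
rewrite invf_div mulrA -(assoc_dvd2 _ (assocM (assoc_refl _) br)); last first.
  by rewrite expf_neq0 // subr_eq0.
by rewrite -exprMn -expr_div_n; apply: rpredX.
Qed.

End Steps.

(** * Descent at q and genus theory over the rationals *)

Lemma rat_common (x y z : algC) : x \in Crat -> y \in Crat -> z \in Crat ->
  exists (N X Y Z : int), [/\ N != 0, N%:~R * x = X%:~R, N%:~R * y = Y%:~R & N%:~R * z = Z%:~R].
Proof.
move=> /Crat_frac[a [b [b0 ->]]] /Crat_frac[c [d [d0 ->]]] /Crat_frac[e [f [f0 ->]]].
have B : b%:~R != 0 :> algC by rewrite intr_eq0.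
have D : d%:~R != 0 :> algC by rewrite intr_eq0.
have F : f%:~R != 0 :> algC by rewrite intr_eq0.
exists (b * d * f), (a * d * f), (c * b * f), (e * b * d); split.
- by rewrite !mulf_neq0.
- by rewrite !intrM; field.
- by rewrite !intrM; field.
by rewrite !intrM; field.
Qed.

Lemma dvdz_primeM (q : nat) (a b : int) : prime q -> (q%:Z %| a * b)%Z -> (q%:Z %| a)%Z || (q%:Z %| b)%Z.
Proof. by move=> pq; rewrite !dvdzE abszM absz_nat Euclid_dvdM. Qed.

(** The form [x ^+ 2 - c * n ^+ 2] is anisotropic modulo [q] when [c] is a nonresidue. *)
Lemma nsq_rel (q : nat) (c x n : int) : prime q -> ~ sqmod c q ->
  (q%:Z %| x ^+ 2 - c * n ^+ 2)%Z -> (q%:Z %| x)%Z && (q%:Z %| n)%Z.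
Proof.
move=> pq nc h; have [qn|qn] := boolP (q%:Z %| n)%Z.
  rewrite andbT; have : (q%:Z %| x ^+ 2)%Z.
    rewrite -[x ^+ 2](subrK (c * n ^+ 2)); apply: rpredD => //.
    by apply: dvdz_mull; rewrite expr2; apply: dvdz_mulr.
  by rewrite expr2 => /(dvdz_primeM pq); rewrite orbb.
exfalso; apply: nc.
have cp : coprimez q%:Z n by rewrite coprimezE absz_nat prime_coprime // -[q]absz_nat -dvdzE.
have /coprimezP[[u v] /= uv] := cp.
exists (x * v).
have e : v * n = 1 - u * q%:Z by rewrite -uv; ring.
have -> : (x * v) ^+ 2 - c = (x ^+ 2 - c * n ^+ 2) * v ^+ 2 + c * ((v * n) ^+ 2 - 1) by ring.
apply: rpredD; first exact: dvdz_mulr.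
apply: dvdz_mull; rewrite e.
have -> : (1 - u * q%:Z) ^+ 2 - 1 = q%:Z * (u * (u * q%:Z - 2)) by ring.
by apply: dvdz_mulr; apply: dvdzz.
Qed.

(** A norm residue symbol at [q]: anisotropy forces [q] to divide [x] and [n], then also [y] because
    [q] divides its coefficient only once, and infinite descent follows. *)
Lemma qres (q : nat) (c u : int) (x y n : algC) : prime q -> ~ sqmod c q -> ~~ (q%:Z %| u)%Z ->
  x \in Crat -> y \in Crat -> n \in Crat ->
  x ^+ 2 - (q%:Z * u)%:~R * y ^+ 2 = c%:~R * n ^+ 2 -> n = 0.
Proof.
move=> pq nc qu xq yq nq e.
have [N [X [Y [Z [N0 eX eY eZ]]]]] := rat_common xq yq nq.
have NC : N%:~R != 0 :> algC by rewrite intr_eq0.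
suff Z0 : Z = 0 by apply: (mulfI NC); rewrite eZ Z0 mulr0.
have E : X ^+ 2 - q%:Z * u * Y ^+ 2 = c * Z ^+ 2.
  apply: (@intr_inj algC); rewrite rmorphB !rmorphM /= -eX -eY -eZ.
  have := congr1 (fun t => N%:~R ^+ 2 * t) e; rewrite /= intrM => h.
  by transitivity (N%:~R ^+ 2 * (c%:~R * n ^+ 2)); [rewrite -h; ring | ring].
have q0 : q%:Z != 0 by rewrite -lt0n prime_gt0.
move: {eX eY eZ} E; have [m] := ubnP `|Z|%N; elim: m X Y Z => // m IH X Y Z lt E.
have /andP[qX qZ] : (q%:Z %| X)%Z && (q%:Z %| Z)%Z.
  apply: (nsq_rel (c := c)) => //; rewrite -E opprB addrC subrK -mulrA.
  by apply: dvdz_mulr; apply: dvdzz.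
have /dvdzP[X' eX] := qX; have /dvdzP[Z' eZ] := qZ.
have qY : (q%:Z %| Y)%Z.
  have : (q%:Z %| u * Y ^+ 2)%Z.
    have -> : u * Y ^+ 2 = q%:Z * (X' ^+ 2 - c * Z' ^+ 2).
      by apply: (mulfI q0); move: E; rewrite eX eZ => E; apply/eqP; rewrite -subr_eq0; apply/eqP; move/eqP: E; rewrite -subr_eq0 => /eqP E; rewrite -[RHS]oppr0 -[in RHS]E; ring.
    by apply: dvdz_mulr; apply: dvdzz.
  by move=> /(dvdz_primeM pq); rewrite (negPf qu) /= expr2 => /(dvdz_primeM pq); rewrite orbb.
have /dvdzP[Y' eY] := qY.
have E' : X' ^+ 2 - q%:Z * u * Y' ^+ 2 = c * Z' ^+ 2.
  apply: (mulfI (expf_neq0 2 q0)); move: E; rewrite eX eY eZ => E.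
  transitivity ((X' * q%:Z) ^+ 2 - q%:Z * u * (Y' * q%:Z) ^+ 2); first by ring.
  by rewrite E; ring.
have [Z'0|Z'0] := eqVneq Z' 0; first by rewrite eZ Z'0 mul0r.
rewrite eZ (IH X' Y' Z') ?mul0r //.
move: lt; rewrite eZ abszM absz_nat ltnS; apply: leq_trans.
by apply: ltn_Pmulr (prime_gt1 pq) _; rewrite absz_gt0.
Qed.

Lemma rat_unit r : r \in Crat -> aunit r -> r = 1 \/ r = -1.
Proof.
move=> rq /and3P[r0 rA rV]; have /intrP[a ea] := Cint_rat_Aint rq rA.
have /intrP[b eb] : r^-1 \in Num.int by apply: Cint_rat_Aint; rewrite ?rpredV.
have : a * b = 1 by apply: (@intr_inj algC); rewrite intrM -ea -eb divff.
move=> ab; have : (a == 1) || (a == -1) by move: ab; case: a {ea} => [[|[|a]]|[|a]]; case: b {eb} => [b|b]; lia.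
by rewrite ea => /orP[] /eqP->; [left | right].
Qed.

Lemma Bez_rat : Bez (fun x => x \in Crat).
Proof. exact: tower_Bez tower_rat rat_subfield Inv_rat. Qed.

Lemma SS_rat v : SS (fun x => x \in Crat) v -> exists n, [/\ n \in Crat, n != 0 & v = n ^+ 2 \/ v = - n ^+ 2].
Proof.
case=> vq v0 [b db bv]; have [r rq br] := DD_rat db.
have r0 := assoc_nz2 br; exists r; split=> //.
have : assoc v (r ^+ 2) by apply: assoc_trans (assoc_sym bv) (assocX 2 br).
have h : v / r ^+ 2 \in Crat by rewrite rpredM // rpredV rpredX.
case/(rat_unit h) => e; [left | right].
  by rewrite -[v](divfK (expf_neq0 2 r0)) e mul1r.
by rewrite -[v](divfK (expf_neq0 2 r0)) e mulN1r.
Qed.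

Section QuadQ.
Variables (K : cset) (g : rmC) (d : algC) (D : int).
Hypotheses (Q : quad (fun x => x \in Crat) K g) (Kd : K d) (gd : g d = - d) (dD : d ^+ 2 = D%:~R).
Hypothesis d0 : d != 0.
Let sK := quad_sK Q.

Lemma quadQ_coord a : K a -> exists x y, [/\ x \in Crat, y \in Crat, a = x + y * d & a * g a = x ^+ 2 - D%:~R * y ^+ 2].
Proof.
move=> Ka; have n2 : 2%:R != 0 :> algC by rewrite pnatr_eq0.
pose x := (a + g a) / 2%:R; pose y := (a - g a) / (2%:R * d).
have xq : x \in Crat.
  by apply: (quad_in Q); [apply: (sfM sK); [apply: (quad_sub Q); apply: (quad_tr Q) | apply: (sfV sK); apply: (sf_nat sK)] |
    rewrite rmorphM rmorphD fmorphV rmorph_nat (quad_inv Q) // [g a + a]addrC].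
have yq : y \in Crat.
  apply: (quad_in Q).
    by apply: (sfM sK); [apply: (sfB sK) => //; apply: (quad_K Q) | apply: (sfV sK); apply: (sfM sK) => //; apply: (sf_nat sK)].
  by rewrite rmorphM rmorphB fmorphV rmorphM rmorph_nat (quad_inv Q) // gd /y; field; rewrite d0.
have e : a = x + y * d by rewrite /x /y; field; rewrite d0.
clearbody x y; have eg : g (x + y * d) = x - y * d.
  by rewrite rmorphD rmorphM gd (quad_fix Q xq) (quad_fix Q yq) mulrN.
rewrite e; exists x, y; split=> //.
by rewrite eg -dD; ring.
Qed.

Lemma SS_normQ a : SS K a -> exists n, [/\ n \in Crat, n != 0 & a * g a = n ^+ 2 \/ a * g a = - n ^+ 2].
Proof. by move=> Sa; apply: SS_rat; apply: (SS_norm Q Bez_rat). Qed.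

(** Genus theory: for a square norm, Hilbert 90 leaves a rational representative, whose ideal is a
    square up to a divisor of [(d - g d) ^+ 2 = 4 * D]. *)
Lemma SS_quadQ a n : SS K a -> n \in Crat -> a * g a = n ^+ 2 ->
  exists e : int, [/\ (e %| 4 * D)%Z, e != 0 & sqe K a e%:~R].
Proof.
move=> Sa nq e; have [Ka a0 _] := Sa.
have [r [b [rq r0 Kb b0 ab]]] := hilbert90 Q Ka a0 nq e.
have Sr : SS K r.
  apply: (SS_sqe sK _ Sa); apply: (sqe_sym sK); by exists b.
have dA : d \in Aint by apply: (@Aint_root 2) => //; rewrite dD Aint_int.
have dgd : d != g d by rewrite gd -subr_eq0 opprK -mulr2n mulrn_eq0.
have [c [f [dc df rcf cA cD]]] := SS_descend Q Bez_rat rq Sr Kd dA dgd.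
have [c0 c0q cc0] := DD_rat dc; have [f0 f0q ff0] := DD_rat df.
have c00 := assoc_nz2 cc0; have f00 := assoc_nz2 ff0.
have c0A : c0 \in Aint by rewrite -[c0]divr1 -(assoc_dvd2 _ cc0) divr1.
have /intrP[m em] := Cint_rat_Aint c0q c0A.
have m0 : m != 0 by rewrite -(intr_eq0 algC) -em.
have /intrP[l el] : (4 * D)%:~R / c0 \in Num.int.
  apply: Cint_rat_Aint; first by rewrite rpredM ?rpredV ?rpred_int.
  rewrite -(assoc_dvd _ cc0); move: cD; congr (_ / c \in Aint).
  by rewrite gd intrM -dD -[4%:~R]/(4%:R); ring.
have dm : (m %| 4 * D)%Z.
  by apply/dvdzP; exists l; apply: (@intr_inj algC); rewrite [RHS]intrM -el -em divfK.
have ar : assoc r (c0 * f0 ^+ 2) by apply: (assoc_trans rcf); apply: assocM => //; apply: assocX.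
have : r / (c0 * f0 ^+ 2) \in Crat by rewrite rpredM ?rpredV ?rpredM ?rpredX.
have nz : c0 * f0 ^+ 2 != 0 by rewrite mulf_neq0 ?expf_neq0.
have Kf : K f0 by apply: (quad_sub Q).
move=> rat; case: (rat_unit rat ar) => h; [exists m | exists (- m)]; split => //; try by rewrite ?dvdzE ?abszN ?oppr_eq0 -?dvdzE.
  exists (f0 * b); split; [exact: (sfM sK) | exact: mulf_neq0 |].
  by rewrite ab -[r](divfK nz) h -em; ring.
exists (f0 * b); split; [exact: (sfM sK) | exact: mulf_neq0 |].
by rewrite ab -[r](divfK nz) h rmorphN /= -em; ring.
Qed.
End QuadQ.

Lemma dvd8 (e : int) : (e %| 8)%Z -> exists (a b : bool) (z : int), z != 0 /\ e = (-1) ^+ a * 2 ^+ b * z ^+ 2.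
Proof.
rewrite dvdzE /= => h; have : (`|e| <= 8)%N by apply: dvdn_leq.
move: h; case: (intP e) => [|n|n] //=; rewrite ?abszN ?absz_nat.
  by do 9?[case: n => [|n]]; try lia; move=> *; rewrite ?NegzE;
   first [by exists false, false, 1 | by exists false, true, 1 | by exists false, false, 2 | by exists false, true, 2].
by do 9?[case: n => [|n]]; try lia; move=> *; rewrite ?NegzE;
   first [by exists true, false, 1 | by exists true, true, 1 | by exists true, false, 2 | by exists true, true, 2].
Qed.

Lemma dvd8q (q : nat) (e : int) : prime q -> e != 0 -> (e %| 8 * q%:Z)%Z ->
  exists (a b c : bool) (z : int), z != 0 /\ e = (-1) ^+ a * 2 ^+ b * q%:Z ^+ c * z ^+ 2.
Proof.
move=> pq e0 h; have q0 : q%:Z != 0 by rewrite -lt0n prime_gt0.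
have [/dvdzP[f ef]|qe] := boolP (q%:Z %| e)%Z.
  have : (f %| 8)%Z by move: h; rewrite ef dvdz_mul2r.
  by case/dvd8 => a [b [z [z0 ez]]]; exists a, b, true, z; split=> //; rewrite ef ez; ring.
have : (e %| 8)%Z.
  by rewrite -(Gauss_dvdzl _ (_ : coprimez e q%:Z)) // coprimez_sym coprimezE absz_nat prime_coprime // -[q]absz_nat -dvdzE.
by case/dvd8 => a [b [z [z0 ez]]]; exists a, b, false, z; split=> //; rewrite ez; ring.
Qed.

Lemma rat_sq_ge0 x : x \in Crat -> 0 <= x ^+ 2.
Proof. by move=> xq; rewrite real_exprn_even_ge0 // Creal_Crat. Qed.

(** * Six quadratic subfields of L *)

Section QuadFields.
Variables (p q : nat) (s2 sq sp si : rmC).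
Hypotheses (ar : arith p q) (st : setup p q s2 sq sp si).
Notation L := (LL p q).
Notation w2 := w2. Notation wq := (wq q). Notation wp := (wp p).
Let rS : rsq (gens p q) := @rsq_gens p q.
Let g2 := flips_s2 st. Let gq := flips_sq st. Let gp := flips_sp st. Let gi := flips_si st.
Definition c2q := comprm s2 sq.
Definition cqi := comprm sq si.
Definition c2i := comprm s2 si.
Lemma g2q : flips (gens p q) c2q. Proof. exact: flips_comp. Qed.
Lemma gqi : flips (gens p q) cqi. Proof. exact: flips_comp. Qed.
Lemma g2i : flips (gens p q) c2i. Proof. exact: flips_comp. Qed.

Lemma LBez gs : allflips (gens p q) gs -> Bez (fixf L gs).
Proof. by move=> h; apply: fixf_Bez => //; apply: LL_Bez st ar. Qed.

Lemma quad_rat g gs : flips (gens p q) g -> allflips (gens p q) gs ->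
  (forall x, L x -> fixf L (g :: gs) x -> [/\ s2 x = x, sq x = x, sp x = x & si x = x]) ->
  quad (fun x => x \in Crat) (fixf L gs) g.
Proof.
move=> fg fgs H; have [a b c d] := fixf_quad rS fg fgs; split=> // x; rewrite -d.
split=> [xq|h]; last first.
  have Lx : L x by apply: (fixf_L (gs := g :: gs)).
  by have [e2 eq ep ei] := H x Lx h; apply: fix_rat st _ _ _ _ _ _ _.
have gx (h : rmC) : h x = x by case/CratP: xq => r ->; apply: fmorph_rat.
have Lx : L x by apply: sf_rat xq; apply: LL_sf.
by elim: (g :: gs) => //= h hs IH; split.
Qed.

Lemma wq_neq0 : wq != 0. Proof. by rewrite -sqrf_eq0 wqK pnatr_eq0 -lt0n prime_gt0 // (ar_q ar). Qed.
Lemma wp_neq0 : wp != 0. Proof. by rewrite -sqrf_eq0 wpK pnatr_eq0 -lt0n prime_gt0 // (ar_p ar). Qed.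
Let i0 : 'i != 0 :> algC := neq0Ci _.
Let L2 : L w2 := @LL_w2 p q. Let Lq : L wq := @LL_wq p q. Let Lp : L wp := @LL_wp p q. Let Li : L 'i := @LL_i p q.
Let sL : is_subfield L := @LL_sf p q.

(** Composites such as [c2q] negate two roots and fix their product: [kk] is Q(sqrt(-2q)), [Qm2] is
    Q(sqrt(-2)), [Q2q] is Q(sqrt(2q)). Tails of the lists are shared on purpose: [Qi] and [Qq] lie
    in the fixed field of [[:: sp; s2]], [Q2] and [kk] in that of [[:: cqi; sp]]. *)
Definition Qi := fixf L [:: sq; sp; s2].
Definition Qq := fixf L [:: si; sp; s2].
Definition Q2 := fixf L [:: si; cqi; sp].
Definition kk := fixf L [:: c2q; cqi; sp].
Definition Qm2 := fixf L [:: c2i; sq; sp].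
Definition Q2q := fixf L [:: c2q; si; sp].

Lemma inv_cancel (g : rmC) x y : flips (gens p q) g -> L x -> L y -> g x = y -> g y = y -> x = y.
Proof. by move=> fg Lx Ly e e'; rewrite -(flips_inv rS fg Lx) e e'. Qed.

Lemma quad_Qi : quad (fun x => x \in Crat) Qi si.
Proof.
apply: (@quad_rat si [:: sq; sp; s2] gi (conj gq (conj gp (conj g2 Logic.I)))).
by move=> x _ [[[[_ ?] ?] ?] ?]; split.
Qed.
Lemma quad_Qq : quad (fun x => x \in Crat) Qq sq.
Proof.
apply: (@quad_rat sq [:: si; sp; s2] gq (conj gi (conj gp (conj g2 Logic.I)))).
by move=> x _ [[[[_ ?] ?] ?] ?]; split.
Qed.
Lemma quad_Q2 : quad (fun x => x \in Crat) Q2 c2q.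
Proof.
apply: (@quad_rat c2q [:: si; cqi; sp] g2q (conj gi (conj gqi (conj gp Logic.I)))).
move=> x Lx [[[[_ ep] eqi] ei] e2q]; have eq : sq x = x by rewrite -{1}ei.
by split=> //; rewrite -{1}eq.
Qed.
Lemma quad_k : quad (fun x => x \in Crat) kk s2.
Proof.
apply: (@quad_rat s2 [:: c2q; cqi; sp] g2 (conj g2q (conj gqi (conj gp Logic.I)))).
move=> x Lx [[[[_ ep] eqi] e2q] e2].
have eq : sq x = x by apply: (inv_cancel g2 (flips_L rS gq Lx) Lx).
by split=> //; apply: (inv_cancel gq (flips_L rS gi Lx) Lx).
Qed.
Lemma quad_Qm2 : quad (fun x => x \in Crat) Qm2 si.
Proof.
apply: (@quad_rat si [:: c2i; sq; sp] gi (conj g2i (conj gq (conj gp Logic.I)))).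
by move=> x Lx [[[[_ ep] eq] e2i] ei]; split=> //; rewrite -{1}ei.
Qed.
Lemma quad_Q2q : quad (fun x => x \in Crat) Q2q s2.
Proof.
apply: (@quad_rat s2 [:: c2q; si; sp] g2 (conj g2q (conj gi (conj gp Logic.I)))).
move=> x Lx [[[[_ ep] ei] e2q] e2]; split=> //.
by apply: (inv_cancel g2 (flips_L rS gq Lx) Lx).
Qed.

Ltac ev := rewrite /= ?rmorphM ?rmorphN /= ?rmorphM ?rmorphN ?(s22 st) ?(s2q st) ?(s2p st) ?(s2i st)
   ?(sq2 st) ?(sqq st) ?(sqp st) ?(sqi st) ?(sp2 st) ?(spq st) ?(spp st) ?(spi st)
   ?(si2 st) ?(siq st) ?(sip st) ?(sii st) ?rmorphM ?rmorphN ?(s22 st) ?(s2q st) ?(s2p st) ?(s2i st)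
   ?(sq2 st) ?(sqq st) ?(sqp st) ?(sqi st) ?(sp2 st) ?(spq st) ?(spp st) ?(spi st)
   ?(si2 st) ?(siq st) ?(sip st) ?(sii st) ?mulrNN ?mulNr ?mulrN ?opprK.

Lemma Qi_i : Qi 'i. Proof. by do !split=> //; ev; rewrite ?mulNr ?mulrN ?opprK. Qed.
Lemma Qq_wq : Qq wq. Proof. by do !split=> //; ev; rewrite ?mulNr ?mulrN ?opprK. Qed.
Lemma Q2_w2 : Q2 w2. Proof. by do !split=> //; ev; rewrite ?mulNr ?mulrN ?opprK. Qed.
Lemma kk_wk : kk ('i * w2 * wq).
Proof. have h : L ('i * w2 * wq) by apply: (sfM sL) => //; apply: (sfM sL).
by do !split=> //; ev; rewrite ?mulNr ?mulrN ?opprK. Qed.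
Lemma Qm2_w : Qm2 ('i * w2).
Proof. have h : L ('i * w2) by apply: (sfM sL).
by do !split=> //; ev; rewrite ?mulNr ?mulrN ?opprK. Qed.
Lemma Q2q_w : Q2q (w2 * wq).
Proof. have h : L (w2 * wq) by apply: (sfM sL).
by do !split=> //; ev; rewrite ?mulNr ?mulrN ?opprK. Qed.
End QuadFields.

(** * Pell's equation and fundamental units *)

Lemma inord_mod (M : nat) (k l l' : int) : k != 0 -> (`|k| < M)%N ->
  (inord `|(l %% k)%Z| : 'I_M.+1) = (inord `|(l' %% k)%Z| : 'I_M.+1) :> nat -> (l %% k)%Z = (l' %% k)%Z.
Proof.
move=> k0 kM; have b t : (`|(t %% k)%Z| < M.+1)%N.
  by have := modz_ge0 t k0; have := ltz_mod t k0; lia.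
by rewrite !inordK // => e; rewrite -(gez0_abs (modz_ge0 l k0)) -(gez0_abs (modz_ge0 l' k0)) e.
Qed.

Section Pell.
Variables (K : cset) (g : rmC) (d : algC) (D : int).
Hypotheses (Q : quad (fun x => x \in Crat) K g) (Kd : K d) (gd : g d = - d) (dD : d ^+ 2 = D%:~R).
Hypothesis d0 : 0 < d.
Let sK := quad_sK Q.
Let dn0 : d != 0 := lt0r_neq0 d0.
Let dr : d \is Num.real := gtr0_real d0.

Lemma KR x : K x -> x \is Num.real.
Proof.
move=> /(quadQ_coord Q Kd gd dD dn0)[a [b [aq bq -> _]]].
by apply: rpredD; [apply: Creal_Crat | apply: rpredM => //; apply: Creal_Crat].
Qed.

Lemma irr (x y : int) : x%:~R = y%:~R * d -> y = 0.
Proof.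
move=> e; have := congr1 g e; rewrite rmorphM !rmorph_int gd mulrN -e => /eqP.
rewrite -subr_eq0 opprK -intrD intr_eq0 => h; have x0 : x = 0 by lia.
by move/eqP: e; rewrite x0 eq_sym mulf_eq0 (negPf dn0) orbF intr_eq0 => /eqP.
Qed.

Lemma dirichlet (N : nat) : (0 < N)%N ->
  exists x y : int, 0 < y /\ N%:R * `|x%:~R - y%:~R * d| < 1 /\ y <= N%:Z.
Proof.
move=> N0; pose fl (i : nat) := Num.floor (i%:R * d).
pose fr (i : nat) := i%:R * d - (fl i)%:~R.
have rr i : i%:R * d \is Num.real by apply: rpredM => //; apply: realn.
have /all_and2[fr0 fr1] i : 0 <= fr i /\ fr i < 1.
  have /andP[h1 h2] := real_floor_itv (rr i); rewrite /fr subr_ge0; split=> //.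
  by move: h2; rewrite intrD ltrBlDl.
pose t i := Num.truncn (N%:R * fr i).
have Nf i : 0 <= N%:R * fr i by rewrite mulr_ge0.
have tN i : (t i < N)%N.
  by rewrite truncn_lt_nat // -[X in _ < X]mulr1 ltr_pM2l // ltr0n.
have /injectivePn[i [j ne e]] : ~~ injectiveb (fun i : 'I_N.+1 => Ordinal (tN i)).
  by apply/injectivePn/injectivePn/negP => /injectiveP/leq_card; rewrite !card_ord ltnn.
wlog ij : i j ne e / (i < j)%N.
  move=> H; case: (ltngtP i j) => [|ji|/val_inj ij]; [exact: H | | by rewrite ij eqxx in ne].
  by apply: (H j i) => //; rewrite eq_sym.
have te : t i = t j by case: e.
exists (fl j - fl i), (j%:Z - i%:Z); split; first by rewrite subr_gt0 ltz_nat.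
split; last by have := ltn_ord j; lia.
have -> : (fl j - fl i)%:~R - (j%:Z - i%:Z)%:~R * d = fr i - fr j.
  by rewrite /fr !rmorphB /= -[(i%:Z)%:~R]/(i%:R) -[(j%:Z)%:~R]/(j%:R); ring.
rewrite -[N%:R]normr_nat -normrM mulrBr.
have /andP[] := truncn_itv (Nf i); have /andP[] := truncn_itv (Nf j).
rewrite -/(t _) -/(t _) te -natr1 => h1 h2 h3 h4.
rewrite real_ltr_norml; last by apply: realB; apply: ger0_real.
apply/andP; split.
  by rewrite ltrBrDl ltrBlDr; apply: lt_le_trans h2 _; rewrite lerD2r.
by rewrite ltrBlDr; apply: lt_le_trans h4 _; rewrite addrC lerD2l.
Qed.

Lemma normE (x y : int) : (x ^+ 2 - D * y ^+ 2)%:~R = (x%:~R - y%:~R * d) * (x%:~R + y%:~R * d) :> algC.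
Proof. by rewrite !expr2 rmorphB !rmorphM /= -dD; ring. Qed.

Lemma good_pairs : exists M : nat, forall e : algC, 0 < e -> exists x y : int,
  [/\ 0 < y, `|x%:~R - y%:~R * d| < e, `|(x ^+ 2 - D * y ^+ 2)%R|%N != 0%N & (`|(x ^+ 2 - D * y ^+ 2)%R|%N < M)%N].
Proof.
(* If [N * |x - y d| < 1] and [y <= N], then [|x + y d|] is at most [|x - y d| + 2 N d], so the norm
   is bounded by [2 d + 1] independently of [N]. *)
exists (Num.truncn (2 * d + 1)).+2 => e e0.
have [N [N0 Ne]] : exists N : nat, (0 < N)%N /\ 1 <= N%:R * e.
  have ir : e^-1 \is Num.real by rewrite realV gtr0_real.
  exists (Num.truncn e^-1).+1; split=> //.
  by rewrite -ler_pdivrMr // div1r ltW // real_truncnS_gt.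
have [x [y [y0 [h yN]]]] := dirichlet N0; exists x, y.
have NR : 0 < N%:R :> algC by rewrite ltr0n.
split=> //.
- by rewrite -(ltr_pM2l NR); apply: lt_le_trans h Ne.
- rewrite absz_eq0; apply/eqP => e1.
  have : (x%:~R - y%:~R * d) * (x%:~R + y%:~R * d) = 0.
    by rewrite -normE e1.
  move/eqP; rewrite mulf_eq0 subr_eq0 addr_eq0 => /orP[] /eqP h1.
    by have := irr h1; lia.
  by rewrite -mulNr -rmorphN /= in h1; have := irr h1; lia.
have X : `|(x ^+ 2 - D * y ^+ 2)%:~R| <= 2 * d + 1 :> algC.
  rewrite normE normrM; set a := `|_ - _|.
  have a0 : 0 <= a by apply: normr_ge0.
  have a1 : a <= 1.
    by apply: le_trans (ltW h); rewrite -[X in X <= _]mul1r ler_wpM2r // ler1n.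
  have b : `|x%:~R + y%:~R * d| <= a + 2 * (N%:R * d).
    have -> : x%:~R + y%:~R * d = (x%:~R - y%:~R * d) + 2 * (y%:~R * d) by ring.
    apply: le_trans (ler_normD _ _) _; rewrite lerD2l normrM normr_nat ler_pM2l ?ltr0n //.
    rewrite normrM (gtr0_norm d0) ler_pM2r // ger0_norm ?ler0z ?(ltW y0) //.
    by rewrite -[N%:R]/((N%:Z)%:~R) ler_int.
  apply: (le_trans (ler_wpM2l a0 b)); rewrite mulrDr addrC; apply: lerD.
    have -> : a * (2 * (N%:R * d)) = (N%:R * a) * (2 * d) by ring.
    by rewrite -[X in _ <= X]mul1r ler_pM2r ?mulr_gt0 ?ltr0n // ltW.
  by rewrite mulr_ile1.
have r1 : 2 * d + 1 \is Num.real.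
  by apply: realD; rewrite ?real1 //; apply: realM; rewrite ?realn.
have := le_lt_trans X (real_truncnS_gt r1).
by rewrite -intr_norm -[X in _ < X]/((_%:Z)%:~R) ltr_int -abszE ltz_nat => /leqW.
Qed.

(** Each new pair is a closer approximation than all the previous ones, hence different from
    them. *)
Lemma many_pairs M : (forall e : algC, 0 < e -> exists x y : int,
  [/\ 0 < y, `|x%:~R - y%:~R * d| < e, `|(x ^+ 2 - D * y ^+ 2)%R|%N != 0%N & (`|(x ^+ 2 - D * y ^+ 2)%R|%N < M)%N]) ->
  forall n, exists s : seq (int * int), [/\ uniq s, size s = n & forall u, u \in s ->
   [/\ 0 < u.2, `|(u.1 ^+ 2 - D * u.2 ^+ 2)%R|%N != 0%N & (`|(u.1 ^+ 2 - D * u.2 ^+ 2)%R|%N < M)%N]].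
Proof.
move=> H; elim=> [|n [s [us ss hs]]]; first by exists [::].
have [e [e0 he]] : exists e : algC, 0 < e /\ forall u, u \in s -> e <= `|u.1%:~R - u.2%:~R * d|.
  elim: s hs {us ss} => [|v s IH] hs; first by exists 1; rewrite ltr01.
  have [u us|e [e0 he]] := IH; first by apply: hs; rewrite inE us orbT.
  have [v2 _ _] := hs v (mem_head _ _).
  have vp : 0 < `|v.1%:~R - v.2%:~R * d|.
    by rewrite normr_gt0 subr_eq0; apply/eqP => /irr h; rewrite h ltxx in v2.
  have vr : `|v.1%:~R - v.2%:~R * d| \is Num.real by apply: normr_real.
  have er : e \is Num.real by apply: gtr0_real.
  have [le|lt] := real_leP er vr.
    by exists e; split=> // u; rewrite inE => /orP[/eqP->|/he].
  exists `|v.1%:~R - v.2%:~R * d|; split=> // u; rewrite inE => /orP[/eqP-> //|/he].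
  by apply: le_trans; apply: ltW.
have [x [y [y0 xy n0 nM]]] := H e e0.
exists ((x, y) :: s); split.
- rewrite /= us andbT; apply/negP => /he /= h.
  by have := lt_le_trans xy h; rewrite ltxx.
- by rewrite /= ss.
by move=> u; rewrite inE => /orP[/eqP->|/hs].
Qed.

(** There are more pairs than combinations of a norm and residues modulo that norm, so two pairs
    agree in all of them, and the quotient of the two numbers is an integer of norm 1. *)
Lemma pell_unit : exists u, [/\ K u, aunit u & 1 < u].
Proof.
have [M HM] := good_pairs.
pose T : finType := (bool * 'I_M.+1 * 'I_M.+1 * 'I_M.+1)%type.
have [s [us ss hs]] := many_pairs HM #|T|.+1.
pose nm (u : int * int) : int := u.1 ^+ 2 - D * u.2 ^+ 2.
pose c (i : 'I_#|T|.+1) : T := let u := s`_i in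
  (0 <= nm u, inord `|nm u|, inord `|(u.1 %% nm u)%Z|, inord `|(u.2 %% nm u)%Z|).
have /injectivePn[i [j ne e]] : ~~ injectiveb c.
  by apply/negP => /injectiveP/leq_card; rewrite card_ord ltnn.
have si k : (k < #|T|.+1)%N -> s`_k \in s by move=> h; apply: mem_nth; rewrite ss.
have uv : s`_i != s`_j by rewrite nth_uniq ?ss.
move: e uv (hs _ (si i (ltn_ord i))) (hs _ (si j (ltn_ord j))); rewrite /c.
case: (s`_i) => x y; case: (s`_j) => x' y'; rewrite /nm /= {c}.
set n := x ^+ 2 - _; set n' := x' ^+ 2 - _ => -[e1 /(congr1 val) /= e2 /(congr1 val) /= e3 /(congr1 val) /= e4].
move=> uv [y0 n0 nM] [y0' n0' nM'].
rewrite absz_eq0 in n0; rewrite absz_eq0 in n0'.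
rewrite !inordK ?ltnS ?(ltnW nM) ?(ltnW nM') // in e2.
have en : n' = n.
  clear -e1 e2; move: n n' e1 e2 => n n'; case: (lerP 0 n); case: (lerP 0 n'); lia.
rewrite en in e3 e4.
have f3 := inord_mod n0 nM e3; have f4 := inord_mod n0 nM e4; clear e1 e2 e3 e4.
have /eqP := f3; rewrite eqz_mod_dvd => /dvdzP[a ea].
have /eqP := f4; rewrite eqz_mod_dvd => /dvdzP[b eb].
have ex : x = x' + a * n by rewrite -ea addrC subrK.
have ey : y = y' + b * n by rewrite -eb addrC subrK.
have NC : n%:~R != 0 :> algC by rewrite intr_eq0.
have nE : n%:~R = (x'%:~R - y'%:~R * d) * (x'%:~R + y'%:~R * d) :> algC.
  by rewrite -en normE.
have nE1 : n%:~R = (x%:~R - y%:~R * d) * (x%:~R + y%:~R * d) :> algC.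
  by rewrite normE.
(* The coordinates of [(x + y d) (x' - y' d) / n], integral because [x = x' + a n] and
   [y = y' + b n]. *)
pose A : int := a * x' - D * b * y' + 1; pose B : int := b * x' - a * y'.
pose u : algC := A%:~R + B%:~R * d.
have eu : u * n%:~R = (x%:~R + y%:~R * d) * (x'%:~R - y'%:~R * d).
  transitivity ((x'%:~R - y'%:~R * d) * (x'%:~R + y'%:~R * d) + n%:~R * (a%:~R + b%:~R * d) * (x'%:~R - y'%:~R * d)).
    by rewrite -nE /u /A /B !(rmorphD, rmorphN, rmorphM) /= rmorph1 -dD; ring.
  by rewrite ex ey !(rmorphD, rmorphM) /=; ring.
have gi (t : int) : g t%:~R = t%:~R by rewrite rmorph_int.
have u1 : u * g u = 1.
  apply: (mulfI (mulf_neq0 NC NC)); rewrite mulr1.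
  have -> : n%:~R * n%:~R * (u * g u) = (u * n%:~R) * g (u * n%:~R) by rewrite rmorphM gi; ring.
  by rewrite eu !rmorphM rmorphD rmorphB !rmorphM !gi gd {1}nE nE1; ring.
have Ku : K u by apply: (sfD sK); [apply: (sf_int sK) | apply: (sfM sK) => //; apply: (sf_int sK)].
have uA : u \in Aint.
  by ai; apply: (@Aint_root 2) => //; rewrite dD Aint_int.
have uu : aunit u by apply: (@aunit_norm1 _ (g u)) => //; [ai | rewrite u1 aunit1].
have B0 : B != 0.
  apply/eqP => B0; have A1 : A * A = 1.
    by move: u1; rewrite /u B0 rmorph0 mul0r addr0 gi -intrM => /(@intr_inj algC _ 1).
  have h : u = 1 \/ u = -1.
    rewrite /u B0 rmorph0 mul0r addr0; have : A = 1 \/ A = -1 by clear -A1; move: A A1 => A A1; nia.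
    by case=> ->; [left | right].
  have z : x'%:~R - y'%:~R * d != 0.
    by apply/eqP => z; move/eqP: NC; rewrite nE z mul0r.
  have h1 : x%:~R + y%:~R * d = u * (x'%:~R + y'%:~R * d).
    by apply: (mulfI z); rewrite [LHS]mulrC -eu nE; ring.
  case: h => h; rewrite h ?mul1r ?mulN1r in h1.
    have h2 : (x - x')%:~R = (y' - y)%:~R * d.
      by rewrite !rmorphB /= -[x%:~R](addrK (y%:~R * d)) h1; ring.
    have h3 := irr h2; have yy : y = y' by clear -h3; lia.
    move: h2; rewrite h3 mul0r => /eqP; rewrite intr_eq0 subr_eq0 => /eqP xx.
    by move/eqP: uv; apply; rewrite yy xx.
  have h2 : (x + x')%:~R = (- y' - y)%:~R * d.
    by rewrite rmorphD rmorphB rmorphN /= -[x%:~R](addrK (y%:~R * d)) h1; ring.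
  by have := irr h2; clear -y0 y0'; lia.
have ur : u \is Num.real by apply: KR.
have un1 : u != 1.
  apply/eqP => h; move/eqP: B0; apply; apply: (@irr (1 - A)).
  by apply/eqP; rewrite rmorphB rmorph1 subr_eq addrC; apply/eqP; exact: esym h.
have unN1 : u != -1.
  apply/eqP => h; move/eqP: B0; apply; apply: (@irr (- 1 - A)).
  by apply/eqP; rewrite rmorphB rmorphN1 subr_eq addrC; apply/eqP; exact: esym h.
have u0 : u != 0 by case/and3P: uu.
clearbody u; clear B0 eu u1 uA.
wlog up : u Ku uu ur un1 unN1 u0 / 0 < u.
  move=> H; have [h|h] := real_leP ur (real0 _); last by apply: (H u).
  apply: (H (- u)).
  - exact: (sfN sK).
  - by rewrite -mulN1r aunitM // aunitN1.
  - by rewrite realN.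
  - by rewrite -subr_eq0 -opprD oppr_eq0 addr_eq0.
  - by rewrite eqr_opp.
  - by rewrite oppr_eq0.
  - by rewrite oppr_gt0 lt_neqAle u0.
have [h|h] := real_leP ur (real1 _); last by exists u.
exists u^-1; split; [exact: (sfV sK) | exact: aunitV |].
by rewrite invf_gt1 // lt_neqAle un1.
Qed.
Lemma unit_norm u : K u -> aunit u -> g u = u^-1 \/ g u = - u^-1.
Proof.
move=> Ku uu; have u0 : u != 0 by case/and3P: uu.
have := rat_unit (quad_N Q Ku) (aunitM uu (etrans (aunit_aut g u) uu)).
case=> h; [left | right]; first by apply: (mulfI u0); rewrite h divff.
by apply: (mulfI u0); rewrite h mulrN divff.
Qed.

(** On units this strictly increasing quantity takes natural values ([meas_nat]), so a least unit
    above 1 exists by well-ordering and division by it lowers the measure. *)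
Lemma sq_meas (x y : algC) : 1 <= x -> x <= y -> x ^+ 2 + x ^- 2 <= y ^+ 2 + y ^- 2 ?= iff (x == y).
Proof.
move=> x1 xy; have x0 := lt_le_trans ltr01 x1; have y0 := lt_le_trans x0 xy.
have e : y ^+ 2 + y ^- 2 - (x ^+ 2 + x ^- 2) = (y - x) * ((y + x) * ((x * y) ^+ 2 - 1) / (x * y) ^+ 2).
  by field; rewrite !lt0r_neq0.
have h : 1 <= (x * y) ^+ 2 by rewrite exprn_ege1 // mulr_ege1 // (le_trans x1).
have p : 0 <= (y + x) * ((x * y) ^+ 2 - 1) / (x * y) ^+ 2.
  by rewrite divr_ge0 ?mulr_ge0 ?subr_ge0 ?exprn_ge0 ?addr_ge0 ?mulr_ge0 // ltW.
split; first by rewrite -subr_ge0 e mulr_ge0 ?subr_ge0.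
apply/eqP/eqP => [E|-> //]; move/eqP: e; rewrite E subrr eq_sym mulf_eq0 subr_eq0 => /orP[/eqP-> //|].
rewrite !mulf_eq0 invr_eq0 expf_eq0 /= mulf_eq0 !(gt_eqF x0) !(gt_eqF y0) !orbF => /orP[].
  by rewrite gt_eqF // addr_gt0.
rewrite subr_eq0 => /eqP h1; have : x * y <= 1.
  by rewrite -(@ler_pXn2r _ 2) ?nnegrE ?mulr_ge0 ?ler01 ?(ltW x0) ?(ltW y0) // h1 expr1n.
move=> h2; have y1 : y = 1.
  apply: le_anti; rewrite (le_trans x1 xy) andbT; apply: le_trans h2.
  by rewrite -[X in X <= _]mul1r ler_wpM2r // ltW.
by apply: le_anti; rewrite xy y1 x1.
Qed.

Lemma meas_nat u : K u -> aunit u -> exists n : nat, u ^+ 2 + u ^- 2 = n%:R.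
Proof.
move=> Ku uu; have u0 : u != 0 by case/and3P: uu.
have uA : u \in Aint by case/and3P: uu.
have e : u ^+ 2 + u ^- 2 = u ^+ 2 + g (u ^+ 2).
  by rewrite rmorphXn -exprVn; case: (unit_norm Ku uu) => ->; rewrite ?sqrrN.
have : u ^+ 2 + u ^- 2 \in Num.int.
  by apply: Cint_rat_Aint; [rewrite e; apply: (quad_tr Q); apply: (sfX sK) | rewrite e; ai].
have ur := KR Ku; have : 0 <= u ^+ 2 + u ^- 2.
  by rewrite addr_ge0 // -?exprVn real_exprn_even_ge0 // realV.
by move=> h0 hi; apply/natrP; rewrite natrEint hi.
Qed.

Lemma fund_unit : exists e, [/\ K e, aunit e, 1 < e &
  forall u, K u -> aunit u -> exists n : int, u = e ^ n \/ u = - e ^ n].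
Proof.
have [n [[e [Ke ue e1 en]] emin]] : exists n, (exists e, [/\ K e, aunit e, 1 < e & e ^+ 2 + e ^- 2 = n%:R]) /\
    forall m, (exists e, [/\ K e, aunit e, 1 < e & e ^+ 2 + e ^- 2 = m%:R]) -> (n <= m)%N.
  apply: (nat_min (P := fun n : nat => exists e, [/\ K e, aunit e, 1 < e & e ^+ 2 + e ^- 2 = n%:R])).
  by have [u [Ku uu u1]] := pell_unit; have [n en] := meas_nat Ku uu; exists n, u.
exists e; split=> //.
have e0 : 0 < e by apply: lt_trans e1; rewrite ltr01.
have H u : K u -> aunit u -> 1 <= u -> exists n : nat, u = e ^+ n.
  move=> Ku uu u1; have [m em] := meas_nat Ku uu.
  elim/ltn_ind: m u Ku uu u1 em => m IH u Ku uu u1 em.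
  have [->|un1] := eqVneq u 1; first by exists 0%N.
  have u1' : 1 < u by rewrite lt_neqAle eq_sym un1.
  have eu : e <= u.
    have [//|ue'] := real_leP (KR Ke) (KR Ku).
    have [] := sq_meas u1 (ltW ue'); rewrite em en ler_nat => h /esym.
    have -> : m = n by apply/anti_leq; rewrite h; apply: emin; exists u.
    by rewrite eqxx => /eqP h'; rewrite h' ltxx in ue'.
  have u0 := lt_trans ltr01 u1'.
  have ve : 1 <= u / e by rewrite ler_pdivlMr // mul1r.
  have Kv : K (u / e) by apply: (sfM sK) => //; apply: (sfV sK).
  have uv : aunit (u / e) by apply: aunitM => //; apply: aunitV.
  have [k ek] := meas_nat Kv uv.
  have lt : u / e < u by rewrite ltr_pdivrMr // -[X in X < _]mulr1 ltr_pM2l.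
  have [] := sq_meas ve (ltW lt); rewrite em ek ler_nat (lt_eqF lt) eqr_nat => h1 h2.
  have km : (k < m)%N by rewrite ltn_neqAle h2 h1.
  have [j ej] := IH k km _ Kv uv ve ek.
  by exists j.+1; rewrite exprSr -ej divfK // lt0r_neq0.
have H' u : K u -> aunit u -> 0 < u -> exists n : int, u = e ^ n.
  move=> Ku uu u0; have [h|h] := real_leP (real1 _) (KR Ku).
    by have [j ->] := H u Ku uu h; exists j%:Z.
  have [|j ej] := H u^-1 (sfV sK Ku) (aunitV uu); first by rewrite invf_ge1 // ltW.
  by exists (- j%:Z); rewrite -exprz_inv -[u]invrK ej -exprVn.
move=> u Ku uu; have u0 : u != 0 by case/and3P: uu.
have [h|h] := real_leP (real0 _) (KR Ku).
  by have [|j ->] := H' u Ku uu; [rewrite lt_neqAle eq_sym u0 | exists j; left].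
have [|||j ej] := H' (- u).
- exact: (sfN sK).
- by rewrite -mulN1r aunitM // aunitN1.
- by rewrite oppr_gt0.
by exists j; right; rewrite -ej opprK.
Qed.
End Pell.

(** * Square classes of units of L *)

(** By the adjugate identity only the term of row [i0] survives. Adjoining the square root of a
    product of units thus halves the determinant of exponents. *)
Lemma det_halve n (M M' : 'M[int]_n) (i0 : 'I_n) (c : 'I_n -> int) :
  (forall i j, i != i0 -> M' i j = M i j) ->
  (forall j, 2 * M' i0 j = \sum_i c i * M i j) -> 2 * \det M' = c i0 * \det M.
Proof.
move=> h1 h2; rewrite (expand_det_row M' i0) big_distrr /=.
have -> : \sum_j 2 * (M' i0 j * cofactor M' i0 j) = \sum_j (\sum_i c i * M i j) * \adj M j i0.
  apply: eq_bigr => j _; rewrite mulrA h2 mxE; congr (_ * _).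
  rewrite /cofactor; congr (_ * \det _); apply/matrixP => a b.
  by rewrite !mxE h1 // eq_sym neq_lift.
transitivity (\sum_i c i * (M *m \adj M) i i0).
  under eq_bigr do rewrite mulr_suml; rewrite exchange_big /=.
  by apply: eq_bigr => i _; rewrite mxE mulr_sumr; apply: eq_bigr => j _; rewrite mulrA.
rewrite mul_mx_adj (bigD1 i0) //= big1 ?addr0 => [|i ne]; first by rewrite mxE eqxx mulr1n.
by rewrite mxE (negPf ne) mulr0n mulr0.
Qed.

Definition pw (b : bool) (x : algC) := if b then x^-1 else x.
(** A multiplicative eigenprojection: the result is inverted by the involution [s] if [b] holds and
    fixed by it otherwise. *)
Definition EE (s : rmC) (b : bool) (u : algC) := u * pw b (s u).

Section Units.
Variables (p q : nat) (s2 sq sp si : rmC).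
Hypotheses (ar : arith p q) (st : setup p q s2 sq sp si).
Notation L := (LL p q).
Notation w2 := w2. Notation wq := (wq q). Notation wp := (wp p).
Notation G := (gens p q).
Let rS : rsq G := @rsq_gens p q.
Let g2 := flips_s2 st. Let gq := flips_sq st. Let gp := flips_sp st. Let gi := flips_si st.
Let L2 : L w2 := @LL_w2 p q. Let Lq : L wq := @LL_wq p q. Let Lp : L wp := @LL_wp p q. Let Li : L 'i := @LL_i p q.
Let sL : is_subfield L := @LL_sf p q.

Definition UL u := L u /\ aunit u.

Lemma pwM b x y : pw b (x * y) = pw b x * pw b y. Proof. by case: b => //=; rewrite invfM. Qed.
Lemma pwV b x : pw b x^-1 = (pw b x)^-1. Proof. by case: b. Qed.
Lemma UL_pw b u : UL u -> UL (pw b u).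
Proof. by case=> Lu uu; case: b => //=; split; [apply: (sfV sL) | apply: aunitV]. Qed.
Lemma ULM u v : UL u -> UL v -> UL (u * v).
Proof. by case=> Lu uu [Lv uv]; split; [apply: (sfM sL) | apply: aunitM]. Qed.
Lemma UL_aut g u : flips G g -> UL u -> UL (g u).
Proof. by move=> fg [Lu uu]; split; [apply: (flips_L rS fg Lu) | rewrite aunit_aut]. Qed.
Lemma UL_EE s b u : flips G s -> UL u -> UL (EE s b u).
Proof. by move=> fs Uu; apply: ULM => //; apply: UL_pw; apply: UL_aut. Qed.
Lemma EEM s b u v : EE s b (u * v) = EE s b u * EE s b v.
Proof. by rewrite /EE rmorphM pwM mulrACA. Qed.
Lemma EEV s b u : EE s b u^-1 = (EE s b u)^-1.
Proof. by rewrite /EE fmorphV pwV -invfM. Qed.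
Lemma EE_pw s b c u : EE s b (pw c u) = pw c (EE s b u).
Proof. by case: c => //=; rewrite EEV. Qed.
Lemma EE_com s g b u : flips G s -> flips G g -> L u -> g (EE s b u) = EE s b (g u).
Proof.
move=> fs fg Lu; rewrite /EE rmorphM; congr (_ * _).
by case: b => /=; rewrite ?fmorphV (flips_comm rS fg fs Lu).
Qed.
Lemma EE_self s b u : flips G s -> UL u -> s (EE s b u) = pw b (EE s b u).
Proof.
move=> fs [Lu uu]; rewrite /EE rmorphM; case: b => /=.
  by rewrite fmorphV (flips_inv rS fs Lu) invfM invrK mulrC.
by rewrite (flips_inv rS fs Lu) mulrC.
Qed.

(** Projection to the units on which [s2], [sq], [sp] act by inversion or trivially, as the three
    booleans prescribe, and [si] trivially; for a nonzero pattern they lie in one real quadratic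
    subfield. *)
Definition TU a b c u := EE si false (EE s2 a (EE sq b (EE sp c u))).
Lemma TUM a b c u v : TU a b c (u * v) = TU a b c u * TU a b c v.
Proof. by rewrite /TU !EEM. Qed.
Lemma TUV a b c u : TU a b c u^-1 = (TU a b c u)^-1.
Proof. by rewrite /TU !EEV. Qed.
Lemma TU_UL a b c u : UL u -> UL (TU a b c u).
Proof. by move=> Uu; do !apply: UL_EE => //. Qed.
Lemma TU_s a b c u : UL u -> [/\ s2 (TU a b c u) = pw a (TU a b c u), sq (TU a b c u) = pw b (TU a b c u),
  sp (TU a b c u) = pw c (TU a b c u) & si (TU a b c u) = TU a b c u].
Proof.
move=> Uu; have U1 := UL_EE c gp Uu; have U2 := UL_EE b gq U1; have U3 := UL_EE a g2 U2.
rewrite /TU; split.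
- by rewrite (EE_com _ gi g2 (proj1 U3)) (EE_self _ g2 U2) EE_pw.
- by rewrite (EE_com _ gi gq (proj1 U3)) (EE_com _ g2 gq (proj1 U2)) (EE_self _ gq U1) !EE_pw.
- rewrite (EE_com _ gi gp (proj1 U3)) (EE_com _ g2 gp (proj1 U2)) (EE_com _ gq gp (proj1 U1)).
  by rewrite (EE_self _ gp Uu) !EE_pw.
by rewrite (EE_self false gi U3).
Qed.
Lemma EE_eig (s : rmC) b c u : u != 0 -> s u = pw c u -> EE s b u = if b == c then u ^+ 2 else 1.
Proof. by move=> u0 e; rewrite /EE e; case: b; case: c e => //= e; rewrite ?invrK ?divff ?mulVf //. Qed.
Lemma EE1 s b : EE s b 1 = 1.
Proof. by rewrite /EE rmorph1; case: b => /=; rewrite ?invr1 mulr1. Qed.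
(** Orthogonality of the projections: four successive steps either double the exponent each time,
    giving 16, or kill the unit at the first mismatch. *)
Lemma TU_eig a b c a' b' c' u : u != 0 -> s2 u = pw a' u -> sq u = pw b' u -> sp u = pw c' u -> si u = u ->
  TU a b c u = if [&& a == a', b == b' & c == c'] then u ^+ 16 else 1.
Proof.
move=> u0 e2 eq ep ei; rewrite /TU (EE_eig c u0 ep).
case: (c == c'); last by rewrite !EE1 !andbF.
rewrite ![EE sq b _](EEM sq b u u) (EE_eig b u0 eq).
case: (b == b'); last by rewrite !mulr1 !EE1 !andbF.
rewrite expr2 !(EEM s2) (EE_eig a u0 e2).
case: (a == a'); last by rewrite !mulr1 !EE1.
by rewrite expr2 !(EEM si) (EE_eig false u0 (ei : si u = pw false u)) /=; ring.
Qed.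

(** The fundamental unit may have norm -1 and then fails to be inverted by the conjugation; its
    square always is. *)
Lemma fund_gen (g : rmC) gs d (D : int) a b c : allflips G gs -> quad (fun x => x \in Crat) (fixf L gs) g ->
  fixf L gs d -> g d = - d -> d ^+ 2 = D%:~R -> 0 < d ->
  (forall u, UL u -> s2 u = pw a u -> sq u = pw b u -> sp u = pw c u -> si u = u -> fixf L gs u) ->
  (forall u, L u -> fixf L gs u -> g u = u^-1 ->
     [/\ s2 u = pw a u, sq u = pw b u, sp u = pw c u & si u = u]) ->
  exists e, [/\ UL e, 1 < e,
    [/\ s2 (e ^+ 2) = pw a (e ^+ 2), sq (e ^+ 2) = pw b (e ^+ 2), sp (e ^+ 2) = pw c (e ^+ 2) & si (e ^+ 2) = e ^+ 2] &
    forall u, UL u -> s2 u = pw a u -> sq u = pw b u -> sp u = pw c u -> si u = u ->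
      exists n : int, u = e ^ n \/ u = - e ^ n].
Proof.
move=> ag Q Kd gd dD d0 H1 H2; have [e [Ke ue e1 He]] := fund_unit Q Kd gd dD d0.
have Le : L e := fixf_L Ke; exists e; split=> //.
  have Le2 : L (e ^+ 2) by apply: (sfX sL).
  apply: (H2 _ Le2); first by apply: (sfX (quad_sK Q)).
  by rewrite rmorphXn; case: (unit_norm Q Ke ue) => ->; rewrite ?sqrrN exprVn.
by move=> u Uu h2 hq hp hi; apply: He; [apply: H1 | case: Uu].
Qed.

Lemma cancel_s (g h : rmC) u : flips G g -> flips G h -> L u -> g (h u) = u -> h u = g u.
Proof. by move=> fg fh Lu e; rewrite -[in RHS]e (flips_inv rS fg) //; apply: (flips_L rS fh Lu). Qed.

Let w20 : 0 < w2. Proof. by rewrite sqrtC_gt0 ltr0n. Qed.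
Let wq0 : 0 < wq. Proof. by rewrite sqrtC_gt0 ltr0n prime_gt0 // (ar_q ar). Qed.
Let wp0 : 0 < wp. Proof. by rewrite sqrtC_gt0 ltr0n prime_gt0 // (ar_p ar). Qed.

Ltac ev := rewrite /= ?rmorphM ?rmorphN /= ?rmorphM ?rmorphN ?(s22 st) ?(s2q st) ?(s2p st) ?(s2i st)
   ?(sq2 st) ?(sqq st) ?(sqp st) ?(sqi st) ?(sp2 st) ?(spq st) ?(spp st) ?(spi st)
   ?(si2 st) ?(siq st) ?(sip st) ?(sii st) ?rmorphM ?rmorphN ?(s22 st) ?(s2q st) ?(s2p st) ?(s2i st)
   ?(sq2 st) ?(sqq st) ?(sqp st) ?(sqi st) ?(sp2 st) ?(spq st) ?(spp st) ?(spi st)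
   ?(si2 st) ?(siq st) ?(sip st) ?(sii st) ?mulrNN ?mulNr ?mulrN ?opprK.

Let q2E : w2 ^+ 2 = 2%:~R. Proof. exact: w2K. Qed.
Let qqE : wq ^+ 2 = q%:Z%:~R. Proof. exact: wqK. Qed.
Let qpE : wp ^+ 2 = p%:Z%:~R. Proof. exact: wpK. Qed.

Lemma fund_abc a b c : a || b || c -> exists e, [/\ UL e, 1 < e,
    [/\ s2 (e ^+ 2) = pw a (e ^+ 2), sq (e ^+ 2) = pw b (e ^+ 2), sp (e ^+ 2) = pw c (e ^+ 2) & si (e ^+ 2) = e ^+ 2] &
    forall u, UL u -> s2 u = pw a u -> sq u = pw b u -> sp u = pw c u -> si u = u ->
      exists n : int, u = e ^ n \/ u = - e ^ n].
Proof.
have aF : allflips G [:: si] := conj gi Logic.I.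
have m3 x y : 0 < x -> 0 < y -> 0 < x * y :> algC by apply: mulr_gt0.
pose t h1 h2 : list rmC := [:: h1; h2; si].
have aT h1 h2 : flips G h1 -> flips G h2 -> allflips G (t h1 h2) by move=> f1 f2; do !split.
have f2q : flips G (comprm s2 sq) by apply: flips_comp.
have f2p : flips G (comprm s2 sp) by apply: flips_comp.
have fqp : flips G (comprm sq sp) by apply: flips_comp.
have M2 x (X : int) y (Y : int) : x ^+ 2 = X%:~R :> algC -> y ^+ 2 = Y%:~R -> (x * y) ^+ 2 = (X * Y)%:~R.
  by move=> ex ey; rewrite exprMn ex ey intrM.
case: a; case: b; case: c => // _.
- apply: (@fund_gen s2 (t (comprm s2 sq) (comprm s2 sp)) (w2 * wq * wp) _ _ _ _ (aT _ _ f2q f2p) _ _ _ (M2 _ _ _ _ (M2 _ _ _ _ q2E qqE) qpE)).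
  + apply: (quad_rat ar st g2 (aT _ _ f2q f2p)) => x Lx [[[[_ ei] e2p] e2q] e2].
    by split=> //; [rewrite (cancel_s g2 gq) | rewrite (cancel_s g2 gp)].
  + by split; [split; [split; [apply: (sfM sL) => //; apply: (sfM sL)|]|]|]; ev.
  + by ev.
  + by rewrite !m3.
  + by move=> u [Lu _] /= e2 eq ep ei; do !split=> //=; rewrite ?eq ?ep fmorphV e2 invrK.
  move=> u Lu [[[_ ei] e2p] e2q] e2; split=> //=; [by rewrite (cancel_s g2 gq) | by rewrite (cancel_s g2 gp)].
- apply: (@fund_gen s2 (t (comprm s2 sq) sp) (w2 * wq) _ _ _ _ (aT _ _ f2q gp) _ _ _ (M2 _ _ _ _ q2E qqE)).
  + apply: (quad_rat ar st g2 (aT _ _ f2q gp)) => x Lx [[[[_ ei] ep] e2q] e2].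
    by split=> //; rewrite (cancel_s g2 gq).
  + by split; [split; [split; [apply: (sfM sL)|]|]|]; ev.
  + by ev.
  + by rewrite !m3.
  + by move=> u [Lu _] /= e2 eq ep ei; do !split=> //=; rewrite ?eq ?ep fmorphV e2 invrK.
  by move=> u Lu [[[_ ei] ep] e2q] e2; split=> //=; rewrite (cancel_s g2 gq).
- apply: (@fund_gen s2 (t sq (comprm s2 sp)) (w2 * wp) _ _ _ _ (aT _ _ gq f2p) _ _ _ (M2 _ _ _ _ q2E qpE)).
  + apply: (quad_rat ar st g2 (aT _ _ gq f2p)) => x Lx [[[[_ ei] e2p] eq] e2].
    by split=> //; rewrite (cancel_s g2 gp).
  + by split; [split; [split; [apply: (sfM sL)|]|]|]; ev.
  + by ev.
  + by rewrite !m3.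
  + by move=> u [Lu _] /= e2 eq ep ei; do !split=> //=; rewrite ?eq ?ep fmorphV e2 invrK.
  by move=> u Lu [[[_ ei] e2p] eq] e2; split=> //=; rewrite (cancel_s g2 gp).
- apply: (@fund_gen s2 (t sq sp) w2 _ _ _ _ (aT _ _ gq gp) _ _ _ q2E).
  + by apply: (quad_rat ar st g2 (aT _ _ gq gp)) => x Lx [[[[_ ei] ep] eq] e2].
  + by do !split=> //; ev.
  + by ev.
  + by [].
  + by move=> u [Lu _] /= e2 eq ep ei; do !split=> //=.
  by move=> u Lu [[[_ ei] ep] eq] e2.
- apply: (@fund_gen sq (t s2 (comprm sq sp)) (wq * wp) _ _ _ _ (aT _ _ g2 fqp) _ _ _ (M2 _ _ _ _ qqE qpE)).
  + apply: (quad_rat ar st gq (aT _ _ g2 fqp)) => x Lx [[[[_ ei] e2p] e2] eq].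
    by split=> //; rewrite (cancel_s gq gp).
  + by split; [split; [split; [apply: (sfM sL)|]|]|]; ev.
  + by ev.
  + by rewrite !m3.
  + by move=> u [Lu _] /= e2 eq ep ei; do !split=> //=; rewrite ep fmorphV eq invrK.
  by move=> u Lu [[[_ ei] e2p] e2] eq; split=> //=; rewrite (cancel_s gq gp).
- apply: (@fund_gen sq (t s2 sp) wq _ _ _ _ (aT _ _ g2 gp) _ _ _ qqE).
  + by apply: (quad_rat ar st gq (aT _ _ g2 gp)) => x Lx [[[[_ ei] ep] e2] eq].
  + by do !split=> //; ev.
  + by ev.
  + by [].
  + by move=> u [Lu _] /= e2 eq ep ei; do !split=> //=.
  by move=> u Lu [[[_ ei] ep] e2] eq.
apply: (@fund_gen sp (t s2 sq) wp _ _ _ _ (aT _ _ g2 gq) _ _ _ qpE).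
+ by apply: (quad_rat ar st gp (aT _ _ g2 gq)) => x Lx [[[[_ ei] eq] e2] ep].
+ by do !split=> //; ev.
+ by ev.
+ by [].
+ by move=> u [Lu _] /= e2 eq ep ei; do !split=> //=.
by move=> u Lu [[[_ ei] eq] e2] ep.
Qed.

(** The three binary digits of [j + 1], which runs over the seven nonzero patterns for [s2], [sq],
    [sp]. *)
Definition b1 (j : 'I_7) := odd j.+1.
Definition b2 (j : 'I_7) := odd (j.+1)./2.
Definition b3 (j : 'I_7) := odd ((j.+1)./2)./2.
Lemma bits_nz j : b1 j || b2 j || b3 j.
Proof. by case: j => [] [|[|[|[|[|[|[|]]]]]]]. Qed.
Lemma bits_inj i j : [&& b1 i == b1 j, b2 i == b2 j & b3 i == b3 j] = (i == j).
Proof.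
by case: i => [] [|[|[|[|[|[|[|]]]]]]] // ?; case: j => [] [|[|[|[|[|[|[|]]]]]]].
Qed.

Definition Tj j u := TU (b1 j) (b2 j) (b3 j) u.
(** [n] is the exponent, up to sign of the value, of the [j]-th projection of [u] in the fundamental
    unit [e j]: an integral substitute for a logarithm. *)
Definition Rj (e : 'I_7 -> algC) j u (n : int) := Tj j u = e j ^ n \/ Tj j u = - e j ^ n.

(** Taking a family of least nonzero determinant replaces the choice of a basis of the unit group
    modulo torsion. *)
Lemma units_basis : exists (e u : 'I_7 -> algC) (M : 'M[int]_7),
  [/\ forall j, UL (e j) /\ 1 < e j, forall u j, UL u -> exists n, Rj e j u n,
   forall i, UL (u i), forall i j, Rj e j (u i) (M i j) &
   \det M != 0 /\ forall u' (M' : 'M[int]_7), (forall i, UL (u' i)) -> (forall i j, Rj e j (u' i) (M' i j)) ->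
     \det M' != 0 -> (`|\det M| <= `|\det M'|)%N].
Proof.
have [e He] := fin_all_exists (fun j => fund_abc (bits_nz j)).
have Ue j : UL (e j) by have [] := He j.
have e1 j : 1 < e j by have [] := He j.
have e0 j : e j != 0 by rewrite gt_eqF // (lt_trans ltr01).
pose P n := exists (u : 'I_7 -> algC) (M : 'M[int]_7), [/\ forall i, UL (u i), forall i j, Rj e j (u i) (M i j),
   \det M != 0 & n = `|\det M|%N].
have [n [[u [M [Uu RM dM en]]] nmin]] : exists n, P n /\ forall m, P m -> (n <= m)%N.
  (* Squares of the fundamental units have a nonzero determinant: their own projection is
     [(e i ^+ 2) ^+ 16], whence 32, and the other projections are 1. *)
  apply: nat_min; eexists; exists (fun i => e i ^+ 2), (32%:M); split=> //.
  - by move=> i; rewrite expr2; apply: ULM.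
  - move=> i j; left; rewrite mxE; have [_ _ [h2 hq hp hi] _] := He i.
    rewrite /Tj (TU_eig _ _ _ _ h2 hq hp hi) ?expf_neq0 // bits_inj eq_sym.
    by case: (eqVneq i j) => [->|_]; rewrite ?mulr0n ?expr0z // mulr1n -exprM.
  by rewrite det_scalar expf_neq0.
exists e, u, M; split=> //.
- move=> v j Uv; have [_ _ _ H] := He j; have [h2 hq hp hi] := TU_s (b1 j) (b2 j) (b3 j) Uv.
  by apply: H h2 hq hp hi; apply: TU_UL.
by split=> // u' M' Uu' RM' dM'; rewrite -en; apply: nmin; exists u', M'.
Qed.

Section Family.
Variables (e u : 'I_7 -> algC).
Hypothesis He : forall j, UL (e j) /\ 1 < e j.
Let ep j : 0 < e j. Proof. by apply: lt_trans (proj2 (He j)); rewrite ltr01. Qed.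
Let e0 j : e j != 0. Proof. by rewrite gt_eqF. Qed.

Lemma RjM j x y m n : Rj e j x m -> Rj e j y n -> Rj e j (x * y) (m + n).
Proof.
rewrite /Rj /Tj TUM expfzDr // => -[-> | ->] [->|->]; rewrite ?mulNr ?mulrN ?opprK; auto.
Qed.
Lemma Rj1 j : Rj e j 1 0.
Proof. by left; rewrite /Tj /TU !EE1. Qed.
Lemma Rj_uniq j x m n : Rj e j x m -> Rj e j x n -> m = n.
Proof.
have H a b : e j ^ a = e j ^ b -> a = b.
  move=> h; have h1 : e j ^ (a - b) = 1 by rewrite expfzDr // h -expfzDr // subrr expr0z.
  have h2 k : (0 < k)%N -> e j ^+ k = 1 -> False.
    move=> k0 h2; have [_ h3] := He j; have : 1 < e j ^+ k by rewrite (expr_gt1 k0 (ltW (ep j))).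
    by rewrite h2 ltxx.
  move: h1; case E : (a - b) => [k|k] h1; last by case: (h2 k.+1) => //; rewrite -[LHS]invrK [X in X^-1](h1) invr1.
  by case: k E h1 => [|k] E h1; [lia | case: (h2 k.+1)].
have H' a b : e j ^ a = - e j ^ b -> False.
  move=> h; have := exprz_gt0 a (ep j); rewrite h oppr_gt0 => h'.
  by have := lt_trans h' (exprz_gt0 b (ep j)); rewrite ltxx.
case=> h1 [] h2; rewrite h1 in h2.
- exact: H.
- by case: (H' _ _ h2).
- by case: (H' _ _ (esym h2)).
by apply: H; move/oppr_inj: h2.
Qed.
Lemma Rj_pow j x m n : Rj e j x m -> Rj e j (x ^+ n) (m * n%:Z).
Proof.
move=> h; elim: n => [|n IH]; first by rewrite mulr0; apply: Rj1.
by rewrite exprS -[n.+1%:Z]/(1 + n%:Z) mulrDr mulr1; apply: RjM.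
Qed.
Lemma Rj_tors j x n : UL x -> (forall u j, UL u -> exists n, Rj e j u n) -> (0 < n)%N -> x ^+ n = 1 -> Rj e j x 0.
Proof.
move=> Ux H n0 xn; have [m Hm] := H x j Ux.
have := Rj_pow n Hm; rewrite xn => /(Rj_uniq (Rj1 j)) /esym/eqP; rewrite mulf_eq0 => /orP[/eqP<- //|].
by case: n n0 {xn}.
Qed.
Lemma Rj_prod j (x : 'I_7 -> algC) (m : 'I_7 -> int) : (forall i, Rj e j (x i) (m i)) ->
  Rj e j (\prod_i x i) (\sum_i m i).
Proof.
move=> H; elim/big_rec2: _ => [|i n y _ IH]; first exact: Rj1.
exact: RjM.
Qed.
End Family.

(** A primitive eighth root of unity. *)
Definition z8 : algC := (1 + 'i) / w2.
Lemma z8K : z8 ^+ 2 = 'i.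
Proof.
have w0 := w2_neq0; rewrite expr_div_n w2K sqrrD sqrCi expr1n mul1r addrAC subrr add0r.
by rewrite -mulr_natr mulfK // pnatr_eq0.
Qed.
Lemma z8_16 : z8 ^+ 16 = 1.
Proof. by rewrite (exprM z8 2 8) z8K (exprM 'i 2 4) sqrCi; ring. Qed.
Lemma UL_z8 : UL z8.
Proof.
split; first by apply: (sfM sL); [apply: (sfD sL) => //; apply: (sf1 sL) | apply: (sfV sL)].
by apply: (@aunit_root 16) => //; rewrite z8_16 aunit1.
Qed.
Lemma s2_z8 : s2 z8 = - z8.
Proof. by rewrite rmorphM fmorphV rmorphD rmorph1 (s2i st) (s22 st) invrN mulrN. Qed.

(** On a square root of [z8] the automorphism [s2] would multiply by plus or minus ['i], which it
    fixes, and so would have order 4 instead of 2. *)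
Lemma no_z16 t : L t -> t ^+ 2 = z8 -> False.
Proof.
move=> Lt e; have t0 : t != 0.
  by apply/eqP => t0; have := z8_16; rewrite -e t0 !expr0n /= => /eqP; rewrite eq_sym oner_eq0.
have h : s2 t = 'i * t \/ s2 t = - ('i * t).
  have : (s2 t) ^+ 2 == ('i * t) ^+ 2 by rewrite -rmorphXn e s2_z8 exprMn sqrCi e mulN1r.
  by rewrite eqf_sqr => /orP[] /eqP; [left | right].
have h2 : s2 (s2 t) = - t.
  by case: h => h; rewrite h ?rmorphN rmorphM (s2i st) h ?mulrN ?opprK mulrA -expr2 sqrCi mulN1r.
by move: h2; rewrite (flips_inv rS g2 Lt) => /eqP; rewrite -subr_eq0 opprK -mulr2n mulrn_eq0 (negPf t0).
Qed.

(** If two products with different exponents had a square as quotient, its root [t] could replace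
    one unit of the family and halve the determinant, against minimality. Seven units and the root
    of unity [z8] give 2^8 classes. *)
Lemma units_many : exists f : {ffun 'I_7 -> bool} * bool -> algC,
  (forall x, UL (f x)) /\ forall x y, sqe L (f x) (f y) -> x = y.
Proof.
have [e [u [M [He Hex Uu RM [dM Hmin]]]]] := units_basis.
pose f (x : {ffun 'I_7 -> bool} * bool) := z8 ^+ x.2 * \prod_i u i ^+ x.1 i.
have Upow v (b : bool) : UL v -> UL (v ^+ b).
  by case: b => //= _; split; [apply: (sf1 sL) | apply: aunit1].
have UP m : UL (\prod_i u i ^+ (m : {ffun 'I_7 -> bool}) i).
  by elim/big_rec: _ => [|i y _ Uy]; [split; [apply: (sf1 sL) | apply: aunit1] | apply: ULM => //; apply: Upow].
have Uf x : UL (f x) by apply: ULM => //; apply: Upow; apply: UL_z8.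
exists f; split=> // -[m b] [m' b'] [t [Lt t0 et]].
have Ut : UL t.
  split=> //; apply: (@aunit_root 2) => //.
  have [Lf uf] := Uf (m', b'); have f0 : f (m', b') != 0 by case/and3P: uf.
  have -> : t ^+ 2 = f (m, b) / f (m', b') by rewrite et mulrC mulKf.
  by apply: aunitM; [case: (Uf (m, b)) | apply: aunitV].
have Rz j (c : bool) : Rj e j (z8 ^+ c) 0.
  apply: (@Rj_tors e He _ _ 16) => //; first by apply: Upow; apply: UL_z8.
  by rewrite -exprM mulnC exprM z8_16 expr1n.
have Rf j x : Rj e j (f x) (\sum_i M i j * (x.1 i : nat)%:Z).
  rewrite -[\sum_i _]add0r; apply: RjM => //; apply: Rj_prod => // i; exact: Rj_pow.
have [N HN] := fin_all_exists (fun j => Hex t j Ut).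
have E j : 2 * N j = \sum_i ((m i : nat)%:Z - (m' i : nat)%:Z) * M i j.
  have h := Rj_uniq He (Rf j (m, b)); rewrite et in h.
  have := h _ (RjM He (Rf j (m', b')) (RjM He (HN j) (HN j))) => /= e1.
  have -> : 2 * N j = (\sum_i M i j * (m i : nat)%:Z) - \sum_i M i j * (m' i : nat)%:Z by rewrite e1; ring.
  by rewrite -sumrB; apply: eq_bigr => i _; ring.
have mm : m = m'.
  apply/ffunP => i0; apply/eqP/negPn/negP => ne.
  pose M' : 'M[int]_7 := \matrix_(i, j) if i == i0 then N j else M i j.
  have h : 2 * \det M' = ((m i0 : nat)%:Z - (m' i0 : nat)%:Z) * \det M.
    apply: (det_halve (c := fun i => (m i : nat)%:Z - (m' i : nat)%:Z)) => [i j ni|j].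
      by rewrite mxE (negPf ni).
    by rewrite mxE eqxx.
  have c1 : `|(m i0 : nat)%:Z - (m' i0 : nat)%:Z|%R = 1 by move: ne; case: (m i0); case: (m' i0).
  have n2 : `|\det M| = 2 * `|\det M'| :> int.
    have e3 : `|2 * \det M'| = `|\det M| :> int by rewrite h normrM c1 mul1r.
    by rewrite -e3 normrM.
  have dM' : \det M' != 0.
    by rewrite -normr_eq0; apply/eqP => z; move: n2; rewrite z mulr0 => /eqP; rewrite normr_eq0 (negPf dM).
  have := Hmin (fun i => if i == i0 then t else u i) M' _ _ dM'.
  suff : (`|\det M'| < `|\det M|)%N.
    rewrite ltnNge => /negP k H; apply: k; apply: H => i; first by case: eqP.
    by move=> j; rewrite mxE; case: eqP.
  have : (0 < `|\det M'|)%N by rewrite absz_gt0.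
  by move: n2; rewrite -!abszE; lia.
rewrite -mm; congr (_, _); rewrite -mm /f /= in et.
have P0 : \prod_i u i ^+ m i != 0 by case/and3P: (proj2 (UP m)).
have et' : z8 ^+ b = z8 ^+ b' * t ^+ 2 by apply: (mulIf P0); rewrite et; ring.
case: b b' et' {et} => [] [] //; rewrite expr1 expr0 ?mul1r => h; exfalso.
  by apply: (no_z16 Lt).
apply: (no_z16 (t := t^-1)); first exact: (sfV sL).
by apply: (mulfI (expf_neq0 2 t0)); rewrite -exprMn divff // expr1n mulrC -h.
Qed.
End Units.

Ltac ai ::= repeat first
  [ assumption | apply: rpredM | apply: rpredB | apply: rpredD | apply: rpredN
  | apply: rpredX | apply: Aintg | apply: Aint1 | apply: Aint_int ].

(** * Comaximality and prime ideals in terms of ideal numbers *)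

(** Comaximality in the ring of all algebraic integers: the coefficients [u] and [v] range over that
    whole ring, not only over a given field. *)
Definition cop (x t : algC) := exists u v, [/\ u \in Aint, v \in Aint & x * u + t * v = 1].

Lemma copM x y t : cop x t -> cop y t -> x \in Aint -> y \in Aint -> t \in Aint -> cop (x * y) t.
Proof.
case=> u [v [uA vA e]] [u' [v' [uA' vA' e']]] xA yA tA.
exists (u * u'), (v * (y * u') + v'); split; try by ai.
transitivity ((x * u + t * v) * (y * u') + t * v'); first by ring.
by rewrite e mul1r.
Qed.
Lemma cop_l x y t : cop (x * y) t -> y \in Aint -> cop x t.
Proof. by case=> u [v [uA vA e]] yA; exists (y * u), v; split; [ai | ai | rewrite mulrA]. Qed.
Lemma cop_r x t s : cop x (t * s) -> s \in Aint -> cop x t.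
Proof. by case=> u [v [uA vA e]] yA; exists u, (s * v); split; [ai | ai | rewrite [t * (s * v)]mulrA]. Qed.
Lemma cop_sym x y : cop x y -> cop y x.
Proof. by case=> u [v [uA vA e]]; exists v, u; rewrite addrC. Qed.
Lemma cop_dvd x y t : t != 0 -> cop x t -> y \in Aint -> (x * y) / t \in Aint -> y / t \in Aint.
Proof.
move=> t0 [u [v [uA vA e]]] yA h.
have -> : y / t = (x * y) / t * u + y * v.
  by transitivity (y * (x * u + t * v) / t); [rewrite e mulr1 | field].
by ai.
Qed.
Lemma cop_cong x y t : t != 0 -> cop x t -> (x - y) / t \in Aint -> cop y t.
Proof.
move=> t0 [u [v [uA vA e]]] h; exists u, ((x - y) / t * u + v); split; try by ai.
rewrite mulrDr mulrA [t * _]mulrC divfK // -e; ring.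
Qed.
Lemma cop_unit x t : aunit x -> cop x t.
Proof. by case/and3P=> x0 xA xV; exists x^-1, 0; split=> //; rewrite ?Aint0 // divff // mulr0 addr0. Qed.
Lemma cop_not x t : cop x t -> x / t \in Aint -> t != 0 -> t^-1 \in Aint.
Proof.
move=> [u [v [uA vA e]]] h t0; have -> : t^-1 = x / t * u + v.
  by apply: (mulfI t0); rewrite divff // mulrDr mulrA [t * _]mulrC divfK.
by ai.
Qed.
Lemma cop_int (p : nat) (m : int) t : prime p -> ~~ (p%:Z %| m)%Z -> t != 0 -> p%:R / t \in Aint -> cop m%:~R t.
Proof.
move=> pp pm t0 pt; have : coprimez p%:Z m by rewrite coprimezE absz_nat prime_coprime // -[p]absz_nat -dvdzE.
case/coprimezP => -[u v] /= e; exists v%:~R, (u%:~R * (p%:R / t)); split; try by ai.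
rewrite mulrCA [t * _]mulrC divfK // -[p%:R]/((p%:Z)%:~R) -!intrM -intrD addrC mulrC [(m * v)%R]mulrC -[RHS]/(1%:~R).
by rewrite -e; congr (_%:~R); ring.
Qed.
Lemma cop_aut (g : rmC) x t : cop x t -> cop (g x) (g t).
Proof. by case=> u [v [uA vA e]]; exists (g u), (g v); rewrite -!rmorphM -rmorphD e rmorph1; split=> //; apply: Aintg. Qed.
Lemma cop_assoc x t s : assoc t s -> cop x t -> cop x s.
Proof.
case/assocE=> t0 s0 h1 h2 [u [v [uA vA e]]]; exists u, (t / s * v); split=> //; first by ai.
by rewrite mulrA [s * _]mulrC divfK.
Qed.
Lemma int_dvd (p : nat) (m : int) t : prime p -> t != 0 -> p%:R / t \in Aint -> t^-1 \notin Aint ->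
  m%:~R / t \in Aint -> (p%:Z %| m)%Z.
Proof.
move=> pp t0 pt nu h; apply/negPn/negP => pm; move/negP: nu; apply.
exact: cop_not (cop_int pp pm t0 pt) h t0.
Qed.

(** Maximality of the ideal of [t] in the integers of [K], stated as a dichotomy so that no residue
    field has to be formed. *)
Definition primeE (K : cset) t := [/\ DD K t, t \in Aint, t^-1 \notin Aint &
  forall x, K x -> x \in Aint -> x / t \in Aint \/ cop x t].

Lemma primeE_dvdM K t x y : is_subfield K -> primeE K t -> K x -> K y -> x \in Aint -> y \in Aint ->
  x * y / t \in Aint -> x / t \in Aint \/ y / t \in Aint.
Proof.
move=> sK [dt tA tn H] Kx Ky xA yA h; case: (H x Kx xA) => [|c]; first by left.
by right; apply: cop_dvd h => //; apply: DD_nz dt.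
Qed.

(** One step of unique factorisation: either some element of the ideal of [c] is comaximal to [t],
    and [t] can be cancelled, or all of them are divisible by [t], and so is [c]. *)
Lemma primeE_step K t M c : primeE K t -> DD K c -> c \in Aint -> M \in Aint -> t * M / c \in Aint ->
  M / c \in Aint \/ c / t \in Aint /\ M / (c / t) \in Aint.
Proof.
move=> [dt tA tn H] dc cA MA h; have t0 := DD_nz dt; have c0 := DD_nz dc.
have [_ [s [sKs sa s1]]] := dc.
have uA u : u \in s -> u.1 \in Aint.
  by move=> us; have [A1 _] := sa u us; rewrite -[u.1](divfK c0); ai.
case: (classic (exists2 u, u \in s & cop u.1 t)) => [[u us cu]|N].
  left; have [A1 A2] := sa u us; apply: (cop_dvd (x := t)) => //; apply: cop_sym.
  by apply: (@cop_l _ (u.1 / c)) => //; rewrite mulrC divfK.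
right; split; last by rewrite invf_div mulrA [M * t]mulrC.
have -> : c / t = \sum_(u <- s) (u.1 / t) * (u.2 * c).
  transitivity ((\sum_(u <- s) u.1 * u.2) * (c / t)); first by rewrite s1 mul1r.
  by rewrite mulr_suml; apply: eq_bigr => u _; field.
rewrite big_seq rpred_sum // => u us; have [K1 K2] := sKs u us; have [A1 A2] := sa u us.
apply: rpredM => //; case: (H u.1 K1 (uA u us)) => // cu; by case: N; exists u.
Qed.

(** The products [u.1 * u.2] sum to 1, so one of them is comaximal to [t]; then [u.1 ^+ 2 / a], in
    the square class of [a], is an integer prime to [t]. *)
Lemma move K t a : is_subfield K -> primeE K t -> SS K a ->
  exists a', [/\ K a', a' \in Aint, sqe K a a' & cop a' t].
Proof.
move=> sK [dt tA tn H] [Ka a0 [b db ba]]; have t0 := DD_nz dt; have b0 := DD_nz db.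
have [_ [s [sKs sa s1]]] := db.
have [u us cu] : exists2 u, u \in s & cop (u.1 * u.2) t.
  apply: NNPP => N; move/negP: tn; apply.
  have -> : t^-1 = \sum_(u <- s) u.1 * u.2 / t by rewrite -mulr_suml s1 mul1r.
  rewrite big_seq rpred_sum // => u us; have [K1 K2] := sKs u us; have [A1 A2] := sa u us.
  have A12 : u.1 * u.2 \in Aint.
    have -> : u.1 * u.2 = (u.1 / b) * (u.2 * b) by field.
    by ai.
  by case: (H (u.1 * u.2)) => //; [apply: (sfM sK) | move=> c; case: N; exists u].
have [K1 K2] := sKs u us; have [A1 A2] := sa u us.
have u0 : u.1 != 0.
  apply/eqP => z; case: cu => x [y [xA yA]]; rewrite z !mul0r add0r => e; move/negP: tn; apply.
  by have -> : t^-1 = y by apply: (mulfI t0); rewrite divff.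
have cb : cop (u.1 / b) t.
  by apply: (@cop_l _ (u.2 * b)) => //; have -> : u.1 / b * (u.2 * b) = u.1 * u.2 by field.
have as1 : assoc ((u.1 / b) ^+ 2) (u.1 ^+ 2 / a).
  by rewrite expr_div_n; apply: assocM; [apply: assoc_refl; rewrite expf_neq0 | apply: assocV].
exists (u.1 ^+ 2 / a); split.
- by sf.
- by rewrite -[_ / a]divr1 -(assoc_dvd2 _ as1) divr1; ai.
- exists (a / u.1); split; [by sf | by rewrite mulf_neq0 // invr_eq0 | by field; rewrite a0 u0].
have /assocE[n1 n2 h1 h2] := as1.
have c2 : cop ((u.1 / b) ^+ 2) t by rewrite expr2; apply: copM.
apply: (@cop_l _ ((u.1 / b) ^+ 2 / (u.1 ^+ 2 / a))) => //.
by rewrite mulrC divfK.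
Qed.

(** Cramer's rule for [x] and [s x] with respect to [1] and [w]; the discriminant is the
    denominator. *)
Lemma quad_basis k K (s : rmC) w x : quad k K s -> K w -> w \in Aint -> w != s w -> K x -> x \in Aint ->
  exists a b, [/\ k a, a \in Aint, k b, b \in Aint & (w - s w) ^+ 2 * x = a + b * w].
Proof.
move=> q Kw wA wsw Kx xA; have sK := quad_sK q.
have Kd : K (w - s w) by apply: (sfB sK) => //; apply: (quad_K q).
have Ksx := quad_K q Kx; have Ksw := quad_K q Kw.
have sxA : s x \in Aint by apply: Aintg.
have swA : s w \in Aint by apply: Aintg.
exists ((w - s w) * (s x * w - x * s w)), ((x - s x) * (w - s w)); split.
- apply: (quad_in q); first by apply: (sfM sK) => //; apply: (sfB sK); apply: (sfM sK).
  by rewrite rmorphM !rmorphB !rmorphM !(quad_inv q) //; ring.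
- by ai.
- apply: (quad_in q); first by apply: (sfM sK) => //; apply: (sfB sK).
  by rewrite rmorphM !rmorphB !(quad_inv q) //; ring.
- by ai.
by ring.
Qed.

(* Ramified step: [t ^+ 2] prime below, [E = (x - s x)^2] is divisible by [t ^+ 2]. *)
Lemma prime_ram k K (s : rmC) t : quad k K s -> primeE k (t ^+ 2) -> DD K t ->
  (forall x, K x -> x \in Aint -> (x - s x) ^+ 2 / t ^+ 2 \in Aint) -> primeE K t.
Proof.
move=> q [dt tA tn H] dK HE; have sK := quad_sK q; have t0 := DD_nz dK.
have tA1 : t \in Aint by apply: (@Aint_root 2).
split=> //; first by apply/negP => h; move/negP: tn; apply; rewrite -exprVn; ai.
move=> x Kx xA; have sA : s x \in Aint by ai.
have NA : x * s x \in Aint by ai.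
case: (H (x * s x) (quad_N q Kx) NA) => [h|c]; last first.
  by right; apply: (@cop_l _ (s x)) => //; apply: (@cop_r _ _ t) => //; rewrite -expr2.
left; have h1 : (x + s x) / t \in Aint.
  apply: (@Aint_root 2) => //.
  have -> : ((x + s x) / t) ^+ 2 = (x - s x) ^+ 2 / t ^+ 2 + 4%:R * (x * s x / t ^+ 2) by field.
  by apply: rpredD; [exact: HE | apply: rpredM => //; rewrite -[4%:R]/(4%:~R) Aint_int].
apply: (@Aint_quad ((x + s x) / t) (- (x * s x / t ^+ 2))) => //; first by rewrite rpredN.
by field.
Qed.

Lemma nat_inv_nA (p : nat) : prime p -> p%:R^-1 \notin Aint.
Proof.
move=> pp; have p0 : p%:R != 0 :> algC by rewrite pnatr_eq0 -lt0n prime_gt0.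
apply/negP => h; have /intrP[m em] : (p%:R^-1 : algC) \in Num.int by apply: Cint_rat_Aint => //; rewrite rpredV rpred_nat.
have : m * p%:Z = 1 by apply: (@intr_inj algC); rewrite intrM -em mulVf.
move=> e; have : (p%:Z %| 1)%Z by apply/dvdzP; exists m; rewrite e.
by rewrite dvdzE dvdn1 absz_nat => /eqP e'; move: (pp); rewrite e'.
Qed.

Section Split.
Variables (k : cset) (tau : rmC) (p : nat) (b X : algC) (x0 j : int).
Hypotheses (sk : is_subfield k) (bk : Bez k) (pp : prime p) (kX : k X) (X2 : X ^+ 2 = x0%:~R).
Hypotheses (tX : tau X = - X) (X0 : X != 0).
Hypotheses (pj : (p%:Z %| j ^+ 2 - x0)%Z) (pnj : ~~ (p%:Z %| 2 * j)%Z).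
Hypotheses (db : DD k b) (bA : b \in Aint) (pb : p%:R / b \in Aint) (tb : assoc (tau b) b).
Let n0 := DD_nz db.
Let p0 : p%:R != 0 :> algC. Proof. by rewrite pnatr_eq0 -lt0n prime_gt0. Qed.
Let XA : X \in Aint. Proof. by apply: (@Aint_root 2) => //; rewrite X2 Aint_int. Qed.

Lemma X_neq_int (i : int) : X != i%:~R.
Proof.
apply/eqP => e; move: (tX); rewrite e rmorph_int -e => /eqP.
by rewrite -subr_eq0 opprK -mulr2n mulrn_eq0 (negPf X0).
Qed.

(** Kummer's factorisation: [p] divides [(X - j) (X + j) = x0 - j ^+ 2], and the factors differ by
    [2 * j], which is prime to [p]; so the gcds of [b] with them are coprime with product [b]. A
    divisor [b] of [p] is allowed in order that a factor can be split again in a larger field. *)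
Lemma split_prime : exists t t', [/\ DD k t, DD k t', t \in Aint /\ t' \in Aint, assoc b (t * t') &
  [/\ cop t t', (X - j%:~R) / t \in Aint, (X + j%:~R) / t' \in Aint, assoc (tau t) t' &
  forall e, e != 0 -> b / e \in Aint -> (X - j%:~R) / e \in Aint -> t / e \in Aint]].
Proof.
have m0 : X - j%:~R != 0 by rewrite subr_eq0 X_neq_int.
have l0 : X + j%:~R != 0 by rewrite -[j]opprK rmorphN /= subr_eq0 X_neq_int.
have dm : DD k (X - j%:~R) by apply: DD_elt => //; apply: (sfB sk) => //; apply: (sf_int sk).
have dl : DD k (X + j%:~R) by apply: DD_elt => //; apply: (sfD sk) => //; apply: (sf_int sk).
have mA : X - j%:~R \in Aint by ai.
have lA : X + j%:~R \in Aint by ai.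
have [t [dt pt mt ut]] := DD_gcd bk db dm; have [t' [dt' pt' lt' ut']] := DD_gcd bk db dl.
have [t0 t0'] := (DD_nz dt, DD_nz dt').
have tA : t \in Aint by rewrite -[t]divr1; apply: ut; rewrite ?oner_neq0 ?divr1.
have tA' : t' \in Aint by rewrite -[t']divr1; apply: ut'; rewrite ?oner_neq0 ?divr1.
have e2j : (X + j%:~R) - (X - j%:~R) = (2 * j)%:~R by rewrite intrM; ring.
have ct : cop t t'.
  have pp1 : p%:R / p%:R \in Aint by rewrite divff // Aint1.
  have [u [v [uA vA e]]] := cop_int pp pnj p0 pp1.
  have pt1 : p%:R / t \in Aint.
    by have -> : p%:R / t = p%:R / b * (b / t); [field; rewrite t0 | apply: rpredM].
  exists (p%:R / t * v - (X - j%:~R) / t * u), ((X + j%:~R) / t' * u); split; try by ai.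
  apply: (etrans _ e); rewrite -e2j; field; rewrite t0 t0' //.
have lm : (X - j%:~R) * (X + j%:~R) / b \in Aint.
  have -> : (X - j%:~R) * (X + j%:~R) = (x0 - j ^+ 2)%:~R.
    by rewrite rmorphB /= -X2 expr2 intrM; ring.
  case/dvdzP: pj => z ez; have -> : x0 - j ^+ 2 = - z * p%:Z by rewrite mulNr -ez opprB.
  by rewrite intrM -mulrA; apply: rpredM => //; apply: Aint_int.
have d1 : b / (t * t') \in Aint.
  have h : t' * (b / t') / t \in Aint by rewrite [t' * _]mulrC divfK.
  by rewrite invfM [t^-1 * _]mulrC mulrA; apply: (cop_dvd t0 (cop_sym ct)).
have d2 : t * t' / b \in Aint.
  have e1 : b / t' != 0 by rewrite mulf_neq0 ?invr_eq0.
  have := ut _ e1; rewrite !invf_div !mulrA; apply; first by rewrite mulrAC divff // mul1r.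
  have e2 : b / (X - j%:~R) != 0 by rewrite mulf_neq0 ?invr_eq0.
  have := ut' _ e2; rewrite !invf_div !mulrA [t' * _]mulrC; apply; first by rewrite mulrAC divff // mul1r.
  by rewrite [(X + _) * _]mulrC.
exists t, t'; split=> //; first by apply: assocI; rewrite ?mulf_neq0.
split=> //; have tt0 : tau t != 0 by rewrite fmorph_eq0.
have el : tau (X - j%:~R) = - (X + j%:~R) by rewrite rmorphB tX rmorph_int; ring.
have em : tau (X + j%:~R) = - (X - j%:~R) by rewrite rmorphD tX rmorph_int; ring.
have tp e : b / e \in Aint -> b / tau e \in Aint.
  by move=> h; rewrite -(assoc_dvd2 _ tb) -fmorphV -rmorphM; apply: Aintg.
have h1 : t' / tau t \in Aint.
  apply: ut' => //; first exact: tp.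
  have -> : (X + j%:~R) / tau t = - tau ((X - j%:~R) / t) by rewrite rmorphM fmorphV el; ring.
  by rewrite rpredN; apply: Aintg.
have tt0' : tau t' != 0 by rewrite fmorph_eq0.
have h2 : t / tau t' \in Aint.
  apply: ut => //; first exact: tp.
  have -> : (X - j%:~R) / tau t' = - tau ((X + j%:~R) / t') by rewrite rmorphM fmorphV em; ring.
  by rewrite rpredN; apply: Aintg.
apply: assoc_sym; apply: (aunit_norm1 h1 h2).
have as1 : assoc b (t * t') by apply: assocI; rewrite ?mulf_neq0.
have as2 : assoc (tau (t * t')) b by apply: assoc_trans tb; rewrite assoc_aut; apply: assoc_sym.
have := assoc_trans as2 as1 => /assoc_sym; rewrite /assoc rmorphM invfM [t * t']mulrC mulrACA.
by [].
Qed.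
End Split.

(** * Selmer elements of the quadratic subfields *)

Section Lists.
Variables (K : cset) (g : rmC) (d : algC) (D : int).
Hypotheses (Q : quad (fun x => x \in Crat) K g) (Kd : K d) (gd : g d = - d) (dD : d ^+ 2 = D%:~R).
Hypothesis d0 : d != 0.
Let sK := quad_sK Q.

Lemma sqe_e (a : algC) (e c z : int) : z != 0 -> e = c * z ^+ 2 -> sqe K a e%:~R -> sqe K a c%:~R.
Proof.
move=> z0 -> h; apply: (sqe_trans sK h); exists z%:~R; split; [exact: (sf_int sK) | by rewrite intr_eq0 |].
by rewrite expr2 !intrM expr2.
Qed.
Lemma Slist8 a n : (4 * D %| 8)%Z -> SS K a -> n \in Crat -> a * g a = n ^+ 2 ->
  exists al be : bool, sqe K a ((-1) ^+ al * 2 ^+ be).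
Proof.
move=> dv Sa nq an; have [e [de e0 h]] := SS_quadQ Q Kd gd dD d0 Sa nq an.
have [al [be [z [z0 ez]]]] := dvd8 (dvdz_trans de dv).
exists al, be; have := sqe_e z0 ez h; rewrite intrM.
by case: al {ez}; case: be.
Qed.
Lemma Slist8q (q : nat) a n : prime q -> (4 * D %| 8 * q%:Z)%Z -> SS K a -> n \in Crat -> a * g a = n ^+ 2 ->
  exists al be ga : bool, sqe K a ((-1) ^+ al * 2 ^+ be * q%:R ^+ ga).
Proof.
move=> pq dv Sa nq an; have [e [de e0 h]] := SS_quadQ Q Kd gd dD d0 Sa nq an.
have [al [be [ga [z [z0 ez]]]]] := dvd8q pq e0 (dvdz_trans de dv).
exists al, be, ga; have := sqe_e z0 ez h; rewrite !intrM.
by case: al {ez}; case: be; case: ga.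
Qed.
Lemma SS_pos a : D < 0 -> SS K a -> exists n, [/\ n \in Crat, n != 0 & a * g a = n ^+ 2].
Proof.
move=> D0 Sa; have [n [nq n0 [h|h]]] := SS_normQ Q Sa; first by exists n.
have [x [y [xq yq ea h']]] := quadQ_coord Q Kd gd dD d0 (SS_K Sa).
exfalso; have n2 := rat_sq_ge0 nq; have x2 := rat_sq_ge0 xq; have y2 := rat_sq_ge0 yq.
have : n ^+ 2 <= 0.
  rewrite -oppr_ge0 -h h' -mulNr addr_ge0 // mulr_ge0 // -rmorphN ler0z oppr_ge0; exact: ltW.
by rewrite le_eqVlt sqrf_eq0 (negPf n0) /= => /(le_lt_trans n2); rewrite ltxx.
Qed.
(** A norm of the form [- n ^+ 2] would contradict [qres] for the nonresidue -1. *)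
Lemma SS_qpos (q : nat) (u : int) a : prime q -> ~ sqmod (-1) q -> D = q%:Z * u -> ~~ (q%:Z %| u)%Z ->
  SS K a -> exists n, [/\ n \in Crat, n != 0 & a * g a = n ^+ 2].
Proof.
move=> pq n1 eD qu Sa; have [n [nq n0 [h|h]]] := SS_normQ Q Sa; first by exists n.
have [x [y [xq yq ea h']]] := quadQ_coord Q Kd gd dD d0 (SS_K Sa).
exfalso; move/eqP: n0; apply; apply: (qres pq n1 qu xq yq nq).
by rewrite -eD -h' h rmorphN1 mulN1r.
Qed.
Lemma sqe_abs a b b' z : K z -> z != 0 -> sqe K a b -> b = b' * z ^+ 2 -> sqe K a b'.
Proof. by move=> Kz z0 h e; apply: (sqe_trans sK h); exists z. Qed.
End Lists.

Section SLists.
Variables (p q : nat) (s2 sq sp si : rmC).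
Hypotheses (ar : arith p q) (st : setup p q s2 sq sp si).
Notation L := (LL p q).
Notation w2 := w2. Notation wq := (wq q). Notation wp := (wp p).
Notation Qi := (Qi p q s2 sq sp). Notation Qq := (Qq p q s2 sp si). Notation Q2 := (Q2 p q sq sp si).
Notation kk := (kk p q s2 sq sp si). Notation Qm2 := (Qm2 p q s2 sq sp si). Notation Q2q := (Q2q p q s2 sq sp si).
Let i0 : 'i != 0 :> algC := neq0Ci _.
Let w20 : w2 != 0 := w2_neq0.
Let wq0 : wq != 0 := wq_neq0 ar.
Let QI := quad_Qi ar st. Let QQ := quad_Qq ar st. Let QT := quad_Q2 ar st.
Let QK := quad_k ar st. Let QM := quad_Qm2 ar st. Let QTq := quad_Q2q ar st.
Let qgt1 : (1 < q)%N := prime_gt1 (ar_q ar).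
Let q2 : (q%:Z %| 2)%Z = false.
Proof. by rewrite dvdzE absz_nat; apply/negP => /dvdn_leq; have := ar_q8 ar; lia. Qed.
Let n2 : 2%:R != 0 :> algC. Proof. by rewrite pnatr_eq0. Qed.

(** The classes of -1 and 2 reduce to two because [-1 = 'i ^+ 2] and [2 = 'i * (1 - 'i) ^+ 2]. *)
Lemma S_Qi a : SS Qi a -> sqe Qi a 1 \/ sqe Qi a 'i.
Proof.
have sK := quad_sK QI; have Ki := Qi_i st; have d2 : 'i ^+ 2 = (-1)%:~R :> algC by rewrite sqrCi.
move=> Sa; have [n [nq n0 h]] := SS_pos QI Ki (sii st) d2 i0 (isT : -1 < 0 :> int) Sa.
have [al [be H]] := Slist8 QI Ki (sii st) d2 i0 (isT : (4 * -1 %| 8)%Z) Sa nq h.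
have H1 : sqe Qi a (2 ^+ be).
  apply: (sqe_abs QI (z := 'i ^+ al)) H _; [exact: (sfX sK) | by rewrite expf_neq0 |].
  by rewrite -exprM mulnC exprM sqrCi mulrC.
case: be H1 {H} => H1; [right | by left].
have i1 : 1 - 'i != 0 :> algC.
  by apply/eqP => e; move/eqP: n2; apply; have -> : 2%:R = (1 - 'i) * (1 + 'i) :> algC; [transitivity (1 - 'i ^+ 2 : algC); [rewrite sqrCi; ring | ring] | rewrite e mul0r].
apply: (sqe_abs QI (z := 1 - 'i)) H1 _ => //; first by apply: (sfB sK) => //; apply: (sf1 sK).
have := sqrCi algC; rewrite expr1 => e; transitivity ('i * (1 + 'i ^+ 2) - 2 * 'i ^+ 2 : algC); [rewrite e; ring | ring].
Qed.
Lemma S_Qq a : SS Qq a -> exists al be : bool, sqe Qq a ((-1) ^+ al * 2 ^+ be).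
Proof.
have sK := quad_sK QQ; have Kd := Qq_wq st; have d2 : wq ^+ 2 = q%:Z%:~R by rewrite wqK.
move=> Sa; have [|n [nq n0 h]] := SS_qpos QQ Kd (sqq st) d2 wq0 (ar_q ar) (ar_N1q ar) (esym (mulr1 _)) _ Sa.
  by rewrite dvdzE absz_nat /= dvdn1; apply/eqP => e; move: qgt1; rewrite e.
have [|al [be [ga H]]] := Slist8q QQ Kd (sqq st) d2 wq0 (ar_q ar) _ Sa nq h; first by rewrite dvdz_mul2r // -lt0n prime_gt0 // (ar_q ar).
exists al, be; apply: (sqe_abs QQ (z := wq ^+ ga)) H _; [exact: (sfX sK) | by rewrite expf_neq0 |].
by rewrite -exprM mulnC exprM wqK.
Qed.
(** Serves to trade the factor [q] for 2, when [d ^+ 2] is [2 * q] up to sign. *)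
Lemma sqe_flip2 (K : cset) a al (be ga : bool) (d : algC) : is_subfield K -> K d -> d != 0 ->
  sqe K a ((-1) ^+ al * 2 ^+ be * d ^+ 2 ^+ ga / 2 ^+ ga) ->
  sqe K a ((-1) ^+ al * 2 ^+ (be (+) ga)).
Proof.
move=> sK Kd d0 H; apply: (sqe_trans sK H); exists (d ^+ ga / 2 ^+ (~~ be && ga)).
split.
- by apply: (sfM sK); [apply: (sfX sK) | apply: (sfV sK); apply: (sfX sK); apply: (sf_nat sK)].
- by rewrite !mulf_neq0 ?invr_eq0 ?expf_neq0.
by case: be {H}; case: ga; rewrite /= ?expr0 ?expr1; field.
Qed.
Lemma S_Q2q a : SS Q2q a -> exists al be : bool, sqe Q2q a ((-1) ^+ al * 2 ^+ be).
Proof.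
have sK := quad_sK QTq; have Kd := Q2q_w st; have d2 : (w2 * wq) ^+ 2 = (q%:Z * 2)%:~R by rewrite exprMn w2K wqK intrM mulrC.
have gd : s2 (w2 * wq) = - (w2 * wq) by rewrite rmorphM (s22 st) (s2q st) mulNr.
have d0 : w2 * wq != 0 by rewrite mulf_neq0.
move=> Sa; have [|n [nq n0 h]] := SS_qpos QTq Kd gd d2 d0 (ar_q ar) (ar_N1q ar) erefl _ Sa; first by rewrite q2.
have [|al [be [ga H]]] := Slist8q QTq Kd gd d2 d0 (ar_q ar) _ Sa nq h; first by apply/dvdzP; exists 1; ring.
exists al, (be (+) ga); apply: (@sqe_flip2 Q2q a al be ga (w2 * wq)) => //.
have -> : (w2 * wq) ^+ 2 = q%:R * 2 by rewrite exprMn w2K wqK mulrC.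
by case: ga H; rewrite ?expr0 ?expr1 ?divr1 // mulrA mulfK.
Qed.
Lemma S_kk a : SS kk a -> exists al be : bool, sqe kk a ((-1) ^+ al * 2 ^+ be).
Proof.
have sK := quad_sK QK; have Kd := kk_wk st; have d2 : ('i * w2 * wq) ^+ 2 = (- (2 * q%:Z))%:~R.
  by rewrite !exprMn w2K wqK sqrCi rmorphN /= intrM; ring.
have gd : s2 ('i * w2 * wq) = - ('i * w2 * wq) by rewrite !rmorphM (s22 st) (s2q st) (s2i st); ring.
have d0 : 'i * w2 * wq != 0 by rewrite !mulf_neq0.
move=> Sa; have [|n [nq n0 h]] := SS_pos QK Kd gd d2 d0 _ Sa; first by lia.
have [|al [be [ga H]]] := Slist8q QK Kd gd d2 d0 (ar_q ar) _ Sa nq h; first by apply/dvdzP; exists (-1); ring.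
exists (al (+) ga), (be (+) ga); apply: (@sqe_flip2 kk a (al (+) ga) be ga ('i * w2 * wq)) => //.
have -> : ('i * w2 * wq) ^+ 2 = - (2 * q%:R) by rewrite !exprMn w2K wqK sqrCi; ring.
move: H; have -> // : (-1) ^+ al * 2 ^+ be * q%:R ^+ ga = (-1) ^+ (al (+) ga) * 2 ^+ be * (- (2 * q%:R)) ^+ ga / 2 ^+ ga :> algC.
by case: al; case: ga; rewrite /= ?expr0 ?expr1; field.
Qed.
(** The unit [1 + w2] of norm -1 corrects the sign of the norm, and 2 is the square of [w2]. *)
Lemma S_Q2 a : SS Q2 a -> exists al be : bool, sqe Q2 a ((-1) ^+ al * (1 + w2) ^+ be).
Proof.
have sK := quad_sK QT; have Kd := Q2_w2 st; have d2 : w2 ^+ 2 = 2%:~R by rewrite w2K.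
have gd : c2q s2 sq w2 = - w2 by rewrite /= (sq2 st) (s22 st).
have u2 : aunit (1 + w2).
  have wA : w2 \in Aint by apply: (@Aint_root 2) => //; rewrite d2 Aint_int.
  apply: (@aunit_norm1 _ (w2 - 1)); [by apply: rpredD => //; apply: Aint1 | by apply: rpredB => //; apply: Aint1 |].
  have -> : (1 + w2) * (w2 - 1) = 1 by transitivity (w2 ^+ 2 - 1); [ring | rewrite w2K; ring].
  exact: aunit1.
have u0 : 1 + w2 != 0 by case/and3P: u2.
have Ku : Q2 (1 + w2) by apply: (sfD sK) => //; apply: (sf1 sK).
have main b n : SS Q2 b -> n \in Crat -> b * c2q s2 sq b = n ^+ 2 -> exists al : bool, sqe Q2 b ((-1) ^+ al).
  move=> Sb nq h; have [al [be H]] := Slist8 QT Kd gd d2 w20 (isT : (4 * 2 %| 8)%Z) Sb nq h.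
  exists al; apply: (sqe_abs QT (z := w2 ^+ be)) H _; [exact: (sfX sK) | by rewrite expf_neq0 |].
  by rewrite -exprM mulnC exprM w2K.
move=> Sa; have [n [nq n0 [h|h]]] := SS_normQ QT Sa.
  by have [al H] := main a n Sa nq h; exists al, false; rewrite expr0 mulr1.
have [||al H] := main (a * (1 + w2)) n _ nq; first by apply: (SSM sK) => //; apply: SS_unit.
  rewrite rmorphM rmorphD rmorph1 gd mulrACA h; transitivity (- n ^+ 2 * (1 - w2 ^+ 2)); first by ring.
  by rewrite w2K; ring.
exists al, true; rewrite expr1; apply: (sqe_mul sK); first by apply: (sfM sK) => //; apply: (sfX sK); apply: (sfN sK); apply: (sf1 sK).
  by rewrite mulf_neq0 // signr_eq0.
have [z [Kz z0 e]] := H; exists z; split=> //.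
transitivity ((-1) ^+ al * (a * (1 + w2))); first by ring.
by rewrite e mulrA -signr_addb addbb.
Qed.
Lemma S_Qm2 a : SS Qm2 a -> exists al : bool, sqe Qm2 a ((-1) ^+ al).
Proof.
have sK := quad_sK QM; have Kd := Qm2_w st; have d2 : ('i * w2) ^+ 2 = (-2)%:~R by rewrite exprMn sqrCi w2K mulN1r.
have gd : si ('i * w2) = - ('i * w2) by rewrite rmorphM (sii st) (si2 st) mulNr.
have d0 : 'i * w2 != 0 by rewrite mulf_neq0.
move=> Sa; have [n [nq n0 h]] := SS_pos QM Kd gd d2 d0 (isT : -2 < 0 :> int) Sa.
have [al [be H]] := Slist8 QM Kd gd d2 d0 (isT : (4 * -2 %| 8)%Z) Sa nq h.
exists (al (+) be); apply: (sqe_abs QM (z := ('i * w2) ^+ be)) H _; [exact: (sfX sK) | by rewrite expf_neq0 |].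
rewrite -exprM mulnC exprM d2; case: al; case: be; rewrite /= ?expr0 ?expr1; ring.
Qed.
End SLists.

Lemma primeE_assoc K t t' : assoc t t' -> primeE K t -> primeE K t'.
Proof.
move=> tt [dt tA tn H]; split.
- exact: DD_assoc dt.
- by rewrite -[t']divr1 -(assoc_dvd2 _ tt) divr1.
- by rewrite -div1r -(assoc_dvd _ tt) div1r.
move=> x Kx xA; case: (H x Kx xA) => h; [left | right]; first by rewrite -(assoc_dvd _ tt).
exact: cop_assoc h.
Qed.

Lemma div_one K t c n : is_subfield K -> primeE K t -> DD K c -> c \in Aint -> t ^+ n / c \in Aint ->
  exists i, assoc c (t ^+ i).
Proof.
move=> sK pt; elim: n c => [|n IH] c dc cA h.
  by exists 0%N; rewrite expr0 in h *; apply: assocI; rewrite ?oner_neq0 ?divr1 // (DD_nz dc).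
have tA : t \in Aint by case: pt.
have t0 : t != 0 by case: pt => /DD_nz.
have tnA : t ^+ n \in Aint by ai.
move: h; rewrite exprS => /(primeE_step pt dc cA tnA) [|[h1 h2]]; first exact: IH.
have dt : DD K t by case: pt.
have [i hi] := IH (c / t) (DDM sK dc (DDV dt)) h1 h2.
exists i.+1; rewrite exprSr; have -> : c = c / t * t by rewrite divfK.
exact: assocM hi (assoc_refl t0).
Qed.

Lemma div_two K t t' c m n : is_subfield K -> primeE K t -> primeE K t' -> DD K c -> c \in Aint ->
  t ^+ m * t' ^+ n / c \in Aint -> exists i j, assoc c (t ^+ i * t' ^+ j).
Proof.
move=> sK pt pt'; elim: m c => [|m IH] c dc cA h.
  by have [|j hj] := div_one (n := n) sK pt' dc cA; [by move: h; rewrite expr0 mul1r | exists 0%N, j; rewrite expr0 mul1r].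
have tA : t \in Aint by case: pt.
have tA' : t' \in Aint by case: pt'.
have t0 : t != 0 by case: pt => /DD_nz.
have tnA : t ^+ m * t' ^+ n \in Aint by ai.
have h' : t * (t ^+ m * t' ^+ n) / c \in Aint by move: h; rewrite exprS !mulrA.
move: h' => /(primeE_step pt dc cA tnA) [|[h1 h2]]; first exact: IH.
have dt : DD K t by case: pt.
have [i [j hi]] := IH (c / t) (DDM sK dc (DDV dt)) h1 h2.
exists i.+1, j; rewrite exprSr mulrAC; have -> : c = c / t * t by rewrite divfK.
exact: assocM hi (assoc_refl t0).
Qed.

(** The defect [c] is a product of powers of [t] and [t'], whose exponents count only modulo 2;
    hence four ideals modulo squares. *)
Lemma pk_two k K (s : rmC) w t t' m n N : quad k K s -> Bez k -> primeE k t -> primeE k t' ->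
  K w -> w \in Aint -> w != s w -> t ^+ m * t' ^+ n / (w - s w) ^+ 2 \in Aint ->
  pk (SS k) k N -> pk (fun r => k r /\ SS K r) k (4 * N).
Proof.
move=> q bk pt pt' Kw wA wsw h H; have sk := quad_sk q.
have dt : DD k t by case: pt.
have dt' : DD k t' by case: pt'.
apply: (pk_ram (t := [:: 1; t; t'; t * t']) q H) => [y|r kr Sr].
  rewrite !inE => /or4P[] /eqP-> //; last exact: DDM.
  exact: DD_unit sk aunit1.
have [c [e [dc de rc cA cd]]] := SS_descend q bk kr Sr Kw wA wsw.
have w0 : (w - s w) ^+ 2 != 0 by rewrite expf_neq0 // subr_eq0.
have [|i [j cij]] := div_two (m := m) (n := n) sk pt pt' dc cA.
  have -> : t ^+ m * t' ^+ n / c = (t ^+ m * t' ^+ n / (w - s w) ^+ 2) * ((w - s w) ^+ 2 / c) by rewrite mulrA divfK //.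
  by ai.
have e2 x a : x ^+ a = x ^+ odd a * (x ^+ a./2) ^+ 2 :> algC.
  by rewrite -exprM -exprD muln2 odd_double_half.
exists (t ^+ odd i * t' ^+ odd j).
  by case: (odd i); case: (odd j); rewrite ?expr0 ?expr1 ?mul1r ?mulr1 !inE eqxx ?orbT.
exists (t ^+ i./2 * t' ^+ j./2 * e); first by do !apply: (DDM sk) => //; apply: (DDX _ sk).
apply: (assoc_trans rc); have -> : t ^+ odd i * t' ^+ odd j * (t ^+ i./2 * t' ^+ j./2 * e) ^+ 2 = (t ^+ i * t' ^+ j) * e ^+ 2.
  by rewrite [t ^+ i]e2 [t' ^+ j]e2; ring.
by apply: assocM => //; apply: assoc_refl; rewrite expf_neq0 // (DD_nz de).
Qed.

(** * Primes above p in a chain of three quadratic steps *)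

Section Case.
Variables (K0 K1 k : cset) (sp tau sig : rmC) (p : nat) (X Y wp : algC) (x0 y0 j : int).
Hypotheses (qk : quad (fun x => x \in Crat) k tau) (q0 : quad k K0 sig) (q1 : quad K0 K1 sp).
Hypotheses (b0 : Bez k) (b1 : Bez K1) (pp : prime p).
Hypotheses (kX : k X) (tX : tau X = - X) (X2 : X ^+ 2 = x0%:~R) (Xn : X != 0).
Hypotheses (KY : K0 Y) (sY : sig Y = - Y) (Y2 : Y ^+ 2 = y0%:~R) (Yn : Y != 0).
Hypotheses (Kwp : K1 wp) (spp : sp wp = - wp) (wp2 : wp ^+ 2 = p%:R).
Hypotheses (pj : (p%:Z %| j ^+ 2 - x0)%Z) (pnj : ~~ (p%:Z %| 2 * j)%Z).
Hypotheses (px : ~~ (p%:Z %| 4 * x0)%Z) (py : ~~ (p%:Z %| 4 * y0)%Z) (ny : ~ sqmod y0 p).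
Let sk := quad_sk q0. Let sK0 := quad_sK q0. Let sK1 := quad_sK q1.
Let XA : X \in Aint. Proof. by apply: (@Aint_root 2) => //; rewrite X2 Aint_int. Qed.
Let YA : Y \in Aint. Proof. by apply: (@Aint_root 2) => //; rewrite Y2 Aint_int. Qed.
Let pA : p%:R \in Aint. Proof. by rewrite -[p%:R]/((p%:Z)%:~R) Aint_int. Qed.
Let p0 : p%:R != 0 :> algC. Proof. by rewrite pnatr_eq0 -lt0n prime_gt0. Qed.
Let wp0 : wp != 0. Proof. by rewrite -sqrf_eq0 wp2. Qed.
Let wpA : wp \in Aint. Proof. by apply: (@Aint_root 2) => //; rewrite wp2. Qed.

Section OnePrime.
Variables (t : algC) (j' : int).
Hypotheses (dt : DD k t) (tA : t \in Aint) (tn : t^-1 \notin Aint) (pt : p%:R / t \in Aint).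
Hypothesis Xt : (X - j'%:~R) / t \in Aint.
Let t0 := DD_nz dt.

(** The prime [t] of [k] has degree one: modulo [t] the generator [X] is the integer [j'], so
    integers of [k] reduce to rational ones once the discriminant [4 * x0] is multiplied in. *)
Lemma red_k y : k y -> y \in Aint -> exists M : int, ((4 * x0)%:~R * y - M%:~R) / t \in Aint.
Proof.
move=> ky yA; have XtX : X != tau X by rewrite tX -subr_eq0 opprK -mulr2n mulrn_eq0.
have [a [b [aq aA bq bA e]]] := quad_basis qk kX XA XtX ky yA.
have /intrP[A eA] := Cint_rat_Aint aq aA; have /intrP[B eB] := Cint_rat_Aint bq bA.
exists (A + B * j').
have -> : (4 * x0)%:~R * y = a + b * X by rewrite -e tX intrM -X2 -[4%:~R]/(4%:R); ring.
have -> : (a + b * X - (A + B * j')%:~R) / t = b * ((X - j'%:~R) / t) by rewrite intrD intrM eA eB; field.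
by ai.
Qed.

(** [t] is inert in [K0], because [y0] is a nonresidue: modulo [t] an integer is [M + N * Y] up to a
    factor prime to [p], and [M ^+ 2 - y0 * N ^+ 2] is prime to [p] unless [p] divides both
    coordinates. *)
Lemma prime_K0 : primeE K0 t.
Proof.
have dt0 : DD K0 t by apply: DD_sub dt; apply: quad_sub q0.
split=> // x Kx xA.
have YsY : Y != sig Y by rewrite sY -subr_eq0 opprK -mulr2n mulrn_eq0.
have [a [b [ka aA kb bA e]]] := quad_basis q0 KY YA YsY Kx xA.
have [M hM] := red_k ka aA; have [N hN] := red_k kb bA.
pose D : int := 4 * x0 * (4 * y0).
have eD : (D%:~R * x - (M%:~R + N%:~R * Y)) / t \in Aint.
  have -> : D%:~R * x = (4 * x0)%:~R * (a + b * Y) by rewrite -e sY /D intrM [(4 * y0)%:~R]intrM -Y2 -[4%:~R]/(4%:R); ring.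
  have -> : ((4 * x0)%:~R * (a + b * Y) - (M%:~R + N%:~R * Y)) / t = ((4 * x0)%:~R * a - M%:~R) / t + ((4 * x0)%:~R * b - N%:~R) / t * Y.
    by field.
  by apply: rpredD => //; ai.
have pD : ~~ (p%:Z %| D)%Z by apply/negP => /(dvdz_primeM pp); rewrite (negPf px) (negPf py).
have cD := cop_int pp pD t0 pt.
have [/andP[pM pN]|h] := boolP ((p%:Z %| M)%Z && (p%:Z %| N)%Z).
  left; have dv (m : int) : (p%:Z %| m)%Z -> m%:~R / t \in Aint.
    by case/dvdzP => z ->; rewrite intrM -mulrA; ai.
  apply: (cop_dvd t0 cD xA).
  rewrite -[D%:~R * x](subrK (M%:~R + N%:~R * Y)) mulrDl; apply: rpredD => //.
  by rewrite mulrDl mulrAC; apply: rpredD; [exact: dv | apply: rpredM => //; exact: dv].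
right; apply: (@cop_l _ (D%:~R)); last by ai.
apply: (@cop_cong (M%:~R + N%:~R * Y)) => //; last first.
  by rewrite -rpredN -mulNr opprB [x * _]mulrC.
apply: (@cop_l _ (M%:~R - N%:~R * Y)); last by ai.
have -> : (M%:~R + N%:~R * Y) * (M%:~R - N%:~R * Y) = (M ^+ 2 - y0 * N ^+ 2)%:~R.
  by rewrite !expr2 rmorphB !rmorphM /= -Y2; ring.
by apply: (cop_int pp) => //; apply/negP => h'; move/negP: h; apply; apply: nsq_rel h'.
Qed.
End OnePrime.

Section Ram.
Variables (t t' : algC).
Hypotheses (dt : DD k t) (tA : t \in Aint) (tA' : t' \in Aint) (tn : t^-1 \notin Aint) (ptt : assoc p%:R (t * t')).
Hypotheses (ct : cop t t') (t0' : t' != 0) (Xt : (X - j%:~R) / t \in Aint).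
Let t0 := DD_nz dt.
Let pt : p%:R / t \in Aint.
Proof.
have [_ _ h _] := assocE ptt.
have -> : p%:R / t = p%:R / (t * t') * t' by field; rewrite t0 t0'.
  by ai.
Qed.
Let P0 : primeE K0 t := prime_K0 dt tA tn pt Xt.

(** The element [(x - sp x) * wp] lies in [K0] and [t] divides its square, hence itself. So [t ^+ 2]
    divides [(x - sp x) ^+ 2 * p], while [p] contains [t] only once. *)
Lemma E_dvd x : K1 x -> x \in Aint -> (x - sp x) ^+ 2 / t \in Aint.
Proof.
move=> Kx xA; have KE : K0 ((x - sp x) ^+ 2).
  apply: (quad_in q1); first by apply: (sfX sK1); apply: (sfB sK1) => //; apply: (quad_K q1).
  by rewrite rmorphXn rmorphB (quad_inv q1 Kx) -sqrrN opprB.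
have Kv : K0 ((x - sp x) * wp).
  apply: (quad_in q1); first by apply: (sfM sK1) => //; apply: (sfB sK1) => //; apply: (quad_K q1).
  by rewrite rmorphM rmorphB (quad_inv q1 Kx) spp; ring.
have spA : sp x \in Aint by ai.
have vA : (x - sp x) * wp \in Aint by ai.
have v2 : ((x - sp x) * wp) ^+ 2 = (x - sp x) ^+ 2 * p%:R by rewrite exprMn wp2.
have tv : ((x - sp x) * wp) / t \in Aint.
  have h : (x - sp x) * wp * ((x - sp x) * wp) / t \in Aint by rewrite -expr2 v2 -mulrA; ai.
  by case: (primeE_dvdM sK0 P0 Kv Kv vA vA h).
have h2 : t' * (x - sp x) ^+ 2 / t \in Aint.
  have [_ _ _ h] := assocE ptt.
  have -> : t' * (x - sp x) ^+ 2 / t = ((x - sp x) * wp / t) ^+ 2 * (t * t' / p%:R).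
    by rewrite expr_div_n v2; field; rewrite t0 p0.
  by ai.
apply: (cop_dvd t0 (cop_sym ct)) => //; by ai.
Qed.

(** [t1] is the gcd of [t] with [wp]; as [p = wp ^+ 2] is [t] times something comaximal to it,
    [t1 ^+ 2] is [t]. *)
Lemma ram_prime : exists t1, [/\ primeE K1 t1, assoc (t1 ^+ 2) t & t / t1 \in Aint].
Proof.
have dt1 : DD K1 t by apply: DD_sub (DD_sub (quad_sub q0) dt); apply: quad_sub q1.
have [t1 [d1 h1 h2 u]] := DD_gcd b1 dt1 (DD_elt sK1 Kwp wp0); have n1 := DD_nz d1.
have tA1 : t1 \in Aint by rewrite -[t1]divr1; apply: u; rewrite ?oner_neq0 ?divr1.
have a1 : t1 ^+ 2 / t \in Aint.
  have e1 : t / t1 != 0 by rewrite mulf_neq0 ?invr_eq0.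
  have := u _ e1; rewrite !invf_div !mulrA -expr2; apply; first by rewrite mulrAC divff // mul1r.
  have e2 : t / wp != 0 by rewrite mulf_neq0 ?invr_eq0.
  have := u _ e2; rewrite !invf_div !mulrA [t1 * _]mulrC; apply; first by rewrite mulrAC divff // mul1r.
  by rewrite -expr2 wp2.
have a2 : t / t1 ^+ 2 \in Aint.
  have n2 : t1 ^+ 2 != 0 by rewrite expf_neq0.
  have c1 : cop t1 t' by apply: (@cop_l _ (t / t1)) => //; rewrite mulrC divfK.
  have c2 : cop t' (t1 ^+ 2) by apply: cop_sym; rewrite expr2; apply: copM.
  apply: (cop_dvd n2 c2 tA); have [_ _ _ h] := assocE ptt.
  have -> : t' * t / t1 ^+ 2 = (wp / t1) ^+ 2 * (t * t' / p%:R) by rewrite expr_div_n wp2; field; rewrite p0 n1.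
  by ai.
have as1 : assoc (t1 ^+ 2) t by apply: assocI => //; rewrite expf_neq0.
exists t1; split=> //.
apply: (prime_ram q1 (primeE_assoc (assoc_sym as1) P0) d1) => x Kx xA.
by rewrite (assoc_dvd _ as1); apply: E_dvd.
Qed.

(** Inertia acts trivially at the ramified prime: [4 * (a * sp a)] is congruent to
    [(a + sp a) ^+ 2]. Taking the norm under [sig] gives 16 and a square from [k]. *)
Lemma residue a : K1 a -> a \in Aint -> exists U, [/\ k U, U \in Aint &
  (16%:R * ((a * sp a) * sig (a * sp a)) - U ^+ 2) / t \in Aint].
Proof.
move=> Ka aA; have E1 := E_dvd Ka aA; set T := a + sp a.
have KT : K0 T := quad_tr q1 Ka.
have spA : sp a \in Aint by ai.
have TA : T \in Aint by apply: rpredD.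
have sTA : sig T \in Aint by ai.
exists (T * sig T); split; [exact: (quad_N q0) | by ai |].
have st : assoc (sig t) t by apply: (DD_fixed (K := k)) dt => x kx; exact: (quad_fix q0 kx).
pose b := a * sp a; have bA : b \in Aint by ai.
have sbA : sig b \in Aint by ai.
have e1 : (4%:R * b - T ^+ 2) / t \in Aint.
  have -> : (4%:R * b - T ^+ 2) / t = - ((a - sp a) ^+ 2 / t) by rewrite /b /T; field.
  by rewrite rpredN.
have e2 : (4%:R * sig b - sig T ^+ 2) / t \in Aint.
  rewrite -(assoc_dvd _ st); have := Aintg sig e1.
  by rewrite rmorphM fmorphV rmorphB rmorphM rmorphXn rmorph_nat.
have n4 : 4%:R \in Aint by rewrite -[4%:R]/(4%:~R) Aint_int.
have -> : (16%:R * (a * sp a * sig (a * sp a)) - (T * sig T) ^+ 2) / t =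
   (4%:R * b - T ^+ 2) / t * (4%:R * sig b) + (4%:R * sig b - sig T ^+ 2) / t * T ^+ 2 by rewrite -/b; field.
by apply: rpredD; ai.
Qed.

(** For a representative prime to [t1] the norm is prime to [t1] too, and by [residue] it is a
    square modulo [t] up to squares. If it were a nonresidue times a square, [t] would divide it. *)
Lemma Res a z c (c0 : int) : odd p -> SS K1 a -> k z -> k c -> c \in Aint -> (c - c0%:~R) / t \in Aint -> ~ sqmod c0 p ->
  (a * sp a) * sig (a * sp a) = c * z ^+ 2 -> False.
Proof.
move=> po Sa kz kc cA cc nc eN; have [t1 [P1 as1 tt1]] := ram_prime.
have t10 : t1 != 0 by case: P1 => /DD_nz.
have t1n : t1^-1 \notin Aint by case: P1.
have [a' [Ka' aA' [w [Kw w0 ea]] ca]] := move sK1 P1 Sa.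
pose Nm x := (x * sp x) * sig (x * sp x).
have NmM x y : Nm (x * y) = Nm x * Nm y by rewrite /Nm !rmorphM; ring.
have kN x : K1 x -> k (Nm x) by move=> Kx; apply: (quad_N q0); apply: (quad_N q1).
have ws0 : w * sp w != 0 by rewrite mulf_neq0 ?fmorph_eq0.
have Nw0 : Nm w != 0 by rewrite /Nm mulf_neq0 // fmorph_eq0.
have eN' : Nm a' = c * (z / Nm w) ^+ 2.
  have : Nm a = c * z ^+ 2 by []; rewrite ea NmM [w ^+ 2]expr2 NmM => h.
  by apply: (mulIf (mulf_neq0 Nw0 Nw0)); rewrite h; field.
pose z' := c * (z / Nm w).
have kz' : k z' by apply: (sfM sk) => //; apply: (sfM sk) => //; apply: (sfV sk); apply: kN.
have spA : sp a' \in Aint by ai.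
have saA : sig (a' * sp a') \in Aint by ai.
have z2 : z' ^+ 2 = c * Nm a' by rewrite eN' /z'; ring.
have NA : Nm a' \in Aint by ai.
have zA : z' \in Aint by apply: (@Aint_root 2) => //; rewrite z2; ai.
have [U [kU UA eU]] := residue Ka' aA'; rewrite -/(Nm a') in eU.
have [M hM] := red_k (dt) Xt kz' zA; have [M' hM'] := red_k dt Xt kU UA.
have c0n : ~~ (p%:Z %| c0)%Z.
  apply/negP => h; apply: nc; exists 0; rewrite expr0n /= sub0r dvdzE abszN -dvdzE; exact: h.
have cc0 : cop c0%:~R t by apply: cop_int pt.
have cct : cop c t by apply: cop_cong cc0 _ => //; rewrite -opprB mulNr rpredN.
pose q4 : algC := (4 * x0)%:~R.
have q4A : q4 \in Aint by ai.
have pM : (p%:Z %| (4 * M) ^+ 2 - c0 * M' ^+ 2)%Z.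
  apply: (int_dvd pp t0 pt tn).
  have -> : ((4 * M) ^+ 2 - c0 * M' ^+ 2)%:~R / t =
     - ((q4 * z' - M%:~R) / t * (16%:R * (q4 * z' + M%:~R))) + (c - c0%:~R) / t * M'%:~R ^+ 2
      + c * ((q4 * U - M'%:~R) / t * (q4 * U + M'%:~R)) + c * q4 ^+ 2 * ((16%:R * Nm a' - U ^+ 2) / t).
    rewrite !expr2 rmorphB !rmorphM /= -[4%:~R]/(4%:R).
    have e : z' * z' = c * Nm a' by rewrite -expr2.
    transitivity ((16%:R * (M%:~R * M%:~R) - c0%:~R * (M'%:~R * M'%:~R) + 16%:R * q4 * q4 * (c * Nm a' - z' * z')) / t); last by field.
    by rewrite e; field.
  have n16 : 16%:R \in Aint by rewrite -[16%:R]/(16%:~R) Aint_int.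
  have MA (m : int) : m%:~R \in Aint by apply: Aint_int.
  by apply: rpredD; [apply: rpredD; [apply: rpredD; [rewrite rpredN; ai |] |] |]; ai.
have /andP[p4M pM'] := nsq_rel pp nc pM.
have {p4M} pM4 : (p%:Z %| M)%Z.
  move: p4M => /(dvdz_primeM pp) /orP[|//]; rewrite dvdzE absz_nat /= => h.
  have : coprime p (2 ^ 2) by apply: coprimeXr; rewrite coprimen2.
  by rewrite prime_coprime // h.
have tz : z' / t \in Aint.
  have cq := cop_int pp px t0 pt.
  apply: (cop_dvd t0 cq zA); rewrite -[_%:~R * z'](subrK M%:~R) mulrDl; apply: rpredD => //.
  by case/dvdzP: pM4 => m ->; rewrite intrM -mulrA; ai.
have h1 : c * Nm a' / t \in Aint by rewrite -z2 expr2 mulrAC; ai.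
have h2 := cop_dvd t0 cct NA h1.
have kt1 (g : rmC) : (forall x, k x -> g x = x) -> assoc t1 (g t1).
  move=> gk; apply: assoc_sym; apply: (@assoc_root 2) => //; rewrite -rmorphXn.
  apply: (assoc_trans (y := g t)); first by rewrite assoc_aut.
  by apply: assoc_trans (DD_fixed gk dt) (assoc_sym as1).
have k1 := kt1 sp (fun x kx => quad_fix q1 (quad_sub q0 kx)).
have k2 := kt1 sig (fun x kx => quad_fix q0 kx).
have tA1 : t1 \in Aint by case: P1.
have cb : cop (a' * sp a') t1.
  by apply: copM => //; apply: (cop_assoc (assoc_sym k1)); apply: cop_aut.
have cN : cop (Nm a') t1.
  by apply: copM => //; [apply: (cop_assoc (assoc_sym k2)); apply: cop_aut | ai].
move/negP: t1n; apply; apply: (cop_not cN) => //.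
have -> : Nm a' / t1 = Nm a' / t * (t / t1) by rewrite mulrA divfK.
  by ai.
Qed.
End Ram.
End Case.

(** * Selmer elements of Q(i, sqrt q) *)

Section Pack.
Variables (p q : nat) (s2 sq sp si : rmC).
Hypotheses (ar : arith p q) (st : setup p q s2 sq sp si).
Notation L := (LL p q).
Notation w2 := w2. Notation wq := (wq q). Notation wp := (wp p).
Notation G := (gens p q).
Notation Qi := (Qi p q s2 sq sp). Notation Qq := (Qq p q s2 sp si).
Let rS : rsq G := @rsq_gens p q.
Let g2 := flips_s2 st. Let gq := flips_sq st. Let gp := flips_sp st. Let gi := flips_si st.
Let L2 : L w2 := @LL_w2 p q. Let Lq : L wq := @LL_wq p q. Let Lp : L wp := @LL_wp p q. Let Li : L 'i := @LL_i p q.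
Let sL : is_subfield L := @LL_sf p q.
Let i0 : 'i != 0 :> algC := neq0Ci _.
Let w20 : w2 != 0 := w2_neq0.
Let wq0 : wq != 0 := wq_neq0 ar.
Let wp0 : wp != 0 := wp_neq0 ar.
Let n2 : 2%:R != 0 :> algC. Proof. by rewrite pnatr_eq0. Qed.
Let q8 := ar_q8 ar.
Let pq := ar_q ar.
Let pp := ar_p ar.

Definition K0 := fixf L [:: sp; s2].
Definition K1 := fixf L [:: s2].
Let aK0 : allflips G [:: sp; s2] := conj gp (conj g2 Logic.I).
Let aK1 : allflips G [:: s2] := conj g2 Logic.I.
Lemma quad_Qi0 : quad Qi K0 sq. Proof. exact: (fixf_quad rS gq aK0). Qed.
Lemma quad_Qq0 : quad Qq K0 si. Proof. exact: (fixf_quad rS gi aK0). Qed.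
Lemma quad_01 : quad K0 K1 sp. Proof. exact: (fixf_quad rS gp aK1). Qed.
Lemma quad_1L : quad K1 L s2. Proof. exact: (@fixf_quad G rS s2 [::] g2 Logic.I). Qed.
Let BQi : Bez Qi. Proof. by apply: (LBez ar st); do !split. Qed.
Let BQq : Bez Qq. Proof. by apply: (LBez ar st); do !split. Qed.
Let B0 : Bez K0. Proof. by apply: (LBez ar st). Qed.
Let B1 : Bez K1. Proof. by apply: (LBez ar st). Qed.
Let sK0 := quad_sK quad_Qi0. Let sK1 := quad_sK quad_01.
Let K0i : K0 'i. Proof. by do !split => //; rewrite ?(spi st) ?(s2i st). Qed.
Let K0q : K0 wq. Proof. by do !split => //; rewrite ?(spq st) ?(s2q st). Qed.
Let K1p : K1 wp. Proof. by split => //; rewrite ?(s2p st). Qed.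
Let K1i : K1 'i. Proof. by split => //; rewrite ?(s2i st). Qed.
Let iA : 'i \in Aint :> bool. Proof. by apply: (@Aint_root 2) => //; rewrite sqrCi rpredN Aint1. Qed.
Let wqA : wq \in Aint. Proof. by apply: (@Aint_root 2) => //; rewrite wqK -[q%:R]/((q%:Z)%:~R) Aint_int. Qed.

Lemma qE : q%:R = 4%:R * (q.+1 %/ 4)%:R - 1 :> algC.
Proof.
have e : (4 * (q.+1 %/ 4) = q.+1)%N by move: q8; clear; move: (q) => n; lia.
by rewrite -natrM e -natr1 addrK.
Qed.

(** Half of 1 plus a square root of -q, integral because -q is 1 modulo 4; it generates [K0] over
    Q(i). *)
Definition om : algC := (1 + 'i * wq) / 2%:R.
Lemma om2 : om ^+ 2 = om - ((q.+1) %/ 4)%:R.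
Proof.
have e := qE.
have e1 : ('i * wq) ^+ 2 = 1 - 4%:R * (q.+1 %/ 4)%:R by rewrite exprMn sqrCi wqK e; ring.
transitivity ((1 + 2%:R * ('i * wq) + ('i * wq) ^+ 2) / 4%:R); first by rewrite /om; field.
by rewrite e1 /om; field.
Qed.
Lemma omA : om \in Aint.
Proof.
by apply: (@Aint_quad 1 (- ((q.+1) %/ 4)%:R)); rewrite ?Aint1 ?rpredN ?rpred_nat // mul1r om2.
Qed.
Lemma K0_om : K0 om.
Proof.
by apply: (sfM sK0); [apply: (sfD sK0); [apply: (sf1 sK0) | apply: (sfM sK0)] | apply: (sfV sK0); apply: (sf_nat sK0)].
Qed.
Lemma sq_om : sq om = 1 - om.
Proof. by rewrite /om rmorphM fmorphV rmorphD rmorph1 rmorphM (sqi st) (sqq st) rmorph_nat; field. Qed.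
Lemma om_diff : (om - sq om) ^+ 2 = - q%:R.
Proof. by transitivity ('i ^+ 2 * wq ^+ 2); [rewrite sq_om /om; field | rewrite sqrCi wqK mulN1r]. Qed.

(** [q] is inert in Q(i): the norm form [A ^+ 2 + B ^+ 2] is anisotropic modulo [q]. *)
Lemma prime_Qi_q : primeE Qi q%:R.
Proof.
have QI := quad_Qi ar st; have sK := quad_sK QI.
have q0 : q%:R != 0 :> algC by rewrite pnatr_eq0 -lt0n prime_gt0.
have qq : q%:R / q%:R \in Aint by rewrite divff // Aint1.
have qA : q%:R \in Aint by rewrite -[q%:R]/((q%:Z)%:~R) Aint_int.
split=> //; first by apply: DD_elt => //; apply: (sf_nat sK).
  exact: nat_inv_nA pq.
move=> x Kx xA; have ii : 'i != si 'i by rewrite (sii st) -subr_eq0 opprK -mulr2n mulrn_eq0.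
have [a [b [aq aA bq bA e]]] := quad_basis QI (Qi_i st) iA ii Kx xA.
have /intrP[A eA] := Cint_rat_Aint aq aA; have /intrP[B eB] := Cint_rat_Aint bq bA.
have e' : (-4)%:~R * x = A%:~R + B%:~R * 'i.
  by rewrite -eA -eB -e (sii st) -[(-4)%:~R]/(- 4%:R); transitivity (4%:R * 'i ^+ 2 * x); [rewrite sqrCi; ring | ring].
have q4 : ~~ (q%:Z %| -4)%Z.
  by rewrite dvdzE absz_nat; apply/negP => /(dvdn_leq (isT : (0 < 4)%N)); move: q8; clear; move: (q) => n; lia.
have c4 := cop_int pq q4 q0 qq.
have [/andP[qa qb]|h] := boolP ((q%:Z %| A)%Z && (q%:Z %| B)%Z).
  left; apply: (cop_dvd q0 c4 xA); rewrite e' mulrDl.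
  have dv (m : int) : (q%:Z %| m)%Z -> m%:~R / q%:R \in Aint.
    by case/dvdzP => z ->; rewrite intrM mulfK // Aint_int.
  by apply: rpredD; [exact: dv | rewrite mulrAC; apply: rpredM => //; exact: dv].
right; apply: (@cop_l _ ((-4)%:~R)); last by ai.
apply: (@cop_l _ (A%:~R - B%:~R * 'i)); last by apply: rpredB; ai.
have -> : x * (-4)%:~R * (A%:~R - B%:~R * 'i) = (A ^+ 2 - (-1) * B ^+ 2)%:~R.
  by rewrite [x * _]mulrC e' !expr2 rmorphB !rmorphM /= rmorphN1 -sqrCi; ring.
apply: (cop_int pq) => //; apply/negP => h'; move/negP: h; apply; exact: nsq_rel (ar_N1q ar) h'.
Qed.

Lemma sqe2_i a (al be : bool) : sqe K0 a ((-1) ^+ al * 2 ^+ be) -> sqe K0 a 1 \/ sqe K0 a 'i.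
Proof.
move=> H; have H1 : sqe K0 a (2 ^+ be).
  apply: (sqe_trans sK0 H); exists ('i ^+ al); split; [exact: (sfX sK0) | by rewrite expf_neq0 |].
  by rewrite -exprM mulnC exprM sqrCi mulrC.
case: be H1 {H} => H1; [right | by left].
have i1 : 1 - 'i != 0 :> algC.
  by apply/eqP => e; move/eqP: n2; apply; have -> : 2%:R = (1 - 'i) * (1 + 'i) :> algC; [transitivity (1 - 'i ^+ 2 : algC); [rewrite sqrCi; ring | ring] | rewrite e mul0r].
apply: (sqe_trans sK0 H1); exists (1 - 'i); split=> //; first by apply: (sfB sK0) => //; apply: (sf1 sK0).
have := sqrCi algC; rewrite expr1 => e; transitivity ('i * (1 + 'i ^+ 2) - 2 * 'i ^+ 2 : algC); [rewrite e; ring | ring].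
Qed.

Lemma sqe_up (K K' : cset) a b : (forall x, K x -> K' x) -> sqe K a b -> sqe K' a b.
Proof. by move=> h [z [Kz z0 e]]; exists z; split=> //; apply: h. Qed.

(** With [om] as generator the different of [K0] over Q(i) is a root of -q, so only the prime [q]
    can intervene, and in [K0] it is the square of [wq]. *)
Lemma r_Qi r : Qi r -> SS K0 r -> sqe K0 r 1 \/ sqe K0 r 'i.
Proof.
have QI := quad_Qi ar st; have sK := quad_sK QI.
have q0 : q%:R != 0 :> algC by rewrite pnatr_eq0 -lt0n prime_gt0.
move=> Kr Sr; have wsw : om != sq om.
  by rewrite -subr_eq0 -sqrf_eq0 om_diff oppr_eq0.
have [c [e [dc de rc cA cd]]] := SS_descend quad_Qi0 BQi Kr Sr K0_om omA wsw.
have [|i ci] := div_one (n := 1) sK prime_Qi_q dc cA.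
  by rewrite expr1; move: cd; rewrite om_diff mulNr rpredN.
have SQ : SS Qi (r / q%:R ^+ i).
  have r0 := SS_nz Sr; have q0i : q%:R ^+ i != 0 :> algC by rewrite expf_neq0.
  split; [apply: (sfM sK) => //; apply: (sfV sK); apply: (sfX sK); apply: (sf_nat sK) | by rewrite mulf_neq0 ?invr_eq0 |].
  exists e => //; have e2 : e ^+ 2 != 0 by rewrite expf_neq0 // (DD_nz de).
  have -> : e ^+ 2 = q%:R ^+ i * e ^+ 2 / q%:R ^+ i by field.
  apply: assocM; last exact: assoc_refl (invr_neq0 q0i).
  apply: assoc_sym; apply: (assoc_trans rc); apply: assocM => //; exact: assoc_refl.
have up b : sqe Qi (r / q%:R ^+ i) b -> sqe K0 r b.
  move=> /(sqe_up (quad_sub quad_Qi0)); apply: (sqe_trans sK0).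
  exists (wq ^+ i); split; [exact: (sfX sK0) | by rewrite expf_neq0 |].
  by rewrite -exprM mulnC exprM wqK divfK // expf_neq0.
by case: (S_Qi ar st SQ) => /up; [left | right].
Qed.

(** The integer [(wq + 'i) / 2] differs from its conjugate by the unit ['i], so [K0] is unramified
    over Q(sqrt q) at all finite primes and [r] is already a Selmer element below. *)
Lemma r_Qq r : Qq r -> SS K0 r -> sqe K0 r 1 \/ sqe K0 r 'i.
Proof.
have QQ := quad_Qq ar st; have sK := quad_sK QQ.
move=> Kr Sr; pose w := (wq + 'i) / 2%:R.
have ws : w - si w = 'i by rewrite /w rmorphM fmorphV rmorphD (siq st) (sii st) rmorph_nat; field.
have wsw : w != si w by rewrite -subr_eq0 ws.
have Kw : K0 w by apply: (sfM sK0); [apply: (sfD sK0) | apply: (sfV sK0); apply: (sf_nat sK0)].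
have e := qE.
have wA : w \in Aint.
  apply: (@Aint_quad wq (- ((q.+1) %/ 4)%:R)); rewrite ?rpredN ?rpred_nat //.
  transitivity (wq * w + ('i ^+ 2 - wq ^+ 2) / 4%:R); first by rewrite /w; field.
  by rewrite sqrCi wqK e; field.
have [c [f [dc df rc cA cd]]] := SS_descend quad_Qq0 BQq Kr Sr Kw wA wsw.
have uc : aunit c.
  rewrite /aunit (DD_nz dc) cA /=; move: cd; rewrite ws sqrCi mulN1r rpredN //.
have SQ : SS Qq r.
  split=> //; first exact: SS_nz Sr.
  exists f => //; apply: assoc_sym; apply: (assoc_trans rc).
  by rewrite mulrC; apply: assoc_unit => //; rewrite expf_neq0 // (DD_nz df).
have [al [be H]] := S_Qq ar st SQ; apply: (@sqe2_i _ al be).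
exact: sqe_up (quad_sub quad_Qq0) H.
Qed.

Lemma pk_K0 : pk (SS K0) K0 4.
Proof.
have QI := quad_Qi ar st; have sK := quad_sK QI.
rewrite -[4%N]/(2 * 2)%N; apply: (pk_step quad_Qi0).
  apply: (pk_list (t := [:: 1; 'i]) sK) => x [a Sa ->].
  case: (S_Qi ar st (SS_norm quad_Qi0 BQi Sa)) => h; [exists 1 | exists 'i] => //; rewrite !inE eqxx ?orbT //.
apply: (pk_list (t := [:: 1; 'i]) sK0) => x [kx Sx].
by case: (r_Qi kx Sx) => h; [exists 1 | exists 'i] => //; rewrite !inE eqxx ?orbT.
Qed.

Lemma conj_si x : L x -> si x = x^*.
Proof.
move=> Lx; suff [] : L x /\ si x = (Num.conj : rmC) x by [].
move: x Lx; apply: L_ind; first exact: agree_sf sL.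
have re n : (sqrtC n%:R)^* = sqrtC n%:R :> algC by apply: conj_Creal; rewrite ger0_real // sqrtC_ge0 ler0n.
move=> d; rewrite !inE => /or4P[] /eqP->; split=> //=.
- by rewrite (si2 st) [RHS]re.
- by rewrite (siq st) [RHS]re.
- by rewrite (sip st) [RHS]re.
by rewrite (sii st) [RHS]conjCi.
Qed.
End Pack.

(** * Selmer elements of Q(i, sqrt q, sqrt p) *)

Lemma odd_ndvd (p : nat) (m : int) n : prime p -> odd p -> ~~ (p%:Z %| m)%Z -> ~~ (p%:Z %| 2 ^+ n * m)%Z.
Proof.
move=> pp po pm; elim: n => [|n IH]; first by rewrite expr0 mul1r.
rewrite exprS -mulrA; apply/negP => /(dvdz_primeM pp); rewrite (negPf IH) orbF dvdzE absz_nat /=.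
by rewrite dvdn_prime2 // => /eqP e; move: po; rewrite e.
Qed.

Lemma even_sq (T V N : int) : T * T + V * V = 4 * N -> exists T' V', T = 2 * T' /\ V = 2 * V'.
Proof.
have half (x : int) : exists a, x = 2 * a \/ x = 2 * a + 1 by exists (x %/ 2)%Z; lia.
have [a ha] := half T; have [b hb] := half V => e; exists a, b.
by case: ha => ha; case: hb => hb; subst T V; lia.
Qed.

Section Pack2.
Variables (p q : nat) (s2 sq sp si : rmC).
Hypotheses (ar : arith p q) (st : setup p q s2 sq sp si).
Notation L := (LL p q).
Notation w2 := w2. Notation wq := (wq q). Notation wp := (wp p).
Notation G := (gens p q).
Notation Qi := (Qi p q s2 sq sp). Notation Qq := (Qq p q s2 sp si).
Notation K0 := (K0 p q s2 sp). Notation K1 := (K1 p q s2). Notation om := (om q).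
Let rS : rsq G := @rsq_gens p q.
Let g2 := flips_s2 st. Let gq := flips_sq st. Let gp := flips_sp st. Let gi := flips_si st.
Let L2 : L w2 := @LL_w2 p q. Let Lq : L wq := @LL_wq p q. Let Lp : L wp := @LL_wp p q. Let Li : L 'i := @LL_i p q.
Let sL : is_subfield L := @LL_sf p q.
Let i0 : 'i != 0 :> algC := neq0Ci _.
Let w20 : w2 != 0 := w2_neq0.
Let wq0 : wq != 0 := wq_neq0 ar.
Let wp0 : wp != 0 := wp_neq0 ar.
Let n2 : 2%:R != 0 :> algC. Proof. by rewrite pnatr_eq0. Qed.
Let q8 := ar_q8 ar. Let p8 := ar_p8 ar.
Let pq := ar_q ar.
Let pp := ar_p ar.
Let BQi : Bez Qi. Proof. by apply: (LBez ar st); do !split. Qed.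
Let BQq : Bez Qq. Proof. by apply: (LBez ar st); do !split. Qed.
Let B0 : Bez K0. Proof. by apply: (LBez ar st). Qed.
Let B1 : Bez K1. Proof. by apply: (LBez ar st). Qed.
Let q01 := quad_01 st. Let q1L := quad_1L st. Let qi0 := quad_Qi0 st. Let qq0 := quad_Qq0 st.
Let sK0 := quad_sK qi0. Let sK1 := quad_sK q01.
Let K0i : K0 'i. Proof. by do !split => //; rewrite ?(spi st) ?(s2i st). Qed.
Let K0q : K0 wq. Proof. by do !split => //; rewrite ?(spq st) ?(s2q st). Qed.
Let K1p : K1 wp. Proof. by split => //; rewrite ?(s2p st). Qed.
Let K1i : K1 'i. Proof. by split => //; rewrite ?(s2i st). Qed.
Let iA : 'i \in Aint :> bool. Proof. by apply: (@Aint_root 2) => //; rewrite sqrCi rpredN Aint1. Qed.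
Let wpA : wp \in Aint. Proof. by apply: (@Aint_root 2) => //; rewrite wpK -[p%:R]/((p%:Z)%:~R) Aint_int. Qed.
Let po : odd p. Proof. by move: p8; clear; move: (p) => n; lia. Qed.
Let pqn : ~~ (p%:Z %| q%:Z)%Z.
Proof.
rewrite dvdzE !absz_nat dvdn_prime2 //; apply/eqP => e; move: p8 q8; rewrite e; clear; move: (q) => n; lia.
Qed.
Let p1n : ~~ (p%:Z %| -1)%Z. Proof. by rewrite dvdzE absz_nat /= dvdn1; apply/eqP => e; move: pp; rewrite e. Qed.
Let p4 m : ~~ (p%:Z %| m)%Z -> ~~ (p%:Z %| 4 * m)%Z.
Proof. exact: (odd_ndvd 2 pp po). Qed.

(** Common frame of the two cases: [k], in which [p] splits while its factors stay inert in [K0], is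
    Q(i) if [p] is 5 modulo 8 and Q(sqrt q) if it is 3. *)
Lemma case_gen (k : cset) (tau sig : rmC) (X Y : algC) (x0 y0 : int) : quad (fun x => x \in Crat) k tau -> quad k K0 sig ->
  Bez k -> k X -> tau X = - X -> X ^+ 2 = x0%:~R -> X != 0 -> K0 Y -> sig Y = - Y -> Y ^+ 2 = y0%:~R -> Y != 0 ->
  ~~ (p%:Z %| x0)%Z -> ~~ (p%:Z %| y0)%Z -> ~ sqmod y0 p -> sqmod x0 p ->
  exists t t' j, [/\ primeE K0 t, primeE K0 t', assoc p%:R (t * t'), (p%:Z %| j ^+ 2 - x0)%Z &
   forall a z c c0, c = c0%:~R \/ c = X /\ c0 = j -> ~ sqmod c0 p -> SS K1 a -> k z ->
     (a * sp a) * sig (a * sp a) = c * z ^+ 2 -> False].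
Proof.
move=> qk q0 bk kX tX X2 Xn KY sY Y2 Yn px py ny [j pj]; have sk := quad_sk q0.
have pj0 : ~~ (p%:Z %| j)%Z.
  apply/negP => h; move/negP: px; apply; rewrite -[x0](subKr (j ^+ 2)); apply: rpredB => //.
  by rewrite expr2; apply: dvdz_mulr.
have p2j : ~~ (p%:Z %| 2 * j)%Z := odd_ndvd 1 pp po pj0.
have p0 : p%:R != 0 :> algC by rewrite pnatr_eq0 -lt0n prime_gt0.
have dp : DD k p%:R by apply: DD_elt => //; apply: (sf_nat sk).
have pA : p%:R \in Aint by rewrite -[p%:R]/((p%:Z)%:~R) Aint_int.
have pp1 : p%:R / p%:R \in Aint by rewrite divff // Aint1.
have tp : assoc (tau p%:R) p%:R by rewrite rmorph_nat; apply: assoc_refl.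
have [t [t' [dt dt' [tA tA'] ptt [ct Xt Xt' tt' u]]]] := split_prime sk bk pp kX X2 tX Xn pj p2j dp pA pp1 tp.
have [_ n12 h1 h2] := assocE ptt; have [t0 t0'] := (DD_nz dt, DD_nz dt').
have pn := nat_inv_nA pp.
have tun : aunit t -> aunit t' -> False.
  move=> u1 u2; move/negP: pn; apply; have := aunitM u1 u2; case/and3P=> _ _ v.
  have -> : p%:R^-1 = (t * t')^-1 * (t * t' / p%:R) by field; rewrite t0 t0' p0.
  by ai.
have tn : t^-1 \notin Aint.
  apply/negP => v; have u1 : aunit t by rewrite /aunit t0 tA v.
  apply: tun => //; have : aunit (tau t) by rewrite aunit_aut.
  by move=> u2; have := aunitM (assoc_sym tt') u2; rewrite divfK ?fmorph_eq0.
have tn' : t'^-1 \notin Aint.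
  apply/negP => v; have u1 : aunit t' by rewrite /aunit t0' tA' v.
  apply: tun => //; have := aunitM tt' u1; rewrite divfK // aunit_aut //.
have pt : p%:R / t \in Aint.
  have -> : p%:R / t = p%:R / (t * t') * t' by field; rewrite t0 t0'.
  by ai.
have pt' : p%:R / t' \in Aint.
  have -> : p%:R / t' = p%:R / (t * t') * t by field; rewrite t0 t0'.
  by ai.
have P := prime_K0 qk q0 pp kX tX X2 Xn KY sY Y2 Yn (p4 px) (p4 py) ny.
exists t, t', j; split=> //.
- exact: P dt tA tn pt Xt.
- apply: (P t' (- j)) => //; by rewrite rmorphN opprK.
have XA : X \in Aint by apply: (@Aint_root 2) => //; rewrite X2 Aint_int.
move=> a z c c0 hc nc Sa kz.
have R := Res qk q0 q01 B1 pp kX tX X2 Xn KY sY Y2 Yn K1p (spp st) (wpK p) (p4 px) (p4 py) ny dt tA tA' tn ptt ct t0' Xt po Sa kz.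
apply: (R c c0) => //.
- by case: hc => [-> | [-> _]] //; apply: (sf_int sk).
- by case: hc => [-> | [-> _]] //; ai.
by case: hc => [-> | [-> ->]] //; rewrite subrr mul0r Aint0.
Qed.

(** Only two classes of [K0] occur as norms. If [p] is 5 modulo 8, the further norm to Q(i) is not
    of class ['i], which is a nonresidue at the primes above [p]. If [p] is 3 modulo 8, the further
    norm to Q(sqrt q) is positive, [si] being complex conjugation, and not of class 2. *)
Lemma primes_image : exists t t', [/\ primeE K0 t, primeE K0 t', assoc p%:R (t * t') &
  forall a, SS K1 a -> sqe K0 (a * sp a) 1 \/ sqe K0 (a * sp a) 'i].
Proof.
have i2 : 'i ^+ 2 = (-1)%:~R :> algC by rewrite sqrCi.
have q2 : wq ^+ 2 = q%:Z%:~R by rewrite wqK.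
case: p8 => h8.
  have [t [t' [j [P P' pt pj H]]]] := case_gen (quad_Qi ar st) qi0 BQi (Qi_i st) (sii st) i2 i0 K0q (sqq st) q2 wq0 p1n pqn (ar_qp ar h8) (ar_N1p ar h8).
  exists t, t'; split=> // a Sa; have Sb := SS_norm q01 B0 Sa; have Sn := SS_norm qi0 BQi Sb.
  have b0 := SS_nz Sb; case: (S_Qi ar st Sn) => [[z [kz z0 e]]|[z [kz z0 e]]]; last first.
    exfalso; apply: (H a z 'i j) e => //; first by right.
    move=> [x hx]; move/negP: (ar_i ar h8 x); apply.
    have -> : x ^+ 4 + 1 = (x ^+ 2 - j) * (x ^+ 2 + j) + (j ^+ 2 - -1) by ring.
    by apply: rpredD => //; apply: dvdz_mulr.
  have [r [b [kr r0 Kb b1 eb]]] := hilbert90 qi0 (SS_K Sb) b0 kz (etrans e (mul1r _)).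
  have E : sqe K0 (a * sp a) r by exists b.
  have Sr : SS K0 r by apply: (SS_sqe sK0 _ Sb); apply: (sqe_sym sK0).
  by case: (r_Qi ar st kr Sr) => h; [left | right]; apply: (sqe_trans sK0 E).
have [t [t' [j [P P' pt pj H]]]] := case_gen (quad_Qq ar st) qq0 BQq (Qq_wq st) (sqq st) q2 wq0 K0i (sii st) i2 i0 pqn p1n (ar_N1p' ar h8) (ar_qp' ar h8).
exists t, t'; split=> // a Sa; have Sb := SS_norm q01 B0 Sa; have Sn := SS_norm qq0 BQq Sb.
have b0 := SS_nz Sb; have [al [be [z [kz z0 e]]]] := S_Qq ar st Sn.
have Lb : L (a * sp a) := fixf_L (SS_K Sb).
have pos : 0 < (a * sp a) * si (a * sp a).
  by rewrite (conj_si st Lb) mulrC -normCKC exprn_gt0 // normr_gt0.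
have z2 : 0 <= z ^+ 2.
  have zr := KR (quad_Qq ar st) (Qq_wq st) (sqq st) q2 (_ : 0 < wq) kz.
  by rewrite real_exprn_even_ge0 // zr // sqrtC_gt0 ltr0n prime_gt0.
have al0 : al = false.
  apply/negP => al1; move: pos; rewrite e al1 expr1 mulN1r mulNr oppr_gt0 => /lt_geF; rewrite mulr_ge0 //.
  by case: (be).
rewrite al0 expr0 mul1r in e.
case: be e => e; first by exfalso; apply: (H a z 2 2) e => //; [left | apply: (ar_2p ar)].
have [r [b [kr r0 Kb b1 eb]]] := hilbert90 qq0 (SS_K Sb) b0 kz (etrans e (mul1r _)).
have E : sqe K0 (a * sp a) r by exists b.
have Sr : SS K0 r by apply: (SS_sqe sK0 _ Sb); apply: (sqe_sym sK0).
by case: (r_Qq ar st kr Sr) => h; [left | right]; apply: (sqe_trans sK0 E).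
Qed.

(** [nu] is half of 1 plus a root of that one of p and -p which is 1 modulo 4. It is even 5 modulo
    8, so [mu] is odd and the equation of [nu] is irreducible modulo 2. *)
Lemma nu_exists : exists (nu : algC) (mu : int) (e : bool), [/\ K1 nu, nu \in Aint, nu ^+ 2 = nu + mu%:~R, sp nu = 1 - nu &
  (nu - sp nu) ^+ 2 = (-1) ^+ e * p%:R /\ ~~ (2%:Z %| mu)%Z].
Proof.
have [n en] : exists n : nat, p = (8 * n + 5)%N \/ p = (8 * n + 3)%N.
  by exists (p %/ 8)%N; move: p8; clear; move: (p) => m; lia.
have Kw (x : algC) : K1 x -> K1 ((1 + x) / 2%:R).
  by move=> Kx; apply: (sfM sK1); [apply: (sfD sK1) => //; apply: (sf1 sK1) | apply: (sfV sK1); apply: (sf_nat sK1)].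
have gen (x : algC) mu : x ^+ 2 = (4 * mu + 1)%:~R -> ((1 + x) / 2%:R) ^+ 2 = (1 + x) / 2%:R + mu%:~R.
  rewrite intrD intrM -[4%:~R]/(4%:R) -[1%:~R]/(1) => e.
  transitivity ((1 + 2%:R * x + x ^+ 2) / 4%:R); first by field.
  by rewrite e; field.
have fin (x : algC) mu : ((1 + x) / 2%:R) ^+ 2 = (1 + x) / 2%:R + mu%:~R -> (1 + x) / 2%:R \in Aint.
  by move=> e; apply: (@Aint_quad 1 mu%:~R); rewrite ?Aint1 ?Aint_int // mul1r.
case: en => en.
  exists ((1 + wp) / 2%:R), (2 * n%:Z + 1), false.
  have e1 : wp ^+ 2 = (4 * (2 * n%:Z + 1) + 1)%:~R.
    by rewrite wpK -[p%:R]/(p%:Z%:~R); congr (_%:~R); rewrite en; clear; lia.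
  have spn : sp ((1 + wp) / 2%:R) = 1 - (1 + wp) / 2%:R.
    by rewrite rmorphM fmorphV rmorphD rmorph1 (spp st) rmorph_nat; field.
  split=> //; [exact: Kw | exact: fin (gen _ _ e1) | exact: gen |].
  split; first by rewrite spn expr0 mul1r; transitivity (wp ^+ 2); [field | exact: wpK].
  by rewrite dvdzE; clear; lia.
exists ((1 + 'i * wp) / 2%:R), (- (2 * n%:Z + 1)), true.
have e1 : ('i * wp) ^+ 2 = (4 * - (2 * n%:Z + 1) + 1)%:~R.
  rewrite exprMn sqrCi wpK mulN1r -[p%:R]/(p%:Z%:~R) -rmorphN; congr (_%:~R); rewrite en; clear; lia.
have spn : sp ((1 + 'i * wp) / 2%:R) = 1 - (1 + 'i * wp) / 2%:R.
  by rewrite rmorphM fmorphV rmorphD rmorph1 rmorphM (spp st) (spi st) rmorph_nat; field.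
split=> //; [by apply: Kw; apply: (sfM sK1) | exact: fin (gen _ _ e1) | exact: gen |].
split; last by rewrite dvdzE; clear; lia.
by transitivity ('i ^+ 2 * wp ^+ 2); [rewrite spn; field | rewrite sqrCi wpK expr1].
Qed.

(** The norm image contributes 2. The kernel contributes 8: four ideals above [p] times four classes
    of [K0], halved because [p] becomes a square. *)
Lemma pk_K1 : pk (SS K1) K1 16.
Proof.
have [t [t' [P P' pt H]]] := primes_image; have [nu [mu [e [Kn nA n2e spn [nd _]]]]] := nu_exists.
rewrite -[16%N]/(2 * 8)%N; apply: (pk_step q01).
  apply: (pk_list (t := [:: 1; 'i]) sK0) => x [a Sa ->].
  by case: (H a Sa) => h; [exists 1 | exists 'i] => //; rewrite !inE eqxx ?orbT.
apply: (pk_half q01 K1p (spp st) wp0).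
rewrite -[(2 * 8)%N]/(4 * 4)%N.
have p0 : p%:R != 0 :> algC by rewrite pnatr_eq0 -lt0n prime_gt0.
have dn0 : (nu - sp nu) ^+ 2 != 0 by rewrite nd mulf_neq0 // signr_eq0.
apply: (pk_two (m := 1) (n := 1) q01 B0 P P' Kn nA); last exact: pk_K0 ar st.
  by rewrite -subr_eq0 -sqrf_eq0.
have [_ _ _ h] := assocE pt; rewrite !expr1 nd invfM mulrCA invr_sign; ai.
all: by rewrite ?rpredN ?Aint1.
Qed.

Let aAint n : n%:R \in Aint. Proof. by rewrite -[n%:R]/((n%:Z)%:~R) Aint_int. Qed.

Lemma Qi_int y : Qi y -> y \in Aint -> exists A B : int, y = A%:~R + B%:~R * 'i.
Proof.
move=> Ky yA; have QI := quad_Qi ar st; have syA : si y \in Aint by ai.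
have i2 : 'i ^+ 2 = (-1)%:~R :> algC by rewrite sqrCi.
have [a [b [aq bq e nrm]]] := quadQ_coord QI (Qi_i st) (sii st) i2 i0 Ky.
have sb c : c \in Crat -> si c = c by exact: (quad_fix QI).
have esi : si y = a - b * 'i by rewrite e rmorphD rmorphM (sii st) !sb // mulrN.
have /intrP[T eT] : 2%:R * a \in Num.int.
  apply: Cint_rat_Aint; first by rewrite rpredM // rpred_nat.
  have -> : 2%:R * a = y + si y by rewrite esi e; ring.
  by apply: rpredD.
have /intrP[N eN] : a ^+ 2 + b ^+ 2 \in Num.int.
  apply: Cint_rat_Aint; first by rewrite rpredD // rpredX.
  have -> : a ^+ 2 + b ^+ 2 = y * si y by rewrite nrm rmorphN1; ring.
  by ai.
have /intrP[V eV] : 2%:R * b \in Num.int.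
  apply: Cint_rat_Aint; first by rewrite rpredM // rpred_nat.
  apply: (@Aint_root 2) => //; have -> : (2%:R * b) ^+ 2 = 4%:R * (a ^+ 2 + b ^+ 2) - (2%:R * a) ^+ 2 by ring.
  by rewrite eN eT; apply: rpredB; ai.
have eq : T * T + V * V = 4 * N.
  by apply: (@intr_inj algC); rewrite intrD !intrM -eT -eV -eN -[4%:~R]/(4%:R); ring.
have [T' [V' [hT hV]]] : exists T' V' : int, T = 2 * T' /\ V = 2 * V'.
  exact: even_sq eq.
rewrite hT intrM in eT; rewrite hV intrM in eV; exists T', V'.
by rewrite e (mulfI n2 eT) (mulfI n2 eV).
Qed.
End Pack2.

(** * Primes above 2, Selmer elements of L and its classes of order 2 *)

Section Pack3.
Variables (p q : nat) (s2 sq sp si : rmC).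
Hypotheses (ar : arith p q) (st : setup p q s2 sq sp si).
Notation L := (LL p q).
Notation w2 := w2. Notation wq := (wq q). Notation wp := (wp p).
Notation Qi := (Qi p q s2 sq sp).
Notation K0 := (K0 p q s2 sp). Notation K1 := (K1 p q s2). Notation om := (om q).
Let g2 := flips_s2 st. Let gq := flips_sq st. Let gp := flips_sp st. Let gi := flips_si st.
Let sL : is_subfield L := @LL_sf p q.
Let w20 : w2 != 0 := w2_neq0.
Let n2 : 2%:R != 0 :> algC. Proof. by rewrite pnatr_eq0. Qed.
Let q8 := ar_q8 ar. Let p8 := ar_p8 ar.
Let pq := ar_q ar. Let pp := ar_p ar.
Let BQi : Bez Qi. Proof. by apply: (LBez ar st); do !split. Qed.
Let B0 : Bez K0. Proof. by apply: (LBez ar st). Qed.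
Let B1 : Bez K1. Proof. by apply: (LBez ar st). Qed.
Let q01 := quad_01 st. Let q1L := quad_1L st. Let qi0 := quad_Qi0 st.
Let sK0 := quad_sK qi0. Let sK1 := quad_sK q01.
Let K1i : K1 'i. Proof. by split; [apply: LL_i | rewrite ?(s2i st)]. Qed.
Let iA : 'i \in Aint :> bool. Proof. by apply: (@Aint_root 2) => //; rewrite sqrCi rpredN Aint1. Qed.
Let aAint n : n%:R \in Aint. Proof. by rewrite -[n%:R]/((n%:Z)%:~R) Aint_int. Qed.
Let K1om : K1 om := quad_sub q01 (K0_om st).
Let omA : om \in Aint := omA ar.
Let wqn0 : wq != 0 := wq_neq0 ar.
Let one_i : 1 + 'i != 0 :> algC.
Proof.
apply/eqP => e; move/eqP: n2; apply; have -> : 2%:R = (1 - 'i) * (1 + 'i) :> algC; last by rewrite e mulr0.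
by transitivity (1 - 'i ^+ 2 : algC); [rewrite sqrCi; ring | ring].
Qed.
Let two_i : 2%:R = (1 - 'i) * (1 + 'i) :> algC.
Proof. by transitivity (1 - 'i ^+ 2 : algC); [rewrite sqrCi; ring | ring]. Qed.
Let i1A : 1 + 'i \in Aint. Proof. by apply: rpredD => //; apply: Aint1. Qed.
Let i2A : 1 - 'i \in Aint. Proof. by apply: rpredB => //; apply: Aint1. Qed.

(** Modulo [t] the element ['i] is 1 and [om] is the integer [o], while [nu] satisfies a quadratic
    equation irreducible modulo 2; so an integer reduces to [M + N * nu], whose norm is odd unless
    both coordinates are even. *)
Lemma prime_lam t (o : int) : DD K1 t -> t \in Aint -> t^-1 \notin Aint -> (1 + 'i) / t \in Aint ->
  (om - o%:~R) / t \in Aint -> primeE K1 t.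
Proof.
move=> dt tA tn it ot; have t0 := DD_nz dt.
have t2 : 2%:R / t \in Aint by rewrite two_i -mulrA; ai.
have [nu [mu [e [Kn nA n2e spn [nd mu2]]]]] := nu_exists ar st.
have red y : K0 y -> y \in Aint -> exists M : int, (- q%:R * y - M%:~R) / t \in Aint.
  move=> Ky yA; have osq : om != sq om.
    by rewrite -subr_eq0 -sqrf_eq0 (om_diff st) oppr_eq0 -wqK expf_neq0.
  have [a [b [ka aA kb bA e1]]] := quad_basis qi0 (K0_om st) omA osq Ky yA.
  have [A [B eA]] := Qi_int ar st ka aA; have [C [D eC]] := Qi_int ar st kb bA.
  exists ((A - B) + (C - D) * o); rewrite -(om_diff st) e1.
  have -> : (a + b * om - ((A - B) + (C - D) * o)%:~R) / t =
    B%:~R * ((1 + 'i) / t) + D%:~R * ((1 + 'i) / t) * o%:~R + b * ((om - o%:~R) / t).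
    by rewrite eA eC intrD intrM !rmorphB /=; field.
  by apply: rpredD; [apply: rpredD |]; ai.
split=> // x Kx xA.
have nn : nu != sp nu by rewrite -subr_eq0 -sqrf_eq0 nd mulf_neq0 ?signr_eq0 // pnatr_eq0 -lt0n prime_gt0.
have [a [b [ka aA kb bA e1]]] := quad_basis q01 Kn nA nn Kx xA.
have [M hM] := red a ka aA; have [N hN] := red b kb bA.
(* The product of the discriminants of [om] and [nu]: an odd denominator, hence harmless at 2. *)
pose D : int := - q%:Z * ((-1) ^+ e * p%:Z).
have eD : D%:~R = - q%:R * ((-1) ^+ e * p%:R) :> algC.
  by rewrite /D !intrM rmorphN /= rmorphXn /= rmorphN1.
have cong : (D%:~R * x - (M%:~R + N%:~R * nu)) / t \in Aint.
  have -> : D%:~R * x = - q%:R * (a + b * nu) by rewrite eD -e1 nd; ring.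
  have -> : (- q%:R * (a + b * nu) - (M%:~R + N%:~R * nu)) / t = (- q%:R * a - M%:~R) / t + (- q%:R * b - N%:~R) / t * nu by field.
  by apply: rpredD => //; ai.
have D2 : ~~ (2%:Z %| D)%Z.
  rewrite dvdzE !abszM abszN !absz_nat abszX /= exp1n mul1n.
  by move: p8 q8; clear; move: (p) (q) => a b; lia.
have cD := cop_int (isT : prime 2) D2 t0 t2.
have dv (m : int) : (2%:Z %| m)%Z -> m%:~R / t \in Aint.
  by case/dvdzP => z ->; rewrite intrM -mulrA; ai.
have [/andP[pM pN]|h] := boolP ((2%:Z %| M)%Z && (2%:Z %| N)%Z).
  left; apply: (cop_dvd t0 cD xA).
  rewrite -[D%:~R * x](subrK (M%:~R + N%:~R * nu)) mulrDl; apply: rpredD => //.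
  by rewrite mulrDl mulrAC; apply: rpredD; [exact: dv | apply: rpredM => //; exact: dv].
right; apply: (@cop_l _ (D%:~R)); last by ai.
apply: (@cop_cong (M%:~R + N%:~R * nu)) => //; last first.
  by rewrite -rpredN -mulNr opprB [x * _]mulrC.
apply: (@cop_l _ (M%:~R + N%:~R - N%:~R * nu)); last by apply: rpredB; [apply: rpredD |]; ai.
have -> : (M%:~R + N%:~R * nu) * (M%:~R + N%:~R - N%:~R * nu) = (M * M + M * N - N * N * mu)%:~R.
  rewrite rmorphB rmorphD !rmorphM /=.
  transitivity (M%:~R * M%:~R + M%:~R * N%:~R - N%:~R * N%:~R * (nu ^+ 2 - nu)); first by ring.
  by rewrite n2e; ring.
apply: (cop_int (isT : prime 2)) => //; clear -h mu2.
have half (x : int) : exists a, x = 2 * a \/ x = 2 * a + 1 by exists (x %/ 2)%Z; lia.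
apply/negP => /dvdzP[z ez].
have [a ha] := half M; have [b hb] := half N; have [c hc] := half mu.
case: hc => hc; first by move/negP: mu2; apply; apply/dvdzP; exists c; rewrite hc mulrC.
have [M1|N1] : M = 2 * a + 1 \/ N = 2 * b + 1.
- case: ha => ha; last by left.
  case: hb => hb; last by right.
  by exfalso; move/negP: h; apply; apply/andP; split; apply/dvdzP; [exists a | exists b]; rewrite ?ha ?hb mulrC.
- by clear ha; case: hb => hb; subst M N mu; lia.
by clear hb; case: ha => ha; subst M N mu; lia.
Qed.

(** As [q] is 7 modulo 8, [om * (1 - om)] is divisible by 2, so [1 + 'i] factors through its gcds
    with [om] and with [1 - om]. *)
Lemma lam_exists : exists t t' : algC, [/\ primeE K1 t, primeE K1 t' & t * t' / (1 + 'i) \in Aint].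
Proof.
have r8 : (q.+1 %/ 4 = 2 * (q.+1 %/ 8))%N by move: q8; clear; move: (q) => b; lia.
have or : om * (1 - om) = (q.+1 %/ 8)%:R * 2%:R.
  rewrite -natrM mulnC -r8; have := om2 ar => e.
  by transitivity (om - om ^+ 2); [ring | rewrite e; ring].
have q40 : (q.+1 %/ 8)%:R != 0 :> algC.
  by rewrite pnatr_eq0; move: q8; clear; move: (q) => b; lia.
have om0 : om * (1 - om) != 0 by rewrite or mulf_neq0.
have [o1 o2] : om != 0 /\ 1 - om != 0 by move: om0; rewrite mulf_eq0 negb_or => /andP[].
have oA' : 1 - om \in Aint by apply: rpredB => //; apply: Aint1.
have K1o' : K1 (1 - om) by apply: (sfB sK1) => //; apply: (sf1 sK1).
have K1i' : K1 (1 + 'i) by apply: (sfD sK1) => //; apply: (sf1 sK1).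
have di := DD_elt sK1 K1i' one_i.
have [t [dt it ot ut]] := DD_gcd B1 di (DD_elt sK1 K1om o1).
have [t' [dt' it' ot' ut']] := DD_gcd B1 di (DD_elt sK1 K1o' o2).
have [t0 t0'] := (DD_nz dt, DD_nz dt').
have tA : t \in Aint by rewrite -[t]divr1; apply: ut; rewrite ?oner_neq0 ?divr1.
have tA' : t' \in Aint by rewrite -[t']divr1; apply: ut'; rewrite ?oner_neq0 ?divr1.
have d2 : t * t' / (1 + 'i) \in Aint.
  have e1 : (1 + 'i) / t' != 0 :> algC by rewrite mulf_neq0 ?invr_eq0.
  have h1 := ut _ e1; rewrite !invf_div in h1; rewrite -mulrA; apply: h1; first by rewrite mulrCA divff // mulr1.
  have e2 : (1 + 'i) / om != 0 by rewrite mulf_neq0 ?invr_eq0.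
  have h2 := ut' _ e2; rewrite !invf_div in h2; rewrite mulrCA; apply: h2; first by rewrite mulrCA divff // mulr1.
  by rewrite mulrA [(1 - om) * _]mulrC or two_i mulrA mulfK //; apply: rpredM.
(* [sq] fixes [1 + 'i] and exchanges [om] with [1 - om]; if one of the two gcds were a unit, so
   would be the other, and [1 + 'i] as well. *)
have sqi1 : sq (1 + 'i) = 1 + 'i by rewrite rmorphD rmorph1 (sqi st).
have [st0 st0'] : sq t != 0 /\ sq t' != 0 by rewrite !fmorph_eq0.
have h1 : t' / sq t \in Aint.
  apply: ut' => //; first by rewrite -sqi1 -fmorphV -rmorphM; apply: Aintg.
  by rewrite -(sq_om st) -fmorphV -rmorphM; apply: Aintg.
have h2 : t / sq t' \in Aint.
  apply: ut => //; first by rewrite -sqi1 -fmorphV -rmorphM; apply: Aintg.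
  have -> : om = sq (1 - om) by rewrite rmorphB rmorph1 (sq_om st); ring.
  by rewrite -fmorphV -rmorphM; apply: Aintg.
have tun : t^-1 \in Aint -> t'^-1 \in Aint -> False.
  move=> v v'; move/negP: (nat_inv_nA (isT : prime 2)); apply.
  have -> : 2%:R^-1 = ((t * t' / (1 + 'i)) * (t^-1 * t'^-1)) ^+ 2 * ('i : algC).
    rewrite two_i; have e : (1 - 'i) * 'i = 1 + 'i :> algC by transitivity ('i - 'i ^+ 2 : algC); [ring | rewrite sqrCi; ring].
    have i1n : 1 - 'i != 0 :> algC by apply/eqP => z; move/eqP: n2; apply; rewrite two_i z mul0r.
    have -> : ((t * t' / (1 + 'i)) * (t^-1 * t'^-1)) = (1 + 'i)^-1 by field; rewrite t0 t0' one_i.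
    apply: (mulfI (mulf_neq0 i1n one_i)); rewrite divff ?mulf_neq0 //.
    transitivity (((1 - 'i) * 'i) * (1 + 'i)^-1 * ((1 + 'i) * (1 + 'i)^-1) : algC); last by ring.
    by rewrite e divff // mulr1.
  by apply: rpredM iA; apply: rpredX; apply: (rpredM d2); apply: rpredM.
have swap a b : a / sq b \in Aint -> a^-1 \in Aint -> a != 0 -> b != 0 -> b^-1 \in Aint.
  move=> h v a0 b0; rewrite -(Aint_aut sq) fmorphV.
  have -> : (sq b)^-1 = (a / sq b) * a^-1 by field; rewrite a0 fmorph_eq0.
  by ai.
have tn : t^-1 \notin Aint by apply/negP => v; apply: (tun v); apply: (swap t t').
have tn' : t'^-1 \notin Aint by apply/negP => v; apply: (tun _ v); apply: (swap t' t).
exists t, t'; split=> //.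
  by apply: (prime_lam (o := 0)) => //; rewrite rmorph0 subr0.
apply: (prime_lam (o := 1)) => //.
by rewrite -rpredN -mulNr opprB.
Qed.

(** The norm image has at most 16 classes, and the kernel four ideals times 16 classes, halved
    because 2 becomes a square. The different of [z8] over [K1] is [2 * z8], whose square is
    [(1 + 'i) ^+ 4] up to a unit; fourth powers of the two primes cover it. *)
Lemma pk_L : pk (SS L) L 512.
Proof.
have [t [t' [P P' ht]]] := lam_exists.
rewrite -[512%N]/(16 * 32)%N; apply: (pk_step q1L).
  move=> I f fP inj; apply: (pk_K1 ar st (f := f)) => // i.
  by have [a Sa ->] := fP i; apply: (SS_norm q1L B1).
apply: (pk_half q1L (@LL_w2 p q) (s22 st) w20).
rewrite -[(2 * 32)%N]/(4 * 16)%N.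
have [Lz uz] := UL_z8 p q; have zA : z8 \in Aint by case/and3P: uz.
have zn : z8 != 0 by case/and3P: uz.
have zd : z8 - s2 z8 = 2%:R * z8 by rewrite (s2_z8 st); ring.
apply: (pk_two (m := 4) (n := 4) q1L B1 P P' Lz zA); last exact: pk_K1 ar st.
  by rewrite -subr_eq0 zd mulf_neq0.
rewrite zd exprMn z8K; have -> : t ^+ 4 * t' ^+ 4 / (2%:R ^+ 2 * 'i) = (t * t' / (1 + 'i)) ^+ 4 * 'i.
  have e4 : (1 + 'i) ^+ 4 = - 4%:R :> algC.
    transitivity ((1 + 'i ^+ 2 + 2%:R * 'i) ^+ 2 : algC); first by ring.
    by rewrite sqrCi addrN add0r exprMn sqrCi; ring.
  rewrite expr_div_n e4 -[RHS]mulr1 -[X in _ = _ * X](divff (neq0Ci algC)) -exprMn.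
  have -> : (t * t') ^+ 4 / - 4%:R * 'i * ('i / 'i) = (t * t') ^+ 4 * 'i ^+ 2 / (- 4%:R * 'i) by field; rewrite (neq0Ci algC).
  rewrite sqrCi; field; rewrite (neq0Ci algC) //.
have [tA tA'] : t \in Aint /\ t' \in Aint by case: P P' => _ ? _ _ [].
by ai.
Qed.

(* 2^8 units times 2^2 Selmer elements would exceed the bound 2^9. *)
Lemma A2 a b : DD L a -> DD L b -> pr L (a ^+ 2) -> pr L (b ^+ 2) -> ~ pr L a -> ~ pr L b -> pr L (a * b).
Proof.
move=> da db [al La aal] [be Lb bbe] na nb; apply: NNPP => nab.
have [a0 b0] := (DD_nz da, DD_nz db); have [al0 be0] := (assoc_nz2 aal, assoc_nz2 bbe).
have [f [Uf inj]] := units_many ar st.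
pose F (x : ({ffun 'I_7 -> bool} * bool) * (bool * bool)) := f x.1 * (al ^+ x.2.1 * be ^+ x.2.2).
have Sal : SS L al by split=> //; exists a.
have Sbe : SS L be by split=> //; exists b.
have S1 (c : bool) x : SS L x -> SS L (x ^+ c).
  by case: c => //= _; apply: (SS_unit sL (sf1 sL) aunit1).
have SF x : SS L (F x).
  by apply: (SSM sL); [have [Lf uf] := Uf x.1; apply: SS_unit | apply: (SSM sL); apply: S1].
suff IF x y : sqe L (F x) (F y) -> x = y.
  have := pk_L SF IF; rewrite !card_prod card_ffun !card_bool card_ord => h.
  by exfalso; move: h; vm_compute.
have abn (c d : bool) : c || d -> ~ pr L (a ^+ c * b ^+ d).
  by case: c; case: d => // _; rewrite ?expr0 ?expr1 ?mul1r ?mulr1.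
case: x y => [x [c d]] [y [c' d']]; rewrite /F /= => -[z [Lz z0 e]].
have [fx0 fy0] : f x != 0 /\ f y != 0.
  by split; [have [_ /and3P[]] := Uf x | have [_ /and3P[]] := Uf y].
(* Different exponents of [al] or [be] would, after a square root is taken, make [a], [b] or [a * b]
   principal. *)
have E : [&& c == c' & d == d'].
  apply/negPn/negP => ne.
  have hc : (c (+) c') || (d (+) d') by move: ne; case: (c); case: (c'); case: (d); case: (d').
  apply: (abn _ _ hc).
  pose X := al ^+ c * be ^+ d; pose Y := al ^+ c' * be ^+ d'.
  have X0 : X != 0 by rewrite mulf_neq0 // expf_neq0.
  have Y0 : Y != 0 by rewrite mulf_neq0 // expf_neq0.
  have sq2 u (n : bool) : u ^+ 2 ^+ n = (u ^+ n) ^+ 2 :> algC by rewrite -!exprM mulnC.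
  have h1 : assoc ((a ^+ c * b ^+ d) ^+ 2) X by rewrite exprMn -!sq2; apply: assocM; apply: assocX.
  have h2 : assoc ((a ^+ c' * b ^+ d') ^+ 2) Y by rewrite exprMn -!sq2; apply: assocM; apply: assocX.
  have xy : assoc X (Y * z ^+ 2).
    have -> : X = (Y * z ^+ 2) * (f y / f x) by apply: (mulfI fx0); rewrite e -/Y; field.
    apply: assoc_unit; first by rewrite mulf_neq0 // expf_neq0.
    by apply: aunitM; [case: (Uf y) | apply: aunitV; case: (Uf x)].
  have h3 : assoc (a ^+ c * b ^+ d) (a ^+ c' * b ^+ d' * z).
    apply: (@assoc_root 2) => //; rewrite [X in assoc _ X]exprMn.
    apply: (assoc_trans h1); apply: (assoc_trans xy); apply: assocM; first exact: assoc_sym.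
    by apply: assoc_refl; rewrite expf_neq0.
  have m2 (u : algC) (m m' : bool) : u ^+ (m (+) m') * u ^+ 2 ^+ (m && m') = u ^+ m * u ^+ m'.
    by case: m; case: m'; rewrite ?expr0 ?expr1 ?mulr1 ?mul1r.
  have p2 u v (m : bool) : assoc (u ^+ 2) v -> L v -> pr L (u ^+ 2 ^+ m).
    by move=> uv Lv; exists (v ^+ m); [apply: (sfX sL) | apply: assocX].
  have P2 : pr L ((a ^+ c * b ^+ d) * (a ^+ c' * b ^+ d')).
    apply: (pr_assoc (a := (a ^+ c' * b ^+ d') ^+ 2 * z)).
      rewrite expr2 mulrAC; apply: assocM; first exact: assoc_sym.
      by apply: assoc_refl; rewrite mulf_neq0 // expf_neq0.
    exists (Y * z); first by apply: (sfM sL) => //; apply: (sfM sL); apply: (sfX sL).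
    by apply: assocM => //; apply: assoc_refl.
  have -> : a ^+ (c (+) c') * b ^+ (d (+) d') = (a ^+ c * b ^+ d) * (a ^+ c' * b ^+ d') * (a ^+ 2 ^+ (c && c') * b ^+ 2 ^+ (d && d'))^-1.
    have q0 : a ^+ 2 ^+ (c && c') * b ^+ 2 ^+ (d && d') != 0 by rewrite mulf_neq0 // !expf_neq0.
    apply: (mulIf q0); rewrite divfK // mulrACA !m2; ring.
  apply: (prM sL) => //; apply: (prV sL); apply: (prM sL); [exact: p2 aal La | exact: p2 bbe Lb].
case/andP: E e => /eqP-> /eqP-> e; congr (_, _); apply: inj; exists z; split=> //.
have X0 : al ^+ c' * be ^+ d' != 0 by rewrite mulf_neq0 // expf_neq0.
by apply: (mulIf X0); rewrite e; ring.
Qed.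
End Pack3.

(** * A prime above p and the relation for its fourth power *)

(** Automorphisms that agree on [K] give the same conjugate ideal, though in general different ideal
    numbers. *)
Lemma DD_agreeK (K : cset) (g h : rmC) a : (forall x, K x -> g x = h x) -> DD K a -> assoc (g a) (h a).
Proof.
move=> e da; have a0 := DD_nz da; have [_ [s [sK sa s1]]] := da.
have H (f f' : rmC) : (forall x, K x -> f x = f' x) -> f a / f' a \in Aint.
  move=> ff; have fa0 : f' a != 0 by rewrite fmorph_eq0.
  have -> : f a / f' a = \sum_(u <- s) f' (u.1 / a) * f (u.2 * a).
    transitivity (f (\sum_(u <- s) u.1 * u.2) * f a / f' a); first by rewrite s1 rmorph1 mul1r.
    rewrite rmorph_sum /= !mulr_suml big_seq [RHS]big_seq; apply: eq_bigr => u us.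
    by have [K1 K2] := sK u us; rewrite !rmorphM fmorphV (ff _ K1); ring.
  by rewrite big_seq rpred_sum // => u us; have [h1 h2] := sa u us; apply: rpredM; apply: Aintg.
by apply: assocI; rewrite ?fmorph_eq0 //; apply: H => // x Kx; rewrite e.
Qed.

Lemma cop_mul_dvd a b x : a != 0 -> b != 0 -> cop a b -> x / a \in Aint -> x / b \in Aint -> x / (a * b) \in Aint.
Proof.
move=> a0 b0 [u [v [uA vA e]]] ha hb.
have -> : x / (a * b) = x / b * u + x / a * v.
  transitivity (x * (a * u + b * v) / (a * b)); first by rewrite e mulr1.
  by field; rewrite a0 b0.
by apply: rpredD; apply: rpredM.
Qed.

Lemma cop_dvd_r x t t' : cop x t -> t' != 0 -> t / t' \in Aint -> cop x t'.
Proof. by move=> c t0 h; apply: (@cop_r _ _ (t / t')) => //; rewrite mulrC divfK. Qed.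
Lemma cop_dvd_l x y t : cop x t -> y != 0 -> x / y \in Aint -> cop y t.
Proof. by move=> c y0 h; apply: (@cop_l _ (x / y)) => //; rewrite mulrC divfK. Qed.

(** The gcd with the root of [p], as for [ram_prime], now for any factor of [p] that is comaximal to
    its cofactor. *)
Lemma sqrt_ram K (p : nat) wp t t' : is_subfield K -> Bez K -> K wp -> wp != 0 -> wp ^+ 2 = p%:R ->
  DD K t -> t \in Aint -> t' \in Aint -> t' != 0 -> cop t t' -> assoc p%:R (t * t') ->
  exists t1, DD K t1 /\ assoc (t1 ^+ 2) t.
Proof.
move=> sK bK Kw w0 w2 dt tA tA' t0' ct ptt; have t0 := DD_nz dt.
have p0 : p%:R != 0 :> algC by rewrite -w2 expf_neq0.
have [_ _ pd1 pd2] := assocE ptt.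
have pt : p%:R / t \in Aint.
  by have -> : p%:R / t = p%:R / (t * t') * t'; [field; rewrite t0 t0' | apply: rpredM].
have wA : wp \in Aint by apply: (@Aint_root 2) => //; rewrite w2 -[p%:R]/((p%:Z)%:~R) Aint_int.
have [t1 [d1 h1 h2 u]] := DD_gcd bK dt (DD_elt sK Kw w0); have n1 := DD_nz d1.
have tA1 : t1 \in Aint by rewrite -[t1]divr1; apply: u; rewrite ?oner_neq0 ?divr1.
have a1 : t1 ^+ 2 / t \in Aint.
  have e1 : t / t1 != 0 by rewrite mulf_neq0 ?invr_eq0.
  have := u _ e1; rewrite !invf_div !mulrA -expr2; apply; first by rewrite mulrAC divff // mul1r.
  have e2 : t / wp != 0 by rewrite mulf_neq0 ?invr_eq0.
  have := u _ e2; rewrite !invf_div !mulrA [t1 * _]mulrC; apply; first by rewrite mulrAC divff // mul1r.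
  by rewrite -expr2 w2.
have n2 : t1 ^+ 2 != 0 by rewrite expf_neq0.
exists t1; split=> //; apply: assocI => //.
have c1 : cop t1 t' by apply: cop_dvd_l ct _ _.
have c2 : cop t' (t1 ^+ 2) by apply: cop_sym; rewrite expr2; apply: copM.
apply: (cop_dvd n2 c2 tA).
have -> : t' * t / t1 ^+ 2 = (wp / t1) ^+ 2 * (t * t' / p%:R) by rewrite expr_div_n w2; field; rewrite p0 n1.
by apply: rpredM => //; apply: rpredX.
Qed.

Section Frak.
Variables (p q : nat) (s2 sq sp si : rmC).
Hypotheses (ar : arith p q) (st : setup p q s2 sq sp si).
Notation L := (LL p q).
Notation w2 := w2. Notation wq := (wq q). Notation wp := (wp p).
Notation G := (gens p q).
Notation Qi := (Qi p q s2 sq sp). Notation Qq := (Qq p q s2 sp si).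
Notation kk := (kk p q s2 sq sp si). Notation Qm2 := (Qm2 p q s2 sq sp si). Notation Q2q := (Q2q p q s2 sq sp si).
Notation cqi := (cqi sq si). Notation c2q := (c2q s2 sq). Notation c2i := (c2i s2 si).
Let rS : rsq G := @rsq_gens p q.
Let g2 := flips_s2 st. Let gq := flips_sq st. Let gp := flips_sp st. Let gi := flips_si st.
Let g2q := g2q st. Let gqi := gqi st. Let g2i := g2i st.
Let L2 : L w2 := @LL_w2 p q. Let Lq : L wq := @LL_wq p q. Let Lp : L wp := @LL_wp p q. Let Li : L 'i := @LL_i p q.
Let sL : is_subfield L := @LL_sf p q.
Let pp := ar_p ar.
Let BL : Bez L := LL_Bez st ar.
Definition Yk : algC := 'i * w2 * wq.
Let Y2 : Yk ^+ 2 = (- (2 * q%:Z))%:~R.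
Proof. by rewrite /Yk !exprMn w2K wqK sqrCi rmorphN /= intrM; ring. Qed.
Let kY : kk Yk := kk_wk st.
Let sqY : sq Yk = - Yk. Proof. by rewrite /Yk !rmorphM (sqi st) (sq2 st) (sqq st) mulrN. Qed.
Let Y0 : Yk != 0. Proof. by rewrite !mulf_neq0 ?neq0Ci ?w2_neq0 ?(wq_neq0 ar). Qed.
Let p2 : odd p. Proof. by move: (ar_p8 ar); clear; move: (p) => n; lia. Qed.

Lemma odd_ndvd2 (m : int) : ~~ (p%:Z %| m)%Z -> ~~ (p%:Z %| 2 * m)%Z.
Proof.
move=> h; apply/negP => /(dvdz_primeM pp); rewrite (negPf h) orbF dvdzE absz_nat /=.
by rewrite dvdn_prime2 // => /eqP e; move: p2; rewrite e.
Qed.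
Let root_n (x0 j : int) : ~~ (p%:Z %| x0)%Z -> (p%:Z %| j ^+ 2 - x0)%Z -> ~~ (p%:Z %| 2 * j)%Z.
Proof.
move=> px pj; apply: odd_ndvd2; apply/negP => h; move/negP: px; apply.
by rewrite -[x0](subKr (j ^+ 2)); apply: rpredB => //; rewrite expr2; apply: dvdz_mulr.
Qed.
Let pqn : ~~ (p%:Z %| q%:Z)%Z.
Proof.
rewrite dvdzE !absz_nat dvdn_prime2 //; last exact: ar_q ar.
apply/eqP => e; move: (ar_p8 ar) (ar_q8 ar); rewrite e; clear; move: (q) => n; lia.
Qed.
Let pyn : ~~ (p%:Z %| - (2 * q%:Z))%Z.
Proof. by rewrite dvdzE abszN -dvdzE; apply: odd_ndvd2. Qed.

(** [p] splits completely in the biquadratic field [F]. For one factor [t] of it, [t * sq t],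
    [t * cqi t] and [t * si t] come from the three quadratic subfields, and their product is
    [t ^+ 2 * p], because [p] is the product of the four conjugates. *)
Lemma frak_gen (kr kR F : cset) X (x0 : int) : quad kr F sq -> quad kk F cqi -> quad kR F si -> Bez kr -> Bez F -> Bez kk -> Bez kR ->
  kr X -> si X = - X -> X ^+ 2 = x0%:~R -> X != 0 -> sqmod x0 p -> ~~ (p%:Z %| x0)%Z -> (forall x, F x -> L x /\ sp x = x) ->
  exists (fp gam P rho rhoR : algC) (s0 : int),
  [/\ [/\ DD L gam, assoc (gam ^+ 2) fp, DD F fp & assoc (sp fp) fp /\ fp \in Aint],
      [/\ assoc (fp * cqi fp) P, DD kk P, P \in Aint, assoc p%:R (P * sq P) & cop P (sq P)],
      (p%:Z %| s0 ^+ 2 + 2 * q%:Z)%Z /\ (Yk - s0%:~R) / P \in Aint &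
      [/\ DD kr rho, DD kR rhoR & assoc (rho * P * rhoR) (fp ^+ 2 * p%:R)]].
Proof.
move=> Qr Qk QR br bF bk bR rX siX X2 X0 [j pj] px FL.
have sr := quad_sk Qr; have sF := quad_sK Qr.
have sqX : sq X = X := quad_fix Qr rX.
have cX : cqi X = - X by rewrite /= siX rmorphN sqX.
have p0 : p%:R != 0 :> algC by rewrite pnatr_eq0 -lt0n prime_gt0.
have dp : DD kr p%:R by apply: DD_elt => //; apply: (sf_nat sr).
have pA : p%:R \in Aint by rewrite -[p%:R]/((p%:Z)%:~R) Aint_int.
have pp1 : p%:R / p%:R \in Aint by rewrite divff // Aint1.
have tp : assoc (cqi p%:R) p%:R by rewrite rmorph_nat; apply: assoc_refl.
have [r [r' [dr dr' [rA rA'] prr [crr Xr Xr' cr ur]]]] := split_prime sr br pp rX X2 cX X0 pj (root_n px pj) dp pA pp1 tp.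
have [r0 r0'] := (DD_nz dr, DD_nz dr'); have [_ _ pd1 pd2] := assocE prr.
have [s0 ps0] := ar_k ar.
have FY : F Yk := quad_sub Qk kY.
have drF : DD F r by apply: DD_sub dr; apply: quad_sub Qr.
have pr_ : p%:R / r \in Aint.
  by have -> : p%:R / r = p%:R / (r * r') * r'; [field; rewrite r0 r0' | apply: rpredM].
have sqr : assoc (sq r) r by apply: (DD_fixed (K := kr)) dr => x; apply: (quad_fix Qr).
(* The factor [r] of [p] found in [kr] is split once more over [F], by the square root [s0] of -2q
   modulo [p]. *)
have [t [t' [dt dt' [tA tA'] rtt [ctt Yt Yt' ct' ut]]]] := split_prime sF bF pp FY Y2 sqY Y0 ps0 (root_n pyn ps0) drF rA pr_ sqr.
have [t0 t0'] := (DD_nz dt, DD_nz dt'); have [_ _ rd1 rd2] := assocE rtt.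
have gn (g : rmC) x : x != 0 -> g x != 0 by rewrite fmorph_eq0.
have sqt0 := gn sq t t0; have cqt0 := gn cqi t t0; have sit0 := gn si t t0.
have ctsq : cop t (sq t) by apply: cop_assoc (assoc_sym ct') ctt.
have cc : cop r (cqi r) by apply: cop_assoc (assoc_sym cr) crr.
have rt : r / t \in Aint by have -> : r / t = r / (t * t') * t'; [field; rewrite t0 t0' | apply: rpredM].
have Fsq x : F x -> sq x = cqi (si x).
  by move=> Fx; have [Lx _] := FL x Fx; rewrite /= (flips_inv rS gi Lx).
have Fsi x : F x -> si x = cqi (sq x).
  move=> Fx; have [Lx _] := FL x Fx; rewrite /= (flips_comm rS gi gq Lx) (flips_inv rS gq) //; exact: (flips_L rS gi Lx).
have a_si : assoc (si t) (cqi (sq t)) := DD_agreeK (h := comprm cqi sq) Fsi dt.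
have a_sq : assoc (sq t) (cqi (si t)) := DD_agreeK (h := comprm cqi si) Fsq dt.
have crn : cqi r != 0 by apply: gn.
have ctc : cop t (cqi t).
  by apply: (cop_dvd_r (t := cqi r)) => //; [apply: cop_dvd_l cc t0 rt | rewrite -fmorphV -rmorphM; apply: Aintg].
have rsq : r / sq t \in Aint by rewrite -(assoc_dvd2 _ sqr) -fmorphV -rmorphM; apply: Aintg.
have ctsi : cop t (si t).
  apply: (cop_assoc (assoc_sym a_si)); apply: (cop_dvd_r (t := cqi r)); [apply: cop_dvd_l cc t0 rt | by rewrite fmorph_eq0 |].
  by rewrite -fmorphV -rmorphM; apply: Aintg.
have [sqA cqA siA] : [/\ sq t \in Aint, cqi t \in Aint & si t \in Aint] by split; apply: Aintg.
have c3 : cop t (sq t * (cqi t * si t)).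
  by apply: cop_sym; apply: copM; [apply: cop_sym | apply: copM; [apply: cop_sym | apply: cop_sym |..] |..] => //; apply: rpredM.
have rts : assoc r (t * sq t) by apply: (assoc_trans rtt); apply: assocM (assoc_refl t0) (assoc_sym ct').
have Nt : assoc p%:R (t * (sq t * (cqi t * si t))).
  have h1 : assoc (cqi r) (cqi t * cqi (sq t)) by rewrite -rmorphM assoc_aut.
  have h2 : assoc (cqi t * cqi (sq t)) (cqi t * si t) by apply: assocM (assoc_refl cqt0) (assoc_sym a_si).
  have h3 := assocM rts (assoc_trans (assoc_sym cr) (assoc_trans h1 h2)).
  apply: (assoc_trans prr); rewrite -mulrA in h3; exact: h3.
have FtL : DD L t by apply: DD_sub dt => x /FL[].
have [gam [dg ag]] : exists t1, DD L t1 /\ assoc (t1 ^+ 2) t.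
  apply: (sqrt_ram sL BL Lp (wp_neq0 ar) (wpK p) FtL tA _ _ c3 Nt); first by do 2?apply: rpredM.
  by rewrite !mulf_neq0.
pose P := t * cqi t; have PA : P \in Aint by apply: rpredM.
have dP : DD kk P := DD_norm Qk bk dt.
have sqc : sq (cqi t) = si t \/ assoc (sq (cqi t)) (si t).
  right; apply: (DD_agreeK (g := comprm sq cqi) (h := si) _ dt) => x Fx; have [Lx _] := FL x Fx.
  by rewrite /= (flips_inv rS gq) //; apply: (flips_L rS gi Lx).
have {}sqc : assoc (sq (cqi t)) (si t) by case: sqc => // ->; apply: assoc_refl.
have sqP : assoc (sq P) (sq t * si t) by rewrite rmorphM; apply: assocM => //; apply: assoc_refl.
exists t, gam, P, r, (t * si t), s0; split.
- split=> //; split=> //; apply: (DD_fixed (K := F)) dt => x Fx; by have [] := FL x Fx.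
- split=> //; first by apply: assoc_refl; rewrite mulf_neq0.
    apply: (assoc_trans Nt); apply: assoc_sym.
    have -> : t * (sq t * (cqi t * si t)) = P * (sq t * si t) by rewrite /P; ring.
    by apply: assocM => //; apply: assoc_refl; rewrite mulf_neq0.
  apply: (cop_assoc (assoc_sym sqP)); apply: copM => //; last by apply: rpredM.
    by apply: cop_sym; apply: copM => //; apply: cop_sym.
  apply: cop_sym; apply: copM => //; last by apply: cop_sym; apply: (cop_assoc (assoc_sym a_si)); apply: cop_aut.
  by apply: cop_sym; apply: (cop_assoc (assoc_sym a_sq)); apply: cop_aut.
- split; first by move: ps0; rewrite opprK.
  apply: cop_mul_dvd => //.
  by have := Aintg cqi Yt; rewrite rmorphM fmorphV rmorphB rmorph_int (quad_fix Qk kY).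
split=> //; first exact: (DD_norm QR bR dt).
have -> : r * P * (t * si t) = r * (t ^+ 2 * (cqi t * si t)) by rewrite /P; ring.
apply: (assoc_trans (y := t * sq t * (t ^+ 2 * (cqi t * si t)))).
  by apply: assocM => //; apply: assoc_refl; rewrite !mulf_neq0 ?expf_neq0.
have -> : t * sq t * (t ^+ 2 * (cqi t * si t)) = t ^+ 2 * (t * (sq t * (cqi t * si t))) by ring.
by apply: assocM; [apply: assoc_refl; rewrite expf_neq0 | apply: assoc_sym].
Qed.

(** The extra clause for [p] equal to 3 modulo 8 holds because [c2q] and [cqi] agree on Q(sqrt(-2),
    sqrt q). *)
Lemma frak_exists : exists (fp gam P rho rhoR : algC) (s0 : int),
  [/\ [/\ DD L gam, assoc (gam ^+ 2) fp & assoc (sp fp) fp /\ fp \in Aint],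
      [/\ assoc (fp * cqi fp) P, DD kk P, P \in Aint, assoc p%:R (P * sq P) & cop P (sq P)],
      (p%:Z %| s0 ^+ 2 + 2 * q%:Z)%Z /\ (Yk - s0%:~R) / P \in Aint,
      DD Qi rho /\ DD Q2q rhoR \/ DD Qm2 rho /\ DD Qq rhoR &
      assoc (rho * P * rhoR) (fp ^+ 2 * p%:R) /\ ((p %% 8 = 3)%N -> assoc (fp * c2q fp) P)].
Proof.
have B gs : allflips G gs -> Bez (fixf L gs) := LBez ar st (gs := gs).
have i0 : 'i != 0 :> algC := neq0Ci _.
have bk : Bez kk by apply: B; do !split.
case: (ar_p8 ar) => h8.
  have aF : allflips G [:: c2q; sp] by do !split.
  have QF g := @fixf_quad G rS g [:: c2q; sp] ^~ aF.
  have Qr : quad Qi (fixf L [:: c2q; sp]) sq.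
    have [a b c d] := QF sq gq; split=> // x; rewrite -d.
    split=> [[[[Lx e2] ep] eq]|[[[Lx ep] e2q] eq]]; do !split=> //; first by rewrite /= eq.
    by rewrite -[RHS]e2q /= eq.
  have Qk : quad kk (fixf L [:: c2q; sp]) cqi.
    by have [a b c d] := QF cqi gqi; split=> // x; rewrite -d; split=> [[[[Lx ep] e1] e2]|[[[Lx ep] e1] e2]]; do !split.
  have QR : quad Q2q (fixf L [:: c2q; sp]) si.
    by have [a b c d] := QF si gi; split=> // x; rewrite -d; split=> [[[[Lx ep] e1] e2]|[[[Lx ep] e1] e2]]; do !split.
  have Bi : Bez Qi by apply: B; do !split.
  have B2q : Bez Q2q by apply: B; do !split.
  have i2 : 'i ^+ 2 = (-1)%:~R :> algC by rewrite sqrCi.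
  have pn1 : ~~ (p%:Z %| -1)%Z by rewrite dvdzE absz_nat /= dvdn1; apply/eqP => e; move: pp; rewrite e.
  have FL x : fixf L [:: c2q; sp] x -> L x /\ sp x = x by case=> [[Lx ep] _].
  have [fp [gam [P [rho [rhoR [s0 [[? ? dF ?] ? ? [? ? ?]]]]]]]] := frak_gen Qr Qk QR Bi (B _ aF) bk B2q (Qi_i st) (sii st) i2 i0 (ar_N1p ar h8) pn1 FL.
  exists fp, gam, P, rho, rhoR, s0; split=> //; first by left.
  by split=> //; rewrite h8.
have aF : allflips G [:: c2i; sp] by do !split.
have QF g := @fixf_quad G rS g [:: c2i; sp] ^~ aF.
have qs x : L x -> s2 (si x) = x -> s2 x = si x.
  by move=> Lx e; rewrite -[in LHS]e (flips_inv rS g2) //; apply: (flips_L rS gi Lx).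
have agr x : fixf L [:: c2i; sp] x -> c2q x = cqi x.
  by move=> [[Lx ep] e]; rewrite /= (flips_comm rS g2 gq Lx) (qs x Lx e).
have Qr : quad Qm2 (fixf L [:: c2i; sp]) sq.
  have [a b c d] := QF sq gq; split=> // x; rewrite -d.
  by split=> [[[[Lx ep] e1] e2]|[[[Lx ep] e1] e2]]; do !split.
have Qk : quad kk (fixf L [:: c2i; sp]) cqi.
  have [a b c d] := QF cqi gqi; split=> // x; rewrite -d.
  split=> [[[[Lx ep] e1] e2]|[Fx e2]]; last by have [[Lx ep] e1] := Fx; do !split=> //; rewrite agr.
  do !split=> //; have e3 : sq x = si x.
    by rewrite -[in LHS]e1 /= (flips_inv rS gq) //; apply: (flips_L rS gi Lx).
  by rewrite /= -e3.
have QR : quad Qq (fixf L [:: c2i; sp]) si.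
  have [a b c d] := QF si gi; split=> // x; rewrite -d.
  split=> [[[[Lx e2] ep] ei]|[[[Lx ep] e1] ei]]; do !split=> //; first by rewrite /= ei.
  by rewrite -[RHS]e1 /= ei.
have Bm : Bez Qm2 by apply: B; do !split.
have Bq : Bez Qq by apply: B; do !split.
have x2 : ('i * w2) ^+ 2 = (-2)%:~R by rewrite exprMn sqrCi w2K mulN1r.
have sX : si ('i * w2) = - ('i * w2) by rewrite rmorphM (sii st) (si2 st) mulNr.
have X0 : 'i * w2 != 0 by rewrite mulf_neq0 // w2_neq0.
have pn2 : ~~ (p%:Z %| -2)%Z.
  by rewrite dvdzE absz_nat /= dvdn_prime2 //; apply/eqP => e; move: p2; rewrite e.
have FL x : fixf L [:: c2i; sp] x -> L x /\ sp x = x by case=> [[Lx ep] _].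
have [fp [gam [P [rho [rhoR [s0 [[? ? dF ?] [a1 ? ? ? ?] ? [? ? ?]]]]]]]] := frak_gen Qr Qk QR Bm (B _ aF) bk Bq (Qm2_w st) sX x2 X0 (ar_N2p' ar h8) pn2 FL.
exists fp, gam, P, rho, rhoR, s0; split=> //; first by right.
split=> // _; apply: assoc_trans a1; apply: assocM; first by apply: assoc_refl; apply: DD_nz dF.
exact: DD_agreeK agr dF.
Qed.
End Frak.

(** * Ramification of rational primes in L, and norm residues at 2 *)

(** [l] is unramified in [K] up to the factor [D]: what is divisible by the root of [l] is, times
    [D], divisible by [l]. No primes above [l] have to be named. *)
Definition unr (l : nat) (K : cset) (D : int) :=
  forall y, K y -> y / sqrtC l%:R \in Aint -> D%:~R * y / l%:R \in Aint.

Lemma unr_rat (l : nat) : prime l -> unr l (fun x => x \in Crat) 1.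
Proof.
move=> pl y yq h; have l0 : l%:R != 0 :> algC by rewrite pnatr_eq0 -lt0n prime_gt0.
have wA : sqrtC l%:R \in Aint by apply: (@Aint_root 2) => //; rewrite sqrtCK -[l%:R]/((l%:Z)%:~R) Aint_int.
have w0 : sqrtC l%:R != 0 :> algC by rewrite sqrtC_eq0.
have yA : y \in Aint by rewrite -[y](divfK w0); apply: rpredM.
have /intrP[m em] := Cint_rat_Aint yq yA.
have /intrP[n en] : y ^+ 2 / l%:R \in Num.int.
  apply: Cint_rat_Aint; first by rewrite rpredM ?rpredV ?rpredX ?rpred_nat.
  by rewrite -[X in _ / X](sqrtCK l%:R) -expr_div_n; apply: rpredX.
have : (l%:Z %| m)%Z.
  have : (l%:Z %| m * m)%Z.
    apply/dvdzP; exists n; apply: (@intr_inj algC).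
    by rewrite !intrM -em -en -expr2 divfK.
  by move/(dvdz_primeM pl); rewrite orbb.
by case/dvdzP => z ez; rewrite mul1r em ez intrM mulfK // Aint_int.
Qed.

(** The elements [y + s y] and [(y - s y) * d] of [k] inherit divisibility by the root of [l], and
    together they recover [2 * d ^+ 2 * y]. *)
Lemma unr_step l k K (s : rmC) d (dz D : int) : quad k K s -> K d -> s d = - d -> d ^+ 2 = dz%:~R ->
  unr l k D -> unr l K (D * (2 * dz)).
Proof.
move=> q Kd sd d2 H y Ky h; have sK := quad_sK q.
have dA : d \in Aint by apply: (@Aint_root 2) => //; rewrite d2 Aint_int.
have h' : s y / sqrtC l%:R \in Aint.
  have := Aintg s h; rewrite rmorphM fmorphV.
  have : (s (sqrtC l%:R)) ^+ 2 == (sqrtC l%:R) ^+ 2 by rewrite -rmorphXn sqrtCK rmorph_nat.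
  by rewrite eqf_sqr => /orP[] /eqP-> //; rewrite invrN mulrN rpredN.
have h1 : D%:~R * (y + s y) / l%:R \in Aint.
  by apply: H; [apply: (quad_tr q) | rewrite mulrDl; apply: rpredD].
have h2 : D%:~R * ((y - s y) * d) / l%:R \in Aint.
  apply: H.
    apply: (quad_in q); first by apply: (sfM sK) => //; apply: (sfB sK) => //; apply: (quad_K q).
    by rewrite rmorphM rmorphB (quad_inv q Ky) sd; ring.
  by rewrite mulrAC; apply: rpredM => //; rewrite mulrBl; apply: rpredB.
have -> : (D * (2 * dz))%:~R * y / l%:R = dz%:~R * (D%:~R * (y + s y) / l%:R) + d * (D%:~R * ((y - s y) * d) / l%:R).
  by rewrite !intrM -d2 -[2%:~R]/(2%:R); ring.
by apply: rpredD; apply: rpredM => //; apply: Aint_int.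
Qed.

(** Nonzero integers that are norms from the 2-adic field with a square root of 2 adjoined; [T8']
    below collects the nonzero integers that are not. *)
Definition T8 (n : int) := exists (i : nat) (u : int), n = 2 ^+ i * u /\ ((8 %| u - 1)%Z \/ (8 %| u + 1)%Z).
Definition T8' (n : int) := exists (i : nat) (u : int), n = 2 ^+ i * u /\ ((8 %| u - 3)%Z \/ (8 %| u + 3)%Z).

Lemma dvd8E (u a : int) : (8 %| u - a)%Z -> exists k, u = 8 * k + a.
Proof. by case/dvdzP => k e; exists k; rewrite -(subrK a u) e mulrC. Qed.
Lemma dvd8I (u a k : int) : u = 8 * k + a -> (8 %| u - a)%Z.
Proof. by move=> ->; apply/dvdzP; exists k; rewrite addrK mulrC. Qed.
Lemma T8I i u k (e : bool) : u = 8 * k + (-1) ^+ e -> T8 (2 ^+ i * u).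
Proof.
move=> h; exists i, u; split=> //; case: e h => h; [right | left]; last exact: dvd8I h.
by rewrite -[u + 1]/(u - -1); apply: dvd8I h.
Qed.
Lemma T8E n : T8 n -> exists i k (e : bool), n = 2 ^+ i * (8 * k + (-1) ^+ e).
Proof.
case=> i [u [-> [/dvd8E[k ->]|h]]]; first by exists i, k, false.
have /dvd8E[k ->] : (8 %| u - -1)%Z by rewrite opprK.
by exists i, k, true.
Qed.
Lemma T8M m n : T8 m -> T8 n -> T8 (m * n).
Proof.
move=> /T8E[i [k [e ->]]] /T8E[j [l [f ->]]].
have -> : 2 ^+ i * (8 * k + (-1) ^+ e) * (2 ^+ j * (8 * l + (-1) ^+ f)) =
   2 ^+ (i + j) * (8 * (8 * k * l + k * (-1) ^+ f + l * (-1) ^+ e) + (-1) ^+ (e (+) f)) :> int.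
  by rewrite exprD signr_addb; ring.
exact: T8I erefl.
Qed.
Lemma T8M' m n : T8 m -> T8' n -> T8' (m * n).
Proof.
move=> /T8E[i [k [e ->]]] [j [v [-> hv]]].
have [l [f ->]] : exists l (f : bool), v = 8 * l + (-1) ^+ f * 3.
  case: hv => [/dvd8E[l ->]|h]; first by exists l, false.
  have /dvd8E[l ->] : (8 %| v - -3)%Z by rewrite opprK.
  by exists l, true.
exists (i + j)%N, ((8 * k + (-1) ^+ e) * (8 * l + (-1) ^+ f * 3)); split; first by rewrite exprD; ring.
case: e; case: f; rewrite ?expr0 ?expr1.
- left; apply/dvdzP; exists (8 * k * l - 3 * k - l); ring.
- right; apply/dvdzP; exists (8 * k * l + 3 * k - l); ring.
- right; apply/dvdzP; exists (8 * k * l - 3 * k + l); ring.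
left; apply/dvdzP; exists (8 * k * l + 3 * k + l); ring.
Qed.
Lemma T8_disj n : T8 n -> T8' n -> False.
Proof.
case=> i [u [-> hu]] [j [v [e hv]]].
have [u' hu'] : exists u', u = 2 * u' + 1.
  by case: hu => /dvdzP[k hk]; [exists (4 * k) | exists (4 * k - 1)]; lia.
have [v' hv'] : exists v', v = 2 * v' + 1.
  by case: hv => /dvdzP[k hk]; [exists (4 * k + 1) | exists (4 * k - 2)]; lia.
have uv : u = v.
  elim: i j e => [|i IH] [|j] e.
  - by move: e; rewrite !expr0 !mul1r.
  - by move: e; rewrite expr0 mul1r exprS -mulrA; move: (2 ^+ j * v) => z; lia.
  - by move: e; rewrite expr0 mul1r exprS -mulrA; move: (2 ^+ i * u) => z; lia.
  by apply: (IH j); move: e; rewrite !exprS -!mulrA; apply: mulfI.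
by subst v; case: hu hv => /dvdzP[a ha] [] /dvdzP[b hb]; lia.
Qed.

(** As [c] is a 2-adic square, this is a norm form for the square root of 2. The proof sorts [x] and
    [y] by parity and halves them when both are even. *)
Lemma T8_form (c x y : int) : (8 %| c - 1)%Z -> (x != 0) || (y != 0) -> T8 (x ^+ 2 - 2 * c * y ^+ 2).
Proof.
move=> /dvd8E[k ->]; have [n] := ubnP (`|x| + `|y|)%N.
have half (t : int) : exists a, t = 2 * a \/ t = 2 * a + 1 by exists (t %/ 2)%Z; lia.
have sq8 (a : int) : exists b, a ^+ 2 + a = 2 * b.
  have [b [hb|hb]] := half a; first by exists (2 * b ^+ 2 + b); rewrite hb; ring.
  by exists (2 * b ^+ 2 + 3 * b + 1); rewrite hb; ring.
have sq8' (a : int) : exists b, a ^+ 2 = 4 * b \/ a ^+ 2 = 8 * b + 1.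
  have [b [hb|hb]] := half a; first by exists (b ^+ 2); left; rewrite hb; ring.
  have [d hd] := sq8 b; exists d; right; rewrite hb; transitivity (4 * (b ^+ 2 + b) + 1); [ring | rewrite hd; ring].
elim: n x y => // n IH x y; rewrite ltnS => le nz.
have [a [ha|ha]] := half x; last first.
  have [d hd] := sq8 a.
  have -> : x ^+ 2 - 2 * (8 * k + 1) * y ^+ 2 = 2 ^+ 0 * (8 * d + 1 - 16 * k * y ^+ 2 - 2 * y ^+ 2).
    by rewrite ha expr0 mul1r; transitivity (4 * (a ^+ 2 + a) + 1 - 16 * k * y ^+ 2 - 2 * y ^+ 2); [ring | rewrite hd; ring].
  have [b [hb|hb]] := sq8' y; rewrite hb.
    by apply: (@T8I 0 _ (d - 8 * k * b - b) false); rewrite expr0; ring.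
  by apply: (@T8I 0 _ (d - 16 * k * b - 2 * k - 2 * b) true); rewrite expr1; ring.
have [b [hb|hb]] := half y; last first.
  have [d hd] := sq8 b; have [f [hf|hf]] := sq8' a.
    have -> : x ^+ 2 - 2 * (8 * k + 1) * y ^+ 2 = 2 ^+ 1 * (8 * (f - (8 * k + 1) * d - k) + (-1) ^+ true).
      rewrite ha hb !expr1; transitivity (4 * a ^+ 2 - 2 * (8 * k + 1) * (4 * (b ^+ 2 + b) + 1)); first by ring.
      by rewrite hd hf; ring.
    exact: T8I erefl.
  have -> : x ^+ 2 - 2 * (8 * k + 1) * y ^+ 2 = 2 ^+ 1 * (8 * (2 * f - (8 * k + 1) * d - k) + (-1) ^+ false).
    rewrite ha hb expr1 expr0; transitivity (4 * a ^+ 2 - 2 * (8 * k + 1) * (4 * (b ^+ 2 + b) + 1)); first by ring.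
    by rewrite hd hf; ring.
  exact: T8I erefl.
have nz' : (a != 0) || (b != 0) by move: nz; rewrite ha hb !mulf_eq0.
have := IH a b _ nz'; have -> : x ^+ 2 - 2 * (8 * k + 1) * y ^+ 2 = 2 ^+ 2 * (a ^+ 2 - 2 * (8 * k + 1) * b ^+ 2).
  by rewrite ha hb; ring.
move=> h; have /T8E[i [l [e ->]]] : T8 (a ^+ 2 - 2 * (8 * k + 1) * b ^+ 2) by apply: h; clear -le nz' ha hb; lia.
by rewrite mulrA -exprD; apply: T8I erefl.
Qed.

Section Rsq.
Variables (p q : nat) (s2 sq sp si : rmC).
Hypotheses (ar : arith p q) (st : setup p q s2 sq sp si).
Notation L := (LL p q).
Notation G := (gens p q).
Let rS : rsq G := @rsq_gens p q.
Let g2 := flips_s2 st. Let gq := flips_sq st. Let gp := flips_sp st. Let gi := flips_si st.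
Let sL : is_subfield L := @LL_sf p q.
Let FQ := fixf_quad rS.

Lemma unr_L l : prime l -> unr l L (1 * (2 * -1) * (2 * p%:Z) * (2 * q%:Z) * (2 * 2)).
Proof.
move=> pl; have a1 : allflips G [:: s2] := conj g2 Logic.I.
have a2 : allflips G [:: sq; s2] := conj gq a1.
have a3 : allflips G [:: sp; sq; s2] := conj gp a2.
have Q4 : quad (fun x => x \in Crat) (fixf L [:: sp; sq; s2]) si.
  by apply: (quad_rat ar st gi a3) => x _ [[[[_ ?] ?] ?] ?].
apply: (unr_step (FQ g2 (Logic.I : allflips G [::])) (@LL_w2 p q) (s22 st) (w2K : _ = 2%:~R)).
apply: (unr_step (FQ gq a1) _ (sqq st) (wqK q : _ = q%:Z%:~R)); first by split; [apply: LL_wq | apply: s2q st].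
apply: (unr_step (FQ gp a2) _ (spp st) (wpK p : _ = p%:Z%:~R)).
  by split; [split; [apply: LL_wp | apply: s2p st] | apply: sqp st].
apply: (unr_step Q4 _ (sii st) (sqrCi _ : _ = (-1)%:~R)); last exact: unr_rat.
by split; [split; [split; [apply: LL_i | apply: s2i st] | apply: sqi st] | apply: spi st].
Qed.

(** Leaving out the root of [p] removes [p] from the denominator, so the statement has content for
    [l = p] as well. *)
Lemma unr_sp l : prime l -> unr l (fixf L [:: sp]) (1 * (2 * -1) * (2 * q%:Z) * (2 * 2)).
Proof.
move=> pl; have a1 : allflips G [:: sp] := conj gp Logic.I.
have a2 : allflips G [:: s2; sp] := conj g2 a1.
have a3 : allflips G [:: sq; s2; sp] := conj gq a2.
have Q4 : quad (fun x => x \in Crat) (fixf L [:: sq; s2; sp]) si.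
  by apply: (quad_rat ar st gi a3) => x _ [[[[_ ?] ?] ?] ?].
apply: (unr_step (FQ g2 a1) _ (s22 st) (w2K : _ = 2%:~R)); first by split; [apply: LL_w2 | apply: sp2 st].
apply: (unr_step (FQ gq a2) _ (sqq st) (wqK q : _ = q%:Z%:~R)).
  by split; [split; [apply: LL_wq | apply: spq st] | apply: s2q st].
apply: (unr_step Q4 _ (sii st) (sqrCi _ : _ = (-1)%:~R)); last exact: unr_rat.
by split; [split; [split; [apply: LL_i | apply: spi st] | apply: s2i st] | apply: sqi st].
Qed.

(** Prime factors are removed one by one: 2, [p], [q] and -1 are squares in [L], and any other prime
    is unramified, so it divides [r] to an even power. *)
Lemma rat_SS_sq (r : int) : r != 0 -> SS L r%:~R -> sqe L r%:~R 1.
Proof.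
have [n] := ubnP `|r|%N; elim: n r => // n IH r; rewrite ltnS => le r0 Sr.
have [r1|r1] := eqVneq `|r|%N 1%N.
  have : (r == 1) || (r == -1) by move: r1; clear; case: r => m; lia.
  case/orP => /eqP->; first exact: sqe_refl.
  exists 'i; split; [exact: LL_i | exact: neq0Ci | by rewrite mul1r sqrCi].
have rgt : (1 < `|r|)%N by move: r0 r1; clear; lia.
pose l := pdiv `|r|; have pl : prime l by apply: pdiv_prime.
have lr : (l%:Z %| r)%Z by rewrite dvdzE absz_nat pdiv_dvd.
have /dvdzP[r' er] := lr; have l0 : l%:R != 0 :> algC by rewrite pnatr_eq0 -lt0n prime_gt0.
have r'0 : r' != 0 by apply: contraNneq r0 => z; rewrite er z mul0r.
have lt' : (`|r'| < `|r|)%N.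
  by rewrite er abszM absz_nat ltn_Pmulr ?prime_gt1 // absz_gt0.
have red z (r2 : int) : L z -> z != 0 -> r2 != 0 -> (`|r2| < `|r|)%N -> r%:~R = r2%:~R * z ^+ 2 :> algC -> sqe L r%:~R 1.
  move=> Lz z0 r20 lt e; have E : sqe L r%:~R r2%:~R by exists z.
  apply: (sqe_trans sL E); apply: IH => //; first exact: leq_trans lt le.
  by apply: (SS_sqe sL _ Sr); apply: (sqe_sym sL).
have rl z : L z -> z ^+ 2 = l%:R -> sqe L r%:~R 1.
  move=> Lz z2; apply: (red z r') => //; first by rewrite -sqrf_eq0 z2.
  by rewrite z2 er intrM.
have [e|l2] := eqVneq l 2; first by apply: (rl w2); [apply: LL_w2 | rewrite w2K e].
have [e|lp] := eqVneq l p; first by apply: (rl (wp p)); [apply: LL_wp | rewrite wpK e].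
have [e|lq] := eqVneq l q; first by apply: (rl (wq q)); [apply: LL_wq | rewrite wqK e].
suff /dvdzP[r2 er2] : (l%:Z %| r')%Z.
  apply: (red l%:R r2) => //; first exact: (sf_nat sL).
  - by apply: contraNneq r'0 => z; rewrite er2 z mul0r.
  - apply: leq_trans lt'; rewrite er2 ltnS abszM absz_nat leq_pmulr // prime_gt0 //.
  by rewrite er er2 !intrM expr2 mulrA.
have [_ _ [b db br]] := Sr; have b0 := DD_nz db.
set D : int := 1 * (2 * -1) * (2 * p%:Z) * (2 * q%:Z) * (2 * 2).
have lD : ~~ (l%:Z %| D)%Z.
  have nl m : prime m -> l != m -> ~~ (l%:Z %| m%:Z)%Z by move=> pm lm; rewrite dvdzE !absz_nat dvdn_prime2.
  have [h2 hp hq] : [/\ ~~ (l%:Z %| 2)%Z, ~~ (l%:Z %| p%:Z)%Z & ~~ (l%:Z %| q%:Z)%Z].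
    by split; [apply: (nl 2) | apply: nl => //; apply: ar_p ar | apply: nl => //; apply: ar_q ar].
  have h1 : ~~ (l%:Z %| -1)%Z by rewrite dvdzE absz_nat /= dvdn1; apply/eqP => e; move: pl; rewrite e.
  have nM (m1 m2 : int) : ~~ (l%:Z %| m1)%Z -> ~~ (l%:Z %| m2)%Z -> ~~ (l%:Z %| m1 * m2)%Z.
    by move=> na nb; apply/negP => /(dvdz_primeM pl); rewrite (negPf na) (negPf nb).
  rewrite /D mul1r; exact: (nM _ _ (nM _ _ (nM _ _ (nM _ _ h2 h1) (nM _ _ h2 hp)) (nM _ _ h2 hq)) (nM _ _ h2 h2)).
pose w : algC := sqrtC l%:R; have w0 : w != 0 by rewrite sqrtC_eq0.
have bw : b / w \in Aint.
  apply: (@Aint_root 2) => //; rewrite expr_div_n sqrtCK (assoc_dvd2 _ br) er intrM mulfK //.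
  exact: Aint_int.
have Db : D%:~R * b / l%:R \in Aint.
  have [_ [s [sK sa s1]]] := db.
  have -> : D%:~R * b / l%:R = \sum_(u <- s) (D%:~R * u.1 / l%:R) * (u.2 * b).
    rewrite -[LHS]mul1r -s1 mulr_suml; apply: eq_bigr => u _; ring.
  rewrite big_seq rpred_sum // => u us; have [K1 K2] := sK u us; have [h1 h2] := sa u us.
  apply: rpredM => //; apply: (unr_L pl K1).
  have -> : u.1 / sqrtC l%:R = u.1 / b * (b / w) by rewrite mulrA divfK.
  exact: rpredM.
have h : (D * D * r')%:~R / l%:R \in Aint.
  have : (D%:~R * b / l%:R) ^+ 2 \in Aint by apply: rpredX.
  have -> : (D%:~R * b / l%:R) ^+ 2 = b ^+ 2 * (D%:~R ^+ 2 / l%:R ^+ 2) by field.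
  rewrite (assoc_mul _ br) er; congr (_ \in Aint); rewrite !intrM; field => //.
have : (l%:Z %| D * D * r')%Z.
  have h1 : (l%:R : algC)^-1 \notin Aint := nat_inv_nA pl.
  by apply: (int_dvd pl l0 _ h1 h); rewrite divff // Aint1.
by move/(dvdz_primeM pl)/orP=> [/(dvdz_primeM pl)|//]; rewrite (negPf lD).
Qed.
End Rsq.

(** * A criterion for a cyclic 2-class group *)

Lemma odd_fact n : (0 < n)%N -> exists e u, odd u /\ n = (2 ^ e * u)%N.
Proof.
elim/ltn_ind: n => n IH n0; case: (boolP (odd n)) => o; first by exists 0%N, n; rewrite expn0 mul1n.
have en : n = (2 * n./2)%N by rewrite mul2n -[LHS]odd_double_half (negPf o).
have h0 : (0 < n./2)%N by move: n0; rewrite {1}en muln_gt0.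
have [|e [u [ou eu]]] := IH n./2 _ h0; first by rewrite [X in (_ < X)%N]en ltn_Pmull.
by exists e.+1, u; split=> //; rewrite en eu expnS mulnA.
Qed.

Section Cyclic.
Variables (K : cset) (C : algC) (m : nat).
Hypotheses (sK : is_subfield K) (tC : TT K C) (Cm : pr K (C ^+ (2 ^ m.+1))) (Cn : ~ pr K (C ^+ (2 ^ m))).
Hypothesis A2 : forall a b, TT K a -> TT K b -> pr K (a ^+ 2) -> pr K (b ^+ 2) -> ~ pr K a -> ~ pr K b -> pr K (a * b).
Hypothesis NS : forall d, TT K d -> ~ pr K (C * d ^+ 2).

Lemma pr_canc a b : pr K (a * b) -> pr K b -> pr K a.
Proof.
move=> h hb; have b0 := pr_nz hb; rewrite -[a](mulfK b0).
by apply: (prM sK) => //; apply: (prV sK).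
Qed.

Lemma cyc_dvd j : pr K (C ^+ j) <-> (2 ^ m.+1 %| j)%N.
Proof.
split=> [h|/dvdnP[k ->]]; last by rewrite mulnC exprM; apply: (prX _ sK).
have h' : pr K (C ^+ (j %% 2 ^ m.+1)).
  apply: (@pr_canc _ ((C ^+ (2 ^ m.+1)) ^+ (j %/ 2 ^ m.+1))); last exact: (prX _ sK).
  by rewrite -exprM -exprD addnC [(2 ^ _ * _)%N]mulnC -divn_eq.
rewrite /dvdn; apply/negPn/negP => ne; set r := (j %% 2 ^ m.+1)%N in h' ne.
have rlt : (r < 2 ^ m.+1)%N by rewrite ltn_mod expn_gt0.
have r0 : (0 < r)%N by rewrite lt0n.
have [e [u [ou er]]] := odd_fact r0.
have lm : (e <= m)%N.
  rewrite -ltnS -(ltn_exp2l _ _ (isT : (1 < 2)%N)); apply: leq_ltn_trans rlt.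
  by rewrite er leq_pmulr // lt0n; apply: contraTneq ou => ->.
apply: Cn; have e1 : (2 ^ m * u = r * 2 ^ (m - e))%N.
  by rewrite er mulnAC -expnD subnKC.
have h2 : pr K (C ^+ (2 ^ m * u)) by rewrite e1 exprM; apply: (prX _ sK).
have eu : (2 ^ m * u = 2 ^ m + 2 ^ m.+1 * u./2)%N.
  by rewrite -{1}[u]odd_double_half ou -muln2 expnS; lia.
rewrite eu exprD in h2; apply: (pr_canc h2); rewrite exprM; exact: (prX _ sK).
Qed.

(** If [x ^+ (2 ^ n)] is not principal, it lies in the only class of order 2, which is that of
    [C ^+ (2 ^ m)]; multiplying [x] by a suitable power of [C] lowers its order. *)
Lemma cyc_le n x : (n <= m.+1)%N -> TT K x -> pr K (x ^+ (2 ^ n)) -> exists j, pr K (x * C ^+ j).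
Proof.
elim: n x => [|n IH] x le tx h; first by exists 0%N; rewrite mulr1; move: h; rewrite expn0 expr1.
case: (classic (pr K (x ^+ (2 ^ n)))) => h1; first exact: IH (ltnW le) tx h1.
have h2 : pr K (x ^+ (2 ^ n) * C ^+ (2 ^ m)).
  by apply: A2 => //; [exact: (TTX _ sK) | exact: (TTX _ sK) | rewrite -exprM -expnSr | rewrite -exprM -expnSr].
have [||j hj] := IH (x * C ^+ (2 ^ (m - n))) (ltnW le).
- by apply: (TTM sK) => //; apply: (TTX _ sK).
- by rewrite exprMn -exprM -expnD subnK.
by exists (2 ^ (m - n) + j)%N; rewrite exprD mulrA.
Qed.

(** If [x] had larger order than [C], some power [X] of it would make [C * X ^+ 2] of smaller order;
    [cyc_le] then relates it to an even power of [C], and [C] would be the class of a square. *)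
Lemma cyc_gen x : TT K x -> exists j, pr K (x * C ^+ j).
Proof.
move=> tx; have [_ [n]] := tx; elim: n => [|n IH] h; first exact: (cyc_le (leq0n _) tx h).
case: (leqP n m) => [le|lt]; first exact: (@cyc_le n.+1 x le tx h).
case: (classic (pr K (x ^+ (2 ^ n)))) => h1; first exact: IH.
exfalso; pose X := x ^+ (2 ^ (n - m.+1)); have tX : TT K X by apply: (TTX _ sK).
have eX : (X ^+ 2) ^+ (2 ^ m) = x ^+ (2 ^ n).
  rewrite /X -!exprM; congr (_ ^+ _).
  by rewrite -[X in _ = (2 ^ X)%N](subnK lt) expnD expnS; ring.
have h2 : pr K (x ^+ (2 ^ n) * C ^+ (2 ^ m)).
  by apply: A2 => //; [exact: (TTX _ sK) | exact: (TTX _ sK) | rewrite -exprM -expnSr | rewrite -exprM -expnSr].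
have h3 : pr K ((C * X ^+ 2) ^+ (2 ^ m)) by rewrite exprMn eX mulrC.
have tCX : TT K (C * X ^+ 2) by apply: (TTM sK) => //; apply: (TTX _ sK).
have [j hj] := cyc_le (leqnSn m) tCX h3.
have h4 : pr K (C ^+ (j * 2 ^ m)).
  apply: (@pr_canc _ ((C * X ^+ 2) ^+ (2 ^ m))) => //.
  by rewrite mulrC exprM -exprMn; apply: (prX _ sK).
have /cyc_dvd := h4; rewrite expnS dvdn_pmul2r ?expn_gt0 // => /dvdnP[i ej].
apply: (NS (d := X * C ^+ i)); first by apply: (TTM sK) => //; apply: (TTX _ sK).
suff -> : C * (X * C ^+ i) ^+ 2 = C * X ^+ 2 * C ^+ j by [].
by rewrite ej exprM; move: (C ^+ i) => y; ring.
Qed.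
End Cyclic.

(** The norm of an ideal that comes from [k] is its square, hence the factor 2. *)
Lemma ord_down k K (s : rmC) b n : quad k K s -> DD k b -> pr K (b ^+ n) -> pr k (b ^+ (2 * n)).
Proof.
move=> q db [l Kl bl]; exists (l * s l); first exact: (quad_N q).
rewrite mul2n -addnn exprD; apply: assocM => //; apply: (assoc_trans (y := (s b) ^+ n)).
  by apply: assocX; apply: assoc_sym; apply: (DD_fixed (K := k)) db => x; apply: (quad_fix q).
by rewrite -rmorphXn assoc_aut.
Qed.

(** An odd power moves any class into the 2-class group. Multiples of [s] are included so that
    several such exponents can be merged. *)
Lemma TT_odd K a n : is_subfield K -> DD K a -> (0 < n)%N -> pr K (a ^+ n) ->
  exists s, odd s /\ forall s', (s %| s')%N -> TT K (a ^+ s').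
Proof.
move=> sK da n0; have [e [u [ou ->]]] := odd_fact n0 => h; exists u; split=> // s' /dvdnP[k ->].
split; first exact: (DDX _ sK).
exists e; rewrite -exprM; have -> : (k * u * 2 ^ e = 2 ^ e * u * k)%N by ring.
by rewrite exprM; apply: (prX _ sK).
Qed.

(** * Odd class numbers of auxiliary quadratic fields, and a genus character *)

Section Triv.
Variables (p q : nat) (s2 sq sp si : rmC).
Hypotheses (ar : arith p q) (st : setup p q s2 sq sp si).
Notation L := (LL p q).
Notation w2 := w2. Notation wq := (wq q). Notation wp := (wp p).
Notation G := (gens p q).
Notation Qi := (Qi p q s2 sq sp). Notation Qq := (Qq p q s2 sp si). Notation Q2 := (Q2 p q sq sp si).
Notation kk := (kk p q s2 sq sp si). Notation Qm2 := (Qm2 p q s2 sq sp si). Notation Q2q := (Q2q p q s2 sq sp si).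
Let rS : rsq G := @rsq_gens p q.
Let g2 := flips_s2 st. Let gq := flips_sq st. Let gp := flips_sp st. Let gi := flips_si st.
Let g2q := g2q st. Let gqi := gqi st. Let g2i := g2i st.
Let sL : is_subfield L := @LL_sf p q.
Let i0 : 'i != 0 :> algC := neq0Ci _.
Let w20 : w2 != 0 := w2_neq0.
Let wq0 : wq != 0 := wq_neq0 ar.
Let n2 : 2%:R != 0 :> algC. Proof. by rewrite pnatr_eq0. Qed.

Lemma fixf_ord gs b : allflips G gs -> DD (fixf L gs) b -> exists n, (0 < n)%N /\ pr (fixf L gs) (b ^+ n).
Proof.
elim: gs => [_|g gs IH [fg fgs] db]; first exact: (proj2 (LL_Bez_ord st ar)).
have Q := fixf_quad rS fg fgs; have db' : DD (fixf L gs) b by apply: DD_sub db; apply: quad_sub Q.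
have [n [n0 h]] := IH fgs db'; exists (2 * n)%N; split; first by rewrite muln_gt0.
exact: ord_down Q db h.
Qed.

Let unit_sgn (al : bool) : aunit ((-1) ^+ al). Proof. by apply: aunitX; apply: aunitN1. Qed.
Let i_unit : aunit 'i.
Proof. by apply: (@aunit_root 2) => //; rewrite sqrCi aunitN1. Qed.

Lemma sqe_triv K u a : is_subfield K -> aunit u -> sqe K a u -> exists2 b, K b & assoc a (b ^+ 2).
Proof.
move=> sK uu [z [Kz z0 ->]]; exists z => //; rewrite mulrC; apply: assoc_unit => //.
by rewrite expf_neq0.
Qed.

Lemma triv_Qi a : TT Qi a -> pr Qi a.
Proof.
have sK := quad_sK (quad_Qi ar st); apply: (TT_triv sK) => b Sb.
by case: (S_Qi ar st Sb) => h; apply: sqe_triv h => //; apply: aunit1.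
Qed.
Lemma triv_Qm2 a : TT Qm2 a -> pr Qm2 a.
Proof.
have sK := quad_sK (quad_Qm2 ar st); apply: (TT_triv sK) => b Sb.
by have [al h] := S_Qm2 ar st Sb; apply: sqe_triv h.
Qed.
Lemma aunit_1w2 : aunit (1 + w2).
Proof.
have wA : w2 \in Aint by apply: (@Aint_root 2) => //; rewrite w2K (Aint_int 2).
apply: (@aunit_norm1 _ (w2 - 1)); [by apply: rpredD => //; apply: Aint1 | by apply: rpredB => //; apply: Aint1 |].
have -> : (1 + w2) * (w2 - 1) = 1 by transitivity (w2 ^+ 2 - 1); [ring | rewrite w2K; ring].
exact: aunit1.
Qed.
Lemma triv_Q2 a : TT Q2 a -> pr Q2 a.
Proof.
have sK := quad_sK (quad_Q2 ar st); apply: (TT_triv sK) => b Sb.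
have [al [be h]] := S_Q2 ar st Sb; apply: sqe_triv h => //.
by apply: aunitM => //; apply: aunitX; apply: aunit_1w2.
Qed.

(** The fundamental unit is positive, so its Selmer class is 1 or 2; being fundamental it is not a
    square, so twice it is one. *)
Lemma two_sq K g d (D : int) : quad (fun x => x \in Crat) K g -> K d -> g d = - d -> d ^+ 2 = D%:~R -> 0 < d ->
  (forall a, SS K a -> exists al be : bool, sqe K a ((-1) ^+ al * 2 ^+ be)) ->
  exists e z, [/\ K e, K z, aunit e, z != 0 & 2 * e = z ^+ 2].
Proof.
move=> Q Kd gd dD d0 HS; have sK := quad_sK Q; have [e [Ke ue e1 He]] := fund_unit Q Kd gd dD d0.
have e0 : 0 < e by apply: lt_trans e1; rewrite ltr01.
have [al [be [z [Kz z0 ez]]]] := HS e (SS_unit sK Ke ue).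
have z2 : 0 < z ^+ 2.
  have zr := KR Q Kd gd dD d0 Kz; rewrite lt_neqAle eq_sym sqrf_eq0 z0 /=.
  by rewrite real_exprn_even_ge0.
have al0 : al = false.
  have h0 : 0 <= 2 ^+ be * z ^+ 2 by apply: mulr_ge0; [apply: exprn_ge0; apply: ler0n | apply: ltW].
  apply/negP => al1; move: e0; rewrite ez al1 expr1 mulN1r mulNr oppr_gt0 => h.
  by have := le_lt_trans h0 h; rewrite ltxx.
rewrite {}al0 expr0 mul1r in ez; case: be ez => ez; last first.
  rewrite expr0 mul1r in ez; exfalso.
  have uz : aunit z by apply: (@aunit_root 2) => //; rewrite -ez.
  have [n zn] := He z Kz uz.
  have en : e ^ (n * 2 - 1) = 1.
    have en0 : e != 0 by rewrite gt_eqF.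
    rewrite expfzDr // -exprz_exp -exprnP; case: zn => zn.
      by rewrite -zn -ez mulfV.
    by rewrite -[_ ^+ 2]sqrrN -zn -ez mulfV.
  have h2 k : (0 < k)%N -> e ^+ k = 1 -> False.
    by move=> k0 h; have := expr_gt1 k0 (ltW e0); rewrite e1 h ltxx.
  case E : (n * 2 - 1)%R en => [[|k]|k] en; [by move: E; clear; lia | exact: h2 en |].
  by apply: (h2 k.+1) => //; rewrite -[LHS]invrK [X in X^-1](en) invr1.
exists e, (2 * z); split=> //; [by apply: (sfM sK) => //; apply: (sf_nat sK) | by rewrite mulf_neq0 |].
by rewrite ez expr1; ring.
Qed.

(** By [two_sq] the number 2 is a square up to a unit, hence so is every class listed in [HS]. *)
Lemma triv_two K g d (D : int) : quad (fun x => x \in Crat) K g -> K d -> g d = - d -> d ^+ 2 = D%:~R -> 0 < d ->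
  (forall a, SS K a -> exists al be : bool, sqe K a ((-1) ^+ al * 2 ^+ be)) ->
  forall a, TT K a -> pr K a.
Proof.
move=> Q Kd gd dD d0 HS; have sK := quad_sK Q; have [e [z [Ke Kz ue z0 ez]]] := two_sq Q Kd gd dD d0 HS.
apply: (TT_triv sK) => b Sb; have [al [be [y [Ky y0 ey]]]] := HS b Sb.
have e0 : e != 0 by case/and3P: ue.
exists (z ^+ be * y); first by apply: (sfM sK) => //; apply: (sfX sK).
have -> : b = (z ^+ be * y) ^+ 2 * ((-1) ^+ al / e ^+ be).
  by rewrite ey; case: be {ey}; rewrite ?expr0 ?expr1; [rewrite exprMn -ez; field | field].
apply: assoc_unit; first by rewrite expf_neq0 // mulf_neq0 // expf_neq0.
by apply: aunitM => //; apply: aunitV; apply: aunitX.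
Qed.

Let d2q : 0 < wq. Proof. by rewrite sqrtC_gt0 ltr0n prime_gt0 // (ar_q ar). Qed.
Lemma triv_Qq a : TT Qq a -> pr Qq a.
Proof. exact: (triv_two (quad_Qq ar st) (Qq_wq st) (sqq st) (wqK q : _ = q%:Z%:~R) d2q (@S_Qq p q s2 sq sp si ar st)). Qed.
Lemma triv_Q2q a : TT Q2q a -> pr Q2q a.
Proof.
have d2 : (w2 * wq) ^+ 2 = (2 * q%:Z)%:~R by rewrite exprMn w2K wqK intrM.
have gd : s2 (w2 * wq) = - (w2 * wq) by rewrite rmorphM (s22 st) (s2q st) mulNr.
have d0 : 0 < w2 * wq by rewrite mulr_gt0 // sqrtC_gt0 ltr0n.
exact: (triv_two (quad_Q2q ar st) (Q2q_w st) gd d2 d0 (@S_Q2q p q s2 sq sp si ar st)).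
Qed.

(* Norms to the rationals; the genus character at q. *)
Lemma NS_k (s : nat) (P d : algC) (b : nat) z : odd s -> (b <= 1)%N -> assoc p%:R (P * sq P) -> DD kk P -> DD kk d -> kk z ->
  assoc (P ^+ s * d ^+ 2) (w2 ^+ b * z) -> False.
Proof.
move=> os b1 pP dP dd kz h; have QK := quad_k ar st.
have sK := quad_sK QK.
have fx x : kk x -> s2 x = sq x.
  by move=> kx; have [[_ _] e] := kx; rewrite -[in LHS]e (flips_inv rS g2) //; apply: (flips_L rS gq); apply: fixf_L kx.
have z0 : z != 0 by have := assoc_nz2 h; rewrite mulf_eq0 negb_or => /andP[].
have [r rq dr] := DD_rat (DD_norm QK Bez_rat dd).
have r0 := assoc_nz2 dr.
have P2 : assoc (P * s2 P) p%:R.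
  apply: assoc_sym; apply: (assoc_trans pP); apply: assocM; first by apply: assoc_refl; apply: DD_nz dP.
  by apply: assoc_sym; apply: DD_agreeK dP.
have Yd : ('i * w2 * wq) ^+ 2 = (- (2 * q%:Z))%:~R by rewrite !exprMn w2K wqK sqrCi rmorphN /= intrM; ring.
have gY : s2 ('i * w2 * wq) = - ('i * w2 * wq) by rewrite !rmorphM (s22 st) (s2q st) (s2i st); ring.
have Y0 : 'i * w2 * wq != 0 by rewrite !mulf_neq0.
have [x [y [xq yq _ nz]]] := quadQ_coord QK (kk_wk st) gY Yd Y0 kz.
have x2 := rat_sq_ge0 xq; have y2 := rat_sq_ge0 yq.
pose N := x ^+ 2 + (2 * q%:R) * y ^+ 2.
have eN : z * s2 z = N by rewrite nz rmorphN /= intrM /N; ring.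
have N0 : 0 <= N by rewrite addr_ge0 // mulr_ge0 // mulr_ge0 // ler0n.
have H : assoc (p%:R ^+ s * r ^+ 2) (2 ^+ b * N).
  have h1 : assoc ((P * s2 P) ^+ s * (d * s2 d) ^+ 2) ((w2 ^+ b * z) * s2 (w2 ^+ b * z)).
    have -> : (P * s2 P) ^+ s * (d * s2 d) ^+ 2 = (P ^+ s * d ^+ 2) * s2 (P ^+ s * d ^+ 2).
      by rewrite rmorphM !rmorphXn !exprMn; ring.
    by apply: assocM => //; rewrite assoc_aut.
  have h2 : assoc ((w2 ^+ b * z) * s2 (w2 ^+ b * z)) (2 ^+ b * N).
    have -> : (w2 ^+ b * z) * s2 (w2 ^+ b * z) = 2 ^+ b * N * (-1) ^+ b.
      rewrite rmorphM rmorphXn (s22 st) -eN [(- w2) ^+ b]exprNn -w2K -exprM mulnC exprM; ring.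
    apply: assoc_unit; last by apply: aunitX; apply: aunitN1.
    by rewrite -eN !mulf_neq0 ?expf_neq0 ?fmorph_eq0.
  apply: assoc_trans h2; apply: assoc_trans h1; apply: assoc_sym.
  by apply: assocM; apply: assocX.
have p0 : 0 < p%:R :> algC by rewrite ltr0n prime_gt0 // (ar_p ar).
have r2 : 0 < r ^+ 2 by rewrite lt_neqAle eq_sym sqrf_eq0 r0 rat_sq_ge0.
have eq : p%:R ^+ s * r ^+ 2 = 2 ^+ b * N.
  have nz2 := assoc_nz2 H.
  have : p%:R ^+ s * r ^+ 2 / (2 ^+ b * N) \in Crat.
    by rewrite rpredM ?rpredV ?rpredM ?rpredX ?rpred_nat // /N rpredD ?rpredM ?rpredX ?rpred_nat.
  case/rat_unit/(_ H) => e; first by rewrite -[LHS](divfK nz2) e mul1r.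
  have : 0 < p%:R ^+ s * r ^+ 2 / (2 ^+ b * N).
    have N1 : 0 < N by rewrite lt_neqAle eq_sym N0 andbT -eN mulf_neq0 ?fmorph_eq0.
    by apply: divr_gt0; apply: mulr_gt0 => //; apply: exprn_gt0 => //; rewrite ltr0n.
  by rewrite e oppr_gt0 ltr10.
(* 2 is a residue and [p] a nonresidue modulo [q], and [s] is odd. *)
have nc : ~ sqmod ((2 ^ b * p ^ s)%N%:Z) q.
  have [j hj] := ar_2q ar => -[t ht]; have [c ec] : exists c, s = (2 * c).+1 by exists s./2; rewrite -[LHS]odd_double_half os mul2n add1n.
  have qd2 : ~~ (q%:Z %| 2)%Z.
    by rewrite dvdzE absz_nat /=; apply/negP => /(dvdn_leq (isT : (0 < 2)%N)); move: (ar_q8 ar); clear; move: (q) => m; lia.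
  have jn : ~~ (q%:Z %| j)%Z.
    apply/negP => qj; move/negP: qd2; apply; have h2 : (q%:Z %| j ^+ 2 - (j ^+ 2 - 2))%Z.
      by apply: rpredB => //; rewrite expr2; apply: dvdz_mulr.
    by rewrite subKr in h2; exact: h2.
  have pn : ~~ (q%:Z %| p%:Z)%Z.
    rewrite dvdzE !absz_nat dvdn_prime2; [|exact: ar_q ar|exact: ar_p ar].
    by apply/eqP => e; move: (ar_p8 ar) (ar_q8 ar); rewrite -e; clear; move: (q) => m; lia.
  have H2 : (q%:Z %| t ^+ 2 - p%:Z * (j ^+ b * p%:Z ^+ c) ^+ 2)%Z.
    have -> : t ^+ 2 - p%:Z * (j ^+ b * p%:Z ^+ c) ^+ 2 = (t ^+ 2 - (2 ^ b * p ^ s)%N%:Z) + p%:Z ^+ s * (2 ^+ b - (j ^+ 2) ^+ b).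
      have eP (a n : nat) : (a ^ n)%N%:Z = a%:Z ^+ n by elim: n => // n IH; rewrite expnS PoszM IH exprS.
      have jb : (j ^+ 2) ^+ b = (j ^+ b) ^+ 2 by rewrite -!exprM mulnC.
      rewrite PoszM !eP jb ec (exprS p%:Z (2 * c)) [(2 * c)%N]mulnC (exprM p%:Z c 2); move: (j ^+ b) (p%:Z ^+ c) => x1 x3.
      by rewrite -[2%:Z]/(2 : int); ring.
    apply: rpredD => //; apply: dvdz_mull.
    case: (b) b1 => [|[|//]] _; first by rewrite !expr0 subrr dvdz0.
    by rewrite !expr1 -opprB dvdzE abszN -dvdzE.
  have /andP[_] := nsq_rel (ar_q ar) (ar_pq ar) H2.
  have qX (a : int) n : ~~ (q%:Z %| a)%Z -> ~~ (q%:Z %| a ^+ n)%Z.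
    move=> ha; elim: n => [|n IH]; first by rewrite expr0 dvdzE absz_nat dvdn1; apply/eqP => e; move: (ar_q ar); rewrite e.
    by rewrite exprS; apply/negP => /(dvdz_primeM (ar_q ar)); rewrite (negPf ha) (negPf IH).
  by move=> /(dvdz_primeM (ar_q ar)); rewrite (negPf (qX _ _ jn)) (negPf (qX _ _ pn)).
have qn2 : ~~ (q%:Z %| -2)%Z.
  by rewrite dvdzE absz_nat /=; apply/negP => /(dvdn_leq (isT : (0 < 2)%N)); move: (ar_q8 ar); clear; move: (q) => m; lia.
(* Scaling by [2 ^+ b] makes the factor [2 ^+ b] on the right part of a square. *)
move/eqP: r0; apply; apply: (qres (x := 2 ^+ b * x) (y := 2 ^+ b * y) (ar_q ar) nc qn2) => //.
- by rewrite rpredM ?rpredX ?rpred_nat.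
- by rewrite rpredM ?rpredX ?rpred_nat.
rewrite -[((2 ^ b * p ^ s)%N%:Z)%:~R]/((2 ^ b * p ^ s)%N%:R) natrM !natrX -[RHS]mulrA eq.
have -> : (q%:Z * -2)%:~R = - (2 * q%:R) :> algC by rewrite intrM mulrC -[(-2)%:~R]/(- 2%:R) mulNr.
rewrite /N.
by case: (b) b1 => [|[|//]] _; rewrite ?expr0 ?expr1; ring.
Qed.
End Triv.

(** * Capitulation in L *)

Section Capit.
Variables (p q : nat) (s2 sq sp si : rmC).
Hypotheses (ar : arith p q) (st : setup p q s2 sq sp si).
Notation L := (LL p q).
Notation w2 := w2. Notation wq := (wq q). Notation wp := (wp p).
Notation G := (gens p q).
Notation Qi := (Qi p q s2 sq sp). Notation Qq := (Qq p q s2 sp si). Notation Q2 := (Q2 p q sq sp si).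
Notation kk := (kk p q s2 sq sp si). Notation Qm2 := (Qm2 p q s2 sq sp si). Notation Q2q := (Q2q p q s2 sq sp si).
Notation cqi := (cqi sq si). Notation c2q := (c2q s2 sq). Notation Yk := (Yk q).
Let rS : rsq G := @rsq_gens p q.
Let g2 := flips_s2 st. Let gq := flips_sq st. Let gp := flips_sp st. Let gi := flips_si st.
Let g2q := g2q st. Let gqi := gqi st.
Let L2 : L w2 := @LL_w2 p q. Let Lq : L wq := @LL_wq p q. Let Lp : L wp := @LL_wp p q. Let Li : L 'i := @LL_i p q.
Let sL : is_subfield L := @LL_sf p q.
Let i0 : 'i != 0 :> algC := neq0Ci _.
Let w20 : w2 != 0 := w2_neq0.
Let wq0 : wq != 0 := wq_neq0 ar.
Let n2 : 2%:R != 0 :> algC. Proof. by rewrite pnatr_eq0. Qed.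
Let QK := quad_k ar st.
Let sk := quad_sK QK.
Let kL x : kk x -> L x. Proof. exact: fixf_L. Qed.
Let Yd : Yk ^+ 2 = (- (2 * q%:Z))%:~R.
Proof. by rewrite /Yk !exprMn w2K wqK sqrCi rmorphN /= intrM; ring. Qed.
Let gY : s2 Yk = - Yk. Proof. by rewrite /Yk !rmorphM (s22 st) (s2q st) (s2i st); ring. Qed.
Let Y0 : Yk != 0. Proof. by rewrite !mulf_neq0. Qed.
Let kY : kk Yk := kk_wk st.

Lemma kk_norm z : kk z -> exists x y, [/\ x \in Crat, y \in Crat, z = x + y * Yk,
   z * s2 z = x ^+ 2 + (2 * q%:R) * y ^+ 2 & 0 <= z * s2 z].
Proof.
move=> kz; have [x [y [xq yq ez nz]]] := quadQ_coord QK kY gY Yd Y0 kz.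
have e : z * s2 z = x ^+ 2 + (2 * q%:R) * y ^+ 2 by rewrite nz rmorphN /= intrM; ring.
exists x, y; split=> //; rewrite e.
by rewrite addr_ge0 ?rat_sq_ge0 // mulr_ge0 ?rat_sq_ge0 // mulr_ge0 // ler0n.
Qed.

Lemma rat_assoc a b : a \in Crat -> b \in Crat -> assoc a b -> a = b \/ a = - b.
Proof.
move=> aq bq h; have b0 := assoc_nz2 h.
have : a / b \in Crat by rewrite rpredM ?rpredV.
case/rat_unit/(_ h) => e; [left | right]; by rewrite -[LHS](divfK b0) e ?mul1r ?mulN1r.
Qed.
Lemma rat_assoc_pos a b : a \in Crat -> b \in Crat -> 0 <= a -> 0 <= b -> assoc a b -> a = b.
Proof.
move=> aq bq a0 b0 h; case: (rat_assoc aq bq h) => // e.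
have : a <= 0 by rewrite e oppr_le0.
move=> a1; have az : a = 0 by apply: le_anti; rewrite a0 a1.
by move: (assoc_nz1 h); rewrite az eqxx.
Qed.

(** Shows that the ideal of [w2], which is the prime of [kk] above 2, is the square of a principal
    ideal of [L]. *)
Lemma z8_sq : (1 + z8) ^+ 2 = z8 * w2 * (1 + w2).
Proof.
have e1 : z8 * w2 = 1 + 'i by rewrite /z8 divfK.
transitivity (1 + 2 * z8 + z8 ^+ 2); first by ring.
rewrite z8K; transitivity (z8 * w2 + z8 * w2 ^+ 2); last by ring.
by rewrite e1 w2K; ring.
Qed.
Lemma w2_sq : assoc w2 ((1 + z8) ^+ 2).
Proof.
apply: assoc_sym; rewrite z8_sq; have -> : z8 * w2 * (1 + w2) = w2 * (z8 * (1 + w2)) by ring.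
by apply: assoc_unit => //; apply: aunitM (aunit_1w2); case: (UL_z8 p q).
Qed.

Lemma nsq_m2 : ~ sqmod (-2) q.
Proof.
move=> [t ht]; have [j hj] := ar_2q ar.
have H : (q%:Z %| t ^+ 2 - (-1) * j ^+ 2)%Z.
  have -> : t ^+ 2 - (-1) * j ^+ 2 = (t ^+ 2 - (-2)) + (j ^+ 2 - 2) by ring.
  exact: rpredD.
have /andP[_ qj] := nsq_rel (ar_q ar) (ar_N1q ar) H.
have h2 : (q%:Z %| j ^+ 2 - (j ^+ 2 - 2))%Z by apply: rpredB => //; rewrite expr2; apply: dvdz_mulr.
rewrite subKr in h2; have : (q%:Z %| 2)%Z := h2; rewrite dvdzE absz_nat /= => /(dvdn_leq (isT : (0 < 2)%N)).
by move: (ar_q8 ar); clear; move: (q) => m; lia.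
Qed.

Let q1n : ~~ (q%:Z %| 1)%Z.
Proof. by rewrite dvdzE absz_nat dvdn1; apply/eqP => e; move: (ar_q ar); rewrite e. Qed.

(** From [2 * e = z ^+ 2] with [z = a + b * wq] of norm 2 it follows that [a + w2] has norm
    [q * b ^+ 2]. Since [z * (a + w2) = (z + w2) ^+ 2 / 2], and [z] is an associate of [w2], which
    is a square up to a unit, so is [a + w2]. *)
Lemma mu_exists : exists mu b m, [/\ Q2 mu, b \in Crat, mu * c2q mu = q%:R * b ^+ 2, L m & assoc mu (m ^+ 2)].
Proof.
have QQ := quad_Qq ar st; have d0 : 0 < wq by rewrite sqrtC_gt0 ltr0n prime_gt0 // (ar_q ar).
have qd : wq ^+ 2 = q%:Z%:~R by rewrite wqK.
have [e [z [Ke Kz ue z0 ez]]] := two_sq QQ (Qq_wq st) (sqq st) qd d0 (@S_Qq p q s2 sq sp si ar st).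
have [a [b [aq bq eab nz]]] := quadQ_coord QQ (Qq_wq st) (sqq st) qd wq0 Kz.
have nq : z * sq z \in Crat := quad_N QQ Kz.
have n4 : (z * sq z) ^+ 2 = 2 ^+ 2.
  have : assoc ((z * sq z) ^+ 2) (2 ^+ 2).
    rewrite exprMn -rmorphXn -ez rmorphM rmorph_nat mulrACA -expr2; apply: assoc_unit; first by rewrite expf_neq0.
    by apply: aunitM; rewrite ?aunit_aut.
  apply: rat_assoc_pos; rewrite ?rpredX ?rpred_nat //; first exact: rat_sq_ge0.
  by rewrite exprn_ge0 ?ler0n.
(* The norm -2 is excluded because -2 is a nonresidue modulo [q]. *)
have N2 : a ^+ 2 - q%:R * b ^+ 2 = 2.
  move/eqP: n4; rewrite eqf_sqr nz => /orP[/eqP // | /eqP h].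
  exfalso; have := oner_neq0 algC; move/eqP; apply; apply: (qres (c := -2) (u := 1) (ar_q ar) nsq_m2 q1n aq bq (rpred1 _)).
  by rewrite mulr1 h expr1n mulr1.
have zz : sq z = a - b * wq.
  by rewrite eab rmorphD rmorphM (sqq st) !(quad_fix QQ) // mulrN.
have rel : z ^+ 2 = 2 * a * z - 2.
  by transitivity (2 * a * z - (a ^+ 2 - wq ^+ 2 * b ^+ 2)); [rewrite eab; ring | rewrite wqK N2].
have s2z : s2 z = z by have [[[_ e2] _] _] := Kz; exact: e2.
have t0 : 1 + z / w2 != 0.
  apply/eqP => h; have zw : z = - w2 by rewrite -[LHS](divfK w20) -[z / w2](addKr 1) h addr0 mulN1r.
  have : s2 z = w2 by rewrite zw rmorphN (s22 st) opprK.
  by rewrite s2z zw => /eqP; rewrite -subr_eq0 -opprD oppr_eq0 -mulr2n mulrn_eq0 (negPf w20).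
have Lz : L z := fixf_L Kz.
have zw2 : assoc z w2.
  by apply: (@assoc_root 2) => //; rewrite w2K -ez; apply: assoc_unit.
have id : z * (a + w2) = (1 + z / w2) ^+ 2.
  transitivity (1 + w2 * z * (2 / w2 ^+ 2) + z ^+ 2 / w2 ^+ 2); last by field.
  by rewrite w2K rel; field.
exists (a + w2), b, ((1 + z / w2) / (1 + z8)); split=> //.
- have s := quad_sK (quad_Q2 ar st); apply: (sfD s); [exact: (sf_rat s aq) | exact: Q2_w2 st].
- rewrite rmorphD (quad_fix (quad_Q2 ar st)) //= (sq2 st) (s22 st).
  by transitivity (a ^+ 2 - w2 ^+ 2); [ring | rewrite w2K -[X in _ - X]N2; ring].
- apply: (sfM sL); first by apply: (sfD sL); [exact: (sf1 sL) | apply: (sfM sL) => //; apply: (sfV sL)].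
  by apply: (sfV sL); apply: (sfD sL); [exact: (sf1 sL) | case: (UL_z8 p q)].
have -> : a + w2 = (1 + z / w2) ^+ 2 / z by rewrite -id mulrC mulKf.
rewrite expr_div_n; apply: assocM; first by apply: assoc_refl; rewrite expf_neq0.
by apply: assocV; apply: (assoc_trans zw2); exact: w2_sq.
Qed.

Lemma rat_sq_L r f : r \in Crat -> DD L f -> assoc (f ^+ 2) r -> exists2 t, L t & r = t ^+ 2.
Proof.
move=> rq df fr; have r0 := assoc_nz2 fr.
have [a [b [b0 er]]] := Crat_frac rq; have B : b%:~R != 0 :> algC by rewrite intr_eq0.
have E : (a * b)%:~R = r * b%:~R ^+ 2 by rewrite er intrM; field.
have Sr : SS L r by split=> //; [exact: (sf_rat sL) | exists f].
have ab0 : a * b != 0 by rewrite -(intr_eq0 algC) E mulf_neq0 // expf_neq0.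
have [|t [Lt t0 et]] := rat_SS_sq ar st ab0.
  by rewrite E; apply: (SSM sL) => //; apply: (SS_sq sL) => //; apply: (sf_int sL).
exists (t / b%:~R); first by apply: (sfM sL) => //; apply: (sfV sL); apply: (sf_int sL).
by rewrite expr_div_n -[t ^+ 2]mul1r -et E mulfK // expf_neq0.
Qed.

(** For rational [n] with [n ^+ 2 = 2 * N], [(Lam + n) ^+ 2] is [2 * Lam * nu] with [nu] in Q(sqrt
    2) of norm [4 * q * y ^+ 2]. The factor [mu] makes this norm a square, so by Hilbert 90
    [nu * mu] is a rational [r] up to a square. Hence [r] is the square of an ideal in [L], so a
    square in [L], and [e] is principal. *)
Lemma capit e z : DD kk e -> kk z -> assoc (e ^+ 2) (w2 * z) -> pr L e.
Proof.
move=> de kz h; have e0 := DD_nz de.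
have z0 : z != 0 by have := assoc_nz2 h; rewrite mulf_eq0 negb_or => /andP[].
have [x [y [xq yq ez nz z_ge0]]] := kk_norm kz.
have [n nq en] := DD_rat (DD_norm QK Bez_rat de).
pose N := z * s2 z; have Nq : N \in Crat := quad_N QK kz.
have N0 : N != 0 by rewrite mulf_neq0 // fmorph_eq0.
have n2E : n ^+ 2 = 2 * N.
  have H1 : n ^+ 2 \in Crat by rewrite rpredX.
  have H2 : 2 * N \in Crat by apply: rpredM => //; apply: rpred_nat.
  apply: (rat_assoc_pos H1 H2 (rat_sq_ge0 nq)); first by apply: mulr_ge0 => //; apply: ler0n.
  apply: (assoc_trans (y := (e * s2 e) ^+ 2)); first by apply: assocX; apply: assoc_sym.
  have h2 : assoc (s2 (e ^+ 2)) (s2 (w2 * z)) by rewrite assoc_aut.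
  rewrite exprMn -rmorphXn; apply: (assoc_trans (assocM h h2)).
  have -> : w2 * z * s2 (w2 * z) = - (2 * N).
    rewrite rmorphM (s22 st); transitivity (- (w2 ^+ 2 * N)); [rewrite /N; ring | by rewrite w2K].
  by apply: assocN; rewrite mulf_neq0.
have ng (r : algC) : r \in Crat -> s2 r = r by exact: (quad_fix QK).
pose Lam := w2 * z; pose nu := n + w2 * x.
have sz : s2 z = x - y * Yk by rewrite ez rmorphD rmorphM gY !ng // mulrN.
have key : (Lam + n) ^+ 2 = 2 * Lam * nu.
  transitivity (Lam ^+ 2 + 2 * Lam * n + n ^+ 2); first by ring.
  have h2 : n ^+ 2 = w2 ^+ 2 * N by rewrite w2K.
  rewrite h2 /nu /Lam /N sz ez; ring.
have nN : nu * (n - w2 * x) = 4 * q%:R * y ^+ 2.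
  transitivity (n ^+ 2 - w2 ^+ 2 * x ^+ 2); first by rewrite /nu; ring.
  rewrite n2E w2K /N nz; ring.
have nu0 : nu != 0.
  apply/eqP => h0; have h1 : s2 nu = 0 by rewrite h0 rmorph0.
  have : nu + s2 nu = 2 * n by rewrite /nu rmorphD rmorphM (s22 st) !ng //; ring.
  rewrite h1 h0 addr0 => /esym/eqP; rewrite mulf_eq0 (negPf n2) /= => /eqP n0.
  by move/eqP: N0; apply; apply: (mulfI n2); rewrite mulr0 -n2E n0 expr0n.
have L0 : Lam != 0 by rewrite mulf_neq0.
have Ln0 : Lam + n != 0 by rewrite -sqrf_eq0 key !mulf_neq0.
have [mu [b [m [Qmu bq muN Lm mm]]]] := mu_exists.
have [mu0 m0] : mu != 0 /\ m != 0.
  by have [x1 x2 _ _] := assocE mm; split=> //; move: x2; rewrite sqrf_eq0.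
have QT := quad_Q2 ar st; have sT := quad_sK QT.
have Qnu : Q2 nu by apply: (sfD sT); [apply: (sf_rat sT) | apply: (sfM sT); [exact: Q2_w2 st | apply: (sf_rat sT)]].
have cnu : c2q nu = n - w2 * x.
  by rewrite /nu rmorphD rmorphM (quad_fix QT nq) (quad_fix QT xq) /= (sq2 st) (s22 st) mulNr.
have [||r [be [rq r0 Qbe be0 er]]] := hilbert90 QT (n := 2 * q%:R * y * b) (sfM sT Qnu Qmu) (mulf_neq0 nu0 mu0).
- by rewrite !rpredM ?rpred_nat.
- by rewrite rmorphM mulrACA cnu nN muN; ring.
have Lbe : L be := fixf_L Qbe.
have LLam : L Lam by apply: (sfM sL) => //; apply: kL.
have Ln : L (Lam + n) by apply: (sfD sL) => //; apply: (sf_rat sL).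
have deL : DD L e by apply: DD_sub de.
pose f := m * ((Lam + n) / (w2 * be)) / e.
have f1 : L (m * ((Lam + n) / (w2 * be))).
  by apply: (sfM sL) => //; apply: (sfM sL) => //; apply: (sfV sL); apply: (sfM sL).
have df : DD L f.
  apply: (DDM sL); last exact: DDV.
  by apply: DD_elt => //; rewrite !mulf_neq0 ?invr_eq0 ?mulf_neq0.
have fr : assoc (f ^+ 2) r.
  have -> : r = mu * ((Lam + n) ^+ 2 / (2 * be ^+ 2)) / Lam.
    have -> : r = nu * mu / be ^+ 2 by rewrite er mulfK // expf_neq0.
    by rewrite key; field; rewrite L0 be0.
  have -> : f ^+ 2 = m ^+ 2 * ((Lam + n) ^+ 2 / (2 * be ^+ 2)) / e ^+ 2.
    by rewrite /f -w2K; field; rewrite e0 be0 w20.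
  apply: assocM; last by apply: assocV.
  apply: assocM; first exact: assoc_sym.
  by apply: assoc_refl; rewrite mulf_neq0 ?expf_neq0 ?invr_eq0 ?mulf_neq0 ?expf_neq0.
have [t Lt et] := rat_sq_L rq df fr.
have t0 : t != 0 by rewrite -sqrf_eq0 -et.
exists (m * (Lam + n) / (w2 * be * t)).
  by apply: (sfM sL); [apply: (sfM sL) | apply: (sfV sL); apply: (sfM sL) => //; apply: (sfM sL)].
apply: (@assoc_root 2) => //.
have -> : (m * (Lam + n) / (w2 * be * t)) ^+ 2 = f ^+ 2 / t ^+ 2 * e ^+ 2.
  by rewrite /f; field; rewrite e0 t0 be0 w20.
rewrite -[X in assoc X _]mul1r; apply: assocM; last by apply: assoc_refl; rewrite expf_neq0.
by apply: assoc_sym; rewrite -et; rewrite /assoc invr1 mulr1; exact: fr.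
Qed.

Lemma sqrt_kk a : DD kk a -> pr kk (a ^+ 2) -> exists (be : bool) z, kk z /\ assoc a (w2 ^+ be * z).
Proof.
move=> da [l kl al]; have Sl : SS kk l by split=> //; [exact: assoc_nz2 al | exists a].
have [x [be [z [kz z0 e]]]] := S_kk ar st Sl; exists be, z; split=> //.
apply: (@assoc_root 2) => //; apply: (assoc_trans al); rewrite e exprMn -exprM mulnC exprM w2K.
have -> : (-1) ^+ x * 2 ^+ be * z ^+ 2 = 2 ^+ be * z ^+ 2 * (-1) ^+ x by ring.
apply: assoc_unit; first by rewrite mulf_neq0 ?expf_neq0.
by apply: aunitX; apply: aunitN1.
Qed.

Lemma A2_kk a b : TT kk a -> TT kk b -> pr kk (a ^+ 2) -> pr kk (b ^+ 2) -> ~ pr kk a -> ~ pr kk b -> pr kk (a * b).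
Proof.
move=> [da _] [db _] ha hb na nb.
have [x [z [kz az]]] := sqrt_kk da ha; have [y [t [kt bt]]] := sqrt_kk db hb.
case: x az => az; last by case: na; exists z => //; move: az; rewrite expr0 mul1r.
case: y bt => bt; last by case: nb; exists t => //; move: bt; rewrite expr0 mul1r.
exists (2 * z * t); first by apply: (sfM sk) => //; apply: (sfM sk) => //; apply: (sf_nat sk).
apply: (assoc_trans (assocM az bt)); rewrite expr1; have e : w2 * z * (w2 * t) = 2 * z * t by rewrite -w2K; ring.
have := assoc_nz2 (assocM az bt); rewrite expr1 e; exact: assoc_refl.
Qed.
End Capit.

Lemma TT_norm k K (s : rmC) a : quad k K s -> Bez k -> TT K a -> TT k (a * s a).
Proof.
move=> q bk [da [n [l Kl al]]]; split; first exact: (DD_norm q bk da).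
exists n, (l * s l); first exact: (quad_N q).
by rewrite exprMn -rmorphXn; apply: assocM => //; rewrite assoc_aut.
Qed.

(** * Norms of the class C to k and to the rationals *)

Section Main.
Variables (p q : nat) (s2 sq sp si : rmC).
Hypotheses (ar : arith p q) (st : setup p q s2 sq sp si).
Notation L := (LL p q).
Notation w2 := w2. Notation wq := (wq q). Notation wp := (wp p).
Notation G := (gens p q).
Notation Qi := (Qi p q s2 sq sp). Notation Qq := (Qq p q s2 sp si). Notation Q2 := (Q2 p q sq sp si).
Notation kk := (kk p q s2 sq sp si). Notation Qm2 := (Qm2 p q s2 sq sp si). Notation Q2q := (Q2q p q s2 sq sp si).
Notation cqi := (cqi sq si). Notation c2q := (c2q s2 sq). Notation Yk := (Yk q).
Let rS : rsq G := @rsq_gens p q.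
Let g2 := flips_s2 st. Let gq := flips_sq st. Let gp := flips_sp st. Let gi := flips_si st.
Let g2q := g2q st. Let gqi := gqi st.
Let sL : is_subfield L := @LL_sf p q.
Let i0 : 'i != 0 :> algC := neq0Ci _.
Let w20 : w2 != 0 := w2_neq0.
Let QK := quad_k ar st.
Let sk := quad_sK QK.
Let kL x : kk x -> L x. Proof. exact: fixf_L. Qed.
Notation F1 := (fixf L [:: sp]). Notation F2 := (fixf L [:: cqi; sp]).
Let q1 : quad F1 L sp := @fixf_quad G rS sp [::] gp Logic.I.
Let q2 : quad F2 F1 cqi := @fixf_quad G rS cqi [:: sp] gqi (conj gp Logic.I).
Let q3 : quad kk F2 c2q := @fixf_quad G rS c2q [:: cqi; sp] g2q (conj gqi (conj gp Logic.I)).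
Let q3' : quad Q2 F2 si := @fixf_quad G rS si [:: cqi; sp] gi (conj gqi (conj gp Logic.I)).
Let B1 : Bez F1 := LBez ar st (conj gp Logic.I : allflips G [:: sp]).
Let B2 : Bez F2 := LBez ar st (conj gqi (conj gp Logic.I) : allflips G [:: cqi; sp]).
Let Bk : Bez kk := LBez ar st (conj g2q (conj gqi (conj gp Logic.I)) : allflips G [:: c2q; cqi; sp]).
Let BT : Bez Q2 := LBez ar st (conj gi (conj gqi (conj gp Logic.I)) : allflips G [:: si; cqi; sp]).

(** First of three quadratic steps of the norm from [L] to [kk]; [relN] is the full norm. *)
Definition relN1 (x : algC) := x * sp x.
Definition relN2 x := relN1 x * cqi (relN1 x).
Definition relN x := relN2 x * c2q (relN2 x).
Lemma N1M x y : relN1 (x * y) = relN1 x * relN1 y. Proof. by rewrite /relN1 rmorphM mulrACA. Qed.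
Lemma N2M x y : relN2 (x * y) = relN2 x * relN2 y. Proof. by rewrite /relN2 N1M rmorphM mulrACA. Qed.
Lemma nkM x y : relN (x * y) = relN x * relN y. Proof. by rewrite /relN N2M rmorphM mulrACA. Qed.
Lemma nkX x n : relN (x ^+ n) = relN x ^+ n.
Proof.
elim: n => [|n IH]; last by rewrite !exprS nkM IH.
by rewrite !expr0 /relN /relN2 /relN1 !(rmorph1, mulr1).
Qed.
Lemma nk_assoc x y : assoc x y -> assoc (relN x) (relN y).
Proof. by move=> h; do 3?(apply: assocM; last rewrite assoc_aut). Qed.
Lemma nk_K x : L x -> kk (relN x).
Proof. by move=> Lx; apply: (quad_N q3); apply: (quad_N q2); apply: (quad_N q1). Qed.
Lemma nk_DD x : DD L x -> DD kk (relN x).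
Proof. by move=> dx; apply: (DD_norm q3 Bk); apply: (DD_norm q2 B2); apply: (DD_norm q1 B1). Qed.

Lemma F2_agree x : F2 x -> c2q (si x) = s2 x /\ s2 (c2q x) = si x.
Proof.
move=> Fx; have [_ e] := Fx; have Lx : L x := fixf_L Fx; have Lsx : L (si x) := flips_L rS gi Lx.
split; first by rewrite /= [sq (si x)]e.
have eq : sq x = si x by rewrite -[in LHS]e /= (flips_inv rS gq Lsx).
by rewrite /= (flips_inv rS g2) // eq.
Qed.

(* Total norms to Q through the two quadratic fields. *)
Lemma total_norm d : TT L d -> exists x y, [/\ x \in Crat, y \in Crat &
  assoc (relN d * s2 (relN d)) (x ^+ 2 - 2 * y ^+ 2)].
Proof.
move=> td; have t2 : TT F2 (relN2 d) by apply: (TT_norm q2 B2); apply: (TT_norm q1 B1).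
(* The norm of [d] to Q(sqrt 2) is principal, as that field has odd class number; so the total norm
   is a value of [x ^+ 2 - 2 * y ^+ 2]. *)
have [t Qt at_] := triv_Q2 ar st (TT_norm q3' BT t2).
have gd : c2q w2 = - w2 by rewrite /= (sq2 st) (s22 st).
have [x [y [xq yq et nt]]] := quadQ_coord (quad_Q2 ar st) (Q2_w2 st) gd (w2K : _ = 2%:~R) w20 Qt.
exists x, y; split=> //; move: nt; rewrite -[2%:~R]/(2) => <-.
have d0 := DD_nz (proj1 t2); set M := relN2 d in t2 at_ d0 *.
have h1 : assoc ((M * si M) * c2q (M * si M)) (t * c2q t) by apply: assocM => //; rewrite assoc_aut.
apply: assoc_trans h1; rewrite /relN -/M [s2 (M * _)]rmorphM [c2q (M * _)]rmorphM.
have a1 : assoc (s2 M) (c2q (si M)).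
  by apply: assoc_sym; apply: (DD_agreeK (g := comprm c2q si) (h := s2) _ (proj1 t2)) => x1 /F2_agree[].
have a2 : assoc (s2 (c2q M)) (si M).
  by apply: (DD_agreeK (g := comprm s2 c2q) (h := si) _ (proj1 t2)) => x1 /F2_agree[].
have -> : M * si M * (c2q M * c2q (si M)) = M * c2q M * (c2q (si M) * si M) by ring.
have [c0 _ _ _] := assocE a1; have [c1 _ _ _] := assocE a2.
apply: assocM; first by apply: assoc_refl; rewrite mulf_neq0 // fmorph_eq0.
exact: assocM a1 a2.
Qed.

Variables (fp gam P rho rhoR : algC) (s0 : int) (s : nat).
Hypotheses (dg : DD L gam) (gf : assoc (gam ^+ 2) fp) (spf : assoc (sp fp) fp) (fA : fp \in Aint).
Hypotheses (fP : assoc (fp * cqi fp) P) (dP : DD kk P) (PA : P \in Aint) (pPP : assoc p%:R (P * sq P)) (cP : cop P (sq P)).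
Hypotheses (ps0 : (p%:Z %| s0 ^+ 2 + 2 * q%:Z)%Z) (YP : (Yk - s0%:~R) / P \in Aint).
Hypotheses (rel : assoc (rho * P * rhoR) (fp ^+ 2 * p%:R)) (f3 : (p %% 8 = 3)%N -> assoc (fp * c2q fp) P).
Hypotheses (os : odd s) (tC : TT L (gam ^+ s)) (tpi : TT kk (P ^+ s)) (prho : pr L (rho ^+ s)) (prR : pr L (rhoR ^+ s)).
Let C := gam ^+ s.
Let pi := P ^+ s.
Let P0 := DD_nz dP.
Let f0 : fp != 0 := assoc_nz2 gf.
Let gam0 := DD_nz dg.
Let pp := ar_p ar.

(** In [rel], raised to the power [s], the factors [rho], [rhoR] and [p] become principal. *)
Lemma C4 k : pr L (pi ^+ k) -> pr L (C ^+ (4 * k)).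
Proof.
move=> h; have : pr L ((rho ^+ s) ^+ k * pi ^+ k * (rhoR ^+ s) ^+ k * ((p%:R ^+ s) ^+ k)^-1).
  have p0 : p%:R ^+ s ^+ k != 0 :> algC by rewrite !expf_neq0 // pnatr_eq0 -lt0n prime_gt0.
  apply: (prM sL); last by apply: (prV sL); apply: pr_elt => //; do !apply: (sfX sL); apply: (sf_nat sL).
  by do 2?apply: (prM sL) => //; apply: (prX _ sL).
apply: pr_assoc; have p0 : p%:R != 0 :> algC by rewrite pnatr_eq0 -lt0n prime_gt0.
have p0' : p%:R ^+ s ^+ k != 0 :> algC by rewrite !expf_neq0.
have h1 : assoc ((rho * P * rhoR) ^+ s ^+ k) ((fp ^+ 2 * p%:R) ^+ s ^+ k) by do 2!apply: assocX.
have -> : (rho ^+ s) ^+ k * pi ^+ k * (rhoR ^+ s) ^+ k = (rho * P * rhoR) ^+ s ^+ k by rewrite /pi !exprMn.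
have -> : C ^+ (4 * k) = ((gam ^+ 2) ^+ 2) ^+ s ^+ k * p%:R ^+ s ^+ k / p%:R ^+ s ^+ k.
  by rewrite mulfK // /C -!exprM; congr (_ ^+ _); ring.
apply: assocM; last by apply: assoc_refl; rewrite invr_eq0.
apply: (assoc_trans h1); rewrite -!exprMn; do 2!apply: assocX; apply: assocM; last exact: assoc_refl.
by apply: assocX; apply: assoc_sym.
Qed.

(** The norm of [fp] is [P ^+ 4]: [sp] and [c2q] fix the ideals they meet and so square them, while
    [cqi] turns [fp] into [P]. For [gam], a square root of [fp], the exponent is halved. *)
Lemma nk_C : assoc (relN C) (pi ^+ 2).
Proof.
rewrite /C nkX /pi -exprM mulnC exprM; apply: assocX; apply: (@assoc_root 2) => //; rewrite -nkX.
apply: (assoc_trans (nk_assoc gf)); rewrite -exprM.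
have h1 : assoc (relN1 fp) (fp ^+ 2) by rewrite expr2; apply: assocM; first exact: assoc_refl.
have h2 : assoc (relN2 fp) (P ^+ 2).
  apply: (assoc_trans (y := fp ^+ 2 * cqi (fp ^+ 2))); first by apply: assocM => //; rewrite assoc_aut.
  by rewrite rmorphXn -exprMn; apply: assocX.
apply: (assoc_trans (y := P ^+ 2 * c2q (P ^+ 2))); first by apply: assocM => //; rewrite assoc_aut.
rewrite (exprD P 2 2); apply: assocM; first by apply: assoc_refl; rewrite expf_neq0.
rewrite rmorphXn; apply: assocX; apply: (DD_fixed (K := kk)) dP => x; exact: (quad_fix q3).
Qed.

Let dpi : DD kk pi := proj1 tpi.

Lemma NS_pi d : TT kk d -> ~ pr kk (pi * d ^+ 2).
Proof.
move=> [dd _] [z kz h]; apply: (NS_k ar st os (leq0n 1) pPP dP dd kz).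
by rewrite expr0 mul1r.
Qed.

(** The order of [pi] is at least 4: with a smaller order its class would be trivial or that of the
    prime above 2, and the genus character at [q] excludes both. *)
Lemma pi_order : exists n, [/\ (0 < n)%N, pr kk (pi ^+ (2 ^ n.+1)) & ~ pr kk (pi ^+ (2 ^ n))].
Proof.
have d1 : DD kk 1 by apply: DD_elt => //; [exact: (sf1 sk) | exact: oner_neq0].
have [n [hn nmin]] := nat_min (proj2 tpi).
have npr j : (j < n)%N -> ~ pr kk (pi ^+ (2 ^ j)) by move=> lt /nmin; rewrite leqNgt lt.
case: n hn nmin npr => [|[|n]] hn nmin npr.
- by exfalso; apply: (NS_pi (pr_TT sk (pr1 sk))); move: hn; rewrite expn0 expr1 expr1n mulr1.
- exfalso; have [be [z [kz az]]] := sqrt_kk ar st dpi hn.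
  apply: (NS_k ar st os (b := be) _ pPP dP d1 kz); first by case: (be).
  by rewrite expr1n mulr1.
by exists n.+1; split=> //; apply: npr.
Qed.

(** If [C * d ^+ 2] were principal, [pi * relN d] would have a principal square, and its norm would
    give [p ^+ s * (x ^+ 2 - 2 * y ^+ 2)] equal to [2 ^+ be * (u ^+ 2 + 2 * q * v ^+ 2)] up to sign.
    The odd part of the second is 1 or -1 modulo 8, as -q is 1 modulo 8; that of the first is 3 or
    -3. *)
Lemma C_nonsq d : TT L d -> ~ pr L (C * d ^+ 2).
Proof.
move=> td [l Ll h]; have dk := nk_DD (proj1 td).
have h1 : pr kk ((pi * relN d) ^+ 2).
  exists (relN l); first exact: nk_K.
  apply: assoc_trans (nk_assoc h); rewrite nkM nkX exprMn; apply: assocM; first exact: assoc_sym nk_C.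
  by apply: assoc_refl; rewrite expf_neq0 // (DD_nz dk).
have [be [z [kz hz]]] := sqrt_kk ar st (DDM sk dpi dk) h1.
have [x [y [xq yq axy]]] := total_norm td.
have [u [v [uq vq _ nz _]]] := kk_norm ar st kz.
have fx t : kk t -> s2 t = sq t.
  by move=> kt; have [_ e] := kt; rewrite -[in LHS]e (flips_inv rS g2) //; apply: (flips_L rS gq); apply: fixf_L kt.
have pP2 : assoc (P * s2 P) p%:R.
  apply: assoc_sym; apply: (assoc_trans pPP); apply: assocM; first exact: assoc_refl.
  by apply: assoc_sym; apply: DD_agreeK dP.
have z0 : z != 0 by have := assoc_nz2 hz; rewrite mulf_eq0 negb_or => /andP[].
have H : assoc (p%:R ^+ s * (x ^+ 2 - 2 * y ^+ 2)) (2 ^+ be * (u ^+ 2 + 2 * q%:R * v ^+ 2)).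
  apply: (assoc_trans (y := (pi * relN d) * s2 (pi * relN d))).
    rewrite rmorphM mulrACA; apply: assoc_sym; apply: assocM => //.
    by rewrite /pi rmorphXn -exprMn; apply: assocX.
  apply: (assoc_trans (y := (w2 ^+ be * z) * s2 (w2 ^+ be * z))); first by apply: assocM => //; rewrite assoc_aut.
  have -> : (w2 ^+ be * z) * s2 (w2 ^+ be * z) = 2 ^+ be * (u ^+ 2 + 2 * q%:R * v ^+ 2) * (-1) ^+ be.
    rewrite rmorphM rmorphXn (s22 st) [(- w2) ^+ be]exprNn -nz -[2 in RHS]w2K -exprM mulnC exprM; ring.
  apply: assoc_unit; last by apply: aunitX; apply: aunitN1.
  by rewrite -nz !mulf_neq0 ?expf_neq0 ?fmorph_eq0 // pnatr_eq0.
have [H1 H2] := (assoc_nz1 H, assoc_nz2 H).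
have [r1 r2] : p%:R ^+ s * (x ^+ 2 - 2 * y ^+ 2) \in Crat /\ 2 ^+ be * (u ^+ 2 + 2 * q%:R * v ^+ 2) \in Crat.
  split; first by apply: rpredM; [apply: rpredX; apply: rpred_nat | apply: rpredB; [exact: rpredX | apply: rpredM; [exact: rpred_nat | exact: rpredX]]].
  apply: rpredM; [apply: rpredX; apply: rpred_nat | apply: rpredD; [exact: rpredX | apply: rpredM; [apply: rpredM; apply: rpred_nat | exact: rpredX]]].
have [e eE] : exists e : bool, p%:R ^+ s * (x ^+ 2 - 2 * y ^+ 2) = (-1) ^+ e * (2 ^+ be * (u ^+ 2 + 2 * q%:R * v ^+ 2)).
  by case: (rat_assoc r1 r2 H) => ->; [exists false | exists true]; rewrite ?expr0 ?mul1r ?expr1 ?mulN1r.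
have [N [X [Y [_ [N0 eX eY _]]]]] := rat_common xq yq yq.
have [M [U [V [_ [M0 eU eV _]]]]] := rat_common uq vq vq.
(* The squares of the denominators [N] and [M] are written as values of the same form, so that
   [T8_form] covers them too. *)
have eI : p%:Z ^+ s * (X ^+ 2 - 2 * 1 * Y ^+ 2) * (M ^+ 2 - 2 * 1 * 0 ^+ 2) =
  (-1) ^+ e * 2 ^+ be * (U ^+ 2 - 2 * (- q%:Z) * V ^+ 2) * (N ^+ 2 - 2 * 1 * 0 ^+ 2).
  apply: (@intr_inj algC).
  have iX (t : int) (j : nat) : (t ^+ j)%:~R = t%:~R ^+ j :> algC by rewrite rmorphXn.
  rewrite !(intrM, rmorphB, rmorphN) /= !(intrM, iX, rmorphN, rmorph0) /= rmorph1 -eX -eY -eU -eV -[2%:~R]/(2) -[p%:Z%:~R]/(p%:R) -[q%:Z%:~R]/(q%:R).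
  transitivity (N%:~R ^+ 2 * M%:~R ^+ 2 * (p%:R ^+ s * (x ^+ 2 - 2 * y ^+ 2))); first by ring.
  by rewrite eE; ring.
have T1 : (8 %| 1 - 1)%Z by [].
have Tq : (8 %| - q%:Z - 1)%Z.
  apply/dvdzP; exists (- (q %/ 8).+1%:Z); have := divn_eq q 8; rewrite (ar_q8 ar); clear; lia.
have nzI (a b : int) (a' b' : algC) (n : int) : n%:~R * a' = a%:~R -> n%:~R * b' = b%:~R -> n != 0 -> (a' != 0) || (b' != 0) -> (a != 0) || (b != 0).
  move=> k1 k2 n0; rewrite -!(intr_eq0 algC) -k1 -k2 !mulf_eq0 intr_eq0 (negPf n0) //.
have xy0 : (x != 0) || (y != 0).
  by apply/negPn/negP; rewrite negb_or !negbK => /andP[/eqP x0 /eqP y0]; move/eqP: H1; apply; rewrite x0 y0 !expr0n /= mulr0 subrr mulr0.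
have uv0 : (u != 0) || (v != 0).
  by apply/negPn/negP; rewrite negb_or !negbK => /andP[/eqP x0 /eqP y0]; move/eqP: H2; apply; rewrite x0 y0 !expr0n /= mulr0 addr0 mulr0.
have TM : T8 (M ^+ 2 - 2 * 1 * 0 ^+ 2) by apply: T8_form => //; rewrite M0.
have TN : T8 (N ^+ 2 - 2 * 1 * 0 ^+ 2) by apply: T8_form => //; rewrite N0.
have TXY := T8_form T1 (nzI _ _ _ _ _ eX eY N0 xy0).
have TUV := T8_form Tq (nzI _ _ _ _ _ eU eV M0 uv0).
have Ts (b : bool) : T8 ((-1) ^+ b) by exists 0%N, ((-1) ^+ b); split; [rewrite expr0 mul1r | case: b; [right | left]].
have T2 (b : bool) : T8 (2 ^+ b) by exists b, 1; split; [rewrite mulr1 | left].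
have Tp : T8' (p%:Z ^+ s).
  have p2 : T8 (p%:Z ^+ 2).
    have -> : p%:Z ^+ 2 = p%:Z ^+ 2 - 2 * 1 * 0 ^+ 2 by ring.
    apply: (@T8_form 1 p%:Z 0) => //.
    by rewrite -lt0n prime_gt0.
  have p1 : T8' p%:Z.
    exists 0%N, p%:Z; split; first by rewrite expr0 mul1r.
    have := divn_eq p 8; case: (ar_p8 ar) => ->; move: (p %/ 8)%N => k ->; [right | left]; apply/dvdzP; [exists (k%:Z + 1) | exists k%:Z]; clear; lia.
  have -> : s = (2 * s./2).+1 by rewrite -[LHS]odd_double_half os mul2n add1n.
  rewrite exprSr exprM; elim: s./2 => [|j IH]; first by rewrite expr0 mul1r.
  by rewrite exprS -mulrA; apply: T8M'.
apply: (@T8_disj (p%:Z ^+ s * (X ^+ 2 - 2 * 1 * Y ^+ 2) * (M ^+ 2 - 2 * 1 * 0 ^+ 2))).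
  by rewrite eI; do 3?apply: T8M.
by rewrite -mulrA mulrC; apply: T8M' Tp; apply: T8M.
Qed.
End Main.

(** * The order of C *)

Section Order.
Variables (p q : nat) (s2 sq sp si : rmC).
Hypotheses (ar : arith p q) (st : setup p q s2 sq sp si).
Notation L := (LL p q).
Notation w2 := w2. Notation wq := (wq q). Notation wp := (wp p).
Notation G := (gens p q).
Notation Qi := (Qi p q s2 sq sp). Notation Qq := (Qq p q s2 sp si). Notation Q2 := (Q2 p q sq sp si).
Notation kk := (kk p q s2 sq sp si). Notation Qm2 := (Qm2 p q s2 sq sp si). Notation Q2q := (Q2q p q s2 sq sp si).
Notation cqi := (cqi sq si). Notation c2q := (c2q s2 sq). Notation Yk := (Yk q).
Let rS : rsq G := @rsq_gens p q.
Let g2 := flips_s2 st. Let gq := flips_sq st. Let gp := flips_sp st. Let gi := flips_si st.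
Let g2q := g2q st. Let gqi := gqi st.
Let sL : is_subfield L := @LL_sf p q.
Let i0 : 'i != 0 :> algC := neq0Ci _.
Let w20 : w2 != 0 := w2_neq0.
Let QK := quad_k ar st.
Let sk := quad_sK QK.
Let kL x : kk x -> L x. Proof. exact: fixf_L. Qed.
Notation F1 := (fixf L [:: sp]). Notation F2 := (fixf L [:: cqi; sp]).
Let q1 : quad F1 L sp := @fixf_quad G rS sp [::] gp Logic.I.
Let q2 : quad F2 F1 cqi := @fixf_quad G rS cqi [:: sp] gqi (conj gp Logic.I).
Let q3 : quad kk F2 c2q := @fixf_quad G rS c2q [:: cqi; sp] g2q (conj gqi (conj gp Logic.I)).
Let q3' : quad Q2 F2 si := @fixf_quad G rS si [:: cqi; sp] gi (conj gqi (conj gp Logic.I)).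
Let B1 : Bez F1 := LBez ar st (conj gp Logic.I : allflips G [:: sp]).
Let B2 : Bez F2 := LBez ar st (conj gqi (conj gp Logic.I) : allflips G [:: cqi; sp]).
Let Bk : Bez kk := LBez ar st (conj g2q (conj gqi (conj gp Logic.I)) : allflips G [:: c2q; cqi; sp]).
Let BT : Bez Q2 := LBez ar st (conj gi (conj gqi (conj gp Logic.I)) : allflips G [:: si; cqi; sp]).

Variables (fp gam P rho rhoR : algC) (s0 : int) (s : nat).
Hypotheses (dg : DD L gam) (gf : assoc (gam ^+ 2) fp) (spf : assoc (sp fp) fp) (fA : fp \in Aint).
Hypotheses (fP : assoc (fp * cqi fp) P) (dP : DD kk P) (PA : P \in Aint) (pPP : assoc p%:R (P * sq P)) (cP : cop P (sq P)).
Hypotheses (ps0 : (p%:Z %| s0 ^+ 2 + 2 * q%:Z)%Z) (YP : (Yk - s0%:~R) / P \in Aint).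
Hypotheses (rel : assoc (rho * P * rhoR) (fp ^+ 2 * p%:R)) (f3 : (p %% 8 = 3)%N -> assoc (fp * c2q fp) P).
Hypotheses (os : odd s) (tC : TT L (gam ^+ s)) (tpi : TT kk (P ^+ s)) (prho : pr L (rho ^+ s)) (prR : pr L (rhoR ^+ s)).
Let C := gam ^+ s.
Let pi := P ^+ s.
Let P0 := DD_nz dP.
Let f0 : fp != 0 := assoc_nz2 gf.
Let gam0 := DD_nz dg.
Let pp := ar_p ar.


Notation N1 := (relN1 sp). Notation N2 := (relN2 sq sp si). Notation nk := (relN s2 sq sp si).
Let dpi : DD kk pi := proj1 tpi.
Let aI : aunit 'i. Proof. by apply: (@aunit_root 2) => //; rewrite sqrCi; apply: aunitN1. Qed.

Let nk_C' : assoc (nk C) (pi ^+ 2). Proof. eapply nk_C; eassumption. Qed.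
Section Alpha.
Variables (n : nat) (al : algC).
Hypotheses (La : L al) (Ca : assoc (C ^+ (2 ^ n)) al).
Hypotheses (pr1n : pr kk (pi ^+ (2 ^ n.+1))) (npr : ~ pr kk (pi ^+ (2 ^ n))).

Lemma al_A : al \in Aint.
Proof.
have [C0 a0 _ h] := assocE Ca.
have gA : gam \in Aint.
  apply: (@Aint_root 2) => //; have [_ _ h1 _] := assocE gf.
  by rewrite -[gam ^+ 2](divfK f0); apply: rpredM.
by rewrite -[al](divfK C0); apply: rpredM => //; do 2!apply: rpredX.
Qed.

(** The class of [pi ^+ (2 ^ n)] has order 2, so it is that of [w2], and the norm of [al] is
    [2 * z ^+ 2] times a unit of [kk]. The Selmer list makes this unit a square up to sign; a factor
    2 in it would make [w2], hence [pi ^+ (2 ^ n)], principal. *)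
Lemma nk_alpha : exists (e : bool) z, [/\ kk z, z != 0, nk al = (-1) ^+ e * 2 * z ^+ 2 & assoc (pi ^+ (2 ^ n)) (w2 * z)].
Proof.
have dn : DD kk (pi ^+ (2 ^ n)) by apply: (DDX _ sk).
have h2 : pr kk ((pi ^+ (2 ^ n)) ^+ 2) by rewrite -exprM mulnC -expnS.
have [[] [z [kz az]]] := sqrt_kk ar st dn h2; last by case: npr; exists z => //; move: az; rewrite expr0 mul1r.
rewrite expr1 in az; have z0 : z != 0 by have := assoc_nz2 az; rewrite mulf_eq0 negb_or => /andP[].
have a1 : assoc (nk al) (2 * z ^+ 2).
  apply: assoc_trans (assoc_sym (nk_assoc s2 sq sp si Ca)) _; rewrite nkX.
  apply: assoc_trans (assocX _ nk_C') _; rewrite exprAC -w2K -exprMn; exact: assocX.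
have t0 : 2 * z ^+ 2 != 0 := assoc_nz2 a1.
have kt : kk (2 * z ^+ 2) by apply: (sfM sk); [apply: (sf_nat sk) | apply: (sfX sk)].
have [e [be [y [ky y0 ey]]]] := S_kk ar st (SS_unit sk (sfM sk (nk_K st La) (sfV sk kt)) a1).
have ue : aunit ((-1) ^+ e) by apply: aunitX; apply: aunitN1.
case: be ey => ey.
  case: npr; exists (y^-1 * z); first by apply: (sfM sk) => //; apply: (sfV sk).
  apply: (assoc_trans az); apply: assocM; last exact: assoc_refl.
  rewrite /assoc invrK; apply: (@aunit_root 2) => //.
  have -> : (w2 * y) ^+ 2 = (-1) ^+ e * (nk al / (2 * z ^+ 2)).
    by rewrite ey exprMn w2K expr1 !mulrA -expr2 sqrr_sign mul1r.
  exact: aunitM.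
exists e, (z * y); split; [exact: (sfM sk) | exact: mulf_neq0 | |].
  by rewrite -[LHS](divfK t0) ey expr0; ring.
apply: (assoc_trans az); rewrite mulrA; apply: assoc_sym; apply: assoc_unit; first exact: assoc_nz2 az.
apply: (@aunit_root 2) => //; have -> : y ^+ 2 = (-1) ^+ e * (nk al / (2 * z ^+ 2)).
  by rewrite ey expr0 mulr1 mulrA -expr2 sqrr_sign mul1r.
exact: aunitM.
Qed.

(* Inertia at p: the square of [al - sp al] is almost divisible by p, so the norm of [al] is a square modulo p. *)
Lemma alpha_residue (e : bool) z : kk z -> nk al = (-1) ^+ e * 2 * z ^+ 2 -> ~ sqmod ((-1) ^+ e * 2) p -> False.
Proof.
move=> kz ez nsq; have alA := al_A; have C0 := assoc_nz1 Ca.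
have p0 : p%:R != 0 :> algC by rewrite pnatr_eq0 -lt0n prime_gt0.
have spP0 : sq P != 0 by rewrite fmorph_eq0.
have wp0 : wp != 0 := wp_neq0 ar.
pose D : int := 1 * (2 * -1) * (2 * q%:Z) * (2 * 2).
have saA : sp al \in Aint by apply: Aintg.
(* [(al - sp al) * wp] is fixed by [sp] and divisible by [wp]; in that fixed field [p] is
   unramified, so [D] times it is divisible by [p]. *)
have h1 : (D%:~R * ((al - sp al) * wp)) / p%:R \in Aint.
  apply: (unr_sp ar st pp).
    apply: (quad_in q1); first by do ?[apply: (sfM sL) | apply: (sfB sL) | exact: (flips_L rS gp) | exact: LL_wp | done].
    by rewrite rmorphM rmorphB (flips_inv rS gp La) (spp st); ring.
  by rewrite mulfK //; apply: rpredB.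
pose A1 := (4 * D ^+ 2)%:~R * N1 al; pose T1 := D%:~R * (al + sp al).
have A1A : A1 \in Aint by rewrite /A1 /N1; apply: rpredM; [exact: Aint_int | exact: rpredM].
have T1A : T1 \in Aint by rewrite /T1; apply: rpredM; [exact: Aint_int | exact: rpredD].
have c1 : (A1 - T1 ^+ 2) / p%:R \in Aint.
  have -> : (A1 - T1 ^+ 2) / p%:R = - ((D%:~R * ((al - sp al) * wp)) / p%:R) ^+ 2.
    have e2 : (D%:~R * ((al - sp al) * wp)) ^+ 2 = D%:~R ^+ 2 * (al - sp al) ^+ 2 * p%:R by rewrite -(wpK p); ring.
    have e4 : (4 * D ^+ 2)%:~R = 4 * D%:~R ^+ 2 :> algC by rewrite intrM rmorphXn; congr (_ * _).
    rewrite expr_div_n e2 /A1 e4 /T1 /relN1; field.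
    exact: p0.
  by rewrite rpredN; apply: rpredX.
have cg (g : rmC) a b : a \in Aint -> b \in Aint -> (a - b ^+ 2) / p%:R \in Aint -> (a * g a - (b * g b) ^+ 2) / p%:R \in Aint.
  move=> aA bA h; have gh : g ((a - b ^+ 2) / p%:R) \in Aint by apply: Aintg.
  have -> : (a * g a - (b * g b) ^+ 2) / p%:R = (a - b ^+ 2) / p%:R * g a + b ^+ 2 * g ((a - b ^+ 2) / p%:R).
    by rewrite rmorphM rmorphB rmorphXn fmorphV rmorph_nat; field.
  by apply: rpredD; apply: rpredM => //; [apply: Aintg | apply: rpredX].
have c2 := cg cqi _ _ A1A T1A c1.
set A2 := A1 * cqi A1 in c2; set T2 := T1 * cqi T1 in c2.
have A2A : A2 \in Aint by apply: rpredM => //; apply: Aintg.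
have T2A : T2 \in Aint by apply: rpredM => //; apply: Aintg.
have c3 := cg c2q _ _ A2A T2A c2; set U := T2 * c2q T2 in c3.
have UA : U \in Aint by apply: rpredM => //; apply: Aintg.
have kU : kk U.
  apply: (quad_N q3); apply: (quad_N q2); apply: (quad_in q1).
    by apply: (sfM sL); [exact: (sf_int sL) | apply: (sfD sL) => //; exact: (flips_L rS gp)].
  by rewrite rmorphM rmorphD rmorph_int (flips_inv rS gp La) addrC.
have eA3 : A2 * c2q A2 = (4 * D ^+ 2)%:~R ^+ 4 * nk al.
  have hM (g : rmC) a b : g (a * b) = g a * g b := rmorphM g a b.
  by rewrite /A2 /A1 /relN /relN2; move: (N1 al) => N; rewrite !(hM cqi) !(hM c2q) !rmorph_int; ring.
(* Chosen so that [W ^+ 2] is, up to sign, twice the norm of [A1], which is congruent to [U ^+ 2]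
   modulo [p]. *)
pose f : int := 4 * D ^+ 2; pose W := f%:~R ^+ 2 * (2 * z).
have kW : kk W by apply: (sfM sk); [apply: (sfX sk); exact: (sf_int sk) | apply: (sfM sk) => //; exact: (sf_nat sk)].
have nkA : nk al \in Aint.
  by rewrite /relN /relN2 /relN1; do ?[apply: rpredM | apply: Aintg | done].
have A2c : (2 : algC) \in Aint by rewrite -[2]/(2%:~R) Aint_int.
have eZ : (2 * z) ^+ 2 = (-1) ^+ e * 2 * nk al.
  by rewrite ez exprMn; case: (e); rewrite ?expr0 ?expr1; ring.
have ZA : 2 * z \in Aint.
  apply: (@Aint_root 2) => //; rewrite eZ; apply: rpredM => //; apply: rpredM => //; apply: rpredX.
  by rewrite rpredN; apply: Aint1.
have WA : W \in Aint by apply: rpredM => //; apply: rpredX; apply: Aint_int.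
have c4 : ((-1) ^+ e * W ^+ 2 - 2 * U ^+ 2) / p%:R \in Aint.
  have -> : ((-1) ^+ e * W ^+ 2 - 2 * U ^+ 2) = 2 * (A2 * c2q A2 - U ^+ 2).
    by rewrite eA3 /W exprMn eZ -/f; case: (e); rewrite ?expr0 ?expr1; ring.
  by rewrite -mulrA; apply: rpredM.
(* Residues are taken at [sq P] instead of [P]: the norm of [al] is a power of [P] up to a unit,
   hence comaximal to [sq P], which gives the contradiction. *)
have tA : sq P \in Aint by apply: Aintg.
have tn : (sq P)^-1 \notin Aint.
  apply/negP => h; have uP : aunit P by rewrite -(aunit_aut sq) /aunit spP0 tA.
  have [_ _ _ h2] := assocE pPP; move/negP: (nat_inv_nA pp); apply.
  have -> : p%:R^-1 = (P * sq P) / p%:R * (P^-1 * (sq P)^-1) by field; rewrite P0 spP0 p0.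
  by apply: rpredM => //; apply: rpredM => //; case/and3P: uP.
have pt : p%:R / sq P \in Aint.
  have [_ _ h2 _] := assocE pPP; have -> : p%:R / sq P = p%:R / (P * sq P) * P by field; rewrite P0 spP0.
  exact: rpredM.
have Yd : Yk ^+ 2 = (- (2 * q%:Z))%:~R.
  by rewrite /Yk !exprMn w2K wqK sqrCi rmorphN /= intrM; ring.
have YA : (Yk - (- s0)%:~R) / sq P \in Aint.
  have -> : (Yk - (- s0)%:~R) / sq P = - sq ((Yk - s0%:~R) / P).
    rewrite rmorphM rmorphB fmorphV rmorph_int /Yk !rmorphM (sqi st) (sq2 st) (sqq st) rmorphN /=; field.
    exact: spP0.
  by rewrite rpredN; apply: Aintg.
have gY : s2 Yk = - Yk by rewrite /Yk !rmorphM (s2i st) (s22 st) (s2q st); ring.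
have Y0 : Yk != 0 by rewrite /Yk !mulf_neq0 //; exact: wq_neq0 ar.
have dsP : DD kk (sq P).
  apply: (DD_aut _ dP) => x; apply: (fixf_flips rS gq); exact: (conj g2q (conj gqi (conj gp Logic.I))).
have [M hM] := red_k QK (kk_wk st) gY Yd Y0 dsP YA kW WA.
have [M' hM'] := red_k QK (kk_wk st) gY Yd Y0 dsP YA kU UA.
set c0 : int := 4 * - (2 * q%:Z) in hM hM'.
have c0A (k : int) : (k%:~R : algC) \in Aint by apply: Aint_int.
have eA : ((-1) ^+ e : algC) \in Aint by apply: rpredX; rewrite rpredN; apply: Aint1.
have hI : (p%:Z %| M ^+ 2 - (-1) ^+ e * 2 * M' ^+ 2)%Z.
  apply: (int_dvd pp spP0 pt tn).
  have c5 : ((-1) ^+ e * W ^+ 2 - 2 * U ^+ 2) / sq P \in Aint.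
    have -> : ((-1) ^+ e * W ^+ 2 - 2 * U ^+ 2) / sq P = ((-1) ^+ e * W ^+ 2 - 2 * U ^+ 2) / p%:R * (p%:R / sq P).
      by field; rewrite spP0 p0.
    exact: rpredM.
  set x1 := (c0%:~R * W - M%:~R) / sq P in hM; set x2 := (c0%:~R * U - M'%:~R) / sq P in hM'.
  set x3 := (_ - _) / sq P in c5.
  have -> : (M ^+ 2 - (-1) ^+ e * 2 * M' ^+ 2)%:~R / sq P =
     (-1) ^+ e * (c0%:~R ^+ 2 * x3 - (-1) ^+ e * x1 * (c0%:~R * W + M%:~R) + 2 * x2 * (c0%:~R * U + M'%:~R)).
    have e1 : M%:~R = c0%:~R * W - x1 * sq P by rewrite divfK //; ring.
    have e2 : M'%:~R = c0%:~R * U - x2 * sq P by rewrite divfK //; ring.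
    have e3 : x3 * sq P = (-1) ^+ e * W ^+ 2 - 2 * U ^+ 2 by rewrite divfK.
    apply: (mulIf spP0); rewrite divfK //.
    transitivity ((-1) ^+ e * (c0%:~R ^+ 2 * (x3 * sq P) - (-1) ^+ e * (x1 * sq P) * (c0%:~R * W + M%:~R) + 2 * (x2 * sq P) * (c0%:~R * U + M'%:~R))); last by ring.
    have -> : x1 * sq P = c0%:~R * W - M%:~R by rewrite divfK.
    have -> : x2 * sq P = c0%:~R * U - M'%:~R by rewrite divfK.
    rewrite e3 rmorphB /= !intrM -!expr2 rmorphXn /= rmorphN1; case: (e); rewrite ?expr0 ?expr1; ring.
  by do ?[done | apply: rpredM | apply: rpredB | apply: rpredD | apply: rpredN | apply: rpredX].
have [/dvdzP[k eM] _] := andP (nsq_rel pp nsq hI).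
have hW : (c0%:~R * W) / sq P \in Aint.
  have -> : (c0%:~R * W) / sq P = (c0%:~R * W - M%:~R) / sq P + k%:~R * (p%:R / sq P).
    by rewrite eM intrM -[p%:Z%:~R]/(p%:R : algC); field.
  by apply: rpredD => //; apply: rpredM.
have ndM (a b : int) : ~~ (p%:Z %| a)%Z -> ~~ (p%:Z %| b)%Z -> ~~ (p%:Z %| a * b)%Z.
  by rewrite !dvdzE abszM !absz_nat Euclid_dvdM // negb_or => -> ->.
have p3 : (2 < p)%N by have := prime_gt1 pp; have := ar_p8 ar; case: (p) => [|[|[|?]]] //= -[].
have nd1 : ~~ (p%:Z %| 1)%Z by rewrite dvdzE /= dvdn1 neq_ltn (ltn_trans _ p3) ?orbT.
have nd2 : ~~ (p%:Z %| 2)%Z by rewrite dvdzE /=; apply/negP => /dvdn_leq h; move: (h isT); rewrite leqNgt p3.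
have nd4 : ~~ (p%:Z %| 4)%Z by apply: (ndM 2 2).
have ndq : ~~ (p%:Z %| q%:Z)%Z.
  rewrite dvdzE !absz_nat dvdn_prime2 //; last exact: ar_q ar.
  by apply/eqP => epq; have := ar_p8 ar; rewrite epq (ar_q8 ar) => -[].
have ndN (a : int) : ~~ (p%:Z %| a)%Z -> ~~ (p%:Z %| - a)%Z by rewrite rpredN.
have ndD : ~~ (p%:Z %| D)%Z.
  exact (ndM _ _ (ndM _ _ (ndM _ _ nd1 (ndM _ _ nd2 (ndN _ nd1))) (ndM _ _ nd2 ndq)) (ndM _ _ nd2 nd2)).
have ndf : ~~ (p%:Z %| f)%Z by exact (ndM _ _ nd4 (ndM _ _ ndD ndD)).
have ndc : ~~ (p%:Z %| c0 * (f * f))%Z.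
  exact (ndM _ _ (ndM _ _ nd4 (ndN _ (ndM _ _ nd2 ndq))) (ndM _ _ ndf ndf)).
have cc := cop_int pp ndc spP0 pt; have c22 := cop_int pp nd2 spP0 pt.
have hZ : 2 * z / sq P \in Aint.
  apply: (cop_dvd spP0 cc ZA).
  by have -> : (c0 * (f * f))%:~R * (2 * z) = c0%:~R * W by rewrite /W !intrM; ring.
have hn : nk al / sq P \in Aint.
  apply: (cop_dvd spP0 c22 nkA).
  have -> : 2%:~R * nk al / sq P = (-1) ^+ e * (2 * z) * (2 * z / sq P).
    transitivity ((-1) ^+ e * (2 * z) ^+ 2 / sq P); last by field.
    by rewrite eZ; case: (e); rewrite ?expr0 ?expr1; congr (_ / _); ring.
  by do ?[done | apply: rpredM].
have cPn j : cop (P ^+ j) (sq P).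
  elim: j => [|j IH]; first by rewrite expr0; apply: cop_unit; apply: aunit1.
  by rewrite exprS; apply: copM => //; apply: rpredX.
have an : assoc (nk al) (P ^+ (s * 2 * 2 ^ n)).
  apply: assoc_trans (assoc_sym (nk_assoc s2 sq sp si Ca)) _; rewrite nkX.
  by rewrite 2!exprM; apply: assocX; exact: nk_C'.
move/negP: tn; apply; apply: (cop_not (cPn (s * 2 * 2 ^ n)%N) _ spP0); rewrite -(assoc_dvd2 _ an); exact: hn.
Qed.

(* A unit of relative norm -1 down to k would force -1 or -2 to be a norm from Q(sqrt(2q)). *)
Lemma alpha_sign z : (p %% 8 = 3)%N -> kk z -> z != 0 -> assoc (pi ^+ (2 ^ n)) (w2 * z) -> nk al = - 1 * 2 * z ^+ 2 -> False.
Proof.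
move=> p3 kz z0 az ez.
have comm (g h : rmC) x : flips G g -> flips G h -> L x -> g (h x) = h (g x) := @flips_comm G rS g h x.
set M1 := N1 al; have F1M : F1 M1 by apply: (quad_N q1).
have LM : L M1 := quad_sub q1 F1M.
have spM : sp M1 = M1 by have [] := F1M.
have Li : L 'i := @LL_i p q. have Lz : L z := kL kz.
have [[[_ spz] cqz] c2z] := kz; have L2 : L w2 := @LL_w2 p q.
have LcM : L (c2q M1) := flips_L rS g2q LM.
(* The norm of [al] to Q(i, sqrt(2q)); through [f3] its ideal is that of [w2 * z]. *)
set a0 := M1 * c2q M1; have La0 : L a0 by apply: (sfM sL).
have c2a : c2q a0 = a0 by rewrite /a0 rmorphM (flips_inv rS g2q LM) mulrC.
have spa : sp a0 = a0 by rewrite /a0 rmorphM (comm _ _ _ gp g2q LM) spM.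
have na : a0 * cqi a0 = nk al.
  have hM (g : rmC) a b : g (a * b) = g a * g b := rmorphM g a b.
  have ec : cqi (c2q M1) = c2q (cqi M1) := comm cqi c2q M1 gqi g2q LM.
  by rewrite /a0 /relN /relN2 -/M1 (hM cqi M1) (hM c2q M1) ec; ring.
have aa : assoc a0 (w2 * z).
  have h1 : assoc (N1 gam) fp.
    apply: (@assoc_root 2) => //; rewrite /relN1 exprMn -rmorphXn expr2; apply: assocM => //.
    by apply: assoc_trans spf; rewrite assoc_aut.
  have h2 : assoc M1 (N1 gam ^+ s ^+ (2 ^ n)).
    have -> : N1 gam ^+ s ^+ (2 ^ n) = C ^+ (2 ^ n) * sp (C ^+ (2 ^ n)) by rewrite /relN1 /C !rmorphXn -!exprMn.
    by apply: assoc_sym; apply: assocM => //; rewrite assoc_aut.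
  have h3 : assoc M1 (fp ^+ s ^+ (2 ^ n)) by apply: (assoc_trans h2); do 2!apply: assocX.
  apply: assoc_trans az; apply: (assoc_trans (y := (fp * c2q fp) ^+ s ^+ (2 ^ n))).
    by rewrite !exprMn -!rmorphXn; apply: assocM => //; rewrite assoc_aut.
  by do 2!apply: assocX; apply: f3.
have ii : 'i * 'i = -1 :> algC by rewrite -expr2 sqrCi.
have n1i : (1 + 'i) * (1 - 'i) = 2 :> algC by rewrite mulrDl !mulrBr ii; ring.
have s1i : (1 + 'i) ^+ 2 = 2 * 'i :> algC by rewrite expr2 mulrDl !mulrDr ii; ring.
have [i1 i2] : 1 + 'i != 0 :> algC /\ 1 - 'i != 0 :> algC.
  by apply/andP; rewrite -negb_or -mulf_eq0 n1i pnatr_eq0.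
(* [w2] is replaced by its associate [1 + 'i], which lies in Q(i, sqrt(2q)); so [u] is a unit of
   this field, of norm -1 to [kk]. *)
set u := a0 / ((1 + 'i) * z).
have uu : aunit u.
  apply: (assoc_trans aa); apply: assocM; last exact: assoc_refl.
  apply: (@assoc_root 2) => //; rewrite w2K s1i; apply: assoc_sym; apply: assoc_unit => //.
  by rewrite pnatr_eq0.
have c2i : c2q 'i = 'i by rewrite /= (sqi st) (s2i st).
have cqi_i : cqi 'i = - 'i by rewrite /= (sii st) rmorphN (sqi st).
have c2u : c2q u = u by rewrite /u fmorph_div c2a rmorphM rmorphD rmorph1 c2i c2z.
have spu : sp u = u by rewrite /u fmorph_div spa rmorphM rmorphD rmorph1 (spi st) spz.
have Lu : L u by apply: (sfM sL) => //; apply: (sfV sL); apply: (sfM sL) => //; apply: (sfD sL) => //; exact: (sf1 sL).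
have e1 : u * cqi u = -1.
  have -> : cqi u = cqi a0 / ((1 - 'i) * z).
    by rewrite /u fmorph_div; congr (_ / _); rewrite rmorphM rmorphD rmorph1 cqi_i cqz.
  rewrite {1}/u.
  transitivity (a0 * cqi a0 / ((1 + 'i) * (1 - 'i) * z ^+ 2)); first by field; rewrite i1 i2 z0.
  rewrite na n1i ez; field; exact: z0.
clearbody u.
have e2 : si u * sq u = -1.
  have h : si (u * sq (si u)) = si (-1) by congr (si _); exact: e1.
  move: h; rewrite rmorphM rmorphN rmorph1 => <-; congr (_ * _).
  by rewrite (comm _ _ _ gi gq) ?(flips_inv rS gi Lu) //; exact: flips_L gi Lu.
have squ : s2 u = sq u.
  by rewrite -[in LHS]c2u /= (flips_inv rS g2) //; exact: flips_L gq Lu.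
(* The norms of [u] to the other two quadratic subfields, Q(sqrt(2q)) and Q(i); together they
   determine [u ^+ 2]. *)
pose w := u * si u; pose v := u * sq u.
have wv : w * v = - u ^+ 2 by transitivity (u ^+ 2 * (si u * sq u)); [rewrite /w /v; ring | rewrite e2; ring].
have Kw : Q2q w.
  split; [split; [split|]|].
  - by apply: (sfM sL) => //; exact: flips_L gi Lu.
  - by rewrite /w rmorphM (comm _ _ _ gp gi Lu) spu.
  - by rewrite /w rmorphM (flips_inv rS gi Lu) mulrC.
  - by rewrite /w rmorphM (comm _ _ _ g2q gi Lu) c2u.
have Kv : Qi v.
  split; [split; [split|]|].
  - by apply: (sfM sL) => //; exact: flips_L gq Lu.
  - by rewrite /v rmorphM squ (comm _ _ _ g2 gq Lu) squ (flips_inv rS gq Lu) mulrC.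
  - by rewrite /v rmorphM (comm _ _ _ gp gq Lu) spu.
  - by rewrite /v rmorphM (flips_inv rS gq Lu) mulrC.
have uw : aunit w by apply: aunitM => //; rewrite aunit_aut.
have uv : aunit v by apply: aunitM => //; rewrite aunit_aut.
have QTq := quad_Q2q ar st; have QI := quad_Qi ar st.
have [e [be [y [Ky y0 ew]]]] := S_Q2q ar st (SS_unit (quad_sK QTq) Kw uw).
have Ly := fixf_L Ky; have [[[_ spy] siy] c2y] := Ky.
have y2 : 0 < y ^+ 2 by rewrite expr2 -{2}siy (conj_si st Ly) mul_conjC_gt0.
have w0 : 0 < w by rewrite /w (conj_si st Lu) mul_conjC_gt0; case/and3P: uu.
have {}ew : w = 2 ^+ be * y ^+ 2.
  case: e ew => ew; last by rewrite ew expr0 mul1r.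
  have h : 0 < 2 ^+ be * y ^+ 2 by apply: mulr_gt0 => //; apply: exprn_gt0; rewrite ltr0n.
  by move: w0; rewrite ew expr1 -mulrA mulN1r oppr_gt0 => /(lt_trans h); rewrite ltxx.
have [a [x [Kx x0 ev]]] : exists (a : bool) x, [/\ Qi x, x != 0 & v = 'i ^+ a * x ^+ 2].
  by case: (S_Qi ar st (SS_unit (quad_sK QI) Kv uv)) => -[x [Kx x0 ev]]; [exists false | exists true]; exists x; split.
have Lx := fixf_L Kx; have [[[_ s2x] spx] sqx] := Kx.
have ux : aunit x.
  apply: (@aunit_root 2) => //; have -> : x ^+ 2 = v / 'i ^+ a by rewrite ev [RHS]mulrC mulKf // expf_neq0.
  by apply: aunitM => //; apply: aunitV; apply: aunitX.
have xx : x * si x = 1.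
  apply: rat_assoc_pos; [exact: (quad_N QI) | exact: rpred1 | by rewrite (conj_si st Lx) mul_conjC_ge0 | exact: ler01 |].
  by rewrite /assoc divr1; apply: aunitM => //; rewrite aunit_aut.
have cqx : cqi x = si x by rewrite /= (comm _ _ _ gq gi Lx) sqx.
have c2x : c2q x = x by rewrite /= sqx.
have cqy : cqi y = s2 y.
  by rewrite /= siy -[in RHS]c2y /= (flips_inv rS g2) //; exact: flips_L gq Ly.
have sy0 : s2 y != 0 by rewrite fmorph_eq0.
(* Dividing out the square parts of [w] and [v] leaves a [t] whose square is one of four explicit
   constants. *)
pose t := u / (x * y).
have c2t : c2q t = t by rewrite /t fmorph_div rmorphM c2u c2x c2y.
have ct : (t * cqi t) * (y * s2 y) = -1.
  have six0 : si x != 0 by rewrite fmorph_eq0.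
  transitivity ((u * cqi u) / (x * si x)); last by rewrite xx e1 divr1.
  rewrite /t fmorph_div rmorphM cqx cqy; field.
  by rewrite ?x0 ?y0 ?six0 ?sy0.
have t2 : t ^+ 2 = - (2 ^+ be * 'i ^+ a).
  have eu : u ^+ 2 = - (w * v) by rewrite wv opprK.
  rewrite /t expr_div_n eu ew ev; field; by rewrite x0 y0.
have g2w : s2 (w2 * wq) = - (w2 * wq) by rewrite rmorphM (s22 st) (s2q st) mulNr.
have w2w : (w2 * wq) ^+ 2 = (q%:Z * 2)%:~R by rewrite exprMn w2K wqK intrM mulrC.
have nw : w2 * wq != 0 by rewrite mulf_neq0 //; exact: wq_neq0 ar.
have [X [Y [Xq Yq ey ny]]] := quadQ_coord QTq (Q2q_w st) g2w w2w nw Ky.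
have q2' : ~~ (q%:Z %| 2)%Z.
  rewrite dvdzE /=; apply/negP => /dvdn_leq h; have := h isT; have := ar_q8 ar; have := prime_gt1 (ar_q ar).
  by case: (q) => [|[|[|?]]].
have no1 : y * s2 y = -1 -> False.
  move=> h; have := qres (ar_q ar) (ar_N1q ar) q2' Xq Yq (rpred1 _) _.
  rewrite -ny h => /(_ _)/eqP; rewrite oner_eq0; move=> K; apply: notF; apply: K.
  by rewrite expr1n mulr1 rmorphN1.
have no2 : 2 * (y * s2 y) = -1 -> False.
  move=> h; have h' : 2^-1 \in Crat by rewrite rpredV rpred_nat.
  have := qres (ar_q ar) (nsq_m2 ar) q2' Xq Yq h' _.
  rewrite -ny => /(_ _)/eqP; rewrite invr_eq0 pnatr_eq0 => K; apply: notF; apply: K.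
  have n2 : 2 != 0 :> algC by rewrite pnatr_eq0.
  apply: (mulfI n2); rewrite h rmorphN /= -[2%:~R]/(2); by field.
have nor r : c2q r = r -> r ^+ 2 = 2 -> False.
  move=> cr /eqP; rewrite -(w2K) eqf_sqr => hr; have cw : c2q w2 = - w2 by rewrite /= (sq2 st) (s22 st).
  have : c2q w2 = w2.
    by case/orP: hr => /eqP er; [rewrite -er | have -> : w2 = - r by rewrite er opprK]; rewrite ?rmorphN cr.
  by move/eqP; rewrite cw -subr_eq0 -opprD oppr_eq0 -mulr2n mulrn_eq0 (negPf w20).
have cr : c2q (t * (1 + 'i)) = t * (1 + 'i) by rewrite rmorphM rmorphD rmorph1 c2i c2t.
(* Two of the cases put a square root of 2 into Q(i, sqrt(2q)). In the other two the norm of [y] is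
   -1 or -1/2, impossible as -1 and -2 are nonresidues modulo [q]. *)
move: t2; case: (a); case: (be); rewrite ?expr0 ?expr1 => t2.
- apply: no2; rewrite -ct; congr (_ * _).
  have /eqP : (t * (1 + 'i)) ^+ 2 = 2 ^+ 2 by rewrite exprMn t2 s1i; transitivity (-4 * ('i * 'i) : algC); [ring | rewrite ii; ring].
  rewrite eqf_sqr => hr; have et : t = (t * (1 + 'i)) / (1 + 'i) by rewrite mulfK.
  have c1 : cqi (1 + 'i) = 1 - 'i by rewrite rmorphD rmorph1 cqi_i.
  case/orP: hr => /eqP er; rewrite et er fmorph_div c1 ?rmorphN rmorph_nat;
    transitivity (4 / ((1 + 'i) * (1 - 'i)) : algC); try (by rewrite n1i; field); by field; rewrite i1 i2.
- apply: (nor _ cr); rewrite exprMn t2 s1i; transitivity (- 2 * ('i * 'i) : algC); [ring | rewrite ii; ring].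
- apply: (nor (t / 'i)); first by rewrite fmorph_div c2t c2i.
  by rewrite expr_div_n t2 sqrCi; field.
- apply: no1; rewrite -ct; have /eqP : t ^+ 2 = 'i ^+ 2 by rewrite t2 sqrCi mulr1.
  by rewrite eqf_sqr => /orP[] /eqP ->; rewrite ?rmorphN cqi_i ?opprK ?mulrN ?mulNr ii; ring.
Qed.

(** For [p] equal to 5 modulo 8 both 2 and -2 are nonresidues, so [alpha_residue] suffices; for 3
    modulo 8 the number -2 is a residue, and the negative sign is left to [alpha_sign]. *)
Lemma C_nonpr : False.
Proof.
have [e [z [kz z0 ez az]]] := nk_alpha.
case: (ar_p8 ar) => p8.
  apply: (alpha_residue kz ez); case: (e); rewrite ?expr0 ?expr1 ?mul1r; last exact: ar_2p ar.
  move=> h; apply: (ar_2p ar); have := sqmodM (ar_N1p ar p8) h.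
  by rewrite mulrA mulN1r opprK mul1r.
case: e ez => ez; first by apply: (alpha_sign p8 kz z0 az); rewrite ez expr1.
by apply: (alpha_residue kz ez); rewrite expr0 mul1r; exact: ar_2p ar.
Qed.

End Alpha.
End Order.

(** * From ideal numbers to ideals as sets *)

Lemma cset_ext (I J : cset) : (forall x, I x <-> J x) -> I = J.
Proof. by move=> h; apply: functional_extensionality => x; apply: propositional_extensionality. Qed.

Section Dictionary.
Variable K : cset.
Hypotheses (sK : is_subfield K) (bK : Bez K).

(* The ideal of [K] generated by the "ideal number" [a]. *)
Definition Idl (a : algC) : cset := fun x => K x /\ x / a \in Aint.

Lemma Idl1 : Idl 1 = ORing K.
Proof. by apply: cset_ext => x; rewrite /Idl divr1. Qed.

Lemma Idl_ideal a : DD K a -> a \in Aint -> nonzero_ideal K (Idl a).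
Proof.
move=> da aA; have a0 := DD_nz da; split.
  split=> [x [Kx xa]||x y [Kx xa] [Ky ya]|c x [Kc cA] [Kx xa]].
  - by split=> //; rewrite -[x](divfK a0); apply: rpredM.
  - by split; [exact: sf0 sK | rewrite mul0r rpred0].
  - by split; [exact: (sfD sK) | rewrite mulrDl; apply: rpredD].
  - by split; [exact: (sfM sK) | rewrite -mulrA; apply: rpredM].
have [_ [t [tK ta t1]]] := da; apply: NNPP => H.
have t0 u : u \in t -> u.1 * u.2 = 0.
  move=> ut; have [-> | n0] := eqVneq u.1 0; first by rewrite mul0r.
  by case: H; exists u.1; split=> //; split; [have [] := tK u ut | have [] := ta u ut].
by move/eqP: t1; rewrite big_seq big1 // eq_sym oner_eq0.
Qed.

Lemma Idl_mul a b : DD K a -> b != 0 -> ideal_mul (Idl a) (Idl b) = Idl (a * b).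
Proof.
move=> da b0; have a0 := DD_nz da; apply: cset_ext => x; split=> [[t [ht ->]]|[Kx xab]].
  split; first by apply: (sf_sum sK) => u /ht[[? _] [? _]]; apply: (sfM sK).
  rewrite big_distrl /= big_seq; apply: rpred_sum => u /ht[[_ h1] [_ h2]].
  by rewrite invfM mulrACA; apply: rpredM.
have [_ [t [tK ta t1]]] := da; exists [seq (u.1, u.2 * x) | u <- t]; split.
  move=> v /mapP[u ut ->] /=; have [k1 k2] := tK u ut; have [h1 h2] := ta u ut.
  split; [by split | split; first exact: (sfM sK)].
  by have -> : u.2 * x / b = (u.2 * a) * (x / (a * b)); [field; rewrite a0 b0 | apply: rpredM].
rewrite big_map -[LHS]mul1r -t1 big_distrl /=; apply: eq_bigr => u _; by rewrite mulrA.
Qed.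

Lemma Idl_pow a n : DD K a -> ideal_pow K (Idl a) n = Idl (a ^+ n).
Proof.
move=> da; elim: n => [|n IH] /=; first by rewrite expr0 Idl1.
by rewrite IH Idl_mul ?exprS // expf_neq0 // (DD_nz da).
Qed.

Lemma Idl_le a b c d : DD K a -> b != 0 -> c != 0 -> d != 0 ->
  (forall x, scale c (Idl a) x -> scale d (Idl b) x) -> (c * a) / (d * b) \in Aint.
Proof.
move=> da b0 c0 d0 H; have a0 := DD_nz da; have [_ [t [tK ta t1]]] := da.
rewrite -[c * a]mul1r -t1 !big_distrl /= big_seq; apply: rpred_sum => u ut.
have [k1 k2] := tK u ut; have [h1 h2] := ta u ut.
have [|y [[_ yb] ey]] := H (c * u.1); first by exists u.1.
have -> : u.1 * u.2 * (c * a) / (d * b) = (c * u.1) / (d * b) * (u.2 * a) by field; rewrite b0 d0.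
apply: rpredM => //; rewrite ey; have -> : d * y / (d * b) = y / b by field; rewrite b0 d0.
exact: yb.
Qed.

(** A denominator of [l] is a nonzero element of the inverse of the fractional ideal generated by 1
    and [l]. *)
Lemma denom l : K l -> exists z, [/\ K z, z != 0, z \in Aint & z * l \in Aint].
Proof.
move=> Kl; pose x (b : bool) := if b then 1 else l.
have [||a [z [a0 zK xa x1]]] := bK (x := x).
- by case; rewrite /x //; exact: sf1 sK.
- by exists true; rewrite /x oner_eq0.
have [[_ z1] [[t1 _] [t0 _]]] := (xa true, (xa true, xa false)).
have [j zj] : exists j, z j != 0.
  apply: NNPP => H; move/eqP: x1; rewrite big1 ?(eq_sym 0) ?oner_eq0 // => i _.
  by have [-> | n0] := eqVneq (z i) 0; [rewrite mulr0 | case: H; exists i].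
have [_ zA] := xa j; exists (z j); split=> //.
  by have -> : z j = (z j * a) * (1 / a); [field | apply: rpredM].
by have -> : z j * l = (z j * a) * (l / a); [field | apply: rpredM].
Qed.

Lemma Idl_equiv a b : DD K a -> DD K b -> ideal_equiv K (Idl a) (Idl b) <-> pr K (a / b).
Proof.
move=> da db; have [a0 b0] := (DD_nz da, DD_nz db); split.
  case=> c [d [[Kc cA] [Kd dA] c0 d0 H]]; exists (d / c); first by apply: (sfM sK) => //; apply: (sfV sK).
  have h1 : (c * a) / (d * b) \in Aint by apply: Idl_le => // x /H.
  have h2 : (d * b) / (c * a) \in Aint by apply: Idl_le => // x /H.
  apply: assocI; rewrite ?mulf_neq0 ?invr_eq0 //.
    by have -> : a / b / (d / c) = (c * a) / (d * b); [field; rewrite b0 c0 d0 |].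
  by have -> : d / c / (a / b) = (d * b) / (c * a); [field; rewrite b0 c0 a0 |].
case=> l Kl /assocE[_ l0 h1 h2]; have [z [Kz z0 zA zlA]] := denom Kl.
exists z, (z * l); split=> //; [by split; first exact: (sfM sK) | exact: mulf_neq0 |].
move=> x; split=> -[y [[Ky ya] ->]].
  exists (y / l); split; last by field.
  split; first by apply: (sfM sK) => //; apply: (sfV sK).
  by have -> : y / l / b = (y / a) * (a / b / l); [field; rewrite a0 b0 l0 | apply: rpredM].
exists (l * y); split; last by ring.
split; first exact: (sfM sK).
by have -> : l * y / a = (y / b) * (l / (a / b)); [field; rewrite a0 b0 | apply: rpredM].
Qed.

Lemma Idl_principal a : DD K a -> principal_class K (Idl a) <-> pr K a.
Proof. by move=> da; rewrite /principal_class -Idl1 Idl_equiv ?divr1 //; apply: DD_unit sK aunit1. Qed.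

Lemma Idl_two a : TT K a -> a \in Aint -> two_power_class K (Idl a).
Proof.
move=> [da [n h]] aA; split; first exact: Idl_ideal.
by exists n; rewrite Idl_pow // Idl_principal //; apply: (DDX _ sK).
Qed.

Lemma pow_mem (I : cset) y n : I y -> ideal_pow K I n (y ^+ n).
Proof.
move=> Iy; elim: n => [|n IH] /=; first by rewrite expr0; split; [exact: sf1 sK | exact: Aint1].
exists [:: (y, y ^+ n)]; split; last by rewrite big_seq1 exprS.
by move=> u; rewrite inE => /eqP ->.
Qed.

(** An element of a power of [I] involves only finitely many elements of [I]; this replaces finite
    generation, which the definition of an ideal does not provide. *)
Lemma pow_list (I : cset) n x : ideal_pow K I n x -> exists S : seq algC, (forall y, y \in S -> I y) /\
  forall c, c != 0 -> (forall y, y \in S -> y / c \in Aint) -> x / c ^+ n \in Aint.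
Proof.
elim: n x => [|n IH] x /=; first by case=> _ xA; exists [::]; split=> // c _ _; rewrite expr0 divr1.
case=> t [ht ->] {x}; elim: t ht => [|u t IHt] ht.
  by exists [::]; split=> // c _ _; rewrite big_nil mul0r rpred0.
have [S [SI HS]] : exists S : seq algC, (forall y, y \in S -> I y) /\
  forall c, c != 0 -> (forall y, y \in S -> y / c \in Aint) -> (\sum_(u <- t) u.1 * u.2) / c ^+ n.+1 \in Aint.
  by apply: IHt => v vt; apply: ht; rewrite inE vt orbT.
have [Iu /IH[T [TI HT]]] := ht u (mem_head _ _).
exists (u.1 :: S ++ T); split=> [y|c c0 H].
  by rewrite inE mem_cat => /orP[/eqP -> //|/orP[/SI|/TI]].
rewrite big_cons mulrDl; apply: rpredD; last by apply: HS => // y yS; apply: H; rewrite inE mem_cat yS orbT.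
rewrite exprS invfM mulrACA; apply: rpredM; first by apply: H; rewrite mem_head.
by apply: HT => // y yT; apply: H; rewrite inE mem_cat yT !orbT.
Qed.

(** Let [w] generate the N-th power of [I] and let [om] be its N-th root. [om] divides every element
    of [I]; conversely, for the gcd [c] of the finitely many elements entering [w], the power
    [c ^+ N] divides [w]. So [c] and [om] are associates. *)
Lemma two_Idl I : two_power_class K I -> exists c, [/\ TT K c, c \in Aint & I = Idl c].
Proof.
case=> -[[IO I0 ID IM] [y0 [Iy0 y0n]]] [k [a [b [[Ka aA] [Kb bA] a0 b0 H]]]].
set N := (2 ^ k)%N in H; have N0 : (0 < N)%N by rewrite expn_gt0.
have [w [Iw ew]] : scale a (ideal_pow K I N) b.
  by apply/H; exists 1; split; [split; [exact: sf1 sK | exact: Aint1] | rewrite mulr1].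
have w0 : w != 0 by move: b0; rewrite ew mulf_eq0 negb_or => /andP[].
have Hw y : ideal_pow K I N y -> y / w \in Aint.
  move=> Iy; have [z [[_ zA] ez]] : scale b (ORing K) (a * y) by apply/H; exists y.
  have -> : y = w * z by apply: (mulfI a0); rewrite ez ew mulrA.
  by rewrite [w * z]mulrC mulfK.
(* The nonzero element [y0] is added so that the family has a gcd. *)
have [S [SI HS]] := pow_list Iw; pose T := y0 :: S.
have TI (i : 'I_(size T)) : I T`_i.
  have : T`_i \in T by exact: mem_nth.
  by rewrite inE => /orP[/eqP -> | /SI].
have TK (i : 'I_(size T)) : K T`_i /\ T`_i \in Aint := IO _ (TI i).
have [||c [z [c0 zK xc x1]]] := bK (x := fun i : 'I_(size T) => T`_i).
- by move=> i; have [] := TK i.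
- by exists ord0.
have dc : DD K c by apply: (fin_DD c0 _ xc x1) => i; split=> //; have [] := TK i.
have ec : c = \sum_(i < size T) T`_i * (z i * c) by rewrite -[LHS]mul1r -x1 big_distrl; apply: eq_bigr => i _ /=; rewrite -mulrA.
have Sc y : y \in S -> y / c \in Aint.
  move=> yS; have yT : y \in T by rewrite inE yS orbT.
  have := yT; rewrite -index_mem => lt; have [] := xc (Ordinal lt).
  by rewrite /= nth_index.
have wc := HS c c0 Sc.
have [om eom] : exists om, om ^+ N = w by exists (N.-root w); rewrite rootCK.
have om0 : om != 0 by move: w0; rewrite -eom expf_eq0 N0.
have dv y : I y -> y / om \in Aint.
  by move=> Iy; apply: (Aint_root N0); rewrite expr_div_n eom; apply: Hw; apply: pow_mem.
have co : c / om \in Aint.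
  rewrite [c in c / om]ec big_distrl; apply: rpred_sum => i _ /=.
  have -> : T`_i * (z i * c) / om = T`_i / om * (z i * c) by ring.
  by apply: rpredM; [exact: dv | have [] := xc i].
have oc : om / c \in Aint by apply: (Aint_root N0); rewrite expr_div_n eom.
exists c; split.
- split=> //; exists k, w; last by rewrite -eom; apply: assocX; apply: assocI.
  by rewrite -[w](mulKf a0) -ew; apply: (sfM sK) => //; apply: (sfV sK).
- by rewrite ec; apply: rpred_sum => i _; apply: rpredM; [have [] := TK i | have [] := xc i].
apply: cset_ext => x; split=> [Ix|[Kx xA]].
  split; first by have [] := IO _ Ix.
  by have -> : x / c = x / om * (om / c); [field; rewrite om0 c0 | apply: rpredM; [exact: dv |]].
have -> : x = \sum_(i < size T) (z i * x) * T`_i by rewrite -[LHS]mul1r -x1 big_distrl; apply: eq_bigr => i _ /=; ring.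
elim/big_ind: _ => // i _; apply: IM => //; split; first by apply: (sfM sK).
have -> : z i * x = (z i * c) * (x / c) by field.
by apply: rpredM => //; have [] := xc i.
Qed.

Section Cyc.
Variables (C : algC) (m : nat).
Hypotheses (tC : TT K C) (CA : C \in Aint) (Cd : forall j, pr K (C ^+ j) <-> (2 ^ m %| j)%N).
Hypothesis Cg : forall x, TT K x -> exists j, pr K (x * C ^+ j).
Let dC := proj1 tC.
Let C0 : C != 0 := DD_nz dC.
Let dCn j : DD K (C ^+ j) := DDX j sK dC.

Lemma Cgen x : TT K x -> exists j : 'I_(2 ^ m), pr K (x / C ^+ j).
Proof.
move=> tx; have [j hj] := Cg tx; have N0 : (0 < 2 ^ m)%N by rewrite expn_gt0.
(* The exponent [j * (2 ^ m).-1] stands for -j modulo [2 ^ m]. *)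
have lt : ((j * (2 ^ m).-1) %% 2 ^ m < 2 ^ m)%N by rewrite ltn_mod.
exists (Ordinal lt); set r := nat_of_ord _.
have h1 : pr K (C ^+ (j + r)).
  apply/Cd; rewrite /dvdn /r /= modnDmr -[X in (X + _)%N]muln1 -mulnDr add1n prednK // modnMl //.
have -> : x / C ^+ r = (x * C ^+ j) * (C ^+ (j + r))^-1.
  by rewrite exprD; field; rewrite !expf_neq0.
by apply: (prM sK) => //; apply: (prV sK).
Qed.

Lemma cyclic_classes : two_class_group_cyclic K (2 ^ m).
Proof.
exists (Idl C); split=> [|j|I /two_Idl[c [tc cA ->]]]; first exact: Idl_two.
  by rewrite Idl_pow // Idl_principal.
by have [j hj] := Cgen tc; exists j; rewrite Idl_pow //; apply/Idl_equiv => //; case: tc.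
Qed.

(** Converts a given number of classes into the order of the generator; it is applied to [kk]. *)
Lemma class_count N : two_class_number K N -> N = (2 ^ m)%N.
Proof.
case=> f [f2 finj fsur].
have /fin_all_exists[c Hc] : forall i : 'I_N, exists c : algC, TT K c /\ f i = Idl c.
  by move=> i; have [c [tc _ ec]] := two_Idl (f2 i); exists c.
have dc i : DD K (c i) by case: (Hc i) => -[].
have quo a b d : DD K a -> DD K b -> DD K d -> pr K (a / d) -> pr K (b / d) -> pr K (a / b).
  move=> /DD_nz a0 /DD_nz b0 /DD_nz d0 h1 h2.
  have -> : a / b = (a / d) * (b / d)^-1 by field; rewrite b0 d0.
  by apply: (prM sK) => //; apply: (prV sK).
apply/eqP; rewrite eqn_leq; apply/andP; split.
  have /fin_all_exists[g Hg] : forall i : 'I_N, exists j : 'I_(2 ^ m), pr K (c i / C ^+ j).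
    by move=> i; apply: Cgen; case: (Hc i).
  rewrite -[N]card_ord -[X in (_ <= X)%N](card_ord (2 ^ m)); apply: (leq_card g) => i j e.
  apply: finj; rewrite (proj2 (Hc i)) (proj2 (Hc j)); apply/Idl_equiv => //.
  by apply: (quo _ _ (C ^+ g i)) => //; rewrite e.
have /fin_all_exists[h Hh] : forall j : 'I_(2 ^ m), exists i : 'I_N, pr K (C ^+ j / c i).
  move=> j; have [|i hi] := fsur (Idl (C ^+ j)).
    by apply: Idl_two; [exact: (TTX _ sK) | exact: rpredX].
  by exists i; apply/Idl_equiv => //; rewrite -(proj2 (Hc i)).
rewrite -[X in (X <= _)%N](card_ord (2 ^ m)) -[N]card_ord; apply: (leq_card h) => i j e.
have Q (a b : 'I_(2 ^ m)) : h a = h b -> (a <= b)%N -> a = b.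
  move=> eh le; apply: val_inj => /=; apply/eqP; rewrite eqn_leq le /=.
  have : pr K (C ^+ (b - a)).
    have -> : C ^+ (b - a) = C ^+ b / C ^+ a by rewrite -[in RHS](subnK le) exprD mulfK // expf_neq0.
    by apply: (quo _ _ (c (h a))) => //; rewrite eh.
  move/Cd => dv; rewrite -subn_eq0; apply/negPn/negP; rewrite -lt0n => /dvdn_leq/(_ dv).
  by rewrite leqNgt (leq_ltn_trans (leq_subr _ _) (ltn_ord b)).
by case/orP: (leq_total i j) => le; [exact: Q | symmetry; apply: Q].
Qed.
End Cyc.
End Dictionary.

(** * Assembly of the theorem *)

Section Assembly.
Variables (p q : nat) (s2 sq sp si : rmC).
Hypotheses (ar : arith p q) (st : setup p q s2 sq sp si).
Notation L := (LL p q).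
Notation G := (gens p q).
Notation Qi := (Qi p q s2 sq sp). Notation Qq := (Qq p q s2 sp si).
Notation kk := (kk p q s2 sq sp si). Notation Qm2 := (Qm2 p q s2 sq sp si). Notation Q2q := (Q2q p q s2 sq sp si).
Notation cqi := (cqi sq si). Notation c2q := (c2q s2 sq).
Let rS : rsq G := @rsq_gens p q.
Let g2 := flips_s2 st. Let gq := flips_sq st. Let gp := flips_sp st. Let gi := flips_si st.
Let g2q := g2q st. Let gqi := gqi st. Let g2i := g2i st.
Let sL : is_subfield L := @LL_sf p q.
Let QK := quad_k ar st.
Let sk := quad_sK QK.
Let BL : Bez L := LL_Bez st ar.
Let Bk : Bez kk := LBez ar st (conj g2q (conj gqi (conj gp Logic.I)) : allflips G [:: c2q; cqi; sp]).

Lemma odd_pr (K : cset) a : is_subfield K -> (forall x, K x -> L x) -> (forall x, TT K x -> pr K x) ->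
  (exists n, (0 < n)%N /\ pr K (a ^+ n)) -> DD K a -> exists s, odd s /\ forall s', (s %| s')%N -> pr L (a ^+ s').
Proof.
move=> sK KL tr [n [n0 h]] da; have [s [os H]] := TT_odd sK da n0 h.
by exists s; split=> // s' /H/tr; apply: pr_sub.
Qed.

(** Which of the two square roots [sqrtC] selects does not matter: it is [Yk] or its opposite, and
    both generate the same field. *)
Lemma quad_kE : quadfield (- (2 * q%:Z)) = kk.
Proof.
apply: cset_ext; pose d : algC := sqrtC (- (2 * q%:Z))%:~R.
have Yd : (Yk q) ^+ 2 = (- (2 * q%:Z))%:~R.
  by rewrite /Yk !exprMn w2K wqK sqrCi rmorphN /= intrM; ring.
have hd : (d == (Yk q)) || (d == - (Yk q)) by rewrite -eqf_sqr Yd sqrtCK.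
have kY : kk (Yk q) := kk_wk st.
have kd : kk d by case/orP: hd => /eqP e; rewrite e //; apply: (sfN sk).
move=> x; split=> [h|kx F sF FS].
  by apply: h => // y; rewrite inE => /eqP ->.
have Fd : F d by apply: FS; rewrite inE.
have FY : F (Yk q).
  by case/orP: hd => /eqP e; [rewrite -e | rewrite (_ : (Yk q) = - d); [exact: (sfN sF) | by rewrite e opprK]].
have [X [Y [Xq Yq -> _ _]]] := kk_norm ar st kx.
by apply: (sfD sF); [exact: sf_rat Xq | apply: (sfM sF) => //; exact: sf_rat Yq].
Qed.

Lemma assembly (m : nat) : two_class_number kk (2 ^ m) -> two_class_group_cyclic L (2 ^ m).
Proof.
have [fp [gam [P [rho [rhoR [s0 [[dg gf [spf fA]] [fP dP PA pPP cP] [ps0 YP] dr [rel f3]]]]]]]] := frak_exists ar st.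
have [n1 [n10 h1]] := fixf_ord ar st (gs := [::]) Logic.I dg.
have [s1 [os1 H1]] := TT_odd sL dg n10 h1.
have [n2 [n20 h2]] := fixf_ord ar st (conj g2q (conj gqi (conj gp Logic.I)) : allflips G [:: c2q; cqi; sp]) dP.
have [s2' [os2 H2]] := TT_odd sk dP n20 h2.
have [s3 [s4 [[os3 H3] [os4 H4]]]] : exists s3 s4,
    (odd s3 /\ forall s', (s3 %| s')%N -> pr L (rho ^+ s')) /\ (odd s4 /\ forall s', (s4 %| s')%N -> pr L (rhoR ^+ s')).
  case: dr => -[d3 d4].
    have [s3 h3] := odd_pr (quad_sK (quad_Qi ar st)) (fun x => @fixf_L G [:: sq; sp; s2] x) (@triv_Qi p q s2 sq sp si ar st)
      (fixf_ord ar st (conj gq (conj gp (conj g2 Logic.I)) : allflips G [:: sq; sp; s2]) d3) d3.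
    have [s4 h4] := odd_pr (quad_sK (quad_Q2q ar st)) (fun x => @fixf_L G [:: c2q; si; sp] x) (@triv_Q2q p q s2 sq sp si ar st)
      (fixf_ord ar st (conj g2q (conj gi (conj gp Logic.I)) : allflips G [:: c2q; si; sp]) d4) d4.
    by exists s3, s4.
  have [s3 h3] := odd_pr (quad_sK (quad_Qm2 ar st)) (fun x => @fixf_L G [:: c2i s2 si; sq; sp] x) (@triv_Qm2 p q s2 sq sp si ar st)
    (fixf_ord ar st (conj g2i (conj gq (conj gp Logic.I)) : allflips G [:: c2i s2 si; sq; sp]) d3) d3.
  have [s4 h4] := odd_pr (quad_sK (quad_Qq ar st)) (fun x => @fixf_L G [:: si; sp; s2] x) (@triv_Qq p q s2 sq sp si ar st)
    (fixf_ord ar st (conj gi (conj gp (conj g2 Logic.I)) : allflips G [:: si; sp; s2]) d4) d4.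
  by exists s3, s4.
(* A single odd exponent that makes [rho] and [rhoR] principal and moves [gam] and [P] into the
   2-class groups. *)
pose s := (s1 * s2' * s3 * s4)%N.
have os : odd s by rewrite !oddM os1 os2 os3 os4.
have tC : TT L (gam ^+ s) by apply: H1; rewrite /s -!mulnA dvdn_mulr.
have tpi : TT kk (P ^+ s) by apply: H2; rewrite /s [(s1 * s2')%N]mulnC -!mulnA dvdn_mulr.
have prho : pr L (rho ^+ s) by apply: H3; rewrite /s dvdn_mulr // dvdn_mull.
have prR : pr L (rhoR ^+ s) by apply: H4; rewrite /s dvdn_mull.
have [n [n0 pn npn]] := pi_order ar st dP pPP os tpi.
have dpi := proj1 tpi.
have CA : gam ^+ s \in Aint.
  apply: rpredX; apply: (@Aint_root 2) => //; have [_ f0 h _] := assocE gf.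
  by rewrite -[gam ^+ 2](divfK f0); apply: rpredM.
have Cn : pr L ((gam ^+ s) ^+ (2 ^ n.+1)).
  (* Positivity of the exponent is needed to write [2 ^ n.+2] as [4 * 2 ^ n] and to take the square
     root of the class of order 2. *)
  case: n n0 pn npn => // n _ pn npn.
  have -> : (2 ^ n.+2 = 4 * 2 ^ n)%N by rewrite !expnS mulnA.
  have pn' : pr kk (((P ^+ s) ^+ (2 ^ n.+1)) ^+ 2) by rewrite -exprM mulnC -expnS.
  have [[] [z [kz az]]] := sqrt_kk ar st (DDX _ sk dpi) pn'; last first.
    by case: npn; exists z => //; move: az; rewrite expr0 mul1r.
  apply: (C4 ar gf rel prho prR).
  apply: (capit ar st (DDX _ sk dpi) kz).
  by rewrite -exprM mulnC -expnS; move: az; rewrite expr1.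
have nCn : ~ pr L ((gam ^+ s) ^+ (2 ^ n)).
  by case=> l Ll hl; eapply C_nonpr; eassumption.
have NSk d : TT kk d -> ~ pr kk (P ^+ s * d ^+ 2) by apply: (NS_pi ar st dP pPP os).
have NSL d : TT L d -> ~ pr L (gam ^+ s * d ^+ 2) by apply: (C_nonsq ar st gf spf fP dP pPP os tpi).
have A2L a b : TT L a -> TT L b -> pr L (a ^+ 2) -> pr L (b ^+ 2) -> ~ pr L a -> ~ pr L b -> pr L (a * b).
  by move=> [da _] [db _]; apply: (A2 ar st).
have PsA : P ^+ s \in Aint by apply: rpredX.
move=> h2N; have := class_count sk Bk tpi PsA (cyc_dvd sk pn npn) (cyc_gen sk tpi pn npn (A2_kk ar st) NSk) h2N.
move=> ->; exact: (cyclic_classes sL BL tC CA (cyc_dvd sL Cn nCn) (cyc_gen sL tC Cn nCn A2L NSL)).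
Qed.
End Assembly.

Theorem theorem3p8 (p q m : nat) :
  prime p -> prime q ->
  ((p %% 4 = 1)%N \/ (p %% 4 = 3)%N) ->
  (q %% 4 = 3)%N ->
  legendre 2 p = -1 -> legendre 2 q = 1 -> legendre p%:Z q = -1 ->
  h2 (- (2 * q%:Z)) (2 ^ m) ->
  two_class_group_cyclic (Lstar p q) (2 ^ m).
Proof.
move=> pp pq p4 q4 l2p l2q lpq; have ar := arith_hyp pp pq p4 q4 l2p l2q lpq.
have [s2 [sq [sp [si st]]]] := setup_exists ar.
rewrite /h2 (quad_kE ar st) => h; exact: (assembly ar st h).
Qed.
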